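(* Let $(\xi^*,\zeta^* )\in\mathcal A^\circ_0(\mathbb F^1)\times\mathcal A^\circ_0(\mathbb F^2)$ be an optimal pair. The families $$\mathbf V^{*,1}=\{\mathsf E[1-\zeta^*_{\theta-}|\mathcal F^1_\theta]\,V^{*,1}(\theta):\theta\in\mathcal T_0(\mathbb F^1)\},\qquad \mathbf V^{*,2}=\{\mathsf E[1-\xi^*_{\gamma-}|\mathcal F^2_\gamma]\,V^{*,2}(\gamma):\gamma\in\mathcal T_0(\mathbb F^2)\}$$ can be aggregated into optional semi-martingale processes of class $(D)$, $(\hat V^{*,1}_t)_{t\in[0,T]}$ (with respect to $\mathbb F^1$) and $(\hat V^{*,2}_t)_{t\in[0,T]}$ (with respect to $\mathbb F^2$), where for $\theta\in\mathcal T_0(\mathbb F^1)$ and $\gamma\in\mathcal T_0(\mathbb F^2)$ $$\hat V^{*,1}_\theta=\operatorname*{ess\,inf}_{\tau\in\mathcal T_\theta(\mathbb F^1)}\mathsf E\Big[f_\tau(1-\zeta^*_\tau)+\int_{[\theta,\tau)}g_u\,d\zeta^*_u+h_\tau\Delta\zeta^*_\tau\Big|\mathcal F^1_\theta\Big],$$ $$\hat V^{*,2}_\gamma=\operatorname*{ess\,sup}_{\sigma\in\mathcal T_\gamma(\mathbb F^2)}\mathsf E\Big[g_\sigma(1-\xi^*_\sigma)+\int_{[\gamma,\sigma)}f_u\,d\xi^*_u+h_\sigma\Delta\xi^*_\sigma\Big|\mathcal F^2_\gamma\Big].$$ Moreover, for $\theta\in\mathcal T_0(\mathbb F^1)$ and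 $\gamma\in\mathcal T_0(\mathbb F^2)$ the following right limits exist and satisfy, $\mathsf P$-a.s. (on $\{\theta<T\}$ and $\{\gamma<T\}$, respectively), $$\hat V^{*,1}_{\theta+}=\hat V^{*,1}_\theta-\mathsf E[1-\zeta^*_{\theta-}|\mathcal F^1_\theta]\,\mathsf E[\Pi^{*,1}_\theta g_\theta\Delta\zeta^{*;\theta}_\theta|\mathcal F^1_\theta]=\hat V^{*,1}_\theta-\mathsf E[g_\theta\Delta\zeta^*_\theta|\mathcal F^1_\theta],$$ $$\hat V^{*,2}_{\gamma+}=\hat V^{*,2}_\gamma-\mathsf E[1-\xi^*_{\gamma-}|\mathcal F^2_\gamma]\,\mathsf E[\Pi^{*,2}_\gamma f_\gamma\Delta\xi^{*;\gamma}_\gamma|\mathcal F^2_\gamma]=\hat V^{*,2}_\gamma-\mathsf E[f_\gamma\Delta\xi^*_\gamma|\mathcal F^2_\gamma].$$ Finally, for any previsible $\theta\in\mathcal T_0(\mathbb F^1)$ and previsible $\gamma\in\mathcal T_0(\mathbb F^2)$ (with $\theta>0$, $\gamma>0$), $$\hat V^{*,1}_{\theta-}\le\mathsf E[1-\zeta^*_{\theta-}|\mathcal F^1_{\theta-}]\operatorname*{ess\,inf}_{\xi\in\mathcal A^\circ_\theta(\mathbb F^1)}J^{\widehat\Pi^{*,1}_\theta}(\xi,\zeta^{*;\theta}|\mathcal F^1_{\theta-}),$$ $$\hat V^{*,2}_{\gamma-}\ge\mathsf E[1-\xi^*_{\gamma-}|\mathcal F^2_{\gamma-}]\operatorname*{ess\,sup}_{\zeta\in\mathcal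 A^\circ_\gamma(\mathbb F^2)}J^{\widehat\Pi^{*,2}_\gamma}(\xi^{*;\gamma},\zeta|\mathcal F^2_{\gamma-}),$$ with equality on the events $\{\xi^*_{\theta-}<1\}$ and $\{\zeta^*_{\gamma-}<1\}$, respectively. Thus, if the filtrations $\mathbb F^1$ and $\mathbb F^2$ are continuous, the processes $(\hat V^{*,1}_t)_{t\in[0,T]}$ and $(\hat V^{*,2}_t)_{t\in[0,T]}$ are càglàd (left-continuous with right limits) as long as $\xi^*_{t-}<1$ and $\zeta^*_{t-}<1$, respectively.
   Context: Let $T\in(0,\infty)$ and let $(\Omega,\mathcal F,\mathsf P)$ be a complete probability space with a right-continuous filtration $\mathbb F=(\mathcal F_t)_{t\in[0,T]}$ completed with $\mathsf P$-null sets, $\mathcal F_T\subsetneq\mathcal F$. Right-continuous filtrations $\mathbb F^i=(\mathcal F^i_t)_{t\in[0,T]}$, $i=1,2$, completed with null sets, satisfy $\mathcal F^1_t\vee\mathcal F^2_t\subseteq\mathcal F_t$. Equalities/inequalities between random variables are $\mathsf P$-a.s. $\mathcal L_b(\mathsf P)$ is the space of càdlàg $\mathcal B([0,T])\times\mathcal F$-measurable $X$ with $\mathsf E[\sup_{0\le t\le T}|X_t|]<\infty$. The payoff processes $f,g,h\in\mathcal L_b(\mathsf P)$ are $\mathbb F$-adapted with $f_t\ge h_t\ge g_t$ for all $t\in[0,T]$ a.s. For a filtration $\mathbb G\subseteq\mathbb F$ and a $\mathbb G$-stopping time $\theta\in[0,T]$: $\mathcal T_\theta(\mathbb G)$ is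 the set of $\mathbb G$-stopping times with values in $[\theta,T]$; $\mathcal A^\circ_\theta(\mathbb G)$ is the set of $\mathbb G$-adapted càdlàg non-decreasing $\rho$ with $\rho_{\theta-}=0$, $\rho_T=1$ (for $\theta=0$, $\rho_{0-}:=0$, so $d\rho$ may charge $\{0\}$); $\Delta\rho_t=\rho_t-\rho_{t-}$. The $\mathbb G$-randomised stopping time generated by $\rho\in\mathcal A^\circ_\theta(\mathbb G)$ is $\eta=\inf\{t\in[0,T]:\rho_t>Z\}$ with $Z\sim U([0,1])$ independent of $\mathcal F_T$; the class of these is $\mathcal T^R_\theta(\mathbb G)$. The randomisation devices $Z$ of the two players are independent. Game: $\mathcal P(\tau,\sigma)=f_\tau\mathbf 1_{\{\tau<\sigma\}}+h_\tau\mathbf 1_{\{\tau=\sigma\}}+g_\sigma\mathbf 1_{\{\sigma<\tau\}}$; Player 1 picks $\tau\in\mathcal T^R_0(\mathbb F^1)$ to minimise, Player 2 picks $\sigma\in\mathcal T^R_0(\mathbb F^2)$ to maximise $\mathsf E[\mathcal P(\tau,\sigma)]$. A pair $(\xi^*,\zeta^* )\in\mathcal A^\circ_0(\mathbb F^1)\times\mathcal A^\circ_0(\mathbb F^2)$ is optimal if it generates a saddle point $(\tau_*,\sigma_* )$: $\mathsf E[\mathcal P(\tau_*,\sigma)]\le\mathsf E[\mathcal P(\tau_*,\sigma_* )]\le\mathsf E[\mathcal P(\tau,\sigma_* )]$ for all $(\tau,\sigma)\in\mathcal T^R_0(\mathbb F^1)\times\mathcal T^R_0(\mathbb F^2)$.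 Truncated controls: for a stopping time $\eta$, $\xi^{*;\eta}_t=\frac{\xi^*_t-\xi^*_{\eta-}}{1-\xi^*_{\eta-}}\mathbf 1_{\{t\ge\eta\}}$, $\zeta^{*;\eta}_t=\frac{\zeta^*_t-\zeta^*_{\eta-}}{1-\zeta^*_{\eta-}}\mathbf 1_{\{t\ge\eta\}}$, with $0/0=1$ and $\xi^{*;\eta}_{\eta-}=\zeta^{*;\eta}_{\eta-}=0$. Set $\Pi^{*,1}_\theta=\frac{1-\zeta^*_{\theta-}}{\mathsf E[1-\zeta^*_{\theta-}|\mathcal F^1_\theta]}$, $\widehat\Pi^{*,1}_\theta=\frac{1-\zeta^*_{\theta-}}{\mathsf E[1-\zeta^*_{\theta-}|\mathcal F^1_{\theta-}]}$, $\Pi^{*,2}_\gamma=\frac{1-\xi^*_{\gamma-}}{\mathsf E[1-\xi^*_{\gamma-}|\mathcal F^2_\gamma]}$, $\widehat\Pi^{*,2}_\gamma=\frac{1-\xi^*_{\gamma-}}{\mathsf E[1-\xi^*_{\gamma-}|\mathcal F^2_{\gamma-}]}$, ratios being $1$ where the denominator is $0$. For a random variable $\Pi\ge0$, a $\sigma$-algebra $\mathcal G$, and $\xi,\zeta$ started at $\theta$, $$J^\Pi(\xi,\zeta|\mathcal G)=\mathsf E\Big[\Pi\Big(\int_{[\theta,T)}f_t(1-\zeta_t)d\xi_t+\int_{[\theta,T)}g_t(1-\xi_t)d\zeta_t+\sum_{t\in[\theta,T]}h_t\Delta\zeta_t\Delta\xi_t\Big)\Big|\mathcal G\Big].$$ Equilibrium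 values: $V^{*,1}(\theta)=\operatorname*{ess\,inf}_{\xi\in\mathcal A^\circ_\theta(\mathbb F^1)}J^{\Pi^{*,1}_\theta}(\xi,\zeta^{*;\theta}|\mathcal F^1_\theta)$ for $\theta\in\mathcal T_0(\mathbb F^1)$, $V^{*,2}(\gamma)=\operatorname*{ess\,sup}_{\zeta\in\mathcal A^\circ_\gamma(\mathbb F^2)}J^{\Pi^{*,2}_\gamma}(\xi^{*;\gamma},\zeta|\mathcal F^2_\gamma)$ for $\gamma\in\mathcal T_0(\mathbb F^2)$. A $\mathbb G$-optional process $(X_t)$ aggregates a family $\{X(\theta),\theta\in\mathcal T_0(\mathbb G)\}$ if $\mathsf P(X(\theta)=X_\theta)=1$ for every $\theta\in\mathcal T_0(\mathbb G)$. Class $(D)$: the family over all stopping times is uniformly integrable. An optional semi-martingale here is an optional process, not necessarily càdlàg, that is the sum of a local martingale and an adapted process of finite variation. For a process $X$, $X_{t+}$, $X_{t-}$ denote limits along $s\downarrow t$, $s>t$, and $s\uparrow t$, $s<t$. A filtration is called continuous if all its martingales have continuous versions (equivalently, all stopping times are previsible). *)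

(* Defs.v *)
From HB Require Import structures.
From mathcomp Require Import all_boot all_order all_algebra.
From mathcomp Require Import all_classical all_reals all_analysis.
From mathcomp Require Import measurable_realfun.

Set Implicit Arguments.
Unset Strict Implicit.
Unset Printing Implicit Defensive.

Import Order.TTheory GRing.Theory Num.Theory.
Import numFieldNormedType.Exports.

Local Open Scope classical_set_scope.
Local Open Scope ring_scope.

(* A process is a function R -> Omega -> R, and a filtration a function
   R -> set (set Omega); only their values at times in [0, T] matter. *)

Section paths.
Context {R : realType}.
Variable T : R.

Definition cadlag (x : R -> R) : Prop :=
  (forall t, 0 <= t < T -> x s @[s --> t^'+] --> x t) /\
  (forall t, 0 < t <= T -> cvg (x s @[s --> t^'-])).

(* The path of a control just before time t, with the convention x_{0-} = 0. *)
Definition before (x : R -> R) (t : R) : R :=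
  if t <= 0 then 0 else lim (x s @[s --> t^'-]).

Definition jump (x : R -> R) (t : R) : R := x t - before x t.

(* The path, extended by 0 on ]-oo, 0[ (so that dx charges {0} with mass x_0)
   and by x_T on ]T, +oo[. *)
Definition path_ext (x : R -> R) (t : R) : R :=
  if t < 0 then 0 else x (Num.min t T).

(* The Lebesgue-Stieltjes measure dx; the second branch is never taken for a
   cadlag non-decreasing x with 0 <= x 0. *)
Definition dmeas (x : R -> R) : {measure set (measurableTypeR R) -> \bar R} :=
  match pselect (nondecreasing (path_ext x) /\ right_continuous (path_ext x))
  with
  | left xP =>
      lebesgue_stieltjes_measure
        (HB.pack_for (cumulative R R) (path_ext x)
           (isCumulative.Build R _ R (path_ext x) (proj1 xP) (proj2 xP)))
  | right _ => mzero
  end.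

(* The sum of an absolutely summable real family over an uncountable index
   set. *)
Definition sum_over (D : set R) (a : R -> R) : R :=
  fine (\esum_(t in D) (EFin \o a)^\+ t - \esum_(t in D) (EFin \o a)^\- t)%E.

End paths.

Section stochastic_processes.
Context {R : realType} {d : measure_display} {Omega : measurableType d}.
Variables (P : probability Omega R) (T : R).

Implicit Types (F G : R -> set (set Omega)) (X M rho : R -> Omega -> R)
  (theta tau : Omega -> R) (H : set (set Omega)).

Definition sub_measurable {d'} {S : measurableType d'} H (Y : Omega -> S) :
    Prop :=
  preimage_set_system setT Y measurable `<=` H.

Definition usual_filtration G : Prop :=
  [/\ forall t, 0 <= t <= T -> sigma_algebra setT (G t) /\ G t `<=` measurable,
      forall s t, 0 <= s -> s <= t -> t <= T -> G s `<=` G t,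
      forall t, 0 <= t < T -> G t = \bigcap_(s in `]t, T]) G s
    & P.-negligible `<=` G 0].

Definition adapted G X : Prop :=
  forall t, 0 <= t <= T -> sub_measurable (G t) (X t).

Definition cadlag_process X : Prop := forall w, cadlag T (X ^~ w).

(* The space L_b(P). *)
Definition bounded_payoff X : Prop :=
  [/\ cadlag_process X,
      measurable_fun (`[0, T] `*` [set: Omega])
        (fun p : R * Omega => X p.1 p.2)
    & (\int[P]_w ereal_sup [set `|X t w|%:E | t in `[0%R, T]] < +oo)%E].

Definition stopping_time G theta : Prop :=
  (forall w, 0 <= theta w <= T) /\
  (forall t, 0 <= t <= T -> G t [set w | theta w <= t]).

(* The set T_theta(G). *)
Definition stopping_times_from G theta : set (Omega -> R) :=
  [set tau | stopping_time G tau /\ forall w, theta w <= tau w].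

(* The sigma-algebra G_theta. *)
Definition sigma_at G theta : set (set Omega) :=
  [set A | G T A /\
    forall t, 0 <= t <= T -> G t (A `&` [set w | theta w <= t])].

(* The sigma-algebra G_{theta-}. *)
Definition sigma_before G theta : set (set Omega) :=
  <<s G 0 `|` [set B | exists t A, [/\ 0 <= t <= T, G t A
                         & B = A `&` [set w | t < theta w]]] >>.

(* Previsible times, through an announcing sequence. *)
Definition previsible_time G theta : Prop :=
  stopping_time G theta /\
  exists2 th : nat -> Omega -> R, forall n, stopping_time G (th n) &
    \forall w \ae P, [/\ nondecreasing_seq (th ^~ w),
      0 < theta w -> forall n, th n w < theta w
      & th n w @[n --> \oo] --> theta w].

(* Conditional expectation. For X >= 0 it is the [0, +oo]-valued H-measurable
   Y with the same integrals as X over the sets of H, and for signed X it is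
   E[X^+ | H] - E[X^- | H]: the variables Pi * X conditioned below are
   conditionally integrable but need not be integrable. *)
Definition is_cexp_ge0 H (X Y : Omega -> \bar R) : Prop :=
  [/\ forall w, (0 <= Y w)%E, sub_measurable H Y
    & forall A, H A -> (\int[P]_(w in A) Y w = \int[P]_(w in A) X w)%E].

Definition cexp_ge0 H (X : Omega -> \bar R) : Omega -> \bar R :=
  xget (cst 0%E) [set Y | is_cexp_ge0 H X Y].

Definition cexp H (X : Omega -> R) (w : Omega) : \bar R :=
  (cexp_ge0 H (EFin \o X)^\+ w - cexp_ge0 H (EFin \o X)^\- w)%E.

(* Essential infimum and supremum of a family of random variables (the
   library's ess_inf and ess_sup are those of a single function). *)
Definition is_essinf (Phi : set (Omega -> \bar R)) (Y : Omega -> \bar R) :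
    Prop :=
  [/\ measurable_fun setT Y,
      forall U, Phi U -> \forall w \ae P, (Y w <= U w)%E
    & forall Z : Omega -> \bar R, measurable_fun setT Z ->
        (forall U, Phi U -> \forall w \ae P, (Z w <= U w)%E) ->
        \forall w \ae P, (Z w <= Y w)%E].

Definition is_esssup (Phi : set (Omega -> \bar R)) (Y : Omega -> \bar R) :
    Prop :=
  [/\ measurable_fun setT Y,
      forall U, Phi U -> \forall w \ae P, (U w <= Y w)%E
    & forall Z : Omega -> \bar R, measurable_fun setT Z ->
        (forall U, Phi U -> \forall w \ae P, (U w <= Z w)%E) ->
        \forall w \ae P, (Y w <= Z w)%E].

Definition essinf (Phi : set (Omega -> \bar R)) : Omega -> \bar R :=
  xget (cst 0%E) [set Y | is_essinf Phi Y].

Definition esssup (Phi : set (Omega -> \bar R)) : Omega -> \bar R :=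
  xget (cst 0%E) [set Y | is_esssup Phi Y].

Definition martingale G M : Prop :=
  [/\ adapted G M,
      forall t, 0 <= t <= T -> P.-integrable setT (EFin \o M t)
    & forall s t, 0 <= s -> s <= t -> t <= T ->
        \forall w \ae P, cexp (G s) (M t) w = (M s w)%:E].

Definition local_martingale G M : Prop :=
  [/\ adapted G M, cadlag_process M
    & exists th : nat -> Omega -> R,
      [/\ forall n, stopping_time G (th n),
          forall w, nondecreasing_seq (th ^~ w),
          \forall w \ae P, exists n, th n w = T
        & forall n, martingale G (fun t w => M (Num.min t (th n w)) w)]].

(* The optional sigma-algebra on [0, T] x Omega. *)
Definition optional_sigma G : set (set (R * Omega)) :=
  <<s `[0, T] `*` [set: Omega],
      [set C | exists2 X, adapted G X /\ cadlag_process X &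
         preimage_set_system (`[0, T] `*` [set: Omega])
           (fun p : R * Omega => X p.1 p.2) measurable C] >>.

Definition optional G X : Prop :=
  preimage_set_system (`[0, T] `*` [set: Omega])
    (fun p : R * Omega => X p.1 p.2) measurable `<=` optional_sigma G.

Definition optional_semimartingale G X : Prop :=
  optional G X /\
  exists M A : R -> Omega -> R,
    [/\ local_martingale G M, adapted G A,
        \forall w \ae P, bounded_variation 0 T (A ^~ w)
      & \forall w \ae P, forall t, 0 <= t <= T -> X t w = M t w + A t w].

Definition uniformly_integrable (Phi : set (Omega -> R)) : Prop :=
  (forall Y, Phi Y -> measurable_fun setT Y) /\
  (forall e : R, 0 < e -> exists K : R, forall Y, Phi Y ->
     (\int[P]_(w in [set w | (K < `|Y w|)%R]) `|Y w|%:E <= e%:E)%E).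

Definition class_D G X : Prop :=
  uniformly_integrable
    [set (fun w => X (theta w) w) | theta in [set theta | stopping_time G theta]].

Definition aggregates G X (V : (Omega -> R) -> Omega -> \bar R) : Prop :=
  optional G X /\
  forall theta, stopping_time G theta ->
    \forall w \ae P, V theta w = (X (theta w) w)%:E.

Definition continuous_filtration G : Prop :=
  forall M, martingale G M ->
    exists2 N : R -> Omega -> R,
      forall w, {within `[0, T], continuous (N ^~ w)}
      & forall t, 0 <= t <= T -> \forall w \ae P, N t w = M t w.

End stochastic_processes.

Section game.
Context {R : realType} {d : measure_display} {Omega : measurableType d}.
Variables (P : probability Omega R) (T : R).

Implicit Types (F G : R -> set (set Omega)) (rho xi zeta : R -> Omega -> R)
  (theta tau sigma Z : Omega -> R) (H : set (set Omega)).

(* The set of controls A_theta(G); 0 <= rho 0 expresses that rho has no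
   negative jump at 0, where rho_{0-} = 0. *)
Definition control G theta : set (R -> Omega -> R) :=
  [set rho | [/\ adapted T G rho, cadlag_process T rho,
     forall w s t, 0 <= s -> s <= t -> t <= T -> rho s w <= rho t w,
     forall w, 0 <= rho 0 w
   & forall w, before (rho ^~ w) (theta w) = 0 /\ rho T w = 1]].

Definition randomised_time rho Z (w : Omega) : R :=
  inf [set t | 0 <= t <= T /\ Z w < rho t w].

Definition uniform01 Z : Prop :=
  measurable_fun setT Z /\
  forall B, measurable B -> P (Z @^-1` B) = uniform_prob (@ltr01 R) B.

(* Randomisation devices of the two players: Z1, Z2 and H are mutually
   independent. *)
Definition devices H (Z1 Z2 : Omega -> R) : Prop :=
  [/\ uniform01 Z1, uniform01 Z2
    & forall A B1 B2, H A -> measurable B1 -> measurable B2 ->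
        P (A `&` (Z1 @^-1` B1) `&` (Z2 @^-1` B2)) =
        (P A * P (Z1 @^-1` B1) * P (Z2 @^-1` B2))%E].

Variables f g h : R -> Omega -> R.

Definition payoff tau sigma (w : Omega) : R :=
  f (tau w) w * \1_[set v | tau v < sigma v] w
  + h (tau w) w * \1_[set v | tau v = sigma v] w
  + g (sigma w) w * \1_[set v | sigma v < tau v] w.

Definition optimal_pair F F1 F2 xi zeta : Prop :=
  [/\ control F1 (cst 0) xi, control F2 (cst 0) zeta
    & exists Z1 Z2,
      let tau_star := randomised_time xi Z1 in
      let sigma_star := randomised_time zeta Z2 in
      [/\ devices (F T) Z1 Z2,
          forall rho Z, control F2 (cst 0) rho -> devices (F T) Z1 Z ->
            ('E_P[payoff tau_star (randomised_time rho Z)] <=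
             'E_P[payoff tau_star sigma_star])%E
        & forall rho Z, control F1 (cst 0) rho -> devices (F T) Z Z2 ->
            ('E_P[payoff tau_star sigma_star] <=
             'E_P[payoff (randomised_time rho Z) sigma_star])%E]].

Definition truncated rho theta (t : R) (w : Omega) : R :=
  let r := before (rho ^~ w) (theta w) in
  if t < theta w then 0 else if r == 1 then 1 else (rho t w - r) / (1 - r).

(* E[1 - rho_{theta-} | H] *)
Definition survival H rho theta : Omega -> \bar R :=
  cexp P H (fun w => 1 - before (rho ^~ w) (theta w)).

(* (1 - rho_{theta-}) / E[1 - rho_{theta-} | H], equal to 1 where the
   denominator is 0. *)
Definition Pi H rho theta (w : Omega) : R :=
  if survival H rho theta w == 0%E then 1
  else (1 - before (rho ^~ w) (theta w)) / fine (survival H rho theta w).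

Definition game_cost xi zeta theta (w : Omega) : R :=
  (\int[dmeas T (xi ^~ w)]_(t in `[theta w, T[) (f t w * (1 - zeta t w)))%R
  + (\int[dmeas T (zeta ^~ w)]_(t in `[theta w, T[) (g t w * (1 - xi t w)))%R
  + sum_over `[theta w, T]
      (fun t => h t w * jump (zeta ^~ w) t * jump (xi ^~ w) t).

Definition J (wgt : Omega -> R) xi zeta theta H : Omega -> \bar R :=
  cexp P H (fun w => wgt w * game_cost xi zeta theta w).

(* For H = G_theta these are the equilibrium values, V^{*,1}(theta) with
   G = F1 and V^{*,2}(theta) with G = F2. *)
Definition value1 G zeta theta H : Omega -> \bar R :=
  essinf P [set J (Pi H zeta theta) rho (truncated zeta theta) theta H
           | rho in control G theta].

Definition value2 G xi theta H : Omega -> \bar R :=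
  esssup P [set J (Pi H xi theta) (truncated xi theta) rho theta H
           | rho in control G theta].

(* Payoff of stopping at tau, for the game started at theta, to the first
   (resp. second) player against the opponent's control rho. *)
Definition stop1 rho theta tau (w : Omega) : R :=
  f (tau w) w * (1 - rho (tau w) w)
  + (\int[dmeas T (rho ^~ w)]_(t in `[theta w, tau w[) g t w)%R
  + h (tau w) w * jump (rho ^~ w) (tau w).

Definition stop2 rho theta tau (w : Omega) : R :=
  g (tau w) w * (1 - rho (tau w) w)
  + (\int[dmeas T (rho ^~ w)]_(t in `[theta w, tau w[) f t w)%R
  + h (tau w) w * jump (rho ^~ w) (tau w).

End game.

(* Main.v *)
(* Fix the strategy x of the opponent.  A randomised stopping time is an
   average of its quantiles, which are pure stopping times; hence the survival
   probability times the equilibrium value at θ is the value of an optimal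
   stopping problem, S_θ = ess inf E[Y_τ | G_θ] over τ >= θ, minus the expected
   past cost E[int_[0, θ) g dx | G_θ], where the reward Y is not adapted.
   The submartingale S is regularised along the dyadic grid and decomposed as
   M + B (Doob-Meyer); the past cost is aggregated by optional projections N of
   int_[0, t] g^± dx and their left-continuous counterparts O, which differ from
   N at countably many stopping times only.  The right limits of the value come
   from the gap between N and O.  Optimality of xi makes S a martingale along
   the quantiles of xi, so that B is constant until xi reaches 1; as only B jumps
   at previsible times, this gives the left limits.  The second player is the
   first one after a change of sign. *)
Require Import Defs.
From HB Require Import structures.
From mathcomp Require Import all_boot all_order all_algebra.
From mathcomp Require Import all_classical all_reals all_analysis.
From mathcomp Require Import measurable_realfun.
From mathcomp Require finmap.
From mathcomp Require Import lra ring.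

Set Implicit Arguments.
Unset Strict Implicit.
Unset Printing Implicit Defensive.

Import Order.TTheory GRing.Theory Num.Theory.
Import numFieldNormedType.Exports.

Local Open Scope classical_set_scope.
Local Open Scope ring_scope.

(** A player does not observe the opponent's control, so the reward is not adapted and the usual
    Snell envelope does not apply. The infimum comes from weak compactness instead, and its
    properties are kept as comparisons of integrals [EI P B X] over events [B] of the relevant
    sigma-algebra; conditional expectations return only to match the statement. The minimiser's
    choices shrink as time passes, hence a submartingale, whose increasing part measures the loss
    caused by not having stopped. Three obstacles shape the rest. The reward is not right-continuous
    where [x] jumps: it is replaced by its right limit, which is smaller because [g <= h] and is
    approached by stopping slightly later. The past cost runs over [[0, θ[], so its projection is
    not càdlàg in general, which is why both [N] and [O] occur. The denominators of the ratios [Pi]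
    may vanish: identities are multiplied by the survival probability, which is zero only where the
    numerator is almost surely zero. At a previsible time, the announcing sequence removes the jump
    of the martingale part and the monotonicity of [B] decides the sign of what remains. *)

Notation mfunT := (measurable_fun setT).
Notation smeas := sub_measurable.
Notation mR := measurableTypeR.
Notation maxr := Num.max.
Notation minr := Num.min.
Notation mcst := measurable_cst.
Notation mcomp := measurableT_comp.
Notation mfunM := measurable_funM.
Notation mfunB := measurable_funB.
Notation mfunD := measurable_funD.

(** * Measurability of comparisons between random variables *)

Section measurable_comparison.
Context {R : realType} {d : measure_display} {Ω : measurableType d}.
Implicit Types (X Y : Ω -> R).

Lemma meas_lt X Y : mfunT X -> mfunT Y ->
 measurable [set w | X w < Y w].
Proof.
move=> mX mY; have := measurable_fun_ltr mX mY measurableT.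
by move=> /(_ [set true]); rewrite setTI; apply.
Qed.

Lemma meas_le X Y : mfunT X -> mfunT Y ->
 measurable [set w | X w <= Y w].
Proof.
move=> mX mY; have := measurable_fun_ler mX mY measurableT.
by move=> /(_ [set true]); rewrite setTI; apply.
Qed.

Lemma meas_eq X Y : mfunT X -> mfunT Y ->
 measurable [set w | X w = Y w].
Proof.
move=> mX mY.
rewrite (_ : mkset _ = [set w | X w <= Y w] `&` [set w | Y w <= X w]).
 apply: measurableI; exact: meas_le.
apply/seteqP; split=> [w /= ->|w /= [XY YX]]; first by rewrite lexx.
by apply/eqP; rewrite eq_le XY YX.
Qed.

End measurable_comparison.

(** * Integrable variables and their integrals over events *)

Section expectation.
Context {R : realType} {d : measure_display} {Ω : measurableType d}
 (P : probability Ω R).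
Implicit Types (X Y : Ω -> R) (A B : set Ω).

Definition L1 X := P.-integrable setT (EFin \o X).

Definition EI A X : R := (\int[P]_(w in A) X w)%R.

Lemma L1_meas X : L1 X -> mfunT X.
Proof. by move=> /(measurable_int P)/measurable_EFinP. Qed.

Lemma L1S A X : measurable A -> L1 X -> P.-integrable A (EFin \o X).
Proof. by move=> mA; apply: integrableS. Qed.

Lemma EIE A X : measurable A -> L1 X ->
 (EI A X)%:E = (\int[P]_(w in A) (X w)%:E)%E.
Proof.
move=> mA iX; rewrite /EI fineK// integrable_fin_num//; exact: L1S.
Qed.

Lemma L1D X Y : L1 X -> L1 Y -> L1 (fun w => X w + Y w).
Proof. exact: integrableD. Qed.

Lemma L1B X Y : L1 X -> L1 Y -> L1 (fun w => X w - Y w).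
Proof. exact: integrableB. Qed.

Lemma L1Z c X : L1 X -> L1 (fun w => c * X w).
Proof. exact: integrableZl. Qed.

Lemma L1N X : L1 X -> L1 (fun w => - X w).
Proof. exact: integrableN. Qed.

Lemma L1cst c : L1 (fun=> c).
Proof. exact: finite_measure_integrable_cst. Qed.

Lemma le_L1 X Y : mfunT X ->
 (forall w, `|X w| <= Y w) -> L1 Y -> L1 X.
Proof.
move=> mX XY; apply: le_integrable => //; first exact/measurable_EFinP.
by move=> w _; rewrite /= lee_fin (le_trans (XY w))// ler_norm.
Qed.

Lemma L1norm X : L1 X -> L1 (fun w => `|X w|).
Proof. move=> iX; exact: integrable_norm. Qed.

Lemma L1bound X (c : R) : mfunT X -> (forall w, `|X w| <= c) -> L1 X.
Proof. move=> mX Xc; apply: (le_L1 mX Xc); exact: L1cst. Qed.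

Lemma EID A X Y : measurable A -> L1 X -> L1 Y ->
 EI A (fun w => X w + Y w) = EI A X + EI A Y.
Proof. move=> mA iX iY; rewrite /EI RintegralD//; exact: L1S. Qed.

Lemma EIB A X Y : measurable A -> L1 X -> L1 Y ->
 EI A (fun w => X w - Y w) = EI A X - EI A Y.
Proof. move=> mA iX iY; rewrite /EI RintegralB//; exact: L1S. Qed.

Lemma EIZ A c X : measurable A -> L1 X -> EI A (fun w => c * X w) = c * EI A X.
Proof. move=> mA iX; rewrite /EI RintegralZl//; exact: L1S. Qed.

Lemma EIN A X : measurable A -> L1 X -> EI A (fun w => - X w) = - EI A X.
Proof.
move=> mA iX; rewrite -mulN1r -EIZ//.
by rewrite /EI; apply: eq_Rintegral => w _; rewrite mulN1r.
Qed.

Lemma EIcst A c : measurable A -> EI A (fun=> c) = c * fine (P A).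
Proof. by move=> mA; rewrite /EI Rintegral_cst. Qed.

Lemma EI_le A X Y : measurable A -> L1 X -> L1 Y ->
 (forall w, A w -> X w <= Y w) -> EI A X <= EI A Y.
Proof. move=> mA iX iY XY; apply: le_Rintegral => //; exact: L1S. Qed.

Lemma EI_ge0 A X : (forall w, A w -> 0 <= X w) -> 0 <= EI A X.
Proof. exact: Rintegral_ge0. Qed.

Lemma eq_EI A X Y : (forall w, A w -> X w = Y w) -> EI A X = EI A Y.
Proof. move=> XY; apply: eq_Rintegral => w /[!inE]; exact: XY. Qed.

Lemma EI_aeq A X Y : measurable A -> L1 X -> L1 Y ->
 (\forall w \ae P, A w -> X w = Y w) -> EI A X = EI A Y.
Proof.
move=> mA iX iY XY; rewrite /EI /Rintegral; congr fine.
apply: ae_eq_integral => //.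
- exact/measurable_funTS/measurable_EFinP/L1_meas.
- exact/measurable_funTS/measurable_EFinP/L1_meas.
- by apply: filterS XY => w XY Aw /=; rewrite XY.
Qed.

Lemma EI_set0 X : EI set0 X = 0.
Proof. exact: Rintegral_set0. Qed.

Lemma EI_setU A B X : measurable A -> measurable B -> L1 X ->
 (forall w, A w -> B w -> False) -> EI (A `|` B) X = EI A X + EI B X.
Proof.
move=> mA mB iX AB; rewrite /EI Rintegral_setU//.
 apply: L1S => //; exact: measurableU.
apply/disj_setPS => w [Aw Bw]; exact: AB Aw Bw.
Qed.

Lemma EI_split A B X : measurable A -> measurable B -> L1 X ->
 EI A X = EI (A `&` B) X + EI (A `&` ~` B) X.
Proof.
move=> mA mB iX; rewrite -EI_setU//.
- by rewrite -setIUr setUv setIT.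
- exact: measurableI.
- apply: measurableI => //; exact: measurableC.
- by move=> w [_ Bw] [_ nBw].
Qed.

Lemma EI_null A X : measurable A -> P A = 0%E -> L1 X -> EI A X = 0.
Proof.
move=> mA A0 iX; rewrite /EI /Rintegral null_set_integral//.
exact/measurable_funTS/measurable_EFinP/L1_meas.
Qed.

Lemma EI_indic A B X : measurable A -> measurable B ->
 EI A (fun w => \1_B w * X w) = EI (A `&` B) X.
Proof.
move=> mA mB; rewrite /EI [RHS]Rintegral_mkcondr; apply: eq_Rintegral => w _.
by rewrite patchE indicE; case: (w \in B); rewrite ?mul1r ?mul0r.
Qed.

Lemma L1indic B X : measurable B -> L1 X -> L1 (fun w => \1_B w * X w).
Proof.
move=> mB iX; apply: (@le_L1 _ (fun w => `|X w|)); last exact: L1norm.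
 by apply: mfunM; [exact: measurable_indic|exact: L1_meas].
move=> w; rewrite normrM indicE; case: (_ \in _); rewrite ?normr1 ?mul1r//.
by rewrite normr0 mul0r.
Qed.

Lemma EI_abs A X : measurable A -> L1 X -> `|EI A X| <= EI A (fun w => `|X w|).
Proof. move=> mA iX; apply: le_normr_Rintegral => //; exact: L1S. Qed.

Lemma EI_subset A B X : measurable A -> measurable B -> A `<=` B -> L1 X ->
 (forall w, 0 <= X w) -> EI A X <= EI B X.
Proof.
move=> mA mB AB iX X0; rewrite (EI_split mB mA iX) (setIidr AB) lerDl.
apply: EI_ge0 => w _; exact: X0.
Qed.

Lemma EI_ae_le A X Y : measurable A -> L1 X -> L1 Y ->
 (\forall w \ae P, A w -> X w <= Y w) -> EI A X <= EI A Y.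
Proof.
move=> mA iX iY XY.
(* The maximum dominates [X] everywhere and equals [Y] almost surely on [A]. *)
have mM : mfunT (fun w => maxr (X w) (Y w)).
 apply: measurable_maxr; exact: L1_meas.
have iM : L1 (fun w => maxr (X w) (Y w)).
 apply: (@le_L1 _ (fun w => `|X w| + `|Y w|)) => //; last first.
  apply: L1D; exact: L1norm.
 move=> w; rewrite /maxr; case: ifP => _.
  by rewrite lerDr.
 by rewrite lerDl.
rewrite (@EI_aeq A Y (fun w => maxr (X w) (Y w)))//.
 by apply: EI_le => // w _; rewrite le_max lexx.
by apply: filterS XY => w XY /XY /max_idPr.
Qed.

(** It suffices to test the inequality on the event where it fails: the difference is positive there
    with a non-positive integral, so the event is null. Integral comparisons are turned into almost
    sure ones in this way. *)
Lemma ae_le_EI X Y : L1 X -> L1 Y ->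
 EI [set w | Y w < X w] X <= EI [set w | Y w < X w] Y ->
 \forall w \ae P, X w <= Y w.
Proof.
move=> iX iY; set A := [set w | _].
have mA : measurable A.
 apply: meas_lt; exact: L1_meas.
move=> le.
have iXY : L1 (fun w => X w - Y w) by exact: L1B.
have Aint : (\int[P]_(w in A) (X w - Y w)%:E = 0)%E.
 have := EIE mA iXY; rewrite /comp/= => <-; congr EFin.
 apply/eqP; rewrite eq_le EIB// subr_le0 le/= -EIB//.
 by apply: EI_ge0 => w /= /ltW; rewrite subr_ge0.
have : ae_eq P A (fun w => (X w - Y w)%:E) (cst 0%E).
 apply/(ae_eq_integral_abs P mA).
  exact/measurable_funTS/measurable_EFinP/L1_meas.
 rewrite -[RHS]Aint; apply: eq_integral => w; rewrite inE /= => /ltW XY.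
 by rewrite ger0_norm// subr_ge0.
apply: filterS => w Aw; rewrite leNgt; apply/negP => YX.
have := Aw YX; move=> -[] /eqP; rewrite subr_eq0 => /eqP XY.
by move: YX; rewrite XY ltxx.
Qed.

Lemma EI_dominated X (X_ : nat -> Ω -> R) Y A : measurable A ->
 (forall n, mfunT (X_ n)) -> mfunT X ->
 L1 Y -> (forall n, \forall w \ae P, `|X_ n w| <= Y w) ->
 (\forall w \ae P, X_ n w @[n --> \oo] --> X w) ->
 L1 X /\ EI A (X_ n) @[n --> \oo] --> EI A X.
Proof.
move=> mA mX_ mX iY XY cX.
have cX' : {ae P, forall w, setT w ->
  (fun n => (X_ n w)%:E) @ \oo --> (X w)%:E}.
 by apply: filterS cX => w cX _; apply/cvg_EFin => //; near=> n.
have iA D (mD : measurable D) := @dominated_convergence _ _ _ P D mD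
 (fun n w => (X_ n w)%:E) (fun w => (X w)%:E) (fun w => (Y w)%:E).
have H D : measurable D -> [/\ P.-integrable D (fun w => (X w)%:E) ,
  [sequence (\int[P]_(x in D) `|(X_ n x)%:E - (X x)%:E|)%E]_n @ \oo --> 0%E &
 [sequence (\int[P]_(x in D) (X_ n x)%:E)%E]_n @ \oo --> (\int[P]_(x in D) (X x)%:E)%E ].
 move=> mD; apply: iA => //.
 - move=> n; exact/measurable_funTS/measurable_EFinP.
 - exact/measurable_funTS/measurable_EFinP.
 - by apply: filterS cX' => w + _; apply.
 - exact: L1S.
 - by apply: filterS (ae_foralln XY) => w XYw n _; rewrite abse_EFin lee_fin.
have [iX _ _] := H _ measurableT; split => //.
have [_ _ cA] := H _ mA.
have fA : (\int[P]_(x in A) (X x)%:E)%E \is a fin_num.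
 apply: integrable_fin_num => //; exact: L1S.
by apply: fine_cvg; rewrite fineK.
Unshelve. all: by end_near.
Qed.

End expectation.

(** * Complete sub-sigma-algebras *)

Section sub_sigma_algebras.
Context {R : realType} {d : measure_display} {Ω : measurableType d}
 (P : probability Ω R).
Implicit Types (X Y : Ω -> R) (A B : set Ω) (H : set (set Ω)).

(** Null sets are included so that a variable can be modified on a null set without losing
    measurability, see [sm_ae]. *)
Definition csub H := [/\ sigma_algebra setT H, H `<=` measurable
 & P.-negligible `<=` H].

Lemma csub_set0 H : csub H -> H set0.
Proof. by move=> [[]]. Qed.

Lemma csubC H A : csub H -> H A -> H (~` A).
Proof. move=> [[_ HC _] _ _] HA; rewrite -setTD; exact: HC. Qed.

Lemma csubT H : csub H -> H setT.
Proof. move=> cH; rewrite -setC0; apply: csubC => //; exact: csub_set0. Qed.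

Lemma csub_bigcup H (A : (set Ω)^nat) : csub H -> (forall n, H (A n)) ->
 H (\bigcup_n A n).
Proof. move=> [[_ _ HU] _ _]; exact: HU. Qed.

Lemma csub_bigcap H (A : (set Ω)^nat) : csub H -> (forall n, H (A n)) ->
 H (\bigcap_n A n).
Proof.
move=> cH HA; rewrite -[X in H X]setCK setC_bigcap; apply: csubC => //.
apply: csub_bigcup => // n; exact: csubC.
Qed.

Lemma csubU H A B : csub H -> H A -> H B -> H (A `|` B).
Proof.
move=> cH HA HB; rewrite -bigcup2E; apply: csub_bigcup => // -[|[|n]]//=.
exact: csub_set0.
Qed.

Lemma csubI H A B : csub H -> H A -> H B -> H (A `&` B).
Proof.
move=> cH HA HB; rewrite -[X in H X]setCK setCI; apply: csubC => //.
apply: csubU => //; exact: csubC.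
Qed.

Lemma csubD H A B : csub H -> H A -> H B -> H (A `\` B).
Proof. move=> cH HA HB; rewrite setDE; apply: csubI => //; exact: csubC. Qed.

Lemma csubm H A : csub H -> H A -> measurable A.
Proof. by move=> [_ +] _; apply. Qed.

Lemma csub_bigsetU H I (r : seq I) (p : pred I) (A : I -> set Ω) :
 csub H -> (forall i, H (A i)) -> H (\big[setU/set0]_(i <- r | p i) A i).
Proof.
move=> cH HA; elim/big_ind : _ => // [|x y]; first exact: csub_set0.
exact: csubU.
Qed.

Lemma csub_sigma H : csub H -> @measurable _ (g_sigma_algebraType H) = H.
Proof. move=> [sH _ _]; exact: measurable_g_measurableTypeE. Qed.

Lemma smE d' (S : measurableType d') H (Y : Ω -> S) : csub H ->
 smeas H Y <->
 @measurable_fun _ _ (g_sigma_algebraType H) S setT Y.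
Proof.
move=> cH; split=> [HY _ B mB|mY].
 by rewrite csub_sigma//; apply: HY; exists B.
move=> _ [B mB <-]; have := mY measurableT B mB.
by rewrite (csub_sigma cH).
Qed.

Lemma sm_meas d' (S : measurableType d') H (Y : Ω -> S) : csub H ->
 smeas H Y -> mfunT Y.
Proof.
move=> cH HY _ B mB; apply: (csubm cH); apply: HY; by exists B.
Qed.

Lemma sm_sub d' (S : measurableType d') H H' (Y : Ω -> S) : H `<=` H' ->
 smeas H Y -> smeas H' Y.
Proof. move=> HH' HY A YA; exact/HH'/HY. Qed.

Lemma sm_preimage d' (S : measurableType d') H (Y : Ω -> S) (B : set S) :
 smeas H Y -> measurable B -> H (Y @^-1` B).
Proof. by move=> HY mB; apply: HY; exists B => //; rewrite setTI. Qed.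

Lemma smT d' (S : measurableType d') (Y : Ω -> S) :
 mfunT Y -> smeas measurable Y.
Proof. move=> mY _ [B mB <-]; exact: mY. Qed.

Lemma csub_lt H X Y : csub H -> smeas H X -> smeas H Y ->
 H [set w | X w < Y w].
Proof.
move=> cH /(smE _ cH) HX /(smE _ cH) HY.
by have := meas_lt HX HY; rewrite csub_sigma.
Qed.

Lemma csub_le H X Y : csub H -> smeas H X -> smeas H Y ->
 H [set w | X w <= Y w].
Proof.
move=> cH /(smE _ cH) HX /(smE _ cH) HY.
by have := meas_le HX HY; rewrite csub_sigma.
Qed.

Lemma csub_eq H X Y : csub H -> smeas H X -> smeas H Y ->
 H [set w | X w = Y w].
Proof.
move=> cH /(smE _ cH) HX /(smE _ cH) HY.
by have := meas_eq HX HY; rewrite csub_sigma.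
Qed.

Lemma smD H X Y : csub H -> smeas H X -> smeas H Y ->
 smeas H (fun w => X w + Y w).
Proof.
by move=> cH /(smE _ cH) HX /(smE _ cH) HY; apply/(smE _ cH)/mfunD.
Qed.

Lemma smB H X Y : csub H -> smeas H X -> smeas H Y ->
 smeas H (fun w => X w - Y w).
Proof.
by move=> cH /(smE _ cH) HX /(smE _ cH) HY; apply/(smE _ cH)/mfunB.
Qed.

Lemma smM H X Y : csub H -> smeas H X -> smeas H Y ->
 smeas H (fun w => X w * Y w).
Proof.
by move=> cH /(smE _ cH) HX /(smE _ cH) HY; apply/(smE _ cH)/mfunM.
Qed.

Lemma smcst d' (S : measurableType d') H (c : S) : csub H ->
 smeas H (fun _ : Ω => c).
Proof. by move=> cH; apply/(smE _ cH)/mcst. Qed.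

Lemma sm_indic H A : csub H -> H A -> smeas H (\1_A : Ω -> R).
Proof.
move=> cH HA; apply/(smE _ cH).
by apply: measurable_indic; rewrite csub_sigma.
Qed.

Lemma sm_lim H (X_ : nat -> Ω -> R) X : csub H ->
 (forall n, smeas H (X_ n)) ->
 (forall w, X_ n w @[n --> \oo] --> X w) -> smeas H X.
Proof.
move=> cH HX cX; apply/(smE _ cH).
apply: (@measurable_fun_cvg _ (g_sigma_algebraType H) _ _ X_) => //.
by move=> n; apply/(smE _ cH).
Qed.

Lemma sm_ae H X Y : csub H -> smeas H X ->
 (\forall w \ae P, X w = Y w) -> smeas H Y.
Proof.
move=> cH HX XY; have [_ _ nH] := cH.
have HN : H [set w | X w <> Y w] by exact: nH.
move=> _ [B mB <-]; rewrite setTI.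
have HNB : H ([set w | X w <> Y w] `&` Y @^-1` B).
 by apply: nH; apply: negligibleS XY => w [].
rewrite (_ : Y @^-1` B = (X @^-1` B `\` [set w | X w <> Y w])
  `|` ([set w | X w <> Y w] `&` Y @^-1` B)).
 apply: csubU => //; apply: csubD => //; exact: sm_preimage.
apply/seteqP; split=> w /=.
 have [XYw|XYw] := pselect (X w = Y w); last by right.
 by rewrite -XYw => ?; left; split => // /(_ erefl).
by move=> [[+ /contrapT <-]|[_]].
Qed.

End sub_sigma_algebras.

(** * Densities and conditional expectation of integrable variables *)

Section conditional_expectation.
Context {R : realType} {d : measure_display} {Ω : measurableType d}
 (P : probability Ω R).
Implicit Types (X Y : Ω -> R) (A B : set Ω) (H : set (set Ω)).

(** Radon-Nikodym on the coarse space: [nu] and [P] are pushed forward along the identity into Ω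
    equipped with [H]. The density found there is [H]-measurable by construction, and a change of
    variables brings its integrals back. It serves both for conditional expectations and for weak
    limits. *)
Lemma density_exists H (nu : {charge set Ω -> \bar R}) :
 csub P H -> nu `<< P ->
 exists Y, [/\ smeas H Y, L1 P Y
  & forall A, H A -> (EI P A Y)%:E = nu A].
Proof.
move=> cH nuP; pose HT := g_sigma_algebraType H.
have mid : @measurable_fun _ _ Ω HT setT id.
 move=> _ B; rewrite (csub_sigma cH) setTI => HB; exact: csubm cH HB.
pose idH : {mfun Ω >-> HT} :=
 HB.pack (id : Ω -> HT) (isMeasurableFun.Build _ _ _ _ _ mid).
pose mu : probability HT R := distribution P idH.
pose nuH0 : {charge set HT -> \bar R} := pushforward nu idH.
pose nuH := nuH0 mid.
have dom : nuH `<< mu by exact: dominates_pushforward.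
have fY x := Radon_Nikodym_fin_num x dom.
pose Y : HT -> R := fine \o Radon_Nikodym nuH mu.
have YE : EFin \o Y = Radon_Nikodym nuH mu.
 by apply/funext => x; rewrite /Y /= fineK.
have iY : mu.-integrable setT (EFin \o Y).
 rewrite YE; exact: Radon_Nikodym_integrable.
have mY : mfunT Y.
 apply/measurable_EFinP; apply: (measurable_int mu); exact: iY.
have HY : smeas H (Y : Ω -> R) by apply/(smE _ cH).
have iPY : L1 P (Y : Ω -> R).
 apply/integrableP; split; first exact/measurable_EFinP/(sm_meas cH HY).
 case/integrableP : iY => mEY.
 rewrite ge0_integral_distribution//; exact: mcomp.
exists Y; split => // A HA.
rewrite EIE//; last exact: csubm cH HA.
have -> : nu A = nuH A by [].
rewrite (@Radon_Nikodym_integral _ _ _ nuH mu A)//; last first.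
 by rewrite (csub_sigma cH).
rewrite -YE /mu /distribution integral_pushforward//.
- exact/measurable_EFinP.
- apply: (L1S _ iPY); exact: csubm cH HA.
- by rewrite (csub_sigma cH).
Qed.

Definition is_ce H X Y := [/\ smeas H Y, L1 P Y
 & forall A, H A -> EI P A Y = EI P A X].

Lemma ce_exists H X : csub P H -> L1 P X -> exists Y, is_ce H X Y.
Proof.
move=> cH iX.
have dom : induced_charge iX `<< P.
 apply/null_content_dominatesP => A mA A0.
 by rewrite /induced_charge -EIE// EI_null.
have [Y [HY iY YE]] := @density_exists H (induced_charge iX) cH dom.
exists Y; split => // A HA; apply: EFin_inj.
rewrite YE// EIE//; exact: csubm cH HA.
Qed.

(** Real-valued, for integrable variables only. The [cexp] of the statement takes extended values
    and agrees with it almost surely, by [cexp_L1]. *)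
Definition ce H X : Ω -> R := xget (cst 0) [set Y | is_ce H X Y].

Lemma ceP H X : csub P H -> L1 P X -> is_ce H X (ce H X).
Proof.
move=> cH iX; have [Y YP] := ce_exists cH iX.
exact: (@xgetPex _ (cst 0) [set Y | is_ce H X Y] (ex_intro _ Y YP)).
Qed.

Lemma ce_sm H X : csub P H -> L1 P X -> smeas H (ce H X).
Proof. by move=> cH iX; have [] := ceP cH iX. Qed.

Lemma ce_L1 H X : csub P H -> L1 P X -> L1 P (ce H X).
Proof. by move=> cH iX; have [] := ceP cH iX. Qed.

Lemma EI_ce H X A : csub P H -> L1 P X -> H A -> EI P A (ce H X) = EI P A X.
Proof. by move=> cH iX HA; have [_ _ ->] := ceP cH iX. Qed.

Lemma sm_ae_le H X Y : csub P H -> smeas H X -> smeas H Y ->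
 L1 P X -> L1 P Y -> (forall A, H A -> EI P A X <= EI P A Y) ->
 \forall w \ae P, X w <= Y w.
Proof.
move=> cH HX HY iX iY XY; apply: ae_le_EI => //; apply: XY.
exact: csub_lt cH HY HX.
Qed.

Lemma sm_ae_eq H X Y : csub P H -> smeas H X -> smeas H Y ->
 L1 P X -> L1 P Y -> (forall A, H A -> EI P A X = EI P A Y) ->
 \forall w \ae P, X w = Y w.
Proof.
move=> cH HX HY iX iY XY.
have XY1 : \forall w \ae P, X w <= Y w.
 by apply: sm_ae_le HX HY iX iY _ => // A HA; rewrite XY.
have XY2 : \forall w \ae P, Y w <= X w.
 by apply: sm_ae_le HY HX iY iX _ => // A HA; rewrite XY.
by apply: filterS2 XY1 XY2 => w ? ?; apply/eqP; rewrite eq_le; apply/andP.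
Qed.

Lemma is_ce_uniq H X Y Y' : csub P H -> is_ce H X Y -> is_ce H X Y' ->
 \forall w \ae P, Y w = Y' w.
Proof.
move=> cH [HY iY YE] [HY' iY' YE']; apply: sm_ae_eq HY HY' iY iY' _ => // A HA.
by rewrite YE// YE'.
Qed.

Lemma ceE H X Y : csub P H -> L1 P X -> is_ce H X Y ->
 \forall w \ae P, ce H X w = Y w.
Proof. move=> cH iX HY; apply: is_ce_uniq HY => //; exact: ceP. Qed.

Lemma ce_ge0 H X : csub P H -> L1 P X -> (forall w, 0 <= X w) ->
 \forall w \ae P, 0 <= ce H X w.
Proof.
move=> cH iX X0; apply: (@sm_ae_le H (cst 0)) => //.
- exact: smcst cH.
- exact: ce_sm.
- exact: L1cst.
- exact: ce_L1.
- move=> A HA; rewrite EI_ce// EIcst ?mul0r; last exact: csubm cH HA.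
 by apply: EI_ge0.
Qed.

Lemma sm_opp H X : csub P H -> smeas H X -> smeas H (fun w => - X w).
Proof. move=> cH HX; apply/(smE _ cH); apply: mcomp => //; exact/(smE _ cH). Qed.

Lemma ceN H X : csub P H -> L1 P X -> \forall w \ae P, ce H (fun w => - X w) w = - ce H X w.
Proof.
move=> cH iX; have [a b c] := ceP cH iX; apply: (ceE cH (L1N iX)).
split; [exact: sm_opp|exact: L1N|move=> A HA; have mA := csubm cH HA].
by rewrite !EIN// c.
Qed.

End conditional_expectation.

Ltac meas_hyp := match goal with
 | H : _ |- _ => solve [apply: H; by []]
 | H : @csub _ _ _ _ ?K |- @measurable _ _ _ => solve [apply: (csubm H); by []]
 | H : @csub _ _ _ _ ?K |- @measurable_fun _ _ _ _ _ _ => solve [apply: (sm_meas H); by []]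
 | H : is_true (@L1 _ _ _ _ ?X) |- @measurable_fun _ _ _ _ _ ?X => exact: L1_meas H
 end.

(** Closes measurability and integrability goals by following the syntax of the expression, after
    trying the hypotheses at hand. *)
Ltac meas := first [by [] | meas_hyp | lazymatch goal with
 | |- forall _, _ => move=> ?; meas
 | |- is_true (@L1 _ _ _ _ (fun w => (@?f w) - (@?g w))) => apply: L1B; meas
 | |- is_true (@L1 _ _ _ _ (fun w => (@?f w) + (@?g w))) => apply: L1D; meas
 | |- is_true (@L1 _ _ _ _ (fun w => - (@?f w))) => apply: L1N; meas
 | |- is_true (@L1 _ _ _ _ (fun w => `|(@?f w)|)) => apply: L1norm; meas
 | |- is_true (@L1 _ _ _ _ (fun w => (\1_ _ w) * (@?g w))) => apply: L1indic; meas
 | |- is_true (@L1 _ _ _ _ (fun w => ?c * (@?g w))) => apply: L1Z; meas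
 | |- is_true (@L1 _ _ _ _ (fun _ => ?c)) => exact: L1cst
 | |- @measurable_fun _ _ _ _ _ (EFin \o _) => apply/measurable_EFinP; meas
 | |- @measurable_fun _ _ _ _ _ (fun w => (@?f w)%:E) => apply/measurable_EFinP; meas
 | |- @measurable_fun _ _ _ _ ?D _ =>
   lazymatch D with setT => idtac | _ => apply: measurable_funTS end;
   first [by [] | meas_hyp | lazymatch goal with
   | |- @measurable_fun _ _ _ _ _ (fun w => (@?f w) - (@?g w)) => apply: mfunB; meas
   | |- @measurable_fun _ _ _ _ _ (fun w => (@?f w) + (@?g w)) => apply: mfunD; meas
   | |- @measurable_fun _ _ _ _ _ (fun w => (@?f w) * (@?g w)) => apply: mfunM; meas
   | |- @measurable_fun _ _ _ _ _ (fun w => maxr (@?f w) (@?g w)) => apply: measurable_maxr; meas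
   | |- @measurable_fun _ _ _ _ _ (fun w => minr (@?f w) (@?g w)) => apply: measurable_minr; meas
   | |- @measurable_fun _ _ _ _ _ (fun w => `|(@?f w)|) => apply: mcomp; meas
   | |- @measurable_fun _ _ _ _ _ (\1_ _) => apply: measurable_indic; meas
   | |- @measurable_fun _ _ _ _ _ (fun w => \1_ _ w) => apply: measurable_indic; meas
   | |- @measurable_fun _ _ _ _ _ (fun x => x) => exact: measurable_id
   | |- @measurable_fun _ _ _ _ _ (fun w => if _ then _ else _) => apply: measurable_fun_ifT; meas
   | |- @measurable_fun _ _ _ _ _ (fun w => (_ < _)%R) => apply: measurable_fun_ltr; meas
   | |- @measurable_fun _ _ _ _ _ (fun w => (_ <= _)%R) => apply: measurable_fun_ler; meas
   | |- _ => apply: L1_meas; meas end]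
 | |- smeas _ (fun w => (@?f w) - (@?g w)) => apply: smB; meas
 | |- smeas _ (fun w => (@?f w) + (@?g w)) => apply: smD; meas
 | |- smeas _ (fun w => (@?f w) * (@?g w)) => apply: smM; meas
 | |- smeas _ (ce _ _ _) => apply: ce_sm; meas
 | |- is_true (@L1 _ _ _ _ (ce _ _ _)) => apply: ce_L1; meas
 | |- @measurable _ _ (_ `&` _) => apply: measurableI; meas
 | |- @measurable _ _ (_ `|` _) => apply: measurableU; meas
 | |- @measurable _ _ (_ `\` _) => apply: measurableD; meas
 | |- @measurable _ _ (~` _) => apply: measurableC; meas
 | |- @measurable _ _ (mkset (fun w => is_true (@Order.lt _ _ (@?f w) (@?g w)))) => apply: meas_lt; meas
 | |- @measurable _ _ (mkset (fun w => is_true (@Order.le _ _ (@?f w) (@?g w)))) => apply: meas_le; meas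
 | |- @measurable _ _ (mkset (fun w => (@?f w) = (@?g w))) => apply: meas_eq; meas
 | |- @measurable _ _ (_ @^-1` _) => apply: measurable_funPTI; meas
 | |- is_true (@integrable _ _ _ _ _ _) => apply: L1S; meas
 end].

(** * One-sided limits and dyadic approximation from the right *)

Section real_limits.
Context {R : realType}.
Implicit Types (f : R -> R) (u : nat -> R) (a t l e : R).

Lemma rcvgP f t l : f r @[r --> t^'+] --> l <->
 forall e, 0 < e -> exists2 c, 0 < c & forall r, t < r -> r < t + c ->
  `|l - f r| < e.
Proof.
split=> [/cvgrPdist_lt fl e e0|fl].
 have [/= c c0 tc] := fl e e0; exists c => // r tr rtc; apply: tc => //=.
 rewrite ltr_distlC; lra.
apply/cvgrPdist_lt => e e0; have [c c0 tc] := fl e e0.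
exists c => //= r /=; rewrite ltr_distlC => /andP[_ rtc] tr; exact: tc.
Qed.

Lemma lcvgP f t l : f r @[r --> t^'-] --> l <->
 forall e, 0 < e -> exists2 c, 0 < c & forall r, r < t -> t - c < r ->
  `|l - f r| < e.
Proof.
split=> [/cvgrPdist_lt fl e e0|fl].
 have [/= c c0 tc] := fl e e0; exists c => // r tr rtc; apply: tc => //=.
 rewrite ltr_distlC; lra.
apply/cvgrPdist_lt => e e0; have [c c0 tc] := fl e e0.
exists c => //= r /=; rewrite ltr_distlC => /andP[rtc _] tr; exact: tc.
Qed.

Lemma cvgnP u l : u n @[n --> \oo] --> l <->
 forall e, 0 < e -> exists N, forall n, (N <= n)%N -> `|l - u n| < e.
Proof.
split=> [/cvgrPdist_lt ul e e0|ul].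
 by have [N _ NP] := ul e e0; exists N => n Nn; exact: NP.
apply/cvgrPdist_lt => e e0; have [N NP] := ul e e0.
exists N => // n  Nn; exact: NP.
Qed.

Definition mesh (n : nat) : R := (2 ^+ n)^-1.

Lemma mesh_gt0 n : 0 < mesh n.
Proof. by rewrite invr_gt0. Qed.

Lemma mesh_ge0 n : 0 <= mesh n.
Proof. exact/ltW/mesh_gt0. Qed.

Lemma mesh_le m n : (m <= n)%N -> mesh n <= mesh m.
Proof.
move=> mn; rewrite lef_pV2 ?posrE ?exprn_gt0//.
by rewrite ler_weXn2l// ler1n.
Qed.

Lemma mesh_small e : 0 < e -> exists n, mesh n < e.
Proof.
move=> e0; have [N _ NP] := near_infty_natSinv_expn_lt (PosNum e0).
by exists N; have := NP N (leqnn _); rewrite div1r.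
Qed.

(** For [x >= 0], the first dyadic number of level [n] strictly above [x]: the approximations must
    stay on the right of [x], as right limits ignore the value at the point. *)
Definition up (n : nat) (x : R) : R := (Num.trunc (x * 2 ^+ n)).+1%:R * mesh n.

Lemma lt_up n x : x < up n x.
Proof. by rewrite ltr_pdivlMr ?exprn_gt0// truncnS_gt. Qed.

Lemma up_le n x : 0 <= x -> up n x <= x + mesh n.
Proof.
move=> x0; rewrite /up -natr1 mulrDl mul1r lerD2r.
rewrite ler_pdivrMr ?exprn_gt0// truncn_le.
by rewrite mulr_ge0.
Qed.

(** The cap makes the sequence constant when [x] is the end point [a], so right-continuity is asked
    below [a] only. *)
Lemma minup_cvg (f : R -> R) a x : 0 <= x <= a ->
 (x < a -> f r @[r --> x^'+] --> f x) ->
 f (minr a (up n x)) @[n --> \oo] --> f x.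
Proof.
move=> /andP[x0]; rewrite le_eqVlt => /predU1P[->|xa] fx.
 rewrite (_ : (fun n => _) = cst (f a)); first exact: cvg_cst.
 by apply/funext => n /=; rewrite min_l// ltW// lt_up.
have /cvg_at_rightP := fx xa; apply; split.
 by move=> n; rewrite lt_min xa lt_up.
apply/cvgnP => e e0; have [N Ne] := mesh_small e0.
exists N => n Nn.
have := up_le n x0; have := mesh_le Nn => ? ?.
have : x < minr a (up n x) by rewrite lt_min xa lt_up.
have : minr a (up n x) <= up n x by rewrite ge_min lexx orbT.
move=> ? ?; rewrite ltr_distlC; lra.
Qed.

End real_limits.

(** * Evaluation of right-continuous processes at random times *)

Section right_continuous_evaluation.
Context {R : realType} {d : measure_display} {S : measurableType d}.

(** The times [up n (s w)], capped at [a], take countably many values, so evaluation there is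
    measurable piece by piece; right-continuity passes to the limit. Applied to a coarser
    sigma-algebra on the same space, this becomes progressive measurability. *)
Lemma meas_eval (U : R -> S -> R) (a : R) (s : S -> R) :
 (forall t, 0 <= t <= a -> mfunT (U t)) ->
 (forall w t, 0 <= t < a -> U r w @[r --> t^'+] --> U t w) ->
 mfunT s -> (forall w, 0 <= s w <= a) ->
 mfunT (fun w => U (s w) w).
Proof.
move=> mU rU ms sa.
apply: (@measurable_fun_cvg _ _ _ setT
  (fun n w => U (minr a (up n (s w))) w)); last first.
 move=> w _; apply: (@minup_cvg _ (U ^~ w)) (sa w) _ => sw; apply: rU.
 by have /andP[-> _] := sa w.
move=> n _ B mB; rewrite setTI.
pose v k : R := minr a (k.+1%:R * mesh n).
pose I k : set R := [set x | k%:R <= x * 2 ^+ n < k.+1%:R].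
rewrite (_ : _ @^-1` B = \bigcup_k
  [set w | [/\ 0 <= v k <= a, I k (s w) & B (U (v k) w)]]); last first.
 apply/seteqP; split=> [w  Bw|w [k _ [ vk Ik BU]]] /=; last first.
  by rewrite /up (truncn_def Ik).
 have /andP[sw0 swa] := sa w; exists (Num.trunc (s w * 2 ^+ n)); split => //.
 - rewrite le_min (le_trans sw0 swa) mulr_ge0 ?mesh_ge0//=.
  by rewrite ge_min lexx.
 - by apply: truncn_itv; rewrite mulr_ge0.
apply: bigcup_measurable => k _.
have [vk|vk] := pselect (0 <= v k <= a); last first.
 rewrite (_ : mkset _ = set0)//; apply/seteqP; split => // w [].
 lra.
rewrite (_ : mkset _ = (s @^-1` I k) `&` ((U (v k)) @^-1` B)).
 apply: measurableI; last by rewrite -[X in measurable X]setTI; exact: mU.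
 rewrite -[X in measurable X]setTI; apply: ms => //.
 rewrite (_ : I k = `[k%:R * mesh n, k.+1%:R * mesh n[%classic)//.
 apply/seteqP; split=> x; rewrite /I /= in_itv/=.
  by rewrite ler_pdivrMr ?exprn_gt0// ltr_pdivlMr.
 by rewrite ler_pdivrMr ?exprn_gt0// ltr_pdivlMr.
by apply/seteqP; split=> w  => [[]//|[]].
Qed.

End right_continuous_evaluation.

(** * Stopping times and their sigma-algebras *)

Section stopping_times.
Context {R : realType} {d : measure_display} {Ω : measurableType d}
 (P : probability Ω R) (T : R) (G : R -> set (set Ω))
 (T0 : 0 < T)
 (UG : usual_filtration P T G).
Implicit Types (X : R -> Ω -> R) (A B : set Ω) (θ τ : Ω -> R)
 (s t : R).

Notation st := (stopping_time T G).
Notation Gat := (sigma_at T G).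

Lemma G_csub t : 0 <= t <= T -> csub P (G t).
Proof.
move=> tT; have [sG mG _ nG] := UG; have [? ?] := sG t tT; split => //.
by move=> A nA; apply: mG (nG _ nA); case/andP: tT.
Qed.

Lemma G_mono s t : 0 <= s -> s <= t -> t <= T -> G s `<=` G t.
Proof. have [_ mG _ _] := UG; exact: mG. Qed.

Lemma T_in : 0 <= T <= T. Proof. by rewrite (ltW T0) lexx. Qed.

Lemma st_le θ t : st θ -> 0 <= t <= T -> G t [set w | θ w <= t].
Proof. by move=> [_]; exact. Qed.

Lemma st_gt θ t : st θ -> 0 <= t <= T -> G t [set w | t < θ w].
Proof.
move=> sth tT; have := csubC (G_csub tT) (st_le sth tT).
by congr G; apply/seteqP; split=> w /=; rewrite ltNge => /negP.
Qed.

Lemma st_lt θ t : st θ -> 0 <= t <= T -> G t [set w | θ w < t].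
Proof.
move=> sth tT; have cG := G_csub tT; have /andP[t0 tT'] := tT.
rewrite (_ : mkset _ = \bigcup_n
  [set w | 0 <= t - mesh n /\ θ w <= t - mesh n]); last first.
 apply/seteqP; split=> [w /= wt|w [n _ /= [_ wt]]]; last first.
  have := @mesh_gt0 R n; lra.
 have [n ne] := @mesh_small R (t - θ w) ltac:(lra); exists n => //.
 have /andP[? _] := sth.1 w; by split; lra.
apply: (csub_bigcup cG) => n.
have [tn|tn] := pselect (0 <= t - mesh n); last first.
 rewrite (_ : mkset _ = set0); last by apply/seteqP; split => // w [].
 exact: csub_set0 cG.
rewrite (_ : mkset _ = [set w | θ w <= t - mesh n]); last first.
 by apply/seteqP; split=> w /=; tauto.
have m0 := @mesh_ge0 R n.
by apply: (@G_mono (t - mesh n)) => //; [lra|apply: st_le => //; lra].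
Qed.

Lemma st_ge θ t : st θ -> 0 <= t <= T -> G t [set w | t <= θ w].
Proof.
move=> sth tT; have := csubC (G_csub tT) (st_lt sth tT).
by congr G; apply/seteqP; split=> w /=; rewrite leNgt => /negP.
Qed.

Lemma st_cst t : 0 <= t <= T -> st (cst t).
Proof.
move=> tT; split => // s sT; have cG := G_csub sT.
have [ts|ts] := pselect (t <= s).
 rewrite (_ : mkset _ = setT); first exact: csubT cG.
 by apply/seteqP; split => w.
rewrite (_ : mkset _ = set0); first exact: csub_set0 cG.
by apply/seteqP; split => w //= /ts.
Qed.

Lemma st_max θ τ : st θ -> st τ ->
 st (fun w => maxr (θ w) (τ w)).
Proof.
move=> sth sta; split=> [w|t tT].
 have := sth.1 w; have := sta.1 w; rewrite le_max ge_max.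
 lra.
rewrite (_ : mkset _ = [set w | θ w <= t] `&` [set w | τ w <= t]).
 apply: (csubI (G_csub tT)); exact: st_le.
by apply/seteqP; split=> w /=; rewrite ge_max => /andP.
Qed.

Lemma st_min θ τ : st θ -> st τ ->
 st (fun w => minr (θ w) (τ w)).
Proof.
move=> sth sta; split=> [w|t tT].
 have := sth.1 w; have := sta.1 w; rewrite le_min ge_min.
 lra.
rewrite (_ : mkset _ = [set w | θ w <= t] `|` [set w | τ w <= t]).
 apply: (csubU (G_csub tT)); exact: st_le.
by apply/seteqP; split=> w /=; rewrite ge_min => /orP.
Qed.

Lemma Gat_csub θ : st θ -> csub P (Gat θ).
Proof.
move=> sth; have cT := G_csub T_in; split.
- split.
 + split; first exact: csub_set0 cT.
  move=> t tT; rewrite set0I; exact: csub_set0 (G_csub tT).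
 + move=> A [GA Ath]; rewrite setTD; split; first exact: csubC cT GA.
  move=> t tT; have cG := G_csub tT.
  have := csubD cG (st_le sth tT) (Ath t tT).
  congr G; apply/seteqP; split=> w /=; tauto.
 + move=> A GA; split.
   by apply: (csub_bigcup cT) => n; have [] := GA n.
  move=> t tT; rewrite setI_bigcupl; apply: (csub_bigcup (G_csub tT)) => n.
  by have [_] := GA n; exact.
- by move=> A [GA _]; exact: csubm cT GA.
- move=> A nA; split; first by have [_ _] := cT; apply.
 move=> t tT; apply: (csubI (G_csub tT)); last exact: st_le.
 by have [_ _] := G_csub tT; apply.
Qed.

Lemma Gat_cst t : 0 <= t <= T -> Gat (cst t) = G t.
Proof.
move=> tT; apply/seteqP; split=> [A [GA /(_ t tT)]|A GA].
 by congr G; apply/seteqP; split=> w /= => [[]//|Aw]; split.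
have /andP[? ?] := tT.
split; first by apply: (@G_mono t).
move=> s sT; have /andP[? ?] := sT; have [ts|ts] := pselect (t <= s).
 rewrite (_ : mkset _ = setT); last by apply/seteqP; split => w.
 by rewrite setIT; apply: (@G_mono t).
rewrite (_ : mkset _ = set0); last by apply/seteqP; split => w //= /ts.
rewrite setI0; exact: csub_set0 (G_csub sT).
Qed.

Lemma Gat_mono θ τ : st θ -> st τ -> (forall w, θ w <= τ w) ->
 Gat θ `<=` Gat τ.
Proof.
move=> sth sta le A [GA Ath]; split => // t tT.
have := csubI (G_csub tT) (Ath t tT) (st_le sta tT).
congr G; apply/seteqP; split=> w /=; first tauto.
by move=> [Aw taut]; split => //; split => //; exact: le_trans taut.
Qed.

Lemma Gat_at θ A t : st θ -> Gat θ A -> 0 <= t <= T ->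
 G t (A `&` [set w | θ w = t]).
Proof.
move=> sth [GA Ath] tT.
have := csubI (G_csub tT) (Ath t tT) (st_ge sth tT).
congr G; apply/seteqP; split=> w /=.
 by move=> [[Aw le] ge]; split => //; apply/eqP; rewrite eq_le le.
by move=> [Aw ->].
Qed.

Lemma st_sm θ : st θ -> smeas (Gat θ) θ.
Proof.
move=> sth; have cG := Gat_csub sth; apply/(smE _ cG).
apply: (@measurability _ _ (g_sigma_algebraType (Gat θ)) R setT θ (@RGenOInfty.G R)).
 exact: RGenOInfty.measurableE.
move=> _ [_ [x ->] <-]; rewrite setTI (csub_sigma cG).
rewrite (_ : _ @^-1` _ = [set w | x < θ w]); last first.
 by apply/seteqP; split=> w /=; rewrite in_itv andbT.
have [x0|x0] := ltP x 0.
 rewrite (_ : mkset _ = setT); first exact: csubT cG.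
 apply/seteqP; split=> // w _ /=; have /andP[? _] := sth.1 w; lra.
have [xT|Tx] := leP x T; last first.
 rewrite (_ : mkset _ = set0); first exact: csub_set0 cG.
 apply/seteqP; split=> // w /=; have /andP[_ ?] := sth.1 w; lra.
have xx : 0 <= x <= T by lra.
split; first by apply: (@G_mono x) => //; exact: st_gt.
move=> t tT; have /andP[? ?] := tT; have [xt|tx] := leP x t.
 apply: (csubI (G_csub tT)); last exact: st_le.
 apply: (@G_mono x) => //; exact: st_gt.
rewrite (_ : _ `&` _ = set0); first exact: csub_set0 (G_csub tT).
apply/seteqP; split=> // w /= []; lra.
Qed.

Lemma st_meas θ : st θ -> mfunT θ.
Proof. move=> sth; apply: (sm_meas (Gat_csub sth)); exact: st_sm. Qed.

(** The event [φ θ <= t] belongs to [G_θ], and it is contained in [θ <= t] because [φ] only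
    postpones. *)
Lemma st_comp θ (φ : R -> R) : st θ -> mfunT φ ->
 (forall x, 0 <= x <= T -> x <= φ x <= T) -> st (φ \o θ).
Proof.
move=> sth mphi phiT; split=> [w|t tT].
 have /andP[? ?] := sth.1 w; have /andP[? ?] := phiT _ (sth.1 w).
 apply/andP; split=> //=; lra.
have mB : measurable [set x | φ x <= t] by meas.
have [_ /(_ t tT)] := sm_preimage (st_sm sth) mB.
congr G; apply/seteqP; split=> w /= => [[]//|le]; split => //.
by have /andP[? _] := phiT _ (sth.1 w); lra.
Qed.

(** Lets stopping times be chosen separately on an event and on its complement; the choice must be
    known at the common earlier time [θ]. *)
Lemma st_paste B θ tau1 tau2 : st θ -> st tau1 -> st tau2 ->
 (forall w, θ w <= tau1 w) -> (forall w, θ w <= tau2 w) ->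
 Gat θ B -> st (fun w => if w \in B then tau1 w else tau2 w).
Proof.
move=> sth s1 s2 le1 le2 GB; split=> [w|t tT].
 by case: ifP => _; [exact: s1.1|exact: s2.1].
have cG := G_csub tT.
have GB1 : Gat tau1 B by exact: (Gat_mono sth s1 le1).
have GB2 : Gat tau2 (~` B).
 apply: (Gat_mono sth s2 le2); exact: csubC (Gat_csub sth) GB.
have := csubU cG (GB1.2 t tT) (GB2.2 t tT).
congr (G t _); apply/seteqP; split=> w /=.
 by move=> [[Bw]|[Bw]]; rewrite ?(mem_set Bw) ?(memNset Bw).
have [Bw|Bw] := pselect (B w); rewrite ?(mem_set Bw) ?(memNset Bw) => le.
 by left.
by right.
Qed.

(** The event is that [θ] equals the minimum of both times, and this minimum is measurable for
    [G_θ]. *)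
Lemma Gat_le θ τ : st θ -> st τ ->
 Gat θ [set w | θ w <= τ w].
Proof.
move=> sth sta; have sm := st_min sth sta.
have cG := Gat_csub sth.
have E : smeas (Gat θ) (fun w => minr (θ w) (τ w)).
 apply: (sm_sub _ (st_sm sm)); apply: Gat_mono => // w.
 by rewrite ge_min lexx.
have := csub_eq cG (st_sm sth) E.
congr Gat; apply/seteqP; split=> w /=.
 by move=> ->; rewrite ge_min lexx orbT.
by move=> /min_idPl ->.
Qed.

(** On [θ <= t] the time [θ] is its minimum with [t], a [G t]-measurable time at which only the
    values of [X] up to [t] are read. *)
Lemma eval_sm X θ : adapted T G X -> (forall w, cadlag T (X ^~ w)) ->
 st θ -> smeas (Gat θ) (fun w => X (θ w) w).
Proof.
move=> aX cX sth _ [B mB <-]; rewrite setTI.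
have H t : 0 <= t <= T ->
  G t ([set w | θ w <= t] `&` [set w | B (X (θ w) w)]).
 move=> tT; have cG := G_csub tT; have /andP[t0 tT'] := tT.
 have smin : st (fun w => minr t (θ w)).
  by apply: (st_min (st_cst tT)).
 have mm : smeas (G t) (fun w => minr t (θ w)).
  rewrite -(Gat_cst tT); apply: (sm_sub _ (st_sm smin)).
  by apply: Gat_mono => //; [exact: st_cst|move=> w; rewrite ge_min lexx].
 have mX : smeas (G t) (fun w => X (minr t (θ w)) w).
  apply/(smE _ cG).
  apply: (@meas_eval _ _ (g_sigma_algebraType (G t)) X t).
  - move=> s /andP[s0 st']; apply/(smE _ cG).
   apply: (@sm_sub _ _ _ _ (G s)); first exact: G_mono.
   apply: aX; apply/andP; split; lra.
  - by move=> w s /andP[s0 st']; apply: (cX w).1; apply/andP; split; lra.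
  - exact/(smE _ cG).
  - by move=> w; rewrite le_min ge_min lexx t0; have /andP[-> _] := sth.1 w.
 have := csubI cG (st_le sth tT) (sm_preimage mX mB).
 by congr G; apply/seteqP; split=> w /= [le]; rewrite min_r.
split=> [|t tT]; last by rewrite setIC; exact: H.
have := H T T_in; congr G; apply/seteqP; split=> w /= => [[]//|Bw].
by split; have /andP[] := sth.1 w.
Qed.

Definition stup n θ (w : Ω) : R := minr T (up n (θ w)).

Lemma measurable_up n : mfunT (fun x : R => minr T (up n x)).
Proof.
apply: measurable_minr; apply: nondecreasing_measurable => //.
move=> x y xy; rewrite ler_pM2r ?mesh_gt0// ler_nat ltnS.
by apply: le_truncn; rewrite ler_pM2r.
Qed.

Lemma st_stup n θ : st θ -> st (stup n θ).
Proof.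
move=> sth; apply: (@st_comp θ (fun x => minr T (up n x))) => //.
 exact: measurable_up.
move=> x /andP[x0 xT]; rewrite le_min ge_min lexx xT/= andbT.
exact/ltW/lt_up.
Qed.

Lemma le_stup n θ w : st θ -> θ w <= stup n θ w.
Proof.
by move=> sth; rewrite le_min (ltW (lt_up _ _)) andbT; have /andP[] := sth.1 w.
Qed.

Lemma stup_cvg θ (f : R -> R) w : st θ ->
 (θ w < T -> f r @[r --> (θ w)^'+] --> f (θ w)) ->
 f (stup n θ w) @[n --> \oo] --> f (θ w).
Proof. move=> sth; apply: minup_cvg; exact: sth.1. Qed.

End stopping_times.

(** * Limits of truncated sequences *)

Section cvg_minmax.
Context {R : realType}.
Implicit Types (u : nat -> R) (c x y l : R).

Lemma dist_maxr c x y : `|maxr c x - maxr c y| <= `|x - y|.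
Proof.
have := ler_norm (x - y); have := ler_norm (y - x); rewrite distrC.
rewrite ler_norml; case: (leP c x) => ?; case: (leP c y) => ? ? ?;
 lra.
Qed.

Lemma dist_minr c x y : `|minr c x - minr c y| <= `|x - y|.
Proof.
have := ler_norm (x - y); have := ler_norm (y - x); rewrite distrC.
rewrite ler_norml; case: (leP c x) => ?; case: (leP c y) => ? ? ?;
 lra.
Qed.

Lemma cvg_maxr u c l : u n @[n --> \oo] --> l ->
 maxr c (u n) @[n --> \oo] --> maxr c l.
Proof.
move=> /cvgnP ul; apply/cvgnP => e /ul[N NP]; exists N => n Nn.
exact: le_lt_trans (dist_maxr _ _ _) (NP n Nn).
Qed.

Lemma cvg_minr u c l : u n @[n --> \oo] --> l ->
 minr c (u n) @[n --> \oo] --> minr c l.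
Proof.
move=> /cvgnP ul; apply/cvgnP => e /ul[N NP]; exists N => n Nn.
exact: le_lt_trans (dist_minr _ _ _) (NP n Nn).
Qed.

End cvg_minmax.

(** * Uniform integrability and Vitali convergence *)

Section uniform_integrability.
Context {R : realType} {d : measure_display} {Ω : measurableType d}
 (P : probability Ω R).
Implicit Types (X Y Xi : Ω -> R) (A B : set Ω) (k c e : R).

(** Continuous in [X], unlike the restriction of [|X|] to the event [|X| > k], so that it passes to
    pointwise limits. *)
Definition tail k X (w : Ω) : R := maxr 0 (`|X w| - k).

Lemma tail_ge0 k X w : 0 <= tail k X w.
Proof. by rewrite le_max lexx. Qed.

Lemma tail_le k X w : 0 <= k -> tail k X w <= `|X w|.
Proof. by move=> k0; rewrite ge_max normr_ge0 gerBl. Qed.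

Lemma meas_tail k X : mfunT X ->
 mfunT (tail k X).
Proof.
move=> mX; apply: measurable_maxr => //.
meas.
Qed.

Lemma L1_tail k X : 0 <= k -> L1 P X -> L1 P (tail k X).
Proof.
move=> k0 iX; apply: le_L1 (L1norm iX).
 exact: meas_tail (L1_meas iX).
by move=> w; rewrite ger0_norm ?tail_ge0 ?tail_le.
Qed.

Lemma EI_cvg_le (x : R ^nat) l c : (forall n, x n <= c) ->
 x n @[n --> \oo] --> l -> l <= c.
Proof.
move=> xc xl; rewrite leNgt; apply/negP => cl.
have [N /(_ N (leqnn N))] := (cvgnP x l).1 xl (l - c) ltac:(lra).
have := xc N; have := ler_norm (l - x N); lra.
Qed.

Lemma EI_cvg_ge (x : R ^nat) l c : (forall n, c <= x n) ->
 x n @[n --> \oo] --> l -> c <= l.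
Proof.
move=> xc xl; rewrite leNgt; apply/negP => cl.
have [N /(_ N (leqnn N))] := (cvgnP x l).1 xl (c - l) ltac:(lra).
have := xc N; rewrite distrC; have := ler_norm (x N - l); lra.
Qed.

(** Dominated convergence for the variables cut at [m], then monotone convergence in [m]. *)
Lemma fatou_EI (Y_ : nat -> Ω -> R) Y c :
 (forall n, L1 P (Y_ n)) -> (forall n w, 0 <= Y_ n w) ->
 mfunT Y -> (forall w, 0 <= Y w) ->
 (\forall w \ae P, Y_ n w @[n --> \oo] --> Y w) ->
 (forall n, EI P setT (Y_ n) <= c) -> L1 P Y /\ EI P setT Y <= c.
Proof.
move=> iY_ Y_0 mY Y0 cY Yc.
have mk k X : mfunT X ->
  mfunT (fun w => minr k (X w)) by meas.
have trunc (m : nat) : EI P setT (fun w => minr m%:R (Y w)) <= c.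
 have [] := @EI_dominated _ _ _ P (fun w => minr m%:R (Y w))
   (fun n w => minr m%:R (Y_ n w)) (cst m%:R) setT measurableT.
 - meas.
 - meas.
 - exact: L1cst.
 - move=> n; apply: aeW => w; rewrite ger0_norm ?ge_min ?lexx//.
  by rewrite le_min Y_0 ler0n.
 - apply: filterS cY => w cY.
  exact: cvg_minr.
 move=> iM; apply: EI_cvg_le => n; apply: le_trans (Yc n).
 apply: EI_le => //; last by move=> w _; rewrite ge_min lexx orbT.
 apply: le_L1 (iY_ n); first meas.
 by move=> w; rewrite ger0_norm ?ge_min ?lexx ?orbT// le_min Y_0 ler0n.
have ic : (\int[P]_w (Y w)%:E <= c%:E)%E.
 have cvM := @cvg_monotone_convergence _ _ _ P setT measurableT
  (fun n w => (minr n%:R (Y w))%:E).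
 have L : (fun w => limn (fun n : nat => (minr n%:R (Y w))%:E)) =
   (fun w => (Y w)%:E).
  apply/funext => w; apply/cvg_lim => //; apply/cvg_EFin; first by near=> n.
  apply/cvgnP => e e0; exists (Num.trunc (Y w)).+1 => n Nn /=.
  rewrite min_r ?subrr ?normr0//; apply: ltW.
  apply: lt_le_trans (truncnS_gt _) _.
  by rewrite ler_nat.
 rewrite -L.
 have C := cvM
  (fun n => (measurable_EFinP _ _).2 (mk n%:R _ mY)) _ _.
 rewrite -(cvg_lim _ (C _ _))//=.
 - apply: lime_le; first by apply/cvg_ex; eexists; apply: C;
   [move=> n w _; rewrite lee_fin le_min Y0 ler0n|
    move=> w _ m n mn; rewrite lee_fin le_min ge_min ler_nat mn ge_min lexx orbT].
  near=> n; rewrite -EIE ?lee_fin//; apply: (@L1bound _ _ _ _ _ n%:R).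
   meas.
  by move=> w; rewrite ger0_norm ?ge_min ?lexx// le_min Y0 ler0n.
 - by move=> n w _; rewrite lee_fin le_min Y0 ler0n.
 - move=> w _ m n mn; rewrite lee_fin le_min ge_min ler_nat mn/=.
  by rewrite ge_min lexx orbT.
have iY : L1 P Y.
 apply/integrableP; split; first meas.
 under eq_integral do rewrite /= ger0_norm//.
 exact: le_lt_trans ic (ltry _).
by split => //; rewrite -lee_fin EIE.
Unshelve. all: by end_near.
Qed.

(** Domination of tails by those of one integrable variable. It makes families uniformly integrable,
    it can be checked on events of a sub-sigma-algebra ([uidom_sm]), and Fatou's lemma hands its
    tail bounds on to limits. *)
Definition uidom Xi X :=
 L1 P X /\ forall k, 0 <= k -> EI P setT (tail k X) <= EI P setT (tail k Xi).

(** The tail of [X] is carried by the event [|X| > k], which belongs to [H], so a comparison with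
    [Xi] on events of [H] is enough. *)
Lemma uidom_sm H Xi X : csub P H -> smeas H X -> L1 P X -> L1 P Xi ->
 (forall B, H B -> EI P B (fun w => `|X w|) <= EI P B Xi) -> uidom Xi X.
Proof.
move=> cH HX iX iXi XXi; split => // k k0.
pose B := [set w | k < `|X w|].
have HB : H B.
 apply: (csub_lt cH); first exact: smcst cH.
 apply/(smE _ cH); apply: mcomp => //; exact/(smE _ cH).
have mB := csubm cH HB.
have ik : L1 P (fun=> k) by meas.
have itX := L1_tail k0 iX; have itXi := L1_tail k0 iXi.
rewrite (EI_split measurableT mB)// !setTI.
rewrite (@eq_EI _ _ _ P (~` B) _ (cst 0)); last first.
 move=> w /negP; rewrite -leNgt => Xk.
 by rewrite /tail max_l// subr_le0.
rewrite EIcst ?mul0r ?addr0; last meas.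
rewrite (@eq_EI _ _ _ P B _ (fun w => `|X w| - k)); last first.
 by move=> w Bw; rewrite /tail max_r// subr_ge0 ltW.
rewrite EIB//; last meas.
apply: (@le_trans _ _ (EI P B (fun w => Xi w - k))).
 by rewrite EIB// lerB// XXi.
apply: (@le_trans _ _ (EI P B (tail k Xi))).
 apply: EI_le => //; first meas.
 by move=> w _; rewrite le_max lerB ?orbT// ler_norm.
apply: EI_subset => // w; exact: tail_ge0.
Qed.

Lemma tail_cvg0 Xi e : L1 P Xi -> 0 < e ->
 exists2 k, 0 < k & EI P setT (tail k Xi) < e.
Proof.
move=> iXi e0.
have [] := @EI_dominated _ _ _ P (cst 0) (fun n => tail n%:R Xi)
  (fun w => `|Xi w|) setT measurableT.
- move=> n; exact: meas_tail (L1_meas iXi).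
- meas.
- meas.
- by move=> n; apply: aeW => w; rewrite ger0_norm ?tail_ge0 ?tail_le.
- apply: aeW => w; apply/cvgnP => a a0.
 exists (Num.trunc `|Xi w|).+1 => n Nn.
 rewrite /tail max_l ?subrr ?normr0// subr_le0 ltW//.
 by apply: lt_le_trans (truncnS_gt _) _; rewrite ler_nat.
move=> _ /cvgnP/(_ e e0)[N NP]; exists N.+1%:R => //.
have := NP N.+1 (leqnSn _); rewrite EIcst// mul0r sub0r normrN.
apply: le_lt_trans; exact: ler_norm.
Qed.

Definition chop k (x : R) := maxr (- k) (minr k x).

Lemma chop_tail k X w : 0 <= k -> `|X w - chop k (X w)| = tail k X w.
Proof.
move=> k0; rewrite /chop /tail; case: (lerP k (X w)) => kX.
 rewrite max_r; last lra.
 rewrite ger0_norm; last lra.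
 by rewrite ger0_norm; [rewrite max_r; lra|lra].
case: (lerP (- k) (X w)) => kX'.
 rewrite subrr normr0 max_l// subr_le0 ler_norml; lra.
rewrite ltr0_norm; last lra.
rewrite ltr0_norm; last lra.
rewrite max_r; lra.
Qed.

(** The distance to the limit is at most the two tails plus the distance of the variables chopped at
    [k]. The tails are bounded by that of [Xi], and the chopped part converges by domination. *)
Lemma vitali Xi (X_ : nat -> Ω -> R) X : L1 P Xi ->
 (forall n, uidom Xi (X_ n)) -> mfunT X ->
 (\forall w \ae P, X_ n w @[n --> \oo] --> X w) ->
 L1 P X /\ EI P setT (fun w => `|X w - X_ n w|) @[n --> \oo] --> 0.
Proof.
move=> iXi dX mX cX.
have cabs k : \forall w \ae P, tail k (X_ n) w @[n --> \oo] --> tail k X w.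
 apply: filterS cX => w cX; rewrite /tail.
 by apply: cvg_maxr; apply: cvgB; [exact: cvg_norm|exact: cvg_cst].
have fat k : 0 <= k -> L1 P (tail k X) /\ EI P setT (tail k X) <= EI P setT (tail k Xi).
 move=> k0; apply: (fatou_EI _ _ _ _ (cabs k)).
 - move=> n; apply: L1_tail => //; exact: (dX n).1.
 - move=> n w; exact: tail_ge0.
 - exact: meas_tail.
 - move=> w; exact: tail_ge0.
 - move=> n; exact: (dX n).2.
have iX : L1 P X.
 apply: le_L1 (fat 0 (lexx 0)).1 => // w.
 by rewrite /tail subr0 le_max lexx orbT.
split => //; apply/cvgnP => e e0.
have e3 : 0 < e / 3 by lra.
have [k k0 ke] := tail_cvg0 iXi e3.
have k0' := ltW k0.
have mchop Y : mfunT Y -> mfunT (fun w => chop k (Y w)).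
 move=> mY; apply: measurable_maxr => //.
 meas.
have bchop x : `|chop k x| <= k.
 rewrite ler_norml le_max ge_max ge_min; lra.
have ichop Y : mfunT Y -> L1 P (fun w => chop k (Y w)).
 move=> mY; apply: (L1bound P (mchop _ mY)) => w; exact: bchop.
have mX_ n : mfunT (X_ n) by exact: L1_meas (dX n).1.
have iD n : L1 P (fun w => `|chop k (X w) - chop k (X_ n w)|) by meas.
have [] := @EI_dominated _ _ _ P (cst 0)
 (fun n w => `|chop k (X w) - chop k (X_ n w)|) (cst (k + k)) setT measurableT.
- move=> n; exact: L1_meas.
- meas.
- exact: L1cst.
- move=> n; apply: aeW => w; rewrite normr_id.
 by apply: le_trans (ler_normB _ _) _; rewrite lerD.
- apply: filterS cX => w cX; rewrite -[X in _ --> X](normr0 R).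
 apply: cvg_norm; rewrite -[X in _ --> X](subrr (chop k (X w))).
 apply: cvgB; first exact: cvg_cst.
 exact/cvg_maxr/cvg_minr.
move=> _ /cvgnP/(_ _ e3)[N NP]; exists N => n Nn.
rewrite sub0r normrN ger0_norm; last by apply: EI_ge0.
apply: (@le_lt_trans _ _ (EI P setT (fun w => (tail k X w + tail k (X_ n) w)
  + `|chop k (X w) - chop k (X_ n w)|))).
 apply: EI_le => //.
 - apply/L1norm/L1B => //; exact: (dX n).1.
 - apply: L1D => //; apply: L1D; apply: L1_tail => //; exact: (dX n).1.
 - move=> w _; rewrite -!chop_tail//.
  have := ler_normB (X w - chop k (X w)) (X_ n w - chop k (X_ n w)).
  have := ler_normD (X w - chop k (X w) - (X_ n w - chop k (X_ n w))) (chop k (X w) - chop k (X_ n w)).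
  rewrite (_ : _ + (_ - _) = X w - X_ n w); [lra|ring].
rewrite EID//; last first.
 apply: L1D; apply: L1_tail => //; exact: (dX n).1.
rewrite EID//; try by apply: L1_tail => //; exact: (dX n).1.
have := (fat k k0').2; have := (dX n).2 k k0'.
have := NP n Nn; rewrite EIcst// mul0r sub0r normrN.
have := ler_norm (EI P setT (fun w => `|chop k (X w) - chop k (X_ n w)|)).
move: ke; lra.
Qed.

Lemma vitali_EI Xi (X_ : nat -> Ω -> R) X A : L1 P Xi -> measurable A ->
 (forall n, uidom Xi (X_ n)) -> mfunT X ->
 (\forall w \ae P, X_ n w @[n --> \oo] --> X w) ->
 L1 P X /\ EI P A (X_ n) @[n --> \oo] --> EI P A X.
Proof.
move=> iXi mA dX mX cX; have [iX /cvgnP cE] := vitali iXi dX mX cX.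
split => //; apply/cvgnP => e e0; have [N NP] := cE e e0; exists N => n Nn.
have iXn := (dX n).1.
have := NP n Nn; rewrite sub0r normrN; apply: le_lt_trans.
rewrite -EIB//; apply: le_trans (ler_norm _).
apply: le_trans (EI_abs mA _) _; first meas.
apply: EI_subset; meas.
Qed.

End uniform_integrability.

(** * Upcrossings of finite sequences *)

Section upcrossing_count.
Context {R : realType}.
Implicit Types (a b x : R) (l : seq R).

(* The number of upcrossings of [a, b] made by [l]; the flag tells whether a
  value at most [a] has been seen since the last completed upcrossing. *)
Fixpoint upc a b (low : bool) l : nat :=
 if l is x :: l' then
  if low then (if b <= x then (upc a b false l').+1 else upc a b true l')
  else upc a b (x <= a) l'
 else 0%N.

(** An initial low flag is worth at most one more upcrossing; this makes the count monotone under
    insertion of points. *)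
Lemma upc_flag a b l : a < b ->
 (upc a b false l <= upc a b true l <= (upc a b false l).+1)%N.
Proof.
move=> ab; elim: l => //= x l /andP[IH1 IH2].
case: (lerP b x) => bx.
 have -> : (x <= a) = false by lra.
 by rewrite leqnSn leqnn.
by case: (x <= a); rewrite ?leqnn ?leqnSn ?IH1.
Qed.

Lemma upc_cons a b low x l : a < b ->
 (upc a b low l <= upc a b low (x :: l))%N.
Proof.
move=> ab; have /andP[H1 H2] := upc_flag l ab; case: low => /=.
 by case: ifP.
by case: (x <= a).
Qed.

Lemma upc_subseq a b low l1 l2 : a < b -> subseq l1 l2 ->
 (upc a b low l1 <= upc a b low l2)%N.
Proof.
move=> ab; elim: l2 low l1 => [|y l2 IH] low [|x l1]//.
rewrite [subseq _ _]/=; case: eqP => [->|_] sub.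
 rewrite /=; case: low; [case: ifP => _; rewrite ?ltnS|]; exact: IH.
exact: leq_trans (IH low _ sub) (upc_cons _ _ _ ab).
Qed.

Lemma upc_cat2 a b low l x y : a < b -> x <= a -> b <= y ->
 (upc a b low l < upc a b low (l ++ [:: x; y]))%N.
Proof.
move=> ab xa yb; elim: l low => [|z l IH] low /=.
 case: low; rewrite ?xa ?yb//.
 have -> : (b <= x) = false by lra.
 by [].
case: low; [case: ifP => _; rewrite ?ltnS|]; exact: IH.
Qed.

Lemma upc_size a b low l : (upc a b low l <= size l)%N.
Proof.
elim: l low => //= x l IH [|]; last by apply: leqW; exact: IH.
case: ifP => _; [rewrite ltnS|apply: leqW]; exact: IH.
Qed.

End upcrossing_count.

(** * Paths on the dyadic grid and their one-sided limits *)

Section dyadic_grid.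
Context {R : realType}
 (T : R)
 (T0 : 0 < T).
Implicit Types (x y : R -> R) (a b c t q l : R).

(** [T] need not be dyadic and is added by hand. The lists grow with [n], and their union is
    countable, so almost sure statements can be made for all grid points at once. *)
Definition gridl n : seq R :=
 rcons [seq q <- [seq k%:R * mesh n | k <- iota 0 (Num.trunc (T * 2 ^+ n)).+1]
    | q < T] T.

Lemma gridlP n q : (q \in gridl n) <->
 q = T \/ exists2 k : nat, q = k%:R * mesh n & q < T.
Proof.
rewrite mem_rcons inE mem_filter; split.
 case/predU1P => [->|/andP[qT /mapP[k _ qk]]]; first lra.
 by right; exists k.
case=> [->|[k qk qT]]; first lra.
rewrite qT; apply/orP; right; apply/mapP; exists k => //.
rewrite mem_iota leq0n/= ltnS truncn_ge_nat.
 by rewrite -ler_pdivrMr ?exprn_gt0// -qk ltW.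
by rewrite mulr_ge0 ?ltW.
Qed.

Lemma gridl_sub m n q : (m <= n)%N -> q \in gridl m -> q \in gridl n.
Proof.
move=> mn /gridlP [->|[k qk qT]]; apply/gridlP; first lra.
have [e ->] : exists e : nat, n = (e + m)%N by exists (n - m)%N; rewrite subnK.
right; exists (k * 2 ^ e)%N => //.
have ? : (2 : R) ^+ e != 0 by [].
by rewrite natrM natrX /mesh exprD invfM !mulrA mulfK.
Qed.

Lemma gridl_sorted n : sorted <%R (gridl n).
Proof.
rewrite /gridl; set l := [seq q <- _ | q < T].
have sl : sorted <%R l.
 apply: sorted_filter; first exact: lt_trans.
 rewrite sorted_map; apply: (sub_sorted _ (iota_ltn_sorted _ _)) => i j ij /=.
 by rewrite ltr_pM2r ?mesh_gt0// ltr_nat.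
case E : l sl => [//|z l'] sl /=; rewrite rcons_path (sl : path _ _ _)/=.
have : last z l' \in l by rewrite E mem_last.
by rewrite mem_filter => /andP[].
Qed.

Lemma gridl_in n q : q \in gridl n -> 0 <= q <= T.
Proof.
move=> /gridlP[->|[k -> kT]]; first by rewrite lexx ltW.
by rewrite (ltW kT) mulr_ge0 ?mesh_ge0.
Qed.

Definition grid : set R := [set q | exists n, q \in gridl n].

Lemma grid_in q : grid q -> 0 <= q <= T.
Proof. by move=> [n /gridl_in]. Qed.

Lemma grid_T : grid T.
Proof. by exists 0%N; apply/gridlP; left. Qed.

Lemma gridl_up n t : minr T (up n t) \in gridl n.
Proof.
apply/gridlP; case: (lerP T (up n t)) => uT; first lra.
by right; exists (Num.trunc (t * 2 ^+ n)).+1.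
Qed.

Lemma grid_up n t : grid (minr T (up n t)).
Proof. exists n; exact: gridl_up. Qed.

Lemma grid_dense t c : 0 <= t -> t < T -> 0 < c -> exists q, [/\ grid q, t < q & q < t + c].
Proof.
move=> t0 tT c0; have [n nc] := mesh_small c0.
exists (minr T (up n t)); split; first exact: grid_up.
 by rewrite lt_min tT lt_up.
rewrite gt_min; apply/orP; right; have := up_le n t0; lra.
Qed.

Lemma grid_list (s : seq R) : (forall q, q \in s -> grid q) ->
 exists n, forall q, q \in s -> q \in gridl n.
Proof.
elim: s => [|q s IH] H; first by exists 0%N.
have [n nP] := IH (fun q' qs => H q' (@mem_behead _ (q :: s) _ qs)).
have [m mP] := H q (mem_head _ _).
exists (maxn n m) => q'; rewrite inE => /predU1P[->|/nP].
 apply: gridl_sub mP; exact: leq_maxr.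
apply: gridl_sub; exact: leq_maxl.
Qed.

Definition bounded_upc x a b :=
 exists M : nat, forall n, (upc a b false (map x (gridl n)) <= M)%N.

Lemma gridl_subseq (s : seq R) n : sorted <%R s ->
 (forall q, q \in s -> q \in gridl n) -> subseq s (gridl n).
Proof.
move=> ss sn; have -> : s = [seq q <- gridl n | q \in s].
 apply: (irr_sorted_eq lt_trans ltxx) => //.
  by apply: sorted_filter; [exact: lt_trans|exact: gridl_sorted].
 by move=> q; rewrite mem_filter; case: (boolP (q \in s)) => //= /sn.
exact: filter_subseq.
Qed.

Lemma upc_list x a b : a < b -> bounded_upc x a b ->
 exists M : nat, forall s : seq R, (forall q, q \in s -> grid q) -> sorted <%R s ->
  (upc a b false (map x s) <= M)%N.
Proof.
move=> ab [M HM]; exists M => s sg ss; have [n sn] := grid_list sg.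
apply: leq_trans (HM n); apply: upc_subseq => //; apply: map_subseq.
exact: gridl_subseq.
Qed.

Definition oscil (nearset : R -> set R) x a b :=
 forall c, 0 < c -> (exists2 q, nearset c q & x q <= a) /\
           (exists2 q, nearset c q & b <= x q).

(** The candidate is the upper limit, the infimum of the eventual upper bounds. If the path did not
    end up above this value minus [e], it would oscillate between the levels lying [e] and [e / 2]
    below the candidate. *)
Lemma osc_limit (N : R -> set R) x C :
 (forall c c', c <= c' -> N c `<=` N c') ->
 (forall c, 0 < c -> N c !=set0) ->
 (forall c q, N c q -> `|x q| <= C) ->
 (forall a b, a < b -> ~ oscil N x a b) ->
 exists l, forall e, 0 < e -> exists2 c, 0 < c &
  forall q, N c q -> `|x q - l| < e.
Proof.
move=> Nmono Nne xC nosc.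
pose A := [set r | exists2 c, 0 < c & forall q, N c q -> x q <= r].
have A0 : A C by exists 1 => // q /xC; exact: le_trans (ler_norm _).
have lbA : lbound A (- C).
 move=> r [c c0 Hr]; have [q Nq] := Nne c c0.
 have := Hr q Nq; have := xC c q Nq; rewrite ler_norml => /andP[]; lra.
have hA : has_inf A by split; [exists C|exists (- C)].
exists (inf A) => e e0.
have [r [c1 c10 Hr] re] := inf_adherent e0 hA.
have [[c2 c20 H2]|H] := pselect (exists2 c, 0 < c & forall q, N c q -> inf A - e < x q).
 exists (minr c1 c2); first by rewrite lt_min c10.
 move=> q Nq; have := H2 q (Nmono (minr c1 c2) c2 ltac:(by rewrite ge_min lexx orbT) _ Nq).
 have := Hr q (Nmono (minr c1 c2) c1 ltac:(by rewrite ge_min lexx) _ Nq).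
 rewrite ltr_distl => ? ?; lra.
exfalso; apply: (nosc (inf A - e) (inf A - e / 2)); first lra.
move=> c c0; split.
 apply: contrapT => H'; apply: H; exists c => // q Nq.
 by rewrite ltNge; apply/negP => xq; apply: H'; exists q.
apply: contrapT => H'; have : A (inf A - e / 2).
 exists c => // q Nq; rewrite leNgt; apply/negP => xq.
 apply: H'; exists q => //; exact: ltW.
move=> /(ge_inf hA.2); lra.
Qed.

(** Oscillation produces lists with arbitrarily many upcrossings: a high point [h] is chosen first,
    then a low point [l] in []t, h[], then by induction a list inside []t, l[], to which [l] and [h]
    are appended. *)
Lemma no_osc_right x t a b : bounded_upc x a b -> 0 <= t -> a < b ->
 ~ oscil (fun c => [set q | [/\ grid q, t < q & q < t + c]]) x a b.
Proof.
move=> bu t0 ab osc; have [M HM] := upc_list ab bu.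
have H m : forall c, 0 < c -> exists s : seq R,
 [/\ forall q, q \in s -> [/\ grid q, t < q & q < t + c], sorted <%R s &
   (m <= upc a b false (map x s))%N].
 elim: m => [|m IH] c c0; first by exists [::].
 have [_ [h [gh th hc] xh]] := osc c c0.
 have [[l [gl tl lc] xl] _] := osc (h - t) ltac:(lra).
 have [s [sP ss sm]] := IH (l - t) ltac:(lra).
 exists (s ++ [:: l; h]); split.
 - move=> q; rewrite mem_cat !inE => /orP[/sP[? ? ?]|/orP[/eqP->|/eqP->]]//.
   split => //; lra.
  split => //; lra.
 - case: s ss sP {sm} => [_ _|z s zs sP] /=; first lra.
  rewrite cat_path (zs : path _ _ _)/=; apply/andP; split; last lra.
  have [] := sP (last z s) (mem_last _ _); lra.
 - rewrite map_cat; exact: leq_ltn_trans sm (upc_cat2 _ _ ab xl xh).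
have [s [sP ss sm]] := H M.+1 1 ltr01.
have := HM s (fun q qs => let: And3 g _ _ := sP q qs in g) ss.
by rewrite leqNgt sm.
Qed.

Lemma no_osc_left x t a b : bounded_upc x a b -> a < b ->
 ~ oscil (fun c => [set q | [/\ grid q, q < t & t - c < q]]) x a b.
Proof.
move=> bu ab osc; have [M HM] := upc_list ab bu.
have H m : forall c, 0 < c -> exists s : seq R,
 [/\ forall q, q \in s -> [/\ grid q, q < t & t - c < q], sorted <%R s &
   (m <= upc a b false (map x s))%N].
 elim: m => [|m IH] c c0; first by exists [::].
 have [[l [gl tl lc] xl] _] := osc c c0.
 have [_ [h [gh th hc] xh]] := osc (t - l) ltac:(lra).
 have [s [sP ss sm]] := IH (t - h) ltac:(lra).
 exists (l :: h :: s); split.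
 - move=> q; rewrite !inE => /orP[/eqP->|/orP[/eqP->|/sP[? ? ?]]]//.
   split => //; lra.
  split => //; lra.
 - rewrite /=; apply/andP; split; first lra.
  case: s ss sP {sm} => [//|z s zs sP] /=; rewrite (zs : path _ _ _) andbT.
  have [] := sP z (mem_head _ _); lra.
 - rewrite /= xl xh; by [].
have [s [sP ss sm]] := H M.+1 1 ltr01.
have := HM s (fun q qs => let: And3 g _ _ := sP q qs in g) ss.
by rewrite leqNgt sm.
Qed.

Definition good_path x := (exists C, forall q, grid q -> `|x q| <= C) /\
 forall a b, a < b -> bounded_upc x a b.

(* The right-continuous regularisation of a path given on the grid. *)
Definition rlimg x t l := forall e, 0 < e -> exists2 c, 0 < c &
 forall q, grid q -> t < q -> q < t + c -> `|x q - l| < e.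

Definition regular x t : R := if t < T then xget 0 [set l | rlimg x t l] else x T.

Lemma regularP x t : good_path x -> 0 <= t < T -> rlimg x t (regular x t).
Proof.
move=> [[C xC] bu] /andP[t0 tT]; rewrite /regular tT.
have [l lP] := @osc_limit (fun c => [set q | [/\ grid q, t < q & q < t + c]]) x C
 ltac:(by move=> c c' cc' q [? ? ?]; split => //; lra)
 ltac:(by move=> c c0; have [q ?] := grid_dense t0 tT c0; exists q)
 ltac:(by move=> c q [/xC])
 (fun a b ab => no_osc_right (bu a b ab) t0 ab).
apply: @xgetPex; exists l => e e0.
by have [c c0 cP] := lP e e0; exists c => // q gq tq qc; exact: cP.
Qed.

Lemma regular_cadlag x : good_path x -> cadlag T (regular x).
Proof.
move=> gx; split=> t /andP[t0 tT].
 have tx := regularP gx (introT andP (conj t0 tT)).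
 apply/rcvgP => e e0; have e2 : 0 < e / 2 by lra.
 have [c c0 cP] := tx (e / 2) e2.
 exists (minr c (T - t)); first by rewrite lt_min; lra.
 move=> r tr; rewrite -ltrBlDl lt_min => /andP[rc rT].
 have rr : 0 <= r < T by lra.
 have [c' c'0 c'P] := regularP gx rr e2.
 have [q [gq rq qc]] := @grid_dense r (minr c' (t + c - r))
   ltac:(lra) ltac:(lra) ltac:(by rewrite lt_min; lra).
 have qc1 : q < r + c' by apply: lt_le_trans qc _; rewrite lerD2l ge_min lexx.
 have qc2 : q < t + c.
  rewrite -(subrKC r (t + c)); apply: lt_le_trans qc _.
  by rewrite lerD2l ge_min lexx orbT.
 have := c'P q gq rq qc1; have := cP q gq ltac:(lra) qc2.
 rewrite !ltr_distl => /andP[? ?] /andP[? ?]; lra.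
have [[C xC] bu] := gx.
have [l lP] := @osc_limit (fun c => [set q | [/\ grid q, q < t & t - c < q]]) x C
 ltac:(by move=> c c' cc' q [? ? ?]; split => //; lra)
 ltac:(move=> c c0; have [q [? ? ?]] := @grid_dense (maxr 0 (t - c)) (t - maxr 0 (t - c))
   ltac:(by rewrite le_max lexx) ltac:(by rewrite gt_max; lra)
   ltac:(by rewrite subr_gt0 gt_max; lra);
   exists q; split => //; [lra|apply: le_lt_trans (_ : maxr 0 (t - c) < q) => //; by rewrite le_max lexx orbT])
 ltac:(by move=> c q [/xC])
 (fun a b ab => no_osc_left (bu a b ab) ab).
apply/cvg_ex; exists l; apply/lcvgP => e e0; have e2 : 0 < e / 2 by lra.
have [c c0 cP] := lP (e / 2) e2.
exists (minr c t); first by rewrite lt_min c0.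
move=> r rt; rewrite ltrBlDr -ltrBlDl lt_min => /andP[rc r0].
have rr : 0 <= r < T by lra.
have [c' c'0 c'P] := regularP gx rr e2.
have [q [gq rq qc]] := @grid_dense r (minr c' (t - r))
  ltac:(lra) ltac:(lra) ltac:(by rewrite lt_min; lra).
have qc1 : q < r + c' by apply: lt_le_trans qc _; rewrite lerD2l ge_min lexx.
have qc2 : q < t.
 rewrite -(subrKC r t); apply: lt_le_trans qc _.
 by rewrite lerD2l ge_min lexx orbT.
have := c'P q gq rq qc1; have := cP q ltac:(by split => //; lra).
rewrite !ltr_distl => /andP[? ?] /andP[? ?]; lra.
Qed.

Lemma regular_up x t : good_path x -> 0 <= t <= T ->
 x (minr T (up n t)) @[n --> \oo] --> regular x t.
Proof.
move=> gx /andP[t0]; rewrite le_eqVlt => /predU1P[->|tT].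
 rewrite /regular ltxx (_ : (fun n => _) = cst (x T)); first exact: cvg_cst.
 by apply/funext => n /=; rewrite min_l// ltW// lt_up.
apply/cvgnP => e e0; have [c c0 cP] := regularP gx (introT andP (conj t0 tT)) e0.
have [N Nc] := mesh_small c0; exists N => n Nn; rewrite distrC; apply: cP.
- exact: grid_up.
- by rewrite lt_min tT lt_up.
- rewrite gt_min; apply/orP; right.
 have := up_le n t0; have := mesh_le (R := R) Nn; lra.
Qed.

End dyadic_grid.

(** * From uniform probability bounds to almost sure bounds *)

Section almost_sure_bounds.
Context {R : realType} {d : measure_display} {Ω : measurableType d}
 (P : probability Ω R).

(** A weak-type estimate uniform in [n] holds for the increasing union over [n]; letting [M] grow,
    the unions of all levels cannot occur together. Upcrossing counts, maxima and sums of gaps are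
    all bounded in this way. *)
Lemma ae_bounded_events (E : nat -> nat -> set Ω) (K : R) :
 (forall M n, measurable (E M n)) -> (forall M n, E M n `<=` E M n.+1) ->
 (forall M n, M%:R * fine (P (E M n)) <= K) ->
 \forall w \ae P, exists M, forall n, ~ E M n w.
Proof.
move=> mE ndE PE.
pose U M := \bigcup_n E M n.
have mU M : measurable (U M) by exact: bigcup_measurable.
have fP A : fine (P A) >= 0 by rewrite fine_ge0.
have PU M : M%:R * fine (P (U M)) <= K.
 have c1 : (P \o E M) n @[n --> \oo] --> P (U M).
  apply: nondecreasing_cvg_mu => //.
   meas.
  move=> m n; elim: n => [|n IH]; first by rewrite leqn0 => /eqP->.
  rewrite leq_eqVlt => /predU1P[->//|/IH /subsetPset mn].
  by apply/subsetPset; apply: subset_trans mn (ndE M n).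
 have c2 : fine (P (E M n)) @[n --> \oo] --> fine (P (U M)).
  by apply: fine_cvg; rewrite fineK ?fin_num_measure.
 apply: (@EI_cvg_le _ (fun n => M%:R * fine (P (E M n)))) => //.
 exact: cvgMr.
have mI : measurable (\bigcap_M U M) by exact: bigcapT_measurable.
exists (\bigcap_M U M); split => //; last first.
 move=> w  H M _; apply: contrapT => nU; apply: H; exists M => n En.
 by apply: nU; exists n.
apply/eqP; rewrite -[P _]fineK ?fin_num_measure// eqe eq_le fP andbT.
rewrite leNgt; apply/negP => p0.
set p := fine _ in p0.
have : (Num.trunc (K / p)).+1%:R * p <= K.
 apply: le_trans (PU (Num.trunc (K / p)).+1); rewrite ler_pM2l ?ltr0n//.
 rewrite fine_le ?fin_num_measure// le_measure ?inE//.
 exact: bigcap_inf.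
by rewrite -ler_pdivlMr// leNgt truncnS_gt.
Qed.

Lemma ae_count (I : countType) (Q : I -> Ω -> Prop) :
 (forall i, \forall w \ae P, Q i w) -> \forall w \ae P, forall i, Q i w.
Proof.
move=> H; pose Q' n w := if unpickle n is Some i then Q i w else True.
have : \forall w \ae P, forall n, Q' n w.
 apply: ae_foralln => n; rewrite /Q'; case: unpickle => [i|]; first by [].
 exact: aeW.
by apply: filterS => w Hw i; have := Hw (pickle i); rewrite /Q' pickleK.
Qed.

End almost_sure_bounds.

(** * Regularisation of submartingales *)

Section regularisation.
Context {R : realType} {d : measure_display} {Ω : measurableType d}
 (P : probability Ω R) (T : R) (G : R -> set (set Ω))
 (T0 : 0 < T)
 (UG : usual_filtration P T G)
 (s : R -> Ω -> R) (Xi : Ω -> R)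
 (s_sm : forall t, 0 <= t <= T -> smeas (G t) (s t))
 (s_L1 : forall t, 0 <= t <= T -> L1 P (s t)).
Hypothesis s_sub : forall t u B, 0 <= t -> t <= u -> u <= T -> G t B ->
 EI P B (s t) <= EI P B (s u).
Hypothesis iXi : L1 P Xi.
Hypothesis s_dom : forall t B, 0 <= t <= T -> G t B ->
 EI P B (fun w => `|s t w|) <= EI P B Xi.
Implicit Types (a b t u : R) (B : set Ω) (l : seq R).

Let G_csub t : 0 <= t <= T -> csub P (G t). Proof. exact: G_csub. Qed.
Let Gm t B : 0 <= t <= T -> G t B -> measurable B.
Proof. move=> tT; exact: csubm (G_csub tT). Qed.
Let ms t : 0 <= t <= T -> mfunT (s t).
Proof. meas. Qed.

Let Z a t w := maxr 0 (s t w - a).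

Let Z0 a t w : 0 <= Z a t w. Proof. by rewrite le_max lexx. Qed.

Let Z_L1 a t : 0 <= t <= T -> L1 P (Z a t).
Proof.
move=> tT; have i := L1B (s_L1 tT) (L1cst P a).
apply: le_L1 (L1norm i).
 apply: measurable_maxr; meas.
by move=> w; rewrite ger0_norm// ge_max normr_ge0 ler_norm.
Qed.

Let Z_sub a t u B : 0 <= t -> t <= u -> u <= T -> G t B ->
 EI P B (Z a t) <= EI P B (Z a u).
Proof.
move=> t0 tu uT GB.
have tT : 0 <= t <= T by lra.
have uuT : 0 <= u <= T by lra.
pose C := [set w | a < s t w].
have GC : G t C by apply: (csub_lt (G_csub tT)); [exact: smcst (G_csub tT)|exact: s_sm].
have GBC := csubI (G_csub tT) GB GC.
have mBC := Gm tT GBC; have mB := Gm tT GB; have mC := Gm tT GC.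
have is_ v : 0 <= v <= T -> L1 P (fun w => s v w - a) by meas.
rewrite (EI_split mB mC (Z_L1 a tT)).
rewrite (@eq_EI _ _ _ P (B `&` ~` C) _ (cst 0)); last first.
 by move=> w [_ /negP]; rewrite -leNgt => sa; rewrite /Z max_l// subr_le0.
rewrite EIcst ?mul0r ?addr0; last meas.
rewrite (@eq_EI _ _ _ P (B `&` C) _ (fun w => s t w - a)); last first.
 by move=> w [_ Cw]; rewrite /Z max_r// subr_ge0 ltW.
apply: (@le_trans _ _ (EI P (B `&` C) (fun w => s u w - a))).
 by rewrite !EIB//; [rewrite lerD2r s_sub|exact: s_L1|exact: L1cst|exact: s_L1|exact: L1cst].
apply: (@le_trans _ _ (EI P (B `&` C) (Z a u))).
 apply: EI_le => //; [exact: is_|exact: Z_L1|].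
 by move=> w _; rewrite le_max lexx orbT.
apply: EI_subset; meas.
Qed.

Let U a b low l w : R := (upc a b low [seq s q w | q <- l])%:R.

Let U_meas a b low l : (forall q, q \in l -> 0 <= q <= T) ->
 mfunT (U a b low l).
Proof.
elim: l low => [|q l IH] low lT; first exact: mcst.
have mq : mfunT (s q) by apply/ms/lT; exact: mem_head.
have {}IH low' := IH low' (fun q' q'l => lT q' (@mem_behead _ (q :: l) _ q'l)).
case: low.
 rewrite (_ : U a b true (q :: l) = fun w => if b <= s q w
   then 1 + U a b false l w else U a b true l w); last first.
  by apply/funext => w; rewrite /U /=; case: ifP => // _; rewrite -natr1 addrC.
 apply: measurable_fun_ifT => //; first meas.
 meas.
rewrite (_ : U a b false (q :: l) = fun w => if s q w <= a
  then U a b true l w else U a b false l w); last first.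
 by apply/funext => w; rewrite /U /=; case: ifP.
meas.
Qed.

Let U_L1 a b low l : (forall q, q \in l -> 0 <= q <= T) -> L1 P (U a b low l).
Proof.
move=> lT; apply: (@L1bound _ _ _ P _ (size l)%:R); first meas.
move=> w; rewrite ger0_norm ?ler0n// ler_nat.
by rewrite (leq_trans (upc_size _ _ _ _))// size_map.
Qed.

(** Doob's upcrossing inequality by induction on the list, in two versions proved together, one for
    each flag. A completed upcrossing is paid for by [Z a t >= b - a] on the event [b <= s t]; the
    version without low flag starts again from there and subtracts this amount. *)
Let upc_bound a b l t B : a < b -> path <%R t l ->
 (forall q, q \in t :: l -> 0 <= q <= T) -> G t B ->
 (b - a) * EI P B (U a b false (t :: l)) <=
  EI P B (Z a (last t l)) - EI P B (Z a t) /\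
 (b - a) * EI P B (U a b true (t :: l)) <= EI P B (Z a (last t l)).
Proof.
move=> ab; elim: l t B => [|t' l IH] t B tl lT GB.
 have tT := lT t (mem_head _ _); have mB := Gm tT GB.
 split; rewrite /=.
  rewrite subrr (@eq_EI _ _ _ P B _ (cst 0)); first by rewrite EIcst// mul0r mulr0.
  by [].
 rewrite -EIZ//; last meas.
 apply: EI_le => //; [by apply: L1Z; exact: U_L1|exact: Z_L1|].
 move=> w _; rewrite /U /=; case: (lerP b (s t w)) => bs /=; last by rewrite mulr0.
 by rewrite mulr1 le_max; apply/orP; right; rewrite lerB.
have tT := lT t (mem_head _ _); have mB := Gm tT GB.
have t'T : 0 <= t' <= T by apply: lT; rewrite !inE eqxx orbT.
have lT' q : q \in t' :: l -> 0 <= q <= T.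
 by move=> ql; apply: lT; rewrite inE ql orbT.
move: tl => /= /andP[tt' t'l].
have [/andP[t0 _] /andP[_ t'1]] := (tT, t'T).
have GG D : G t D -> G t' D by apply: (G_mono UG t0 (ltW tt') t'1).
have LT : 0 <= last t' l <= T by apply: lT'; exact: mem_last.
have cG := G_csub tT.
have ms0 := s_sm tT.
pose C := [set w | s t w <= a].
have GC : G t C by apply: (csub_le cG) => //; exact: smcst cG.
pose D := [set w | b <= s t w].
have GD : G t D by apply: (csub_le cG) => //; exact: smcst cG.
have GBC := csubI cG GB GC; have GBC' := csubI cG GB (csubC cG GC).
have GBD := csubI cG GB GD; have GBD' := csubI cG GB (csubC cG GD).
have iU low := U_L1 a b low lT; have iU' low := U_L1 a b low lT'.
split.
 rewrite (EI_split mB (Gm tT GC))//.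
 rewrite (@eq_EI _ _ _ P (B `&` C) _ (U a b true (t' :: l))); last first.
  by move=> w [_ Cw]; rewrite /U [in LHS]/= Cw.
 rewrite (@eq_EI _ _ _ P (B `&` ~` C) _ (U a b false (t' :: l))); last first.
  by move=> w [_ /negP/negbTE Cw]; rewrite /U [in LHS]/= Cw.
 rewrite mulrDr.
 have [_ H1] := IH t' _ t'l lT' (GG _ GBC).
 have [H2 _] := IH t' _ t'l lT' (GG _ GBC').
 have Ht := EI_split mB (Gm tT GC) (Z_L1 a tT).
 have HL := EI_split mB (Gm tT GC) (Z_L1 a LT).
 have Hz : EI P (B `&` C) (Z a t) = 0.
  rewrite (@eq_EI _ _ _ P (B `&` C) _ (cst 0)); first by rewrite EIcst ?mul0r//; exact: Gm GBC.
  by move=> w [_ Cw]; rewrite /Z max_l// subr_le0.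
 have Hs := Z_sub a t0 (ltW tt') t'1 GBC'.
 lra.
rewrite (EI_split mB (Gm tT GD))//.
rewrite (@eq_EI _ _ _ P (B `&` D) _ (fun w => 1 + U a b false (t' :: l) w)); last first.
 by move=> w [_ Dw]; rewrite /U [in LHS]/= Dw -natr1 addrC.
rewrite (@eq_EI _ _ _ P (B `&` ~` D) _ (U a b true (t' :: l))); last first.
 by move=> w [_ /negP/negbTE Dw]; rewrite /U [in LHS]/= Dw.
rewrite EID//; [|exact: Gm GBD|exact: L1cst].
rewrite !mulrDr.
have [H2 _] := IH t' _ t'l lT' (GG _ GBD).
have [_ H1] := IH t' _ t'l lT' (GG _ GBD').
have HL := EI_split mB (Gm tT GD) (Z_L1 a LT).
have Hs := Z_sub a t0 (ltW tt') t'1 GBD.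
have Hb : (b - a) * EI P (B `&` D) (fun=> 1) <= EI P (B `&` D) (Z a t).
 rewrite -EIZ; [|exact: Gm GBD|exact: L1cst].
 apply: EI_le; [exact: Gm GBD|by apply: L1Z; exact: L1cst|exact: Z_L1|].
 by move=> w [_ Dw]; rewrite mulr1 le_max; apply/orP; right; rewrite lerB.
lra.
Qed.

Let ae_upc a b : a < b -> \forall w \ae P, bounded_upc T (s ^~ w) a b.
Proof.
move=> ab; pose E M n := [set w | M%:R < U a b false (gridl T n) w].
have gT n q : q \in gridl T n -> 0 <= q <= T by exact: gridl_in.
have mE M n : measurable (E M n).
 apply: meas_lt => //; apply: U_meas; exact: gT.
have ba : 0 < b - a by lra.
pose K := (EI P setT (Z a T)) / (b - a).
have EIU n : EI P setT (U a b false (gridl T n)) <= K.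
 rewrite ler_pdivlMr// mulrC.
 have := gridl_sorted T n; case El : (gridl T n) (gT n) => [|t l] lT sl.
  rewrite EIcst// mul0r mulr0; apply: EI_ge0 => w _; exact: Z0.
 have tT := lT t (mem_head _ _).
 have [+ _] := upc_bound ab sl lT (csubT (G_csub tT)).
 have := @EI_ge0 _ _ _ P setT (Z a t) (fun w _ => Z0 a t w).
 have -> : last t l = T.
  by rewrite -[last t l]/(last 0 (t :: l)) -El last_rcons.
 lra.
have HK M n : M%:R * fine (P (E M n)) <= K.
 rewrite -EIcst//; apply: le_trans (EIU n).
 apply: (@le_trans _ _ (EI P (E M n) (U a b false (gridl T n)))).
  apply: EI_le => //; [exact: L1cst|by apply: U_L1; exact: gT|].
  by move=> w /ltW.
 apply: EI_subset => //; apply: U_L1; exact: gT.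
have ndE M n : E M n `<=` E M n.+1.
 move=> w; rewrite /E => /lt_le_trans; apply; rewrite ler_nat; apply: upc_subseq => //.
 apply: map_subseq; apply: gridl_subseq; first exact: gridl_sorted.
 move=> q; exact: gridl_sub.
apply: filterS (ae_bounded_events mE ndE HK) => w [M HM]; exists M => n; have := HM n.
by rewrite /E => /negP; rewrite -leNgt ler_nat.
Qed.

Let ever lam l := [set w : Ω | exists2 q, q \in l & lam < `|s q w|].

Let ever_cons lam t l : ever lam (t :: l) = [set w | lam < `|s t w|] `|` ever lam l.
Proof.
apply/seteqP; split=> w; rewrite /ever /=.
 by move=> [q]; rewrite inE => /predU1P[->|ql]; [left|right; exists q].
by move=> [lw|[q ql qw]]; [exists t; rewrite ?mem_head|exists q; rewrite ?inE ?ql ?orbT].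
Qed.

Let G_abs lam t : 0 <= t <= T -> G t [set w | lam < `|s t w|].
Proof.
move=> tT; have cG := G_csub tT; apply: (csub_lt cG); first exact: smcst cG.
by apply/(smE _ cG); apply: mcomp => //; apply/(smE _ cG)/s_sm.
Qed.

Let ever_meas lam l : (forall q, q \in l -> 0 <= q <= T) -> measurable (ever lam l).
Proof.
elim: l => [|t l IH] lT.
 by rewrite (_ : ever _ _ = set0)//; apply/seteqP; split => // w [].
rewrite ever_cons; apply: measurableU.
 apply: (Gm (lT t (mem_head _ _))); apply: G_abs; exact/lT/mem_head.
by apply: IH => q ql; apply: lT; rewrite inE ql orbT.
Qed.

Let Xi_ge0 t B : 0 <= t <= T -> G t B -> 0 <= EI P B Xi.
Proof. by move=> tT GB; apply: le_trans (s_dom tT GB); apply: EI_ge0. Qed.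

(** Splitting by the first point at which the level is exceeded: [Xi] dominates [s] on that event,
    and the induction continues on its complement, which is known at the same time. *)
Let maximal lam l t B : 0 <= lam -> path <%R t l ->
 (forall q, q \in t :: l -> 0 <= q <= T) -> G t B ->
 lam * fine (P (B `&` ever lam (t :: l))) <= EI P B Xi.
Proof.
move=> lam0; elim: l t B => [|t' l IH] t B tl lT GB.
 have tT := lT t (mem_head _ _); have mB := Gm tT GB.
 have GA := G_abs lam tT.
 rewrite ever_cons (_ : ever lam [::] = set0) ?setU0; last first.
  by apply/seteqP; split => // w [].
 have GBA := csubI (G_csub tT) GB GA.
 rewrite -EIcst; last exact: Gm GBA.
 rewrite (EI_split mB (Gm tT GA) iXi).
 have := Xi_ge0 tT (csubI (G_csub tT) GB (csubC (G_csub tT) GA)).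
 have := s_dom tT GBA.
 have : EI P (B `&` [set w | lam < `|s t w|]) (fun=> lam) <=
   EI P (B `&` [set w | lam < `|s t w|]) (fun w => `|s t w|).
  apply: EI_le; [exact: Gm GBA|exact: L1cst|exact/L1norm/s_L1|].
  by move=> w [_ /ltW].
 lra.
have tT := lT t (mem_head _ _); have mB := Gm tT GB.
have t'T : 0 <= t' <= T by apply: lT; rewrite !inE eqxx orbT.
have lT' q : q \in t' :: l -> 0 <= q <= T.
 by move=> ql; apply: lT; rewrite inE ql orbT.
move: tl => /= /andP[tt' t'l].
have [/andP[t0 _] /andP[_ t'1]] := (tT, t'T).
have cG := G_csub tT.
have GA := G_abs lam tT; set A := [set w | _] in GA.
have GBA := csubI cG GB GA; have GBA' := csubI cG GB (csubC cG GA).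
have := IH t' _ t'l lT' (G_mono UG t0 (ltW tt') t'1 GBA').
have mI : measurable (B `&` ~` A `&` ever lam (t' :: l)) by meas.
have -> : B `&` ever lam (t :: t' :: l) =
  (B `&` A) `|` (B `&` ~` A `&` ever lam (t' :: l)).
 rewrite ever_cons -/A; apply/seteqP; split=> w /=; last tauto.
 move=> [Bw [Aw|Ew]]; first by left.
 by have [Aw|Aw] := pselect (A w); [left|right].
rewrite -!EIcst//; last first.
 meas.
rewrite EI_setU//; [|exact: Gm GBA|exact: L1cst|by move=> w [_ Aw] [[_ nAw]]].
rewrite (EI_split mB (Gm tT GA) iXi).
have := s_dom tT GBA.
have : EI P (B `&` A) (fun=> lam) <= EI P (B `&` A) (fun w => `|s t w|).
 apply: EI_le; [exact: Gm GBA|exact: L1cst|exact/L1norm/s_L1|].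
 by move=> w [_ /ltW].
lra.
Qed.

Let ae_bdd : \forall w \ae P, exists C, forall q, grid T q -> `|s q w| <= C.
Proof.
pose E (M n : nat) := ever M%:R (gridl T n).
have gT n q : q \in gridl T n -> 0 <= q <= T by exact: gridl_in.
have mE M n : measurable (E M n) by apply: ever_meas; exact: gT.
have TT := T_in T0.
have HK M n : M%:R * fine (P (E M n)) <= EI P setT Xi.
 have := gridl_sorted T n; rewrite /E.
 case El : (gridl T n) (gT n) => [|t l] lT sl.
  rewrite (_ : ever _ _ = set0) ?measure0 ?mulr0; last first.
   by apply/seteqP; split => // w [].
  exact: Xi_ge0 (csubT (G_csub TT)).
 rewrite -[X in P X]setTI; apply: maximal => //.
 exact: csubT (G_csub (lT t (mem_head _ _))).
have ndE M n : E M n `<=` E M n.+1.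
 by move=> w [q ql sq]; exists q => //; exact: gridl_sub ql.
apply: filterS (ae_bounded_events mE ndE HK) => w [M HM]; exists M%:R => q [n qn]; rewrite leNgt.
by apply/negP => Mq; apply: (HM n); exists q.
Qed.

(** Rational levels suffice: with rationals [a < x < y < b], every upcrossing of [[a, b]] contains
    one of [[x, y]]. *)
Lemma ae_good : \forall w \ae P, good_path T (s ^~ w).
Proof.
have H : \forall w \ae P, forall p : rat * rat, ratr p.1 < ratr p.2 :> R ->
  bounded_upc T (s ^~ w) (ratr p.1) (ratr p.2).
 apply: ae_count => -[a b] /=.
 have [ab|ab] := pselect (ratr a < ratr b :> R); last by apply: aeW => w /ab.
 by apply: filterS (ae_upc ab) => w.
apply: filterS2 ae_bdd H => w bw Hw; split => // a b ab.
have [x] := rat_in_itvoo ab; rewrite in_itv/= => /andP[ax xb].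
have [y] := rat_in_itvoo xb; rewrite in_itv/= => /andP[xy yb].
have [M HM] := Hw (x, y) xy; exists M => n; apply: leq_trans (HM n).
have low : forall (low : bool) l, (upc a b low l <= upc (ratr x) (ratr y) low l)%N.
 move=> + l; elim: l => // z l IH [|] /=.
  case: (lerP b z) => bz.
   by rewrite (le_trans (ltW yb) bz) ltnS.
  case: lerP => yz; last by [].
  apply: leq_trans (IH true) _.
  by have /andP[_] := upc_flag l xy.
 case: lerP => za; first by rewrite (le_trans za (ltW ax)).
 case: lerP => zx; last by [].
 apply: leq_trans (IH false) _.
 by have /andP[] := upc_flag l xy.
by [].
Qed.

Hypothesis s_rc : forall t, 0 <= t < T ->
 EI P setT (s (minr T (up n t))) @[n --> \oo] --> EI P setT (s t).

(** The right limits along the grid define [S]. The submartingale property gives [s t <= S t], and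
    by right-continuity of the means ([s_rc]) both have the same mean, which excludes a strict
    inequality. *)
Theorem regularisation : exists S : R -> Ω -> R,
 [/\ adapted T G S, forall w, cadlag T (S ^~ w)
  & forall t, 0 <= t <= T -> \forall w \ae P, S t w = s t w].
Proof.
pose N := [set w | good_path T (s ^~ w)].
pose S t w := \1_N w * regular T (s ^~ w) t.
have SN t w : N w -> S t w = regular T (s ^~ w) t.
 by move=> Nw; rewrite /S indicE mem_set// mul1r.
have SN' w : ~ N w -> S ^~ w = cst 0.
 by move=> Nw; apply/funext => t; rewrite /S indicE memNset// mul0r.
have GN t : 0 <= t <= T -> G t N.
 move=> tT; have cG := G_csub tT; rewrite -[N]setCK; apply: (csubC cG).
 by have [_ _] := cG; apply; exact: ae_good.
have up_in t n : 0 <= t <= T -> t <= minr T (up n t) <= T.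
 by move=> /andP[? ?]; rewrite le_min ge_min lexx andbT; apply/andP; split => //; exact/ltW/lt_up.
have up_in0 t n : 0 <= t <= T -> 0 <= minr T (up n t) <= T.
 move=> tT; have /andP[? ->] := up_in t n tT; rewrite andbT; lra.
have cS t : 0 <= t <= T -> forall w,
  \1_N w * s (minr T (up n t)) w @[n --> \oo] --> S t w.
 move=> tT w; have [Nw|Nw] := pselect (N w).
  rewrite SN// indicE mem_set//.
  under eq_fun do rewrite mul1r.
  exact: regular_up.
 rewrite (_ : S t w = 0); last by rewrite /S indicE memNset// mul0r.
 rewrite indicE memNset//; under eq_fun do rewrite mul0r.
 exact: cvg_cst.
have adS : adapted T G S.
 move=> t tT; have /andP[t0 tT'] := tT.
 have [tT1|Tt] := ltP t T; last first.
  have -> : t = T by lra.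
  have TT := T_in T0.
  apply: (@sm_lim _ _ _ P _ _ _ (G_csub TT) _ (cS T TT)) => n.
  apply: (smM (G_csub TT)); first by apply: (sm_indic (G_csub TT)); exact: GN.
  rewrite min_l; last exact/ltW/lt_up.
  meas.
 (* Right-continuity of the filtration: for each [u > t], the approximations of [S t] of a fine
    enough mesh are known at [u]. *)
 move=> A SA; have [_ _ rG _] := UG.
 rewrite rG; last lra.
 move=> u /=; rewrite in_itv/= => /andP[tu uT].
 have uuT : 0 <= u <= T by lra.
 have [n0 n0u] := @mesh_small R (u - t) ltac:(lra).
 suff : smeas (G u) (S t) by meas.
 apply: (@sm_lim _ _ _ P _ (fun n w => \1_N w * s (minr T (up (n + n0) t)) w) _ (G_csub uuT)).
  move=> n; apply: (smM (G_csub uuT)); first by apply: (sm_indic (G_csub uuT)); exact: GN.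
  apply: (sm_sub (H := G (minr T (up (n + n0) t)))); last by apply/s_sm/up_in0.
  have /andP[? ?] := up_in0 t (n + n0)%N tT.
  apply: (G_mono UG) => //; rewrite ge_min; apply/orP; right.
  have := up_le (n + n0) t0; have := @mesh_le R _ _ (leq_addl n n0); lra.
 move=> w; have := cS t tT w.
 by move/(cvg_comp _ _ (cvg_addnr n0)); apply: cvg_trans; apply: near_eq_cvg; apply: nearW.
exists S; split => //.
 move=> w; have [Nw|Nw] := pselect (N w).
  rewrite (_ : S ^~ w = regular T (s ^~ w)); first exact: regular_cadlag.
  apply/funext => t; exact: SN.
 rewrite SN'//; split=> [t _|t _]; first exact: cvg_cst.
 apply/cvg_ex; exists 0; exact: cvg_cst.
move=> t tT; have cG := G_csub tT; have /andP[t0 tT'] := tT.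
have dom n : uidom P Xi (s (minr T (up n t))).
 have uT := up_in0 t n tT.
 apply: (uidom_sm (G_csub uT)) => //; [exact: s_sm|exact: s_L1|move=> B; exact: s_dom].
have mS : mfunT (S t) by apply: (sm_meas cG); exact: adS.
have cae : \forall w \ae P, s (minr T (up n t)) w @[n --> \oo] --> S t w.
 apply: filterS ae_good => w Nw; rewrite SN//; exact: regular_up.
have V A mA := @vitali_EI _ _ _ P Xi _ _ A iXi mA dom mS cae.
have [iS _] := V setT measurableT.
have le1 : \forall w \ae P, s t w <= S t w.
 apply: (sm_ae_le cG) => //; [exact: s_sm|exact: adS|exact: s_L1|].
 move=> B GB; have [_ cB] := V B (Gm tT GB).
 apply: (@EI_cvg_ge _ (fun n => EI P B (s (minr T (up n t))))) => // n.
 by have /andP[? ?] := up_in t n tT; apply: s_sub.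
have Eeq : EI P setT (S t) = EI P setT (s t).
 have [_ cB] := V setT measurableT.
 have [tT1|Tt] := ltP t T; last first.
  have E : t = T by lra.
  symmetry; apply: (cvg_unique _ _ cB) => //.
  rewrite E (_ : (fun n => _) = cst (EI P setT (s T))); first exact: cvg_cst.
  apply/funext => n /=; rewrite min_l//; exact/ltW/lt_up.
 by apply: (cvg_unique _ cB) => //; apply: s_rc; rewrite t0.
have : \forall w \ae P, S t w <= s t w.
 apply: ae_le_EI => //; first meas.
 set A := [set w | _]; have mA : measurable A.
  apply: meas_lt; meas.
 have := EI_split measurableT mA iS; have := EI_split measurableT mA (s_L1 tT).
 rewrite Eeq !setTI => -> H.
 have mA' := measurableC mA.
 have : EI P (~` A) (s t) <= EI P (~` A) (S t).
  by apply: EI_ae_le => //; [exact: s_L1|apply: filterS le1].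
 move: H; lra.
by apply: filterS2 le1 => w ? ?; apply/eqP; rewrite eq_le; apply/andP.
Qed.

End regularisation.

(** * Weak compactness along an ultrafilter *)

Lemma hgt0 {R : realType} (e : R) : 0 < e -> 0 < e / 2.
Proof. lra. Qed.

(** Every bounded sequence converges along one fixed ultrafilter finer than the neighbourhoods of
    infinity. A single choice thus gives the limits of the integrals over all events, and later at
    all times, without extracting subsequences. *)
Definition Ultra : set_system nat :=
 xget \oo [set U | UltraFilter U /\ \oo `<=` U].

Lemma UltraP : UltraFilter Ultra /\ \oo `<=` Ultra.
Proof.
have [U [uU sU]] := @ultraFilterLemma nat \oo _.
by apply: (@xgetPex _ \oo [set U | UltraFilter U /\ \oo `<=` U]); exists U.
Qed.

#[global] Instance Ultra_ultra : UltraFilter Ultra := UltraP.1.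
#[global] Instance Ultra_proper : ProperFilter Ultra := @ultra_proper _ _ Ultra_ultra.

Section weak_limits.
Context {R : realType} {d : measure_display} {Ω : measurableType d}
 (P : probability Ω R).
Implicit Types (X : nat -> Ω -> R) (u v : nat -> R).

Lemma cvg_Ultra u (l : R) : u n @[n --> \oo] --> l -> u n @[n --> Ultra] --> l.
Proof. move=> ul A /ul; exact: UltraP.2. Qed.

Lemma is_cvg_Ultra u (C : R) : (forall n, `|u n| <= C) -> cvg (u n @[n --> Ultra]).
Proof.
move=> uC; have [] := @segment_compact R (- C) C (u @ Ultra) _.
 apply: (@filterS _ Ultra _ setT); last exact: filterT.
 by move=> n _; have := uC n; rewrite ler_norml.
move=> l [_ cl]; apply/cvg_ex; exists l => A lA.
have [//|nA] := in_ultra_setVsetC (u @^-1` A) Ultra_ultra.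
by have [x [nAx Ax]] := cl (~` A) A nA lA.
Qed.

(** Equi-integrability, in the form that makes the weak limit countably additive. *)
Definition ui X := forall e : R, 0 < e -> exists2 c : R, 0 < c &
 forall A, measurable A -> fine (P A) < c ->
  forall n, EI P A (fun w => `|X n w|) <= e.

Lemma Ultra_le u (l C : R) : (forall n, `|u n| <= C) -> u n @[n --> Ultra] --> l ->
 `|l| <= C.
Proof.
move=> uC ul; have cn : `|u n| @[n --> Ultra] --> `|l| by exact: cvg_norm.
apply: (cvgr_to_le cn); exact: filterE.
Qed.

Section weak_limit.
Context (X : nat -> Ω -> R) (C : R)
 (iX : forall n, L1 P (X n))
 (XC : forall n, EI P setT (fun w => `|X n w|) <= C)
 (uiX : ui X).

Let EIC A n : measurable A -> `|EI P A (X n)| <= C.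
Proof.
move=> mA; apply: le_trans (XC n); apply: le_trans (EI_abs mA (iX n)) _.
apply: EI_subset; meas.
Qed.

Let nu0 (A : set Ω) : R := lim (EI P A (X n) @[n --> Ultra]).

Let nuE A : measurable A -> EI P A (X n) @[n --> Ultra] --> nu0 A.
Proof. move=> mA; apply: @is_cvg_Ultra => n; exact: EIC. Qed.

Definition wnu (A : set Ω) : \bar R := (nu0 A)%:E.

Let wnu0 : wnu set0 = 0%E.
Proof.
rewrite /wnu; congr EFin; apply: norm_cvg_lim.
rewrite (_ : (fun n => _) = cst 0); first exact: cvg_cst.
by apply/funext => n; rewrite EI_set0.
Qed.

Let wnu_fin A : measurable A -> wnu A \is a fin_num.
Proof. meas. Qed.

Let nuU A B : measurable A -> measurable B -> (forall w, A w -> B w -> False) ->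
 nu0 (A `|` B) = nu0 A + nu0 B.
Proof.
move=> mA mB AB; apply: norm_cvg_lim.
rewrite (_ : (fun n => _) = (fun n => EI P A (X n) + EI P B (X n))).
 apply: cvgD; exact: nuE.
by apply/funext => n; rewrite EI_setU.
Qed.

(** The remainders [W n] of the union have small probability, hence small integrals uniformly in the
    sequence, and the limit along [Ultra] keeps the bound. *)
Let wnu_sigma : semi_sigma_additive wnu.
Proof.
move=> F mF tF mUF.
pose V n := \big[setU/set0]_(i < n) F i.
have mV n : measurable (V n) by exact: bigsetU_measurable.
have VE n : (\sum_(0 <= i < n) wnu (F i))%E = (nu0 (V n))%:E.
 elim: n => [|n IH].
  rewrite big_geq// /V big_ord0; exact/esym/wnu0.
 rewrite big_nat_recr//= IH /V big_ord_recr/= -/(V n) nuU// => w.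
 rewrite /V -bigcup_mkord => -[i /= ilt Fi] Fw.
 by have := tF i n I I (ex_intro _ w (conj Fi Fw)) => E; rewrite E ltnn in ilt.
under eq_fun do rewrite VE.
apply/cvg_EFin; first exact: nearW.
apply/cvgnP => e e0; have [c c0 cP] := uiX (hgt0 e0).
pose W n := (\bigcup_n F n) `\` V n.
have mW n : measurable (W n) by exact: measurableD.
have cW : P (W n) @[n --> \oo] --> P (\bigcap_n W n).
 apply: nonincreasing_cvg_mu => //.
 - by rewrite ltey_eq fin_num_measure.
 - exact: bigcapT_measurable.
 - move=> m n mn; apply/subsetPset => w [Uw nV]; split => // Vw; apply: nV.
  by apply: (subset_bigsetU mn).
have W0 : \bigcap_n W n = set0.
 apply/seteqP; split => // w Ww; have [[n _ Fn] _] := Ww 0%N I.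
 have [_ nV] := Ww n.+1 I; apply: nV; rewrite /V big_ord_recr; by right.
rewrite W0 measure0 in cW.
have /cvgnP/(_ c c0)[N NP] : fine (P (W n)) @[n --> \oo] --> (0 : R).
 exact: fine_cvg.
exists N => n Nn; have := NP n Nn; rewrite sub0r normrN => Wc.
have {}Wc : fine (P (W n)) < c by apply: le_lt_trans (ler_norm _) Wc.
have -> : \bigcup_n F n = V n `|` W n.
 rewrite setDUK//; exact: bigsetU_bigcup.
rewrite nuU//; last by move=> w Vw [_].
rewrite addrC addKr; apply: (@le_lt_trans _ _ (e / 2)); last lra.
apply: (@Ultra_le (fun m => EI P (W n) (X m))); last exact: nuE.
move=> m; apply: le_trans (EI_abs (mW n) (iX m)) _; exact: cP.
Qed.

HB.instance Definition _ := isCharge.Build _ _ _ wnu wnu0 wnu_fin wnu_sigma.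

Lemma wnu_dominates : wnu `<< P.
Proof.
apply/null_content_dominatesP => A mA A0.
rewrite /wnu; congr EFin; apply: norm_cvg_lim.
rewrite (_ : (fun n => _) = cst 0); first exact: cvg_cst.
by apply/funext => n; rewrite EI_null.
Qed.

Lemma weak_limit H : csub P H -> exists Y,
 [/\ smeas H Y, L1 P Y
  & forall A, H A -> EI P A (X n) @[n --> Ultra] --> EI P A Y].
Proof.
move=> cH; have [Y [HY iY YE]] := density_exists cH wnu_dominates.
exists Y; split => // A HA; have mA := csubm cH HA.
have -> : EI P A Y = nu0 A by apply: EFin_inj; rewrite YE.
exact: nuE.
Qed.

End weak_limit.

Lemma uidom_ui X (Xi : Ω -> R) : L1 P Xi -> (forall n, uidom P Xi (X n)) -> ui X.
Proof.
move=> iXi dX e e0; have [k k0 kP] := tail_cvg0 iXi (hgt0 e0).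
exists (e / 2 / k); first by rewrite divr_gt0; lra.
move=> A mA PA n.
have iX := (dX n).1; have k0' := ltW k0.
apply: (@le_trans _ _ (EI P A (fun w => tail k (X n) w + k))).
 apply: EI_le => //; [exact: L1norm|by apply: L1D; [exact: L1_tail|exact: L1cst]|].
 by move=> w _; rewrite -lerBlDr le_max lexx orbT.
rewrite EID//; [|exact: L1_tail|exact: L1cst].
rewrite EIcst//.
have : EI P A (tail k (X n)) <= EI P setT (tail k (X n)).
 apply: EI_subset => //; [exact: L1_tail|move=> w; exact: tail_ge0].
have := (dX n).2 k k0'.
have : k * fine (P A) <= e / 2 by rewrite mulrC -ler_pdivlMr// ltW.
move: kP; lra.
Qed.

Lemma le_uidom (Xi X : Ω -> R) : mfunT X -> (forall w, `|X w| <= Xi w) ->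
 L1 P Xi -> uidom P Xi X.
Proof.
move=> mX XXi iXi; have iX := le_L1 mX XXi iXi; split => // k k0.
apply: EI_le => //; try exact: L1_tail.
move=> w _; rewrite ge_max !le_max lexx lerB ?orbT//.
apply: le_trans (XXi w) _; exact: ler_norm.
Qed.

End weak_limits.

(** * Lower envelope of a non-adapted process over stopping times *)

Section envelope.
Context {R : realType} {d : measure_display} {Ω : measurableType d}
 (P : probability Ω R) (T : R) (G : R -> set (set Ω))
 (T0 : 0 < T)
 (UG : usual_filtration P T G).
Implicit Types (U S : R -> Ω -> R) (Xi s : Ω -> R) (θ τ : Ω -> R)
 (B : set Ω) (t : R).

Notation st := (stopping_time T G).
Notation Gat := (sigma_at T G).

(* A raw process: it need not be adapted. *)
Definition raw U Xi := [/\ forall w, cadlag T (U ^~ w),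
 forall t, 0 <= t <= T -> mfunT (U t), L1 P Xi
 & forall t w, 0 <= t <= T -> `|U t w| <= Xi w].

Lemma raw_eval U Xi τ : raw U Xi -> mfunT τ ->
 (forall w, 0 <= τ w <= T) -> L1 P (fun w => U (τ w) w).
Proof.
move=> [cU mU iXi UXi] mtau tT; apply: le_L1 iXi.
 apply: (@meas_eval _ _ _ U T) => // w t /andP[t0 tT'].
 by apply: (cU w).1; rewrite t0.
move=> w; exact: UXi.
Qed.

Lemma raw_st U Xi τ : raw U Xi -> st τ -> L1 P (fun w => U (τ w) w).
Proof.
move=> rU sta; apply: (raw_eval rU); last exact: sta.1.
exact: (st_meas (P := P) T0 UG).
Qed.

(** The essential infimum of [E[U_τ | G_θ]] over [τ >= θ], described by integrals. Near-optimality
    is asked in mean over the whole space only; [env_attain] localises it. *)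
Definition is_env U θ s := [/\ smeas (Gat θ) s, L1 P s,
 forall τ B, st τ -> (forall w, θ w <= τ w) -> Gat θ B ->
  EI P B s <= EI P B (fun w => U (τ w) w)
 & forall e : R, 0 < e -> exists τ, [/\ st τ, forall w, θ w <= τ w
  & EI P setT (fun w => U (τ w) w) <= EI P setT s + e]].

(** The lower bound holds on the complement of [B] too, so the excess over [s] on [B] alone cannot
    be more than the total excess. *)
Lemma env_attain U Xi θ s B e : raw U Xi -> st θ -> is_env U θ s ->
 Gat θ B -> 0 < e -> exists τ, [/\ st τ, forall w, θ w <= τ w,
  EI P B (fun w => U (τ w) w) <= EI P B s + e
  & EI P setT (fun w => U (τ w) w) <= EI P setT s + e].
Proof.
move=> rU sth [_ is_ lb att] GB e0; have [τ [sta le Htau]] := att e e0.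
have cG := Gat_csub T0 UG sth; have mB := csubm cG GB.
exists τ; split => //.
have GB' := csubC cG GB.
have := EI_split measurableT mB is_.
have := EI_split measurableT mB (raw_st rU sta).
rewrite !setTI; have := lb τ _ sta le GB'.
move: Htau; lra.
Qed.

Lemma env_sub U Xi θ theta' s s' B : raw U Xi -> st θ -> st theta' ->
 (forall w, θ w <= theta' w) -> is_env U θ s -> is_env U theta' s' ->
 Gat θ B -> EI P B s <= EI P B s'.
Proof.
move=> rU sth sth' le es es' GB; apply/ler_addgt0Pr => e e0.
have GB' : Gat theta' B by apply: (Gat_mono UG sth sth' le).
have [τ [sta let' + _]] := env_attain rU sth' es' GB' e0.
apply: le_trans; have [_ _ lb _] := es; apply: lb => // w.
exact: le_trans (le w) (let' w).
Qed.

(** Where [s >= 0], the time [θ] itself is a competitor and bounds [s] above; where [s < 0], nearly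
    optimal times bound it below by [- Xi]. *)
Lemma env_dom U Xi θ s B : raw U Xi -> st θ -> is_env U θ s ->
 Gat θ B -> EI P B (fun w => `|s w|) <= EI P B Xi.
Proof.
move=> rU sth es GB; have cG := Gat_csub T0 UG sth.
have [Hs is_ lb _] := es; have [cU mU iXi UXi] := rU.
pose C := [set w | 0 <= s w].
have GC : Gat θ C by apply: (csub_le cG) => //; exact: smcst cG.
have GBC := csubI cG GB GC; have GBC' := csubI cG GB (csubC cG GC).
have mC := csubm cG GC; have mB := csubm cG GB.
rewrite (EI_split mB mC (L1norm is_)) (EI_split mB mC iXi).
apply: lerD.
 rewrite (@eq_EI _ _ _ P _ _ s); last by move=> w [_ Cw]; rewrite ger0_norm.
 apply: le_trans (lb θ _ sth (fun w => lexx _) GBC) _.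
 apply: EI_le => //; [exact: measurableI|exact: raw_st rU sth|].
 move=> w _; apply: le_trans (ler_norm _) _; apply: UXi; exact: sth.1.
have mI : measurable (B `&` ~` C) by meas.
rewrite (@eq_EI _ _ _ P _ _ (fun w => - s w)); last first.
 by move=> w [_ /negP]; rewrite -ltNge => /ltr0_norm.
rewrite EIN//; apply/ler_addgt0Pr => e e0.
have [τ [sta le H _]] := env_attain rU sth es GBC' e0.
rewrite lerNl opprD; have : EI P (B `&` ~` C) (fun w => - Xi w) <=
  EI P (B `&` ~` C) (fun w => U (τ w) w).
 apply: EI_le => //; [exact: L1N|exact: raw_st rU sta|].
 by move=> w _; have := UXi _ w (sta.1 w); rewrite ler_norml => /andP[].
rewrite EIN//; move: H; lra.
Qed.

Lemma env_uidom U Xi θ s : raw U Xi -> st θ -> is_env U θ s ->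
 uidom P Xi s.
Proof.
move=> rU sth es; have [Hs is_ _ _] := es; have [_ _ iXi _] := rU.
apply: (uidom_sm (Gat_csub T0 UG sth)) => // B GB; exact: env_dom rU sth es GB.
Qed.

(* A minimising sequence of stopping times is weakly compact, and pasting
  shows that its weak limit is a lower bound. *)
Lemma env_exists U Xi θ : raw U Xi -> st θ -> exists s, is_env U θ s.
Proof.
move=> rU sth; have [cU mU iXi UXi] := rU; have cG := Gat_csub T0 UG sth.
pose A := [set x | exists τ, [/\ st τ, forall w, θ w <= τ w
 & x = EI P setT (fun w => U (τ w) w)]].
have lbA : lbound A (- EI P setT Xi).
 move=> x [τ [sta le ->]]; rewrite -EIN//.
 apply: EI_le => //; [exact: L1N|exact: raw_st rU sta|].
 by move=> w _; have := UXi _ w (sta.1 w); rewrite ler_norml => /andP[].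
have hA : has_inf A by split; [exists (EI P setT (fun w => U (θ w) w)); exists θ|eexists; exact: lbA].
have ex n : exists τ, [/\ st τ, forall w, θ w <= τ w
  & EI P setT (fun w => U (τ w) w) < inf A + mesh n].
 have [x [τ [sta le ->]] xl] := inf_adherent (mesh_gt0 n) hA.
 by exists τ.
have /choice[τ tauP] := ex.
pose X n w := U (τ n w) w.
have sta n : st (τ n) by have [] := tauP n.
have dX n : uidom P Xi (X n).
 apply: le_uidom => //; first exact: L1_meas (raw_st rU (sta n)).
 move=> w; apply: UXi; exact: (sta n).1.
have [s [Hs is_ cs]] := @weak_limit _ _ _ P X (EI P setT Xi) (fun n => (dX n).1)
 (fun n => EI_le measurableT (L1norm (dX n).1) iXi (fun w _ => UXi _ w ((sta n).1 w)))
 (uidom_ui iXi dX) _ cG.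
have Es : EI P setT s = inf A.
 apply: (cvg_unique _ (cs _ (csubT cG))) => //; apply: cvg_Ultra.
 apply/cvgnP => e e0; have [N Ne] := mesh_small e0; exists N => n Nn.
 have [_ le lt] := tauP n; have := @mesh_le R _ _ Nn.
 have : inf A <= EI P setT (X n) by apply: ge_inf; [exact: hA.2|exists (τ n)].
 rewrite ltr_distlC => ? ?; apply/andP; split; rewrite /X; lra.
exists s; split => //.
- move=> tau' B sta' le' GB; have mB := csubm cG GB.
 have := EI_split measurableT mB is_; rewrite !setTI Es => E1.
 (* As [s] has total mean [inf A], a bound from below off [B] is a bound from above on [B]. It comes
    from the competitor that follows [tau'] on [B] and the minimising sequence off [B]. *)
 have : inf A - EI P B (fun w => U (tau' w) w) <= EI P (~` B) s.
  have cB := cs _ (csubC cG GB).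
  apply: (cvgr_to_ge cB); apply: filterE => n.
  have [_ len _] := tauP n.
  have sp := st_paste T0 UG sth sta' (sta n) le' len GB.
  have Ain : A (EI P setT (fun w => U (if w \in B then tau' w else τ n w) w)).
   by exists (fun w => if w \in B then tau' w else τ n w); split => // w; case: ifP.
  have := ge_inf hA.2 Ain.
  rewrite (EI_split measurableT mB (raw_st rU sp)) !setTI.
  rewrite (@eq_EI _ _ _ P B _ (fun w => U (tau' w) w)); last by move=> w Bw; rewrite mem_set.
  rewrite (@eq_EI _ _ _ P (~` B) _ (X n)); last by move=> w Bw; rewrite memNset.
  lra.
 move: E1; lra.
- move=> e e0; have [n ne] := mesh_small e0; exists (τ n).
 by have [? ? lt] := tauP n; split => //; rewrite Es; lra.
Qed.

Lemma max_stup_cvg (f : R -> R) θ τ w : (forall t, 0 <= t < T -> f r @[r --> t^'+] --> f t) ->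
 st θ -> θ w <= τ w ->
 f (maxr (τ w) (stup T n θ w)) @[n --> \oo] --> f (τ w).
Proof.
move=> rf sth; rewrite le_eqVlt => /predU1P[<-|lt].
 rewrite (_ : (fun n => _) = (fun n => f (stup T n θ w))).
  by apply: (stup_cvg sth) => ?; apply: rf; apply/andP; split; have /andP[] := sth.1 w.
 apply/funext => n; rewrite max_r//; exact: le_stup sth.
apply/cvgnP => e e0; have [N Ne] := @mesh_small R (τ w - θ w) ltac:(lra).
exists N => n Nn; rewrite max_l ?subrr ?normr0//.
rewrite ge_min; apply/orP; right.
have /andP[th0 _] := sth.1 w; have := up_le n th0; have := @mesh_le R _ _ Nn; lra.
Qed.

(** Replaces a competitor after [θ] by competitors after the dyadic times [stup T n θ], at a
    vanishing cost. *)
Lemma max_stup_EI U Xi θ τ B : raw U Xi -> st θ -> st τ ->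
 (forall w, θ w <= τ w) -> measurable B ->
 EI P B (fun w => U (maxr (τ w) (stup T n θ w)) w) @[n --> \oo] -->
 EI P B (fun w => U (τ w) w).
Proof.
move=> rU sth sta le mB; have [cU mU iXi UXi] := rU.
have sm n := st_max UG sta (st_stup T0 UG n sth).
have [] // := @EI_dominated _ _ _ P (fun w => U (τ w) w)
 (fun n w => U (maxr (τ w) (stup T n θ w)) w) Xi B mB.
- move=> n; exact: L1_meas (raw_st rU (sm n)).
- exact: L1_meas (raw_st rU sta).
- move=> n; apply: aeW => w; apply: UXi; exact: (sm n).1.
- apply: aeW => w; apply: (@max_stup_cvg (U ^~ w)) => //; exact: (cU w).1.
Qed.

Lemma EI_discrete (X : Ω -> R) (sg : Ω -> R) (l : seq R) B :
 L1 P X -> mfunT sg -> measurable B -> uniq l ->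
 EI P (B `&` [set w | sg w \in l]) X =
 \sum_(q <- l) EI P (B `&` [set w | sg w = q]) X.
Proof.
move=> iX msg mB.
have mq q : measurable (B `&` [set w | sg w = q]) by meas.
have ml (l' : seq R) : measurable (B `&` [set w | sg w \in l']).
 elim: l' => [|q l' IH].
  by rewrite (_ : _ `&` _ = set0)//; apply/seteqP; split => // w [].
 rewrite (_ : _ `&` _ = (B `&` [set w | sg w = q]) `|` (B `&` [set w | sg w \in l'])).
  meas.
 apply/seteqP; split=> w /=; rewrite inE.
  by move=> [Bw /predU1P[|]]; [left|right].
 by move=> [[Bw ->]|[Bw ->]]; rewrite ?eqxx ?orbT.
elim: l => [_|q l IH  /andP[ql ul]].
 rewrite big_nil (_ : _ `&` _ = set0) ?EI_set0//.
 by apply/seteqP; split => // w [].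
rewrite big_cons -IH// -EI_setU//.
 congr EI; apply/seteqP; split=> w /=; rewrite inE.
  by move=> [Bw /predU1P[|]]; [left|right].
 by move=> [[Bw ->]|[Bw ->]]; rewrite ?eqxx ?orbT.
by move=> w [_  swq] [_ /=]; rewrite swq (negbTE ql).
Qed.

Lemma stup_grid n θ w : stup T n θ w \in gridl T n.
Proof. exact: gridl_up. Qed.

Lemma EI_stup n θ (X : Ω -> R) B : st θ -> L1 P X -> measurable B ->
 EI P B X = \sum_(q <- gridl T n) EI P (B `&` [set w | stup T n θ w = q]) X.
Proof.
move=> sth iX mB; rewrite -EI_discrete//.
- congr EI; apply/seteqP; split=> w; last by case.
 move=> Bw; split => //=; exact: stup_grid.
- exact: (st_meas T0 UG (st_stup T0 UG n sth)).
- exact: (sorted_uniq lt_trans ltxx (gridl_sorted T n)).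
Qed.

Section envelope_process.
Context (U : R -> Ω -> R) (Xi : Ω -> R)
 (rU : raw U Xi)
 (S : R -> Ω -> R)
 (adS : adapted T G S)
 (cS : forall w, cadlag T (S ^~ w))
 (envS : forall t, 0 <= t <= T -> is_env U (cst t) (S t)).

(** A dyadic time has finitely many values [q], and on each event [sg = q] it is a constant time. A
    nearly optimal time is assembled from one chosen for every [q], the error being shared among the
    grid points. *)
Lemma env_stup n θ : st θ ->
 is_env U (stup T n θ) (fun w => S (stup T n θ w) w).
Proof.
move=> sth; set sg := stup T n θ; have ssg : st sg by exact: (st_stup T0 UG).
have cG := Gat_csub T0 UG ssg.
have HS : smeas (Gat sg) (fun w => S (sg w) w).
 exact: (eval_sm T0 UG).
have sgq q w : sg w = q -> 0 <= q <= T by move=> <-; exact: ssg.1.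
have msg := st_meas T0 UG ssg.
have mq q : measurable [set w | sg w = q] by meas.
have Gq q B : 0 <= q <= T -> Gat sg B -> sigma_at T G (cst q) (B `&` [set w | sg w = q]).
 move=> qT GB; rewrite (Gat_cst UG qT); exact: (Gat_at UG).
have iS : L1 P (fun w => S (sg w) w).
 have gq q : q \in gridl T n -> 0 <= q <= T by exact: gridl_in.
 have iM : L1 P (fun w => \sum_(q <- gridl T n) `|S q w|).
  rewrite /L1 (_ : EFin \o _ = fun w => (\sum_(q <- gridl T n | q \in gridl T n) (`|S q w|)%:E)%E).
   apply: integrable_sum => // q ql.
   by have [_ i _ _] := envS (gq q ql); exact: L1norm.
  by apply/funext => w /=; rewrite -big_seq sumEFin.
 apply: le_L1 iM; first meas.
 move=> w; have := stup_grid n θ w; rewrite -/sg => sl.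
 by rewrite (big_rem _ sl) lerDl sumr_ge0.
split => //.
- move=> τ B sta le GB; have mB := csubm cG GB.
 rewrite (EI_stup n sth iS mB) (EI_stup n sth (raw_st rU sta) mB).
 rewrite !big_seq; apply: ler_sum => q /(gridl_in T0) qT.
 have GBq := Gq q B qT GB.
 have sm := st_max UG sta (st_cst UG qT).
 rewrite (@eq_EI _ _ _ P _ _ (S q)); last by move=> w [_ <-].
 rewrite [leRHS](@eq_EI _ _ _ P _ _ (fun w => U (maxr (τ w) q) w)); last first.
  by move=> w [_  <-]; rewrite max_l//; exact: le.
 have [_ _ lb _] := envS qT; apply: (lb (fun w => maxr (τ w) q)) => //.
 by move=> w; rewrite le_max lexx orbT.
- move=> e e0.
 pose N : R := (size (gridl T n)).+1%:R.
 have eN : 0 < e / N by rewrite divr_gt0.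
 have ex q : exists τ, 0 <= q <= T -> [/\ st τ, forall w, q <= τ w &
   EI P [set w | sg w = q] (fun w => U (τ w) w) <= EI P [set w | sg w = q] (S q) + e / N].
  have [qT|qT] := pselect (0 <= q <= T); last by exists (cst 0) => /qT.
  have := Gq q setT qT (csubT cG); rewrite setTI => Gsq.
  by have [τ [? ? ? _]] := env_attain rU (st_cst UG qT) (envS qT) Gsq eN; exists τ.
 have /choice[tq tqP] := ex.
 pose τ w := tq (sg w) w.
 have sgle w : sg w <= τ w by have [_ + _] := tqP _ (ssg.1 w); apply.
 have sta : st τ.
  split=> [w|t tT]; first by have [+ _ _] := tqP _ (ssg.1 w); move=> s; exact: s.1.
  have cGt := G_csub UG tT.
  (* The condition [q <= t] is free, since the assembled time is never before [sg]; it places the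
     event [sg = q] in [G t]. *)
  rewrite (_ : mkset _ = \big[setU/set0]_(q <- gridl T n)
   ([set w | sg w = q] `&` [set w | tq q w <= t /\ 0 <= q <= t])); last first.
   apply/seteqP; split=> w /=; rewrite -bigcup_seq; last first.
    by move=> [q  ql [ sq [tqt _]]]; rewrite /τ sq.
   move=> tt; exists (sg w); first by rewrite /= stup_grid.
   split; split => //; have /andP[-> _] := ssg.1 w.
   exact: le_trans (sgle w) tt.
  apply: (csub_bigsetU _ _ cGt) => q.
  have [qt|qt] := pselect (0 <= q <= t); last first.
   rewrite (_ : _ `&` _ = set0); first exact: csub_set0 cGt.
   by apply/seteqP; split => // w [_ [_ /qt]].
  have /andP[q0 qt'] := qt; have /andP[? ?] := tT.
  have qT : 0 <= q <= T by lra.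
  have [stq _ _] := tqP q qT.
  rewrite (_ : [set w | _ /\ _] = [set w | tq q w <= t]); last first.
   by apply/seteqP; split=> w /=; tauto.
  apply: (csubI cGt); last exact: (st_le stq tT).
  apply: (G_mono UG q0 qt') => //.
  by have := Gat_at UG ssg (csubT cG) qT; rewrite setTI.
 exists τ; split => //.
 rewrite (EI_stup n sth (raw_st rU sta) measurableT) (EI_stup n sth iS measurableT).
 have sN : \sum_(q <- gridl T n) (e / N) <= e.
  rewrite big_const_seq iter_addr_0 count_predT -mulr_natr -mulrA.
  rewrite ger_pMr// mulrC ler_pdivrMr// mul1r ler_nat; by [].
 apply: (@le_trans _ _ (\sum_(q <- gridl T n) (EI P ([set: Ω] `&` [set w | sg w = q]) (fun w => S (sg w) w) + e / N))); last first.
  by rewrite big_split lerD2l.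
 rewrite !big_seq; apply: ler_sum => q /(gridl_in T0) qT; rewrite !setTI.
 rewrite (@eq_EI _ _ _ P _ _ (fun w => U (tq q w) w)); last by move=> w  sq; rewrite /τ sq.
 rewrite [X in _ <= X + _](@eq_EI _ _ _ P _ _ (S q)); last by move=> w  <-.
 by have [] := tqP q qT.
Qed.

(** Limit of the dyadic case: Vitali convergence for [S], dominated convergence for the
    competitors. *)
Lemma env_stopping θ : st θ -> is_env U θ (fun w => S (θ w) w).
Proof.
move=> sth; have [cU mU iXi UXi] := rU; have cG := Gat_csub T0 UG sth.
have HS : smeas (Gat θ) (fun w => S (θ w) w) by exact: (eval_sm T0 UG).
have cae : \forall w \ae P, S (stup T n θ w) w @[n --> \oo] --> S (θ w) w.
 apply: aeW => w; apply: (stup_cvg (f := S ^~ w) sth) => lt.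
 by apply: (cS w).1; rewrite lt andbT; have /andP[] := sth.1 w.
have V B mB := @vitali_EI _ _ _ P Xi (fun n w => S (stup T n θ w) w)
 (fun w => S (θ w) w) B iXi mB
 (fun n => env_uidom rU (st_stup T0 UG n sth) (env_stup n sth))
 (sm_meas cG HS) cae.
have [iS cT] := V _ measurableT.
split => //.
- move=> τ B sta le GB; have mB := csubm cG GB.
 have [_ cB] := V B mB.
 have cU' := max_stup_EI rU sth sta le mB.
 have ssn n := st_stup T0 UG n sth.
 have H n : EI P B (fun w => S (stup T n θ w) w) <=
   EI P B (fun w => U (maxr (τ w) (stup T n θ w)) w).
  have [_ _ lb _] := env_stup n sth; apply: (lb (fun w => maxr (τ w) (stup T n θ w))).
  + exact: (st_max UG).
  + by move=> w; rewrite le_max lexx orbT.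
  + apply: (Gat_mono UG sth (ssn n)) => // w; exact: le_stup sth.
 rewrite -(cvg_lim _ cB)// -(cvg_lim _ cU')//; apply: ler_lim.
 + apply/cvg_ex; eexists; exact: cB.
 + apply/cvg_ex; eexists; exact: cU'.
 + exact: nearW.
- move=> e e0; have [N NP] := (cvgnP _ _).1 cT (e / 2) (hgt0 e0).
 have [_ _ _ att] := env_stup N sth; have [τ [sta le H]] := att _ (hgt0 e0).
 exists τ; split => //; first by move=> w; apply: le_trans (le w); exact: le_stup sth.
 have := NP N (leqnn N); rewrite ltr_distlC => /andP[_]; move: H; lra.
Qed.

End envelope_process.

(** The regularisation requires right-continuous means. They are, because a nearly optimal time for
    [t] can be postponed to [up n t] at little cost, [U] being right-continuous. *)
Theorem envelope U Xi : raw U Xi -> exists S, [/\ adapted T G S,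
 forall w, cadlag T (S ^~ w)
 & forall θ, st θ -> is_env U θ (fun w => S (θ w) w)].
Proof.
move=> rU; have [cU mU iXi UXi] := rU.
have ex t : exists s, 0 <= t <= T -> is_env U (cst t) s.
 have [tT|tT] := pselect (0 <= t <= T); last by exists (cst 0) => /tT.
 by have [s es] := env_exists rU (st_cst UG tT); exists s.
have /choice[s sP] := ex.
have upT t n : 0 <= t < T -> t <= minr T (up n t) <= T.
 move=> /andP[_ /ltW tT]; rewrite le_min ge_min lexx andbT tT/=.
 exact/ltW/lt_up.
have [|||||S [aS cS Ss]] := @regularisation _ _ _ P T G T0 UG s Xi _ _ _ iXi _ _.
- by move=> t tT; have [] := sP t tT; rewrite (Gat_cst UG tT).
- by move=> t tT; have [] := sP t tT.
- move=> t u B t0 tu uT GB.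
 have tT : 0 <= t <= T by lra.
 have uT' : 0 <= u <= T by lra.
 apply: (env_sub rU (st_cst UG tT) (st_cst UG uT')) => //; [exact: sP|exact: sP|].
 by rewrite (Gat_cst UG tT).
- move=> t B tT GB; apply: (env_dom rU (st_cst UG tT) (sP t tT)).
 by rewrite (Gat_cst UG tT).
- move=> t tT.
 have tT' : 0 <= t <= T by lra.
 have stt := st_cst UG tT'.
 have u01 n : 0 <= minr T (up n t) <= T.
  by have /andP[? ->] := upT t n tT; rewrite andbT; lra.
 have le n : EI P setT (s t) <= EI P setT (s (minr T (up n t))).
  apply: (env_sub rU stt (st_cst UG (u01 n)) _ (sP _ tT') (sP _ (u01 n))).
   by move=> w; have /andP[] := upT t n tT.
  exact: csubT (Gat_csub T0 UG stt).
 apply/cvgnP => e e0.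
 have [_ _ _ att] := sP t tT'; have [τ [sta let' Htau]] := att _ (hgt0 e0).
 have /cvgnP/(_ _ (hgt0 e0))[N NP] := max_stup_EI rU stt sta let' measurableT.
 exists N => n Nn; rewrite distrC ger0_norm ?subr_ge0//.
 have [_ _ lb _] := sP _ (u01 n).
 have := lb (fun w => maxr (τ w) (stup T n (cst t) w)) setT
  (st_max UG sta (st_stup T0 UG n stt))
  (fun w => ltac:(by rewrite le_max lexx orbT))
  (csubT (Gat_csub T0 UG (st_cst UG (u01 n)))).
 have := NP n Nn; rewrite ltr_distlC => /andP[_]; move: Htau; lra.
exists S; split => // θ sth.
apply: (env_stopping rU) => // t tT; have [Hs is_ lb att] := sP t tT.
have cGt := Gat_csub T0 UG (st_cst UG tT).
have HS : smeas (Gat (cst t)) (S t).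
 rewrite (Gat_cst UG tT); meas.
have iS : L1 P (S t).
 apply/integrableP; split; first meas.
 case/integrableP : is_ => ms; apply: le_lt_trans.
 rewrite le_eqVlt; apply/orP; left; apply/eqP; apply: ae_eq_integral => //.
 - apply: mcomp; meas.
 - exact: mcomp.
 - by apply: filterS (Ss t tT) => w /= ->.
have E B : measurable B -> EI P B (S t) = EI P B (s t).
 by move=> mB; apply: EI_aeq => //; apply: filterS (Ss t tT).
split => //.
- by move=> τ B sta le GB; rewrite E; [exact: lb|exact: csubm cGt GB].
- move=> e e0; rewrite E//; exact: att.
Qed.

(* The envelope of a raw process with non-decreasing paths is its optional
  projection. *)
Lemma env_proj U Xi θ s B : raw U Xi -> st θ ->
 (forall w t u, 0 <= t -> t <= u -> u <= T -> U t w <= U u w) ->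
 is_env U θ s -> Gat θ B -> EI P B s = EI P B (fun w => U (θ w) w).
Proof.
move=> rU sth inc es GB; have [Hs is_ lb att] := es.
have mB := csubm (Gat_csub T0 UG sth) GB.
apply/eqP; rewrite eq_le lb//=; apply/ler_addgt0Pr => e e0.
have [τ [sta le H _]] := env_attain rU sth es GB e0.
apply: le_trans H; apply: EI_le => //; [exact: raw_st rU sth|exact: raw_st rU sta|].
move=> w _; have /andP[? _] := sth.1 w; have /andP[_ ?] := sta.1 w.
exact: inc.
Qed.

End envelope.

(** * Finite sums of integrable variables *)

Section sums.
Context {R : realType} {d : measure_display} {Ω : measurableType d}
 (P : probability Ω R).
Implicit Types (X : nat -> Ω -> R) (B : set Ω).

Lemma L1_sum X n : (forall k, L1 P (X k)) -> L1 P (fun w => \sum_(k < n) X k w).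
Proof.
move=> iX; elim: n => [|n IH].
 under eq_fun do rewrite big_ord0; exact: L1cst.
under eq_fun do rewrite big_ord_recr; exact: L1D.
Qed.

Lemma EI_sum X n B : measurable B -> (forall k, L1 P (X k)) ->
 EI P B (fun w => \sum_(k < n) X k w) = \sum_(k < n) EI P B (X k).
Proof.
move=> mB iX; elim: n => [|n IH].
 rewrite big_ord0 (@eq_EI _ _ _ P _ _ (cst 0)); first by rewrite EIcst// mul0r.
 by move=> w _; rewrite big_ord0.
rewrite big_ord_recr/= -IH -EID//; last exact: L1_sum.
by apply: eq_EI => w _; rewrite big_ord_recr.
Qed.

Lemma sm_sum H X n : csub P H -> (forall k, (k < n)%N -> smeas H (X k)) ->
 smeas H (fun w => \sum_(k < n) X k w).
Proof.
move=> cH; elim: n => [|n IH] HX.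
 under eq_fun do rewrite big_ord0; exact: (smcst cH).
under eq_fun do rewrite big_ord_recr/=; apply: (smD cH).
 apply: IH => k kn; apply: HX; exact: ltnW.
exact: HX.
Qed.

End sums.

(** * Integrals against weights with values in [0, 1] *)

Section duality.
Context {R : realType} {d : measure_display} {Ω : measurableType d}
 (P : probability Ω R).
Implicit Types (X Y φ : Ω -> R) (B C : set Ω) (H : set (set Ω)).

Lemma sum_ltn (k m : nat) : (\sum_(j < m) (j < k))%N = minn m k.
Proof.
elim: m => [|m IH]; first by rewrite big_ord0 min0n.
rewrite big_ord_recr/= IH; case: ltnP => mk.
 by rewrite addn1 (minn_idPl mk).
by rewrite addn0 (minn_idPr _)// leqW.
Qed.

(** An average of indicators of upper level sets of [φ], within [1 / m] of [φ] by [stairP]: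
    statements about events extend to weights. *)
Definition stair m φ (w : Ω) : R :=
 \sum_(j < m) m%:R^-1 * \1_[set v | j.+1%:R / m%:R <= φ v] w.

Lemma stairP m φ w : (0 < m)%N -> 0 <= φ w <= 1 ->
 stair m φ w <= φ w <= stair m φ w + m%:R^-1.
Proof.
move=> m0 /andP[p0 p1]; have m0' : 0 < m%:R :> R by rewrite ltr0n.
have -> : stair m φ w = (Num.trunc (φ w * m%:R))%:R / m%:R.
 rewrite /stair -mulr_sumr mulrC; congr (_ * _).
 have tm : (Num.trunc (φ w * m%:R) <= m)%N.
  by rewrite truncn_le_nat -natr1 (le_lt_trans (_ : _ <= m%:R)) ?ltrDl// ler_piMl.
 rewrite -[in RHS](minn_idPr tm) -sum_ltn natr_sum; apply: eq_bigr => j _.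
 rewrite indicE; congr (nat_of_bool _)%:R.
 rewrite truncn_gt_nat -ler_pdivrMr//.
 by apply/idP/idP; rewrite inE.
have /andP[h1 h2] := truncn_itv (mulr_ge0 p0 (ltW m0')).
rewrite ler_pdivrMr// h1/= -{2}[m%:R^-1]mul1r -mulrDl ler_pdivlMr//.
lra.
Qed.

Lemma EI_stair m φ X : mfunT φ -> L1 P X ->
 EI P setT (fun w => stair m φ w * X w) =
 \sum_(j < m) m%:R^-1 * EI P [set v | j.+1%:R / m%:R <= φ v] X.
Proof.
move=> mphi iX.
have mL (j : nat) : measurable [set v | j.+1%:R / m%:R <= φ v] by meas.
rewrite (@eq_EI _ _ _ P _ _ (fun w => \sum_(j < m)
  m%:R^-1 * (\1_[set v | j.+1%:R / m%:R <= φ v] w * X w))); last first.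
 by move=> w _; rewrite mulr_suml; apply: eq_bigr => j _; rewrite mulrA.
have iY (j : nat) : L1 P (fun w => m%:R^-1 * (\1_[set v | j.+1%:R / m%:R <= φ v] w * X w)) by meas.
rewrite (EI_sum (X := fun j w => m%:R^-1 * (\1_[set v | j.+1%:R / m%:R <= φ v] w * X w)))//.
apply: eq_bigr => j _; rewrite EIZ//; last meas.
by rewrite EI_indic// setTI.
Qed.

Lemma L1_mul φ X : mfunT φ -> (forall w, 0 <= φ w <= 1) ->
 L1 P X -> L1 P (fun w => φ w * X w).
Proof.
move=> mphi p01 iX; apply: le_L1 (L1norm iX).
 meas.
move=> w; have /andP[p0 p1] := p01 w.
by rewrite normrM ler_piMl// ger0_norm.
Qed.

Lemma stair_err m φ X : (0 < m)%N -> mfunT φ ->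
 (forall w, 0 <= φ w <= 1) -> L1 P X ->
 `|EI P setT (fun w => φ w * X w) - EI P setT (fun w => stair m φ w * X w)|
 <= m%:R^-1 * EI P setT (fun w => `|X w|).
Proof.
move=> m0 mphi p01 iX.
have mL (j : nat) : measurable [set v | j.+1%:R / m%:R <= φ v] by meas.
have iS : L1 P (fun w => stair m φ w * X w).
 rewrite (_ : (fun w => _) = (fun w => \sum_(j < m)
   m%:R^-1 * (\1_[set v | j.+1%:R / m%:R <= φ v] w * X w))); last first.
  by apply/funext => w; rewrite mulr_suml; apply: eq_bigr => j _; rewrite mulrA.
 apply: (L1_sum (X := fun j w => m%:R^-1 * (\1_[set v | j.+1%:R / m%:R <= φ v] w * X w))).
 meas.
have iP := L1_mul mphi p01 iX.
rewrite -EIB//; apply: le_trans (EI_abs measurableT _) _; first meas.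
rewrite -EIZ//; last meas.
apply: EI_le => //; [by apply/L1norm/L1B|by apply/L1Z/L1norm|].
move=> w _; rewrite -mulrBl normrM ler_wpM2r//.
have /andP[h1 h2] := stairP m0 (p01 w).
rewrite ger0_norm; lra.
Qed.

(** The error of [stair] is uniform along the sequence because the mean absolute values are bounded
    by [C]; it can therefore be exchanged with the limit. *)
Lemma weak_dual H (X : nat -> Ω -> R) Y φ (C : R) : csub P H ->
 (forall n, L1 P (X n)) -> L1 P Y -> (forall n, EI P setT (fun w => `|X n w|) <= C) ->
 (forall B, H B -> EI P B (X n) @[n --> Ultra] --> EI P B Y) ->
 smeas H φ -> (forall w, 0 <= φ w <= 1) ->
 EI P setT (fun w => φ w * X n w) @[n --> Ultra] --> EI P setT (fun w => φ w * Y w).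
Proof.
move=> cH iX iY XC cXY Hphi p01; have mphi := sm_meas cH Hphi.
have cS m : EI P setT (fun w => stair m φ w * X n w) @[n --> Ultra] -->
  EI P setT (fun w => stair m φ w * Y w).
 rewrite EI_stair//; under eq_fun do rewrite EI_stair//.
 suff S (k : nat) : \sum_(j < k) m%:R^-1 * EI P [set v | j.+1%:R / m%:R <= φ v] (X n)
   @[n --> Ultra] --> \sum_(j < k) m%:R^-1 * EI P [set v | j.+1%:R / m%:R <= φ v] Y.
  exact: S.
 elim: k => [|k IH].
  rewrite big_ord0; under eq_fun do rewrite big_ord0; exact: cvg_cst.
 rewrite big_ord_recr/=; under eq_fun do rewrite big_ord_recr/=.
 apply: cvgD IH _; apply: cvgMr; apply: cXY.
 apply: (csub_le cH) => //; exact: smcst cH.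
apply/cvgrPdist_lt => e e0.
pose K := C + EI P setT (fun w => `|Y w|).
have [m m0 mK] : exists2 m : nat, (0 < m)%N & m%:R^-1 * K < e / 2.
 exists (Num.trunc (K / (e / 2))).+1 => //.
 by rewrite mulrC ltr_pdivrMr ?ltr0n// -ltr_pdivrMl ?hgt0// mulrC truncnS_gt.
have /cvgrPdist_lt/(_ _ (hgt0 e0)) := cS m; apply: filterS => n nlt.
have := stair_err m0 mphi p01 (iX n); have := stair_err m0 mphi p01 iY.
have : m%:R^-1 * EI P setT (fun w => `|X n w|) <= m%:R^-1 * C.
 by rewrite ler_wpM2l.
move: mK nlt; rewrite mulrDr !ltr_distlC !ler_distl.
lra.
Qed.

Lemma EI_dual H X Y φ : csub P H -> L1 P X -> L1 P Y ->
 (forall B, H B -> EI P B X = EI P B Y) ->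
 smeas H φ -> (forall w, 0 <= φ w <= 1) ->
 EI P setT (fun w => φ w * X w) = EI P setT (fun w => φ w * Y w).
Proof.
move=> cH iX iY XY Hphi p01.
have XYc B : H B -> EI P B X @[_ --> Ultra] --> EI P B Y.
 move=> HB; rewrite (XY _ HB); exact: cvg_cst.
have := weak_dual cH (fun=> iX) iY (fun=> lexx _) XYc Hphi p01.
move=> /cvg_lim <-//; apply/esym/cvg_lim => //; exact: cvg_cst.
Qed.

(** Here [φ] is the conditional probability of [C]. For [Y] chopped at [k] this is [EI_dual] with
    the weight [psi], an affine image of it in [0, 1]; the chopping disappears by dominated
    convergence. *)
Lemma EI_pullout H C φ Y : csub P H -> measurable C ->
 smeas H φ -> (forall w, 0 <= φ w <= 1) ->
 (forall B, H B -> EI P B φ = EI P B \1_C) ->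
 smeas H Y -> L1 P Y ->
 EI P C Y = EI P setT (fun w => φ w * Y w).
Proof.
move=> cH mC Hphi p01 phiC HY iY; have mphi := sm_meas cH Hphi.
have iphi : L1 P φ.
 by apply: (L1bound P mphi (c := 1)) => w; have /andP[? ?] := p01 w; rewrite ger0_norm.
have iC : L1 P (\1_C : Ω -> R) by exact: integrable_indic.
have ck k : 0 < k -> EI P C (fun w => chop k (Y w)) = EI P setT (fun w => φ w * chop k (Y w)).
 move=> k0; pose psi w := (chop k (Y w) + k) / (k + k).
 have Hchop : smeas H (fun w => chop k (Y w)).
  apply/(smE _ cH); apply: measurable_maxr => //.
  by apply: measurable_minr; [exact: mcst|exact/(smE _ cH)].
 have Hpsi : smeas H psi.
  apply: (smM cH); [apply: (smD cH) => //; exact: (smcst cH)|exact: (smcst cH)].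
 have kk : 0 < k + k by lra.
 have bchop w : - k <= chop k (Y w) <= k.
  rewrite le_max ge_max ge_min; apply/andP; split; lra.
 have psi01 w : 0 <= psi w <= 1.
  have /andP[? ?] := bchop w.
  by rewrite divr_ge0 ?ler_pdivrMr//=; [lra|lra|exact: ltW].
 have := @EI_dual H φ \1_C psi cH iphi iC phiC Hpsi psi01.
 have ich : L1 P (fun w => chop k (Y w)).
  by apply: (L1bound P (sm_meas cH Hchop) (c := k)) => w; rewrite ler_norml.
 have E X : L1 P X -> (forall w, 0 <= X w <= 1) ->
   EI P setT (fun w => psi w * X w) = (k + k)^-1 * (EI P setT (fun w => X w * chop k (Y w)) + k * EI P setT X).
  move=> iX X01; have mX := L1_meas iX.
  have i1 := L1_mul mX X01 ich.
  rewrite -EIZ// -EID//; last meas.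
  rewrite -EIZ//; last meas.
  apply: eq_EI => w _; rewrite /psi; ring.
 have ind01 w : 0 <= (\1_C w : R) <= 1 by rewrite indicE; case: (_ \in _); rewrite ?lexx ler01.
 rewrite !E// => /(mulfI (invr_neq0 (lt0r_neq0 kk))).
 have := phiC _ (csubT cH) => ->; move/addIr => ->.
 by rewrite (EI_indic _ _ measurableT mC) setTI.
have cchop A (psi : Ω -> R) : measurable A -> mfunT psi -> (forall w, 0 <= psi w <= 1) ->
  EI P A (fun w => psi w * chop n.+1%:R (Y w)) @[n --> \oo] --> EI P A (fun w => psi w * Y w).
 move=> mA mpsi psi01.
 have [] // := @EI_dominated _ _ _ P (fun w => psi w * Y w)
   (fun n w => psi w * chop n.+1%:R (Y w)) (fun w => `|Y w|) A mA.
 - move=> n; apply: mfunM => //.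
  apply: measurable_maxr => //.
  meas.
 - meas.
 - meas.
 - move=> n; apply: aeW => w; have /andP[? ?] := psi01 w.
  rewrite normrM ger0_norm//; apply: (@le_trans _ _ `|chop n.+1%:R (Y w)|).
   by rewrite ler_piMl.
  have n0 : 0 <= n.+1%:R :> R by [].
  have := ler_norm (Y w); have := ler_norm (- Y w); rewrite normrN => ? ?.
  have := normr_ge0 (Y w) => ?.
  rewrite ler_norml le_max ge_max le_min ge_min.
  lra.
 - apply: aeW => w; apply: cvgMr; apply/cvgnP => e e0.
  exists (Num.trunc `|Y w|).+1 => n Nn.
  have : `|Y w| <= n.+1%:R.
   by apply: ltW; apply: lt_le_trans (truncnS_gt _) _; rewrite ler_nat leqW.
  rewrite ler_norml => /andP[? ?]; rewrite /chop min_r// max_r//.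
  by rewrite subrr normr0.
have c1 := cchop setT φ measurableT mphi p01.
have c2 := cchop C (cst 1) mC (@measurable_cst _ _ _ _ _ _) (fun w => ltac:(by rewrite ler01 lexx)).
rewrite (@eq_EI _ _ _ P C Y (fun w => cst 1 w * Y w)); last by move=> w _; rewrite mul1r.
apply: (cvg_unique _ c2) => //; rewrite (_ : (fun n => _) = (fun n : nat =>
  EI P setT (fun w => φ w * chop n.+1%:R (Y w))))//.
apply/funext => n; rewrite -ck ?ltr0n//.
by apply: eq_EI => w _; rewrite mul1r.
Qed.

(** Clipping gives a version that lies in [0, 1] everywhere, as required of weights. *)
Lemma clipped_ce H C : csub P H -> measurable C -> exists φ,
 [/\ smeas H φ, forall w, 0 <= φ w <= 1
  & forall B, H B -> EI P B φ = EI P B \1_C].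
Proof.
move=> cH mC; have iC : L1 P (\1_C : Ω -> R) by exact: integrable_indic.
pose y := ce P H \1_C.
have Hy := ce_sm cH iC; have iy := ce_L1 cH iC.
pose φ w := maxr 0 (minr 1 (y w)).
have y0 : \forall w \ae P, 0 <= y w by apply: ce_ge0 => // w; rewrite indicE.
have y1 : \forall w \ae P, y w <= 1.
 apply: (sm_ae_le cH) => //; [exact: smcst cH|exact: L1cst|].
 move=> A HA; rewrite EI_ce//; have mA := csubm cH HA.
 apply: (EI_le mA iC (L1cst P 1)) => w _.
 by [].
have Hphi : smeas H φ.
 apply/(smE _ cH); apply: measurable_maxr => //.
 by apply: measurable_minr; [exact: mcst|exact/(smE _ cH)].
have p01 w : 0 <= φ w <= 1.
 by rewrite le_max lexx ge_max ge_min lexx ler01.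
exists φ; split => // B HB; rewrite -(EI_ce cH iC HB).
have mB := csubm cH HB.
apply: EI_aeq => //.
 apply: (L1bound P (sm_meas cH Hphi) (c := 1)) => w.
 by have /andP[? ?] := p01 w; rewrite ger0_norm.
by apply: filterS2 y0 y1 => w ? ? _; rewrite /φ min_r// max_r.
Qed.

End duality.

(** * Doob-Meyer decomposition *)

Section doob_meyer.
Context {R : realType} {d : measure_display} {Ω : measurableType d}
 (P : probability Ω R) (T : R) (G : R -> set (set Ω))
 (T0 : 0 < T)
 (UG : usual_filtration P T G).
Implicit Types (S M A : R -> Ω -> R) (Xi X : Ω -> R) (θ τ : Ω -> R)
 (B C : set Ω) (t : R).
Notation st := (stopping_time T G).
Notation Gat := (sigma_at T G).

(* Cadlag martingales closed by a terminal variable. *)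
Definition cmart M X := [/\ adapted T G M, forall w, cadlag T (M ^~ w), L1 P X,
 forall θ, st θ -> L1 P (fun w => M (θ w) w)
 & forall θ B, st θ -> Gat θ B ->
   EI P B (fun w => M (θ w) w) = EI P B X].

Lemma raw_cst X : L1 P X -> raw P T (fun=> X) (fun w => `|X w|).
Proof.
move=> iX; split => //; last meas.
- by move=> w; split=> t tT; [exact: cvg_cst|exact: is_cvg_cst].
- meas.
Qed.

(** The martingale is the envelope of the process constantly equal to [X], for which all stopping
    times are equally good. *)
Lemma cmart_exists X : L1 P X -> exists M, cmart M X.
Proof.
move=> iX; have [M [aM cM eM]] := envelope T0 UG (raw_cst iX).
exists M; split => //.
 by move=> θ sth; have [_ i _ _] := eM _ sth.
move=> θ B sth GB.
by apply: (env_proj T0 UG (raw_cst iX) sth _ (eM _ sth) GB).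
Qed.

Definition dsub S Xi := [/\ adapted T G S, forall w, cadlag T (S ^~ w), L1 P Xi &
 [/\ forall θ, st θ -> L1 P (fun w => S (θ w) w),
  forall θ B, st θ -> Gat θ B ->
   EI P B (fun w => `|S (θ w) w|) <= EI P B Xi
 & forall θ τ B, st θ -> st τ -> (forall w, θ w <= τ w) ->
   Gat θ B -> EI P B (fun w => S (θ w) w) <= EI P B (fun w => S (τ w) w)]].

Lemma env_dsub U Xi S : raw P T U Xi -> adapted T G S -> (forall w, cadlag T (S ^~ w)) ->
 (forall θ, st θ -> is_env P T G U θ (fun w => S (θ w) w)) -> dsub S Xi.
Proof.
move=> rU aS cS eS; have [_ _ iXi _] := rU; split => //; split.
- by move=> θ sth; have [_ i _ _] := eS _ sth.
- by move=> θ B sth; apply: (env_dom T0 UG rU sth (eS _ sth)).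
- move=> θ τ B sth sta le; apply: (env_sub T0 UG rU sth sta le); exact: eS.
Qed.

Section decomposition.
Context (S : R -> Ω -> R) (Xi : Ω -> R)
 (dS : dsub S Xi).

Let aS : adapted T G S. Proof. by have [] := dS. Qed.
Let cS w : cadlag T (S ^~ w). Proof. by have [_ +] := dS; move=> /(_ w). Qed.
Let iXi : L1 P Xi. Proof. by have [] := dS. Qed.
Let iS t : 0 <= t <= T -> L1 P (S t).
Proof. by move=> tT; have [_ _ _ [+ _ _]] := dS => /(_ _ (st_cst UG tT)). Qed.
Let sdom t B : 0 <= t <= T -> G t B -> EI P B (fun w => `|S t w|) <= EI P B Xi.
Proof.
by move=> tT GB; have [_ _ _ [_ + _]] := dS => /(_ (cst t) B (st_cst UG tT)); rewrite (Gat_cst UG tT); exact.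
Qed.
Let ssub s t B : 0 <= s -> s <= t -> t <= T -> G s B -> EI P B (S s) <= EI P B (S t).
Proof.
move=> s0 st tT GB; have sT : 0 <= s <= T by apply/andP; split; lra.
have tT' : 0 <= t <= T by lra.
have [_ _ _ [_ _ +]] := dS => /(_ (cst s) (cst t) B (st_cst UG sT) (st_cst UG tT')).
by rewrite (Gat_cst UG sT); exact.
Qed.
Let cG t : 0 <= t <= T -> csub P (G t). Proof. exact: G_csub. Qed.

Section fixed_mesh.
Variable n : nat.
Let g (k : nat) : R := minr T (k%:R * mesh n).
Let N := (Num.trunc (T * 2 ^+ n)).+1.

Let g_in k : 0 <= g k <= T.
Proof. by rewrite le_min ge_min lexx (ltW T0) mulr_ge0 ?mesh_ge0. Qed.
Let g_mono j k : (j <= k)%N -> g j <= g k.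
Proof.
by move=> jk; rewrite le_min !ge_min lexx; apply/orP; right; rewrite ler_wpM2r ?mesh_ge0 ?ler_nat.
Qed.
Let gN : g N = T.
Proof.
rewrite /g min_l// ler_pdivlMr ?exprn_gt0//; apply/ltW/truncnS_gt.
Qed.
Let gE t : t \in gridl T n -> exists2 j, (j <= N)%N & g j = t.
Proof.
move/(gridlP T0) => [->|[k -> kT]]; first by exists N; rewrite ?gN.
exists k; last by rewrite /g min_r// ltW.
rewrite leqNgt; apply/negP => Nk; have := g_mono (ltnW Nk); rewrite gN /g.
by rewrite (min_r (ltW kT)) leNgt kT.
Qed.

(** Increment of the discrete compensator. Clipping at 0 makes its sums monotone everywhere and
    changes nothing almost surely, by [ceD]. *)
Let D k w : R := maxr 0 (ce P (G (g k)) (fun w => S (g k.+1) w - S (g k) w) w).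
Let iI k : L1 P (fun w => S (g k.+1) w - S (g k) w).
Proof. meas. Qed.
Let D0 k w : 0 <= D k w. Proof. by rewrite le_max lexx. Qed.
Let HD k : smeas (G (g k)) (D k).
Proof.
have cH := cG (g_in k); apply/(smE _ cH); apply: measurable_maxr => //.
apply/(smE _ cH); exact: (ce_sm cH (iI k)).
Qed.
Let ceD k : \forall w \ae P, D k w = ce P (G (g k)) (fun w => S (g k.+1) w - S (g k) w) w.
Proof.
have cH := cG (g_in k).
have : \forall w \ae P, (cst 0 : Ω -> R) w <= ce P (G (g k)) (fun w => S (g k.+1) w - S (g k) w) w.
 apply: (sm_ae_le cH); [exact: smcst cH|exact: (ce_sm cH (iI k))|exact: L1cst|exact: (ce_L1 cH (iI k))|].
 move=> A HA; have mA := csubm cH HA.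
 rewrite (EI_ce cH (iI k) HA) EIcst// mul0r EIB//; [|exact: iS..].
 rewrite subr_ge0; have /andP[? _] := g_in k; have /andP[_ ?] := g_in k.+1.
 apply: ssub => //; exact: g_mono.
by apply: filterS => w ?; rewrite /D max_r.
Qed.
Let iD k : L1 P (D k).
Proof.
have cH := cG (g_in k); have ic := ce_L1 cH (iI k).
have mD : mfunT (D k) by meas.
refine (le_L1 mD _ (L1norm ic)) => w; rewrite ger0_norm ?D0// ge_max normr_ge0; exact: ler_norm.
Qed.
Let ED j k B : (j <= k)%N -> G (g j) B ->
 EI P B (D k) = EI P B (S (g k.+1)) - EI P B (S (g k)).
Proof.
move=> jk GB; have cH := cG (g_in k).
have GB' : G (g k) B.
 have /andP[? _] := g_in j; have /andP[_ ?] := g_in k.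
 apply: (G_mono UG _ _ _ GB) => //; exact: g_mono.
have mB := csubm cH GB'.
rewrite -EIB//; [|exact: iS..].
rewrite -(EI_ce cH (iI k) GB').
refine (EI_aeq mB (iD k) (ce_L1 cH (iI k)) _).
by apply: filterS (ceD k).
Qed.

Let A j w : R := \sum_(k < j) D k w.
Let iA j : L1 P (A j). Proof. exact: (L1_sum (X := D)). Qed.
Let A_ge0 j w : 0 <= A j w. Proof. by rewrite sumr_ge0. Qed.
Let A_mono i j w : (i <= j)%N -> A i w <= A j w.
Proof.
move=> ij; rewrite /A -(big_mkord xpredT (D ^~ w)) -(big_mkord xpredT (D ^~ w)).
by rewrite (@big_cat_nat _ _ _ i 0%N j)//= lerDl sumr_ge0.
Qed.
Let HAS j : smeas (G (g j)) (A j.+1).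
Proof.
have cH := cG (g_in j); apply: (sm_sum (P := P)) => // k kj.
have /andP[? _] := g_in k; have /andP[_ ?] := g_in j.
refine (sm_sub _ (@HD k)); apply: (G_mono UG) => //; exact: g_mono.
Qed.
Let HA j : smeas (G (g j)) (A j).
Proof.
case: j => [|j].
 have cH := cG (g_in 0).
 rewrite (_ : A 0 = cst 0); first exact: smcst cH.
 by apply/funext => w; rewrite /A big_ord0.
have /andP[? _] := g_in j; have /andP[_ ?] := g_in j.+1.
refine (sm_sub _ (@HAS j)); apply: (G_mono UG) => //; exact: g_mono.
Qed.

Let EA j B : (j <= N)%N -> G (g j) B ->
 EI P B (A N) - EI P B (A j) = EI P B (S T) - EI P B (S (g j)).
Proof.
move=> jN GB; have mB := csubm (cG (g_in j)) GB; rewrite -gN.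
rewrite -(subnKC jN); elim: (N - j)%N => [|m IH]; first by rewrite addn0 !subrr.
rewrite addnS (@eq_EI _ _ _ P _ (A (j + m).+1) (fun w => A (j + m) w + D (j + m) w)).
 rewrite (EID mB (iA _) (iD _)) (ED (leq_addr m j) GB); move: IH; lra.
by move=> w _; rewrite /A big_ord_recr.
Qed.

Let EAle j B : (j <= N)%N -> G (g j) B ->
 EI P B (A N) - EI P B (A j) <= 2 * EI P B Xi.
Proof.
move=> jN GB; rewrite EA//; have mB := csubm (cG (g_in j)) GB.
have GT : G T B.
 have /andP[? ?] := g_in j; apply: (G_mono UG _ _ _ GB) => //.
have h1 := sdom (T_in T0) GT; have h2 := sdom (g_in j) GB.
have := EI_abs mB (iS (T_in T0)); have := EI_abs mB (iS (g_in j)).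
rewrite !ler_norml => /andP[? ?] /andP[? ?]; lra.
Qed.

Let mAc c j : measurable [set w | c < A j w].
Proof. meas. Qed.

(** Split at the first index where the sum is about to pass [c]. This is known one step ahead, so
    [C] belongs to [G (g j)]; the rest of the sum has on [C] the mean of an increment of [S], at
    most twice that of [Xi]. *)
Let overshoot c j : 0 <= c -> (j <= N)%N ->
 EI P [set w | c < A j w] (fun w => A N w - c) <= 2 * EI P [set w | c < A j w] Xi.
Proof.
move=> c0; elim: j => [_|j IH jN].
 rewrite (_ : mkset _ = set0) ?EI_set0 ?mulr0//.
 apply/seteqP; split => // w /=; rewrite /A big_ord0; lra.
pose C := [set w | A j w <= c] `&` [set w | c < A j.+1 w].
have cH := cG (g_in j).
have GC : G (g j) C.
 apply: (csubI cH); [apply: (csub_le cH (@HA j))|apply: (csub_lt cH _ (@HAS j))]; exact: (smcst cH).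
have mC := csubm cH GC.
have E : [set w | c < A j.+1 w] = [set w | c < A j w] `|` C.
 apply/seteqP; split=> w /=; last first.
  by move=> [/lt_le_trans|[]//]; apply; exact: A_mono.
 by move=> cA; case: (ltP c (A j w)) => ?; [left|right].
have dis w : [set w | c < A j w] w -> C w -> False by move=> /= + [/= + _]; lra.
have iB : L1 P (fun w => A N w - c) by meas.
rewrite E !EI_setU// mulrDr; apply: lerD; first exact/IH/ltnW.
apply: le_trans (EAle (ltnW jN) GC).
rewrite -EIB//; apply: EI_le => //; first meas.
by move=> w [ ? _]; rewrite lerD2l lerN2.
Qed.

Let EAN : EI P setT (A N) <= 2 * EI P setT Xi.
Proof.
have := EAle (leq0n N) (csubT (cG (g_in 0))).
rewrite (@eq_EI _ _ _ P _ (A 0) (cst 0)) ?EIcst ?mul0r ?subr0//.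
by move=> w _; rewrite /A big_ord0.
Qed.

Let tail_bound B (k : R) : 0 <= k -> measurable B ->
 EI P B Xi <= EI P setT (tail k Xi) + k * fine (P B).
Proof.
move=> k0 mB; have it := L1_tail k0 iXi.
have H1 : EI P B (tail k Xi) <= EI P setT (tail k Xi).
 apply: EI_subset => //; exact: tail_ge0.
rewrite -EIcst//; apply: le_trans (lerD H1 (lexx _)); rewrite -EID//; last meas.
apply: EI_le => //; first meas.
move=> w _; rewrite /tail; have := ler_norm (Xi w).
have : `|Xi w| - k <= maxr 0 (`|Xi w| - k) by rewrite le_max lexx orbT.
lra.
Qed.

(** The bound does not depend on the mesh: choosing [k], then [c], then [P B] small makes the totals
    uniformly integrable, whence a weak limit. *)
Lemma increment_bound B (c k : R) : 0 < c -> 0 <= k -> measurable B ->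
 EI P B (A N) <= c * fine (P B) +
  2 * (EI P setT (tail k Xi) + k * (2 * EI P setT Xi / c)).
Proof.
move=> c0 k0 mB; have c0' := ltW c0.
have iB : L1 P (fun w => A N w - c) by meas.
have mC := mAc c N.
have PC : fine (P [set w | c < A N w]) <= 2 * EI P setT Xi / c.
 rewrite ler_pdivlMr// mulrC -EIcst//; apply: le_trans EAN.
 apply: (@le_trans _ _ (EI P [set w | c < A N w] (A N))).
  by apply: (EI_le mC (L1cst P c) (iA N)) => w /ltW.
 exact: EI_subset.
have := overshoot c0' (leqnn N).
have := tail_bound k0 mC.
have : k * fine (P [set w | c < A N w]) <= k * (2 * EI P setT Xi / c) by rewrite ler_wpM2l.
have : EI P B (A N) <= c * fine (P B) + EI P [set w | c < A N w] (fun w => A N w - c).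
 rewrite -EIcst// -[X in EI P X (fun w => A N w - c)]setTI -EI_indic//.
 have H2 : EI P B (fun w => \1_[set w | c < A N w] w * (A N w - c)) <=
   EI P setT (fun w => \1_[set w | c < A N w] w * (A N w - c)).
  apply: EI_subset => //; first meas.
  move=> w; rewrite indicE; case: (boolP (_ \in _)); rewrite ?mul0r// mul1r inE => /ltW.
  lra.
 apply: le_trans (lerD (lexx _) H2); rewrite -EID//; [|exact: L1cst|exact: L1indic].
 apply: EI_le => //; first meas.
 move=> w _; rewrite indicE; case: (ltP c (A N w)) => cA.
  rewrite mem_set// mul1r; lra.
 by rewrite memNset ?mul0r ?addr0//=; apply/negP; rewrite -leNgt.
lra.
Qed.

Definition dm_total : Ω -> R := A N.

Lemma dm_total_L1 : L1 P dm_total. Proof. meas. Qed.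
Lemma dm_total_ge0 w : 0 <= dm_total w. Proof. exact: A_ge0. Qed.
Lemma dm_total_mean : EI P setT dm_total <= 2 * EI P setT Xi. Proof. by []. Qed.

(** Given [G (g j)], the variable [S (g j) - S T + dm_total] has conditional expectation [A j]. In
    this form the integral of [A j] over [C] involves the mesh through [dm_total] only, so it passes
    to the weak limit. *)
Let EI_phi j (φ : Ω -> R) C : (j <= N)%N -> measurable C -> smeas (G (g j)) φ ->
 (forall w, 0 <= φ w <= 1) -> (forall B, G (g j) B -> EI P B φ = EI P B \1_C) ->
 EI P setT (fun w => φ w * (S (g j) w - S T w + dm_total w)) = EI P C (A j).
Proof.
move=> jN mC Hphi p01 phiC; have cH := cG (g_in j).
rewrite (EI_pullout cH mC Hphi p01 phiC (@HA j) (iA j)).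
have iX : L1 P (fun w => S (g j) w - S T w + dm_total w).
 by apply: L1D; [apply: L1B; [exact: iS|exact: (iS (T_in T0))]|exact: dm_total_L1].
apply: (EI_dual cH) => // B GB; have mB := csubm cH GB.
have iT := iS (T_in T0); have ig := iS (g_in j).
rewrite (EID mB (L1B ig iT) dm_total_L1) (EIB mB ig iT).
have := EA jN GB; rewrite /dm_total; lra.
Qed.

Lemma dm_mesh_le s t (φ psi : Ω -> R) C : s \in gridl T n -> t \in gridl T n -> s < t ->
 measurable C ->
 smeas (G s) φ -> (forall w, 0 <= φ w <= 1) ->
 (forall B, G s B -> EI P B φ = EI P B \1_C) ->
 smeas (G t) psi -> (forall w, 0 <= psi w <= 1) ->
 (forall B, G t B -> EI P B psi = EI P B \1_C) ->
 EI P setT (fun w => φ w * (S s w - S T w + dm_total w)) <=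
 EI P setT (fun w => psi w * (S t w - S T w + dm_total w)).
Proof.
move=> /gE[i iN <-] /gE[j jN <-] ij mC ? ? ? ? ? ?.
rewrite (EI_phi iN mC)// (EI_phi jN mC)//; apply: (EI_le mC (iA i) (iA j)) => w _.
apply: A_mono; rewrite leqNgt; apply/negP => ji.
by have := g_mono (ltnW ji); rewrite leNgt ij.
Qed.

End fixed_mesh.

Let total_ui : ui P dm_total.
Proof.
move=> e e0; have K0 : 0 <= EI P setT Xi.
 apply: le_trans (sdom (T_in T0) (csubT (cG (T_in T0)))).
 by apply: EI_ge0.
have [k k0 kt] := tail_cvg0 iXi (e := e / 8) ltac:(lra).
(* Each of the three contributions is then at most [e / 4]: [c * P B], twice the tail, and twice the
   term in [1 / c]. *)
pose c := 16 * k * EI P setT Xi / e + 1.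
have c0 : 0 < c by rewrite ltr_pwDr// divr_ge0 ?(ltW e0)// !mulr_ge0// ltW.
exists (e / 4 / c); first by rewrite divr_gt0; lra.
move=> B mB PB n; rewrite (@eq_EI _ _ _ P _ _ (dm_total n)); last first.
 by move=> w _; rewrite ger0_norm// dm_total_ge0.
apply: le_trans (increment_bound n c0 (ltW k0) mB) _.
have : c * fine (P B) <= e / 4.
 by rewrite mulrC -ler_pdivlMr// ltW.
have : k * (2 * EI P setT Xi / c) <= e / 8.
 rewrite mulrA ler_pdivrMr// mulrDr mulr1.
 have -> : e / 8 * (16 * k * EI P setT Xi / e) = 2 * (k * EI P setT Xi).
  by field; rewrite gt_eqF.
 lra.
lra.
Qed.

(** With [a] the weak limit of the totals, [M] is closed by [S T - a]. Monotonicity of [A = S - M]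
    holds between two grid times at every fine mesh, passes to the limit along [Ultra], and reaches
    all times by right-continuity. *)
Theorem doob_meyer : exists M A X, [/\ cmart M X, adapted T G A,
 forall w, cadlag T (A ^~ w),
 forall t w, S t w = M t w + A t w
 & \forall w \ae P, forall s t, 0 <= s -> s <= t -> t <= T -> A s w <= A t w].
Proof.
have TT := T_in T0.
have [a [Ha ia ca]] := @weak_limit _ _ _ P dm_total (2 * EI P setT Xi) dm_total_L1
 (fun n => ltac:(rewrite (@eq_EI _ _ _ P _ _ (dm_total n)); [exact: dm_total_mean|by move=> w _; rewrite ger0_norm// dm_total_ge0])) total_ui _ (cG TT).
have iX : L1 P (fun w => S T w - a w) by meas.
have [M mM] := cmart_exists iX; have [aM cM _ iM EM] := mM.
pose A t w := S t w - M t w.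
exists M, A, (fun w => S T w - a w).
have aA : adapted T G A by move=> t tT; apply: (smB (cG tT)); [exact: aS|exact: aM].
have iMt t : 0 <= t <= T -> L1 P (M t) by move=> tT; exact: (iM _ (st_cst UG tT)).
have iA t : 0 <= t <= T -> L1 P (A t) by move=> tT; apply: L1B; [exact: iS|exact: iMt].
have cA w : cadlag T (A ^~ w).
 split=> t tT; first by apply: cvgB; [exact: (cS w).1|exact: (cM w).1].
 by apply: is_cvgB; [exact: (cS w).2|exact: (cM w).2].
split => //; first by move=> t w; rewrite addrC subrK.
have lim t (φ : Ω -> R) C : 0 <= t <= T -> measurable C -> smeas (G t) φ ->
  (forall w, 0 <= φ w <= 1) -> (forall B, G t B -> EI P B φ = EI P B \1_C) ->
  EI P setT (fun w => φ w * (S t w - S T w + dm_total n w)) @[n --> Ultra] -->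
  EI P C (A t).
 move=> tT mC Hphi p01 phiC; have cH := cG tT; have mphi := sm_meas cH Hphi.
 rewrite (EI_pullout cH mC Hphi p01 phiC (aA _ tT) (iA _ tT)).
 have iST : L1 P (fun w => S t w - S T w) by meas.
 have -> : EI P setT (fun w => φ w * A t w) =
   EI P setT (fun w => φ w * (S t w - S T w)) + EI P setT (fun w => φ w * a w).
  rewrite -EID//; [|exact: L1_mul..].
  rewrite -[RHS](@eq_EI _ _ _ P _ (fun w => φ w * (S t w - (S T w - a w)))); last first.
   move=> w _; ring.
  apply: (EI_dual cH) => //; [exact: iA|by apply: L1B => //; exact: iS|].
  move=> B GB; have mB := csubm cH GB.
  rewrite (EIB mB (iS tT) (iMt _ tT)) (EIB mB (iS tT) iX).
  congr (_ - _); have := EM _ B (st_cst UG tT); rewrite (Gat_cst UG tT); exact.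
 under eq_fun => n.
  rewrite (@eq_EI _ _ _ P _ _ (fun w => φ w * (S t w - S T w) + φ w * dm_total n w)); last first.
   by move=> w _; rewrite mulrDr.
  rewrite EID//; [|exact: L1_mul|by apply: L1_mul => //; exact: dm_total_L1].
  over.
 apply: cvgD; first by apply: cvg_Ultra; exact: cvg_cst.
 apply: (@weak_dual _ _ _ P (G T) dm_total a φ (2 * EI P setT Xi)) => //.
 - exact: cG.
 - exact: dm_total_L1.
 - move=> n; rewrite (@eq_EI _ _ _ P _ _ (dm_total n)); first exact: dm_total_mean.
  by move=> w _; rewrite ger0_norm// dm_total_ge0.
 - by apply: (sm_sub _ Hphi); have /andP[? ?] := tT; apply: (G_mono UG).
have le_st s t : grid T s -> grid T t -> s < t -> \forall w \ae P, A s w <= A t w.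
 move=> gs gt slt; have sT := grid_in T0 gs; have tT := grid_in T0 gt.
 have /andP[s0 _] := sT; have /andP[_ tT1] := tT.
 apply: (sm_ae_le (cG tT)); [|exact: aA|exact: iA|exact: iA|].
  apply: (sm_sub _ (aA _ sT)); apply: (G_mono UG) => //; exact: ltW.
 move=> C GC; have mC := csubm (cG tT) GC.
 (* Both integrals over [C] are rewritten with conditional probabilities of [C], the form in which
    they are limits of the discrete ones. *)
 have [φ [H1 H2 H3]] := clipped_ce (cG sT) mC.
 have [psi [H4 H5 H6]] := clipped_ce (cG tT) mC.
 have l1 := lim _ _ _ sT mC H1 H2 H3; have l2 := lim _ _ _ tT mC H4 H5 H6.
 have [m1 sm1] := gs; have [m2 sm2] := gt.
 rewrite -(cvg_lim _ l1)// -(cvg_lim _ l2)//; apply: ler_lim.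
 + apply/cvg_ex; eexists; exact: l1.
 + apply/cvg_ex; eexists; exact: l2.
 + apply: UltraP.2; exists (maxn m1 m2) => // n /= nm.
  have nm1 : (m1 <= n)%N by apply: leq_trans nm; exact: leq_maxl.
  have nm2 : (m2 <= n)%N by apply: leq_trans nm; exact: leq_maxr.
  by apply: (dm_mesh_le _ _ slt mC) => //; [exact: gridl_sub sm1|exact: gridl_sub sm2].
have key : \forall w \ae P, forall i j : nat * nat,
  nth T (gridl T i.1) i.2 < nth T (gridl T j.1) j.2 ->
  A (nth T (gridl T i.1) i.2) w <= A (nth T (gridl T j.1) j.2) w.
 have gn (i : nat * nat) : grid T (nth T (gridl T i.1) i.2).
  case: (ltnP i.2 (size (gridl T i.1))) => h; first by exists i.1; exact: mem_nth.
  rewrite nth_default//; exact: grid_T.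
 apply: ae_count => i; apply: ae_count => j.
 have [lt|nlt] := pselect (nth T (gridl T i.1) i.2 < nth T (gridl T j.1) j.2).
  by apply: filterS (le_st _ _ (gn i) (gn j) lt).
 exact: aeW.
apply: filterS key => w kw s t s0 st tT.
have gle q r : grid T q -> grid T r -> q < r -> A q w <= A r w.
 move=> [m qm] [k rk] qr.
 have := kw (m, index q (gridl T m)) (k, index r (gridl T k)).
 by rewrite !nth_index; exact.
have := st; rewrite le_eqVlt => /predU1P[->//|lt].
have up_s : (fun n => A (minr T (up n s)) w) @ \oo --> A s w.
 apply: (@minup_cvg _ (A ^~ w)) => [|?]; first lra.
 apply: (cA w).1; lra.
have up_t : (fun n => A (minr T (up n t)) w) @ \oo --> A t w.
 apply: (@minup_cvg _ (A ^~ w)) => [|?]; first lra.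
 apply: (cA w).1; lra.
rewrite -(cvg_lim _ up_s)// -(cvg_lim _ up_t)//; apply: ler_lim.
- apply/cvg_ex; eexists; exact: up_s.
- apply/cvg_ex; eexists; exact: up_t.
- have [m me] := @mesh_small R (t - s) ltac:(lra).
 exists m => // n /= nm.
 have us : minr T (up n s) < t.
  rewrite gt_min; apply/orP; right; have := up_le n s0; have := @mesh_le R _ _ nm; lra.
 case: (ltP t T) => [ltT|Tt].
  apply: gle; [exact: grid_up|exact: grid_up|].
  apply: (lt_le_trans us); rewrite le_min tT ltW//; exact: lt_up.
 have -> : minr T (up n t) = T by apply: min_l; apply: le_trans Tt (ltW (lt_up n t)).
 by apply: gle; [exact: grid_up|exact: grid_T|lra].
Qed.

End decomposition.
End doob_meyer.

(** * Increasing paths, left limits and summable gaps *)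

Section increasing_paths.
Context {R : realType}
 (T : R).
Implicit Types (x y : R -> R) (s t a : R).

Definition nondec x := forall s t, 0 <= s -> s <= t -> t <= T -> x s <= x t.

Lemma before_lim x t : 0 < t -> before x t = lim (x s @[s --> t^'-]).
Proof. by move=> t0; rewrite /before leNgt t0. Qed.

Lemma cadlag_left x t : cadlag T x -> 0 < t <= T -> x s @[s --> t^'-] --> before x t.
Proof. move=> cx tT; have /andP[t0 _] := tT; rewrite before_lim//; exact: cx.2. Qed.

(** The default 0 reproduces the convention that the path vanishes before time 0: at [t = 0] it is
    the whole sequence. *)
Lemma before_cvg x t : cadlag T x -> 0 <= t <= T ->
 (if t < mesh n then 0 else x (t - mesh n)) @[n --> \oo] --> before x t.
Proof.
move=> cx /andP[t0 tT]; have [t0'|t0'] := leP t 0.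
 have -> : t = 0 by lra.
 rewrite /before lexx (_ : (fun n => _) = cst 0); first exact: cvg_cst.
 by apply/funext => n; rewrite mesh_gt0.
have tT' : 0 < t <= T by lra.
have /lcvgP c := cadlag_left cx tT'.
apply/cvgnP => e e0; have [c1 c10 H] := c e e0.
have [N Nm] := @mesh_small R (minr c1 t) ltac:(by rewrite lt_min c10).
move: Nm; rewrite lt_min => /andP[N1 N2]; exists N => n Nn.
have := @mesh_le R _ _ Nn; have := @mesh_gt0 R n => ? ?.
have -> : (t < mesh n) = false by lra.
apply: H; lra.
Qed.

Lemma le_before x s t : cadlag T x -> nondec x -> 0 <= s -> s < t -> t <= T ->
 x s <= before x t.
Proof.
move=> cx nx s0 st tT; have t0 : 0 < t by lra.
have c : x r @[r --> t^'-] --> before x t by apply: cadlag_left => //; rewrite t0.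
apply: (cvgr_to_ge c); exists (t - s) => /=; first lra.
move=> r /= h rt; move: h; rewrite ger0_norm => [h|]; last lra.
apply: nx; lra.
Qed.

Lemma before_le x t : cadlag T x -> nondec x -> 0 <= x 0 -> 0 <= t <= T ->
 before x t <= x t.
Proof.
move=> cx nx x0 /andP[t0 tT]; case: (leP t 0) => t0'.
 have -> : t = 0 by lra.
 by rewrite /before lexx.
have c : x r @[r --> t^'-] --> before x t by apply: cadlag_left => //; rewrite t0'.
apply: (cvgr_to_le c); exists t => //= r /= h rt.
move: h; rewrite ger0_norm => [h|]; last lra.
apply: nx; lra.
Qed.

Lemma before_ge0 x t : cadlag T x -> nondec x -> 0 <= x 0 -> 0 <= t <= T ->
 0 <= before x t.
Proof.
move=> cx nx x0 /andP[t0 tT]; case: (leP t 0) => t0'; first by rewrite /before t0'.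
by apply: le_trans x0 _; apply: le_before.
Qed.

Lemma before_mono x s t : cadlag T x -> nondec x -> 0 <= x 0 -> 0 <= s -> s <= t ->
 t <= T -> before x s <= before x t.
Proof.
move=> cx nx x0 s0; rewrite le_eqVlt => /predU1P[->//|st] tT.
apply: le_trans (le_before cx nx s0 st tT).
apply: before_le => //; apply/andP; split; lra.
Qed.

Lemma jumps_sorted x l t : cadlag T x -> nondec x -> 0 <= x 0 ->
 path <%R t l -> (forall q, q \in t :: l -> 0 <= q <= T) ->
 \sum_(q <- l) (x q - before x q) <= x (last t l) - x t.
Proof.
move=> cx nx x0; elim: l t => [|q l IH] t /=; first by rewrite big_nil subrr.
move=> /andP[tq pl] lT; rewrite big_cons.
have := IH q pl (fun r rl => lT r ltac:(by rewrite inE rl orbT)).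
have /andP[t0 _] := lT t (mem_head _ _).
have /andP[_ qT] := lT q ltac:(by rewrite !inE eqxx orbT).
have := le_before cx nx t0 tq qT; lra.
Qed.

Lemma jumps_le x l : 0 < T -> cadlag T x -> nondec x -> 0 <= x 0 -> uniq l ->
 (forall q, q \in l -> 0 <= q <= T) -> \sum_(q <- l) (x q - before x q) <= x T.
Proof.
move=> T0 cx nx x0 ul lT.
have ps : perm_eq (sort <=%R l) l by rewrite perm_sort.
rewrite -(perm_big _ ps)/=.
have : sorted <%R (sort <=%R l) by rewrite sort_lt_sorted.
have : forall q, q \in sort <=%R l -> 0 <= q <= T by move=> q; rewrite mem_sort; exact: lT.
case: (sort _ _) => [|t l'] lT'.
 rewrite big_nil => _; apply: le_trans x0 _; apply: nx => //; exact: ltW.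
move=> pl; rewrite big_cons.
have := jumps_sorted cx nx x0 pl lT'.
have tT := lT' t (mem_head _ _); have := before_ge0 cx nx x0 tT.
have /andP[? ?] := lT' (last t l') (mem_last _ _).
have := @nx (last t l') T; move=> H.
have := H ltac:(lra) ltac:(lra) (lexx _); lra.
Qed.

(** For [y <= x] this forces equal one-sided limits. Limits pass in this way from the càdlàg
    projections to the left-continuous ones. *)
Definition summable_gap x y := exists C : R, forall l, uniq l ->
 (forall q, q \in l -> 0 <= q <= T) -> \sum_(q <- l) (x q - y q) <= C.

Lemma gap_finite x y e : summable_gap x y -> 0 < e ->
 finite_set [set q | 0 <= q <= T /\ e <= x q - y q].
Proof.
move=> [C CP] e0; apply: contrapT => inf.
have [l lP sl] := infinite_set_fset (Num.trunc (C / e)).+1 inf.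
have := CP (finmap.enum_fset l) (finmap.fset_uniq l) (fun q ql => (lP q ql).1); rewrite leNgt => /negP; apply.
apply: (@lt_le_trans _ _ (\sum_(q <- finmap.enum_fset l) e)); last by rewrite !big_seq; apply: ler_sum => q /lP[].
rewrite big_const_seq iter_addr_0 count_predT -mulr_natr mulrC -ltr_pdivrMr//.
by apply: lt_le_trans (truncnS_gt _) _; rewrite ler_nat.
Qed.

(** Only finitely many times have a gap of at least [e / 2]; a finite set is closed, so close to [t]
    and off [t] the gap is smaller. *)
Lemma gap_cvg x y t (F : set_system R) (FF : Filter F) (l : R) : (forall t, 0 <= t <= T -> y t <= x t) ->
 summable_gap x y -> (forall A : set R, nbhs t A -> F A) -> (\forall s \near F, s != t /\ 0 <= s <= T) ->
 x @ F --> l -> y @ F --> l.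
Proof.
move=> yx sg Ft FT /cvgrPdist_lt cx; apply/cvgrPdist_lt => e e0.
have fin := sub_finite_set (@subDsetl _ _ [set t]) (gap_finite sg (hgt0 e0)).
have /Ft nb : nbhs (t : R) (~` ([set q | 0 <= q <= T /\ e / 2 <= x q - y q] `\` [set t])).
 apply: open_nbhs_nbhs; split; last by move=> [_ /(_ erefl)].
 apply: closed_openC; exact: (accessible_finite_set_closed.1 (hausdorff_accessible (@Rhausdorff R)) _ fin).
apply: filterS3 FT nb (cx _ (hgt0 e0)) => s [/eqP st sT] ns.
have [lt|ge] := ltP (x s - y s) (e / 2); last by case: ns; split.
have := yx s sT; rewrite !ltr_distlC => ? /andP[? ?]; lra.
Qed.

Lemma gap_right x y t : (forall t, 0 <= t <= T -> y t <= x t) -> summable_gap x y ->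
 0 <= t < T -> x s @[s --> t^'+] --> x t -> y s @[s --> t^'+] --> x t.
Proof.
move=> yx sg /andP[t0 tT]; apply: (@gap_cvg x y t t^'+ _ _ yx sg).
 by move=> A; apply: filterS => s As _.
near=> s; have ts : t < s by near: s; exact: nbhs_right_gt.
have sT : s < T by near: s; exact: nbhs_right_lt.
by split; [rewrite gt_eqF|lra].
Unshelve. all: by end_near. Qed.

Lemma gap_left x y t (l : R) : (forall t, 0 <= t <= T -> y t <= x t) -> summable_gap x y ->
 0 < t <= T -> x s @[s --> t^'-] --> l -> y s @[s --> t^'-] --> l.
Proof.
move=> yx sg /andP[t0 tT]; apply: (@gap_cvg x y t t^'- _ _ yx sg).
 by move=> A; apply: filterS => s As _.
near=> s; have ts : s < t by near: s; exact: nbhs_left_lt.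
have sT : 0 < s by near: s; exact: nbhs_left_gt.
by split; [rewrite lt_eqF|lra].
Unshelve. all: by end_near. Qed.

End increasing_paths.

(** * Entrance times *)

Section debut.
Context {R : realType} {d : measure_display} {Ω : measurableType d}
 (P : probability Ω R) (T : R) (G : R -> set (set Ω))
 (T0 : 0 < T)
 (UG : usual_filtration P T G).
Implicit Types (X : R -> Ω -> R) (θ τ : Ω -> R) (q e t : R).
Notation st := (stopping_time T G).
Notation Gat := (sigma_at T G).

(** Strict inequalities suffice because the filtration is right-continuous. *)
Lemma st_of_lt θ : (forall w, 0 <= θ w <= T) ->
 (forall t, 0 < t <= T -> G t [set w | θ w < t]) -> st θ.
Proof.
move=> thT lt; split => // t tT; have /andP[t0 tT'] := tT.
have cG := G_csub UG tT.
have [TT|tlt] := leP T t.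
 rewrite (_ : mkset _ = setT); first exact: csubT cG.
 by apply/seteqP; split => // w _ /=; have /andP[_ /le_trans] := thT w; apply.
have [_ _ rc _] := UG; rewrite rc ?t0// => s /=; rewrite in_itv/= => /andP[ts sT].
have sT' : 0 <= s <= T by lra.
have cGs := G_csub UG sT'.
have [n0 n0s] := @mesh_small R (s - t) ltac:(lra).
rewrite (_ : mkset _ = \bigcap_n [set w | θ w < t + mesh (n + n0)]).
 apply: (csub_bigcap cGs) => n; have m0 := @mesh_gt0 R (n + n0).
 have mn : (mesh (n + n0) : R) <= mesh n0 by exact/mesh_le/leq_addl.
 apply: (G_mono UG _ _ _ (lt (t + mesh (n + n0)) _)); try apply/andP; try split; lra.
apply/seteqP; split=> w /=; first by move=> thw n _ /=; have := @mesh_gt0 R (n + n0); lra.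
move=> H; rewrite leNgt; apply/negP => tth.
have [n nth] := @mesh_small R (θ w - t) ltac:(lra).
have := H n I => /=; have : (mesh (n + n0) : R) <= mesh n by exact/mesh_le/leq_addr.
lra.
Qed.

Lemma Gat_lt θ τ : st θ -> st τ -> Gat θ [set w | θ w < τ w].
Proof.
move=> sth sta.
have H t : 0 <= t <= T -> G t ([set w | θ w < τ w] `&` [set w | θ w <= t]).
 move=> tT; have cG := G_csub UG tT; have sc := st_cst UG tT.
 have sm s : st s -> smeas (G t) (fun w => minr (s w) t).
  move=> ss; rewrite -(Gat_cst UG tT).
  refine (sm_sub _ (st_sm T0 UG (st_min UG ss sc))).
  by apply: (Gat_mono UG (st_min UG ss sc) sc) => w; rewrite ge_min lexx orbT.
 have H1 := csub_lt cG (sm _ sth) (sm _ sta).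
 have H2 := csubI cG (st_le sth tT) (st_gt UG sta tT).
 have := csubU cG H1 H2; congr G; apply/seteqP; split=> w /=.
  move=> [|[? ?]]; last lra.
  rewrite lt_min => /andP[h]; rewrite gt_min ltxx orbF => tht.
  by split; [move: h; rewrite (min_idPl (ltW tht))|exact: ltW].
 move=> [? ?]; case: (ltP t (τ w)) => ?; [by right|left].
 by rewrite (min_idPl _).
split => //; have := H T (T_in T0); congr G; apply/seteqP; split=> w //=; first lra.
by move=> ?; split; have /andP[] := sth.1 w.
Qed.

(** With [e < X t] strict, an entrance before [t] is already visible on the grid by
    right-continuity. Adjoining [T] fixes the value when there is no entrance. *)
Definition debut X q e (w : Ω) : R :=
 inf ([set t | q <= t <= T /\ e < X t w] `|` [set T]).

Section debut_props.
Context (X : R -> Ω -> R) (q e : R)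
 (aX : adapted T G X)
 (cX : forall w, cadlag T (X ^~ w))
 (qT : 0 <= q <= T).

Let S w := [set t | q <= t <= T /\ e < X t w] `|` [set T].
Let hS w : has_inf (S w).
Proof.
split; first by exists T; right.
by exists q => t [[/andP[]]//|->]; have /andP[] := qT.
Qed.

Lemma debut_ge w : q <= debut X q e w <= T.
Proof.
apply/andP; split; last by apply: ge_inf; [exact: (hS w).2|right].
apply: lb_le_inf; first exact: (hS w).1.
by move=> t [[/andP[]]//|->]; have /andP[] := qT.
Qed.

Lemma debut_le w t : q <= t <= T -> e < X t w -> debut X q e w <= t.
Proof. by move=> ? ?; apply: ge_inf; [exact: (hS w).2|left]. Qed.

Lemma debut_lt w t : t <= T -> debut X q e w < t ->
 exists s, [/\ q <= s, s < t & e < X s w].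
Proof.
move=> tT /(inf_lt (hS w).1)[s [[/andP[? ?] ?] ?|->]]; first by exists s.
lra.
Qed.

Lemma debut_val w : debut X q e w < T -> e <= X (debut X q e w) w.
Proof.
move=> thT; have /andP[qth _] := debut_ge w; have /andP[q0 _] := qT.
rewrite leNgt; apply/negP => Xe.
have /rcvgP/(_ (e - X (debut X q e w) w)) := (cX w).1 (debut X q e w) ltac:(lra).
move=> /(_ ltac:(lra))[c c0 H].
have [s [qs]] := @debut_lt w (minr T (debut X q e w + c)) ltac:(by rewrite ge_min lexx)
 ltac:(by rewrite lt_min; lra).
rewrite lt_min => /andP[sT sc] eX.
have := debut_le (t := s) (w := w) ltac:(lra) eX.
rewrite le_eqVlt => /predU1P[E|lt]; first by move: eX; rewrite -E; lra.
have := H s lt sc; rewrite ltr_distlC => /andP[_]; lra.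
Qed.

Lemma st_debut : st (debut X q e).
Proof.
have /andP[q0 qT'] := qT.
apply: st_of_lt => [w|t /andP[t0 tT]].
 by have /andP[? ?] := debut_ge w; lra.
have tT' : 0 <= t <= T by lra.
have cG := G_csub UG tT'.
have GX r : 0 <= r -> r < t -> G t [set w | e < X r w].
 move=> r0 rt; have rT : 0 <= r <= T by lra.
 apply: (G_mono UG r0 (ltW rt) tT); have cGr := G_csub UG rT.
 by apply: (csub_lt cGr); [exact: (smcst cGr)|exact: aX].
have [qt|tq] := ltP q t; last first.
 rewrite (_ : mkset _ = set0); first exact: csub_set0 cG.
 apply/seteqP; split => // w /=; have /andP[? ?] := debut_ge w; lra.
rewrite (_ : mkset _ = [set w | e < X q w] `|` \bigcup_n
  \big[setU/set0]_(r <- gridl T n | q < r < t) [set w | e < X r w]).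
 apply: (csubU cG); first exact: GX.
 apply: (csub_bigcup cG) => n; elim: gridl => [|r l IH].
  rewrite big_nil; exact: csub_set0 cG.
 rewrite big_cons; case: ifP => // /andP[qr rt]; apply: (csubU cG) => //.
 apply: GX; lra.
apply/seteqP; split=> w /=.
 move=> /(debut_lt tT)[s [qs st' eX]].
 have /rcvgP/(_ (X s w - e)) := (cX w).1 s ltac:(lra).
 move=> /(_ ltac:(lra))[c c0 H].
 have [r [[n rn] sr]] := @grid_dense R T T0 s (minr c (t - s)) ltac:(lra) ltac:(lra)
  ltac:(by rewrite lt_min; lra).
 rewrite -ltrBlDl lt_min => /andP[rc rt].
 right; exists n => //; rewrite -bigcup_seq_cond; exists r => /=.
  rewrite rn; lra.
 have := H r sr ltac:(lra); rewrite ltr_distlC => /andP[]; lra.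
move=> [eX|[n _]].
 apply: le_lt_trans (debut_le _ eX) qt; lra.
rewrite -bigcup_seq_cond => -[r /= /andP[_ /andP[qr rt]] eX].
by apply: (le_lt_trans (debut_le _ eX) rt); rewrite (ltW qr) (le_trans (ltW rt) tT).
Qed.

End debut_props.

Lemma debut_mono X Y q e w : 0 <= q <= T -> (forall t, 0 <= t <= T -> Y t w <= X t w) ->
 debut X q e w <= debut Y q e w.
Proof.
move=> /andP[q0 qT] YX; apply: lb_le_inf; first by exists T; right.
have hl : has_lbound ([set t | q <= t <= T /\ e < X t w] `|` [set T]).
 by exists q => t [[/andP[]]//|->].
move=> t [[/andP[qt tT] eY]|->]; apply: ge_inf => //; last by right.
left; split; first lra.
apply: lt_le_trans eY (YX _ _); lra.
Qed.

End debut.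

(** * Optional projections of an increasing process and of its left limits *)

Section left_projection.
Context {R : realType} {d : measure_display} {Ω : measurableType d}
 (P : probability Ω R) (T : R) (G : R -> set (set Ω))
 (T0 : 0 < T)
 (UG : usual_filtration P T G).
Implicit Types (θ τ : Ω -> R) (q e t : R) (B : set Ω).
Notation st := (stopping_time T G).
Notation Gat := (sigma_at T G).
Context (K : R -> Ω -> R) (Xi : Ω -> R)
 (rK : raw P T K Xi)
 (nK : forall w, nondec T (K ^~ w))
 (K0 : forall w, 0 <= K 0 w).

Let cK w : cadlag T (K ^~ w). Proof. by have [+ _ _ _] := rK. Qed.
Let mK t : 0 <= t <= T -> mfunT (K t). Proof. by have [_ + _ _] := rK; exact. Qed.
Let iXi : L1 P Xi. Proof. by have [] := rK. Qed.
Let K_ge0 t w : 0 <= t <= T -> 0 <= K t w.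
Proof. move=> /andP[t0 tT]; apply: (le_trans (K0 w)); exact: nK. Qed.

(** Càdlàg processes that increase with [n] to the left limits of [K]: each has a càdlàg projection,
    and the projection of the left limits is obtained as their limit. *)
Definition delay n (t : R) (w : Ω) : R := if t < mesh n then 0 else K (t - mesh n) w.

Let delay_nondec n w : nondec T (delay n ^~ w).
Proof.
move=> s t s0 st tT; rewrite /delay; have m0 := @mesh_ge0 R n.
case: ltP => sm; case: ltP => tm; try lra.
 apply: K_ge0; lra.
apply: nK; lra.
Qed.

Let delay_ge0 n t w : 0 <= t <= T -> 0 <= delay n t w.
Proof.
move=> tT; rewrite /delay; have m0 := @mesh_ge0 R n; case: ltP => // tm.
apply: K_ge0; lra.
Qed.

Let delay_le m n t w : (m <= n)%N -> 0 <= t <= T -> delay m t w <= delay n t w.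
Proof.
move=> mn tT; rewrite /delay; have m0 := @mesh_ge0 R n; have := @mesh_le R _ _ mn.
case: ltP => tm; case: ltP => tn h; try lra.
 apply: K_ge0; lra.
apply: nK; lra.
Qed.

Let delay_leK n t w : 0 <= t <= T -> delay n t w <= K t w.
Proof.
move=> tT; rewrite /delay; have m0 := @mesh_ge0 R n; case: ltP => tm; first exact: K_ge0.
apply: nK; lra.
Qed.

Let cadlag_delay n w : cadlag T (delay n ^~ w).
Proof.
have m0 := @mesh_gt0 R n; split=> t /andP[t0 tT].
 apply/rcvgP => e e0; rewrite /delay; case: ltP => tm.
  exists (mesh n - t); first lra.
  move=> r tr rt; have -> : r < mesh n by lra.
  by rewrite subrr normr0.
 have /rcvgP/(_ e e0)[c c0 H] := (cK w).1 (t - mesh n) ltac:(lra).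
 exists c => // r tr rc; have -> : (r < mesh n) = false by apply/negbTE; rewrite -leNgt; lra.
 apply: H; lra.
have [tm|tm] := leP t (mesh n).
 apply/cvg_ex; exists 0; apply/lcvgP => e e0; exists 1 => // r rt _.
 have -> : delay n r w = 0 by rewrite /delay; have -> : r < mesh n by lra.
 by rewrite subrr normr0.
have /cvg_ex[l /lcvgP H] := (cK w).2 (t - mesh n) ltac:(lra).
apply/cvg_ex; exists l; apply/lcvgP => e e0; have [c c0 Hc] := H e e0.
exists (minr c (t - mesh n)); first by rewrite lt_min; lra.
move=> r rt; rewrite ltrBlDr -ltrBlDl lt_min => /andP[rc rm].
rewrite /delay; have -> : (r < mesh n) = false by apply/negbTE; rewrite -leNgt; lra.
apply: Hc; lra.
Qed.

Let raw_delay n : raw P T (delay n) Xi.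
Proof.
have m0 := @mesh_ge0 R n; split => //.
- move=> t tT; rewrite /delay; case: ltP => tm => //.
 apply: mK; lra.
- move=> t w tT; rewrite ger0_norm ?delay_ge0//; apply: le_trans (delay_leK n w tT) _.
 by apply: le_trans (ler_norm _) _; have [_ _ _] := rK; exact.
Qed.

Lemma delay_cvg t w : 0 <= t <= T -> delay n t w @[n --> \oo] --> before (K ^~ w) t.
Proof. exact: before_cvg. Qed.

Let before_sm θ : st θ ->
  mfunT (fun w => before (K ^~ w) (θ w)).
Proof.
move=> sth; apply: (@measurable_fun_cvg _ _ _ setT (fun n w => delay n (θ w) w)) => // [n|w _].
  exact: L1_meas (raw_st T0 UG (raw_delay n) sth).
by apply: delay_cvg; exact: sth.1.
Qed.

Let before_bound t w : 0 <= t <= T -> 0 <= before (K ^~ w) t <= K t w.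
Proof. by move=> tT; rewrite (before_ge0 (T := T))// (before_le (T := T)). Qed.

Lemma before_L1 θ : st θ -> L1 P (fun w => before (K ^~ w) (θ w)).
Proof.
move=> sth; apply: le_L1 iXi; first meas.
move=> w; have /andP[b0 bK] := before_bound w (sth.1 w).
rewrite ger0_norm//; apply: le_trans bK _; apply: le_trans (ler_norm _) _.
by have [_ _ _] := rK; apply; exact: sth.1.
Qed.

Definition is_proj (U N : R -> Ω -> R) := [/\ adapted T G N,
 forall w, cadlag T (N ^~ w),
 forall θ, st θ -> L1 P (fun w => N (θ w) w) &
 forall θ B, st θ -> Gat θ B ->
  EI P B (fun w => N (θ w) w) = EI P B (fun w => U (θ w) w)].

Lemma proj_exists U : raw P T U Xi -> (forall w, nondec T (U ^~ w)) ->
 exists N, is_proj U N.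
Proof.
move=> rU nU; have [N [aN cN eN]] := envelope T0 UG rU; exists N; split => //.
 by move=> θ sth; have [_ + _ _] := eN _ sth.
move=> θ B sth GB; apply: (env_proj T0 UG rU sth _ (eN _ sth) GB) => w t u; exact: nU.
Qed.

Lemma proj_le U U' N N' : is_proj U N -> is_proj U' N' ->
 raw P T U Xi -> raw P T U' Xi ->
 (forall t w, 0 <= t <= T -> U t w <= U' t w) ->
 \forall w \ae P, forall t, 0 <= t <= T -> N t w <= N' t w.
Proof.
move=> [aN cN iN eN] [aN' cN' iN' eN'] rU rU' UU'.
have pt t : 0 <= t <= T -> \forall w \ae P, N t w <= N' t w.
 move=> tT; have cG := G_csub UG tT; have sc := st_cst UG tT.
 apply: (sm_ae_le cG); [exact: aN|exact: aN'|exact: iN|exact: iN'|].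
 move=> A GA; have GA' : Gat (cst t) A by rewrite (Gat_cst UG tT).
 have -> := eN _ _ sc GA'; have -> := eN' _ _ sc GA'.
 apply: EI_le; [exact: csubm cG GA|exact: raw_st rU sc|exact: raw_st rU' sc|].
 move=> w _; exact: UU'.
have key : \forall w \ae P, forall i : nat * nat,
  N (nth T (gridl T i.1) i.2) w <= N' (nth T (gridl T i.1) i.2) w.
 apply: ae_count => i; apply: pt.
 case: (ltnP i.2 (size (gridl T i.1))) => h; last by rewrite nth_default//; exact: T_in.
 apply: (gridl_in T0 (n := i.1)); exact: mem_nth.
apply: filterS key => w kw t tT.
have gq n : N (minr T (up n t)) w <= N' (minr T (up n t)) w.
 have := kw (n, index (minr T (up n t)) (gridl T n)).
 by rewrite nth_index// gridl_up.
have c1 : N (minr T (up n t)) w @[n --> \oo] --> N t w.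
 apply: (@minup_cvg _ (N ^~ w)) => // ?; apply: (cN w).1; have /andP[-> _] := tT; done.
have c2 : N' (minr T (up n t)) w @[n --> \oo] --> N' t w.
 apply: (@minup_cvg _ (N' ^~ w)) => // ?; apply: (cN' w).1; have /andP[-> _] := tT; done.
rewrite -(cvg_lim _ c1)// -(cvg_lim _ c2)//; apply: ler_lim.
- apply/cvg_ex; eexists; exact: c1.
- apply/cvg_ex; eexists; exact: c2.
- exact: nearW.
Qed.

Lemma proj_restrict U N E : is_proj U N -> raw P T U Xi -> G 0 E ->
 (\forall w \ae P, E w) -> is_proj U (fun t w => \1_E w * N t w).
Proof.
move=> [aN cN iN eN] rU GE aeE.
have T00 : 0 <= (0 : R) <= T by rewrite lexx ltW.
have mE := csubm (G_csub UG T00) GE.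
split.
- move=> t tT; have cG := G_csub UG tT; have /andP[? ?] := tT.
 apply: (smM cG); last meas.
 by apply: (sm_indic cG); apply: (G_mono UG _ _ _ GE).
- move=> w; split=> t tT; first by apply: cvgMr; exact: (cN w).1.
 apply: is_cvgMr; exact: (cN w).2.
- meas.
- move=> θ B sth GB; rewrite -eN//; have mB := csubm (Gat_csub T0 UG sth) GB.
 apply: EI_aeq => //; [by apply: L1indic => //; exact: iN|exact: iN|].
 by apply: filterS aeE => w Ew _; rewrite indicE mem_set// mul1r.
Qed.

(** The projections are ordered almost surely. Multiplying them by the indicator of an almost sure
    event of [G 0] orders them everywhere, so that the later limit in [n] is monotone at every
    point. *)
Lemma nested_proj : exists (N : R -> Ω -> R) (Nn : nat -> R -> Ω -> R),
 [/\ is_proj K N, forall n, is_proj (delay n) (Nn n),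
  forall t w, 0 <= t <= T -> 0 <= Nn 0%N t w
  & forall n t w, 0 <= t <= T -> Nn n t w <= Nn n.+1 t w <= N t w].
Proof.
have [N pN] := proj_exists rK nK.
have /choice[Nn pNn] : forall n, exists N', is_proj (delay n) N'.
 move=> n; exact: proj_exists (raw_delay n) (delay_nondec n).
have r0 : raw P T (fun=> cst 0) Xi.
 split => //; first by move=> w; split=> t _; [exact: cvg_cst|exact: is_cvg_cst].
 move=> t w tT; rewrite normr0; apply: le_trans (_ : `|K T w| <= _) => //.
 by have [_ _ _] := rK; apply; exact: T_in.
have p0 : is_proj (fun=> cst 0) (fun=> cst 0).
 split => //.
 - move=> t tT; exact: smcst (G_csub UG tT).
 - by move=> w; split=> t _; [exact: cvg_cst|exact: is_cvg_cst].
 - move=> θ _; exact: L1cst.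
pose Q w := [/\ forall t, 0 <= t <= T -> 0 <= Nn 0%N t w,
  forall n t, 0 <= t <= T -> Nn n t w <= Nn n.+1 t w
  & forall n t, 0 <= t <= T -> Nn n t w <= N t w].
have aQ : \forall w \ae P, Q w.
 have h1 := proj_le p0 (pNn 0%N) r0 (raw_delay 0) (fun t w tT => delay_ge0 0 w tT).
 have h2 := ae_count (fun n => proj_le (pNn n) (pNn n.+1) (raw_delay n)
   (raw_delay n.+1) (fun t w tT => delay_le w (leqnSn n) tT)).
 have h3 := ae_count (fun n => proj_le (pNn n) pN (raw_delay n) rK
   (fun t w tT => delay_leK n w tT)).
 exact: filterS3 h1 h2 h3 => w H1 H2 H3.
have T00 : 0 <= (0 : R) <= T by rewrite lexx ltW.
have GQ : G 0 [set w | Q w].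
 have cG := G_csub UG T00; rewrite -(setCK [set w | Q w]); apply: (csubC cG).
 by have [_ _] := cG; apply.
exists (fun t w => \1_[set w | Q w] w * N t w), (fun n t w => \1_[set w | Q w] w * Nn n t w).
split.
- exact: proj_restrict.
- move=> n; apply: proj_restrict => //; exact: raw_delay.
- move=> t w tT; rewrite indicE; case: (boolP (_ \in _)); rewrite ?mul0r ?mul1r// inE.
 by move=> [h _ _]; exact: h.
- move=> n t w tT; rewrite indicE; case: (boolP (_ \in _)); rewrite ?mul0r ?mul1r ?lexx// inE.
 by move=> [_ h h']; rewrite h// h'.
Qed.

Section thin_set.
Context (N : R -> Ω -> R) (Nn : nat -> R -> Ω -> R)
 (pN : is_proj K N)
 (pNn : forall n, is_proj (delay n) (Nn n))
 (Nn_ge0 : forall t w, 0 <= t <= T -> 0 <= Nn 0%N t w)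
 (NnS : forall n t w, 0 <= t <= T -> Nn n t w <= Nn n.+1 t w <= N t w).

Definition leftp t w : R := lim (Nn n t w @[n --> \oo]).

Let Nn_mono m n t w : (m <= n)%N -> 0 <= t <= T -> Nn m t w <= Nn n t w.
Proof.
move=> mn tT; rewrite -(subnKC mn); elim: (n - m)%N => [|k IH]; first by rewrite addn0.
by rewrite addnS; apply: le_trans IH _; have /andP[] := NnS (m + k) w tT.
Qed.

Let Nn_le n t w : 0 <= t <= T -> Nn n t w <= N t w.
Proof.
move=> tT; have /andP[h1 h2] := NnS n w tT; lra.
Qed.

Lemma leftp_cvg t w : 0 <= t <= T -> Nn n t w @[n --> \oo] --> leftp t w.
Proof.
move=> tT; suff : cvg (Nn n t w @[n --> \oo]) by [].
apply: nondecreasing_is_cvgn; first by move=> m n mn; exact: Nn_mono.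
by exists (N t w) => _ [n _ <-]; exact: Nn_le.
Qed.

Lemma leftp_bounds t w : 0 <= t <= T -> 0 <= leftp t w <= N t w.
Proof.
move=> tT; apply/andP; split.
 apply: (EI_cvg_ge _ (@leftp_cvg t w tT)) => n.
 apply: le_trans (Nn_ge0 w tT) _; exact: Nn_mono.
apply: (EI_cvg_le _ (@leftp_cvg t w tT)) => n; exact: Nn_le.
Qed.

Lemma Nn_leftp n t w : 0 <= t <= T -> Nn n t w <= leftp t w.
Proof.
move=> tT; apply: (cvgr_to_ge (@leftp_cvg t w tT)); exists n => // m /= nm.
exact: Nn_mono.
Qed.

Lemma leftp_EI θ B : st θ -> Gat θ B ->
 [/\ smeas (Gat θ) (fun w => leftp (θ w) w),
   L1 P (fun w => leftp (θ w) w)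
  & EI P B (fun w => leftp (θ w) w) =
   EI P B (fun w => before (K ^~ w) (θ w))].
Proof.
move=> sth GB; have cG := Gat_csub T0 UG sth; have mB := csubm cG GB.
have [aN cN iN eN] := pN.
have Hn n : smeas (Gat θ) (fun w => Nn n (θ w) w).
 by have [a c _ _] := pNn n; exact: (eval_sm T0 UG).
have H : smeas (Gat θ) (fun w => leftp (θ w) w).
 apply: (sm_lim cG Hn) => w; apply: leftp_cvg; exact: sth.1.
have [] := @EI_dominated _ _ _ P (fun w => leftp (θ w) w) (fun n w => Nn n (θ w) w)
 (fun w => N (θ w) w) B mB (fun n => sm_meas cG (Hn n)) (sm_meas cG H) (iN _ sth).
- move=> n; apply: aeW => w; rewrite ger0_norm; first exact: Nn_le _ (sth.1 w).
 apply: le_trans (Nn_ge0 w (sth.1 w)) _; apply: Nn_mono => //; exact: sth.1.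
- apply: aeW => w; apply: leftp_cvg; exact: sth.1.
move=> iO cO; split => //; apply: (cvg_unique _ cO) => //.
have mKb : forall n, mfunT (fun w => delay n (θ w) w).
 move=> n; exact: L1_meas (raw_st T0 UG (raw_delay n) sth).
have [] := @EI_dominated _ _ _ P (fun w => before (K ^~ w) (θ w))
 (fun n w => delay n (θ w) w) (fun w => K (θ w) w) B mB mKb
 (L1_meas (before_L1 sth)) (raw_st T0 UG rK sth).
- move=> n; apply: aeW => w; rewrite ger0_norm ?delay_ge0 ?delay_leK//; exact: sth.1.
- apply: aeW => w; apply: delay_cvg; exact: sth.1.
move=> _; apply: cvg_trans; apply: near_eq_cvg; apply: nearW => n.
by have [_ _ _ ->] := pNn n.
Qed.

Let D n t w := N t w - Nn n t w.

Let st_seqlim (th : nat -> Ω -> R) θ : (forall n, st (th n)) ->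
 (forall n w, th n w <= θ w) -> (forall w, 0 <= θ w <= T) ->
 (forall w, th n w @[n --> \oo] --> θ w) -> st θ.
Proof.
move=> sn le thT cth; split => // t tT; have cG := G_csub UG tT.
rewrite (_ : mkset _ = \bigcap_n [set w | th n w <= t]).
 apply: (csub_bigcap cG) => n; exact: st_le.
apply/seteqP; split=> w /=; first by move=> ? n _; apply: le_trans (le n w) _.
move=> H; apply: (EI_cvg_le _ (cth w)) => n; exact: H.
Qed.

(** The gaps [N - Nn n] decrease in [n], so their entrance times [th n] increase to some [θ]. They
    reach it: where they stay strictly below, the gap at [th n] is at least [e], while its mean is
    that of [K (th n) - delay n (th n)], which tends to 0 as both terms approach the left limit of
    [K] at [θ]. *)
Lemma thin_debut q e : 0 <= q <= T -> 0 < e -> exists θ, [/\ st θ,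
 forall w, q <= θ w
 & \forall w \ae P, (θ w < T -> e <= N (θ w) w - leftp (θ w) w) /\
   forall t, q <= t <= T -> e < N t w - leftp t w -> θ w <= t].
Proof.
move=> qT e0; have [aN cN iN eN] := pN.
have aD n : adapted T G (D n).
 by move=> t tT; apply: (smB (G_csub UG tT)); [exact: aN|have [+ _ _ _] := pNn n; exact].
have cD n w : cadlag T (D n ^~ w).
 have [_ c _ _] := pNn n.
 split=> t tT; first by apply: cvgB; [exact: (cN w).1|exact: (c w).1].
 by apply: is_cvgB; [exact: (cN w).2|exact: (c w).2].
pose th n := debut T (D n) q e.
have thq n w : q <= th n w <= T by exact: debut_ge.
have sth n : st (th n) by exact: (@st_debut _ _ _ P T G T0 UG (D n) q e (aD n) (cD n) qT).
have th_mono w : nondecreasing_seq (th ^~ w).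
 apply/nondecreasing_seqP => n; apply: debut_mono => // t tT.
 by rewrite lerD2l lerN2; have /andP[] := NnS n w tT.
have thcvg w : cvg (th n w @[n --> \oo]).
 apply: nondecreasing_is_cvgn (th_mono w) _.
 by exists T => _ [n _ <-]; have /andP[] := thq n w.
pose θ w : R := lim (th n w @[n --> \oo]).
have thle n w : th n w <= θ w by exact: nondecreasing_cvgn_le (th_mono w) (thcvg w) n.
have thT w : q <= θ w <= T.
 apply/andP; split; first by apply: le_trans (thle 0%N w); have /andP[] := thq 0%N w.
 by apply: (EI_cvg_le _ (thcvg w)) => n; have /andP[] := thq n w.
have thT' w : 0 <= θ w <= T.
 by have /andP[? ?] := thT w; have /andP[? ?] := qT; lra.
have sta : st θ by exact: st_seqlim.
exists θ; split => //; first by move=> w; have /andP[] := thT w.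
pose C n := [set w | th n w < θ w].
have GC n : Gat (th n) (C n).
 rewrite (_ : C n = \bigcup_m [set w | th n w < th m w]).
  apply: (csub_bigcup (Gat_csub T0 UG (sth n))) => m.
  exact: (Gat_lt T0 UG (sth n) (sth m)).
 apply/seteqP; split=> w /=.
  move=> lt; apply: contrapT => nex.
  suff : θ w <= th n w by rewrite leNgt => /negP; apply.
  apply: (EI_cvg_le _ (thcvg w)) => m; rewrite leNgt; apply/negP => ?.
  by apply: nex; exists m.
 by move=> [m _  lt]; exact: lt_le_trans lt (thle m w).
have mC n : measurable (C n) by exact: csubm (Gat_csub T0 UG (sth n)) (GC n).
have cvg0 : EI P setT (fun w => \1_(C n) w * (K (th n w) w - delay n (th n w) w))
  @[n --> \oo] --> EI P setT (cst 0).
 have iT := raw_st T0 UG rK (st_cst UG (T_in T0)).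
 have iK n : L1 P (fun w => K (th n w) w - delay n (th n w) w).
  by apply: L1B; [exact: (raw_st T0 UG rK)|exact: (raw_st T0 UG (raw_delay n))].
 have [] // := @EI_dominated _ _ _ P (cst 0)
  (fun n w => \1_(C n) w * (K (th n w) w - delay n (th n w) w)) (K T) setT measurableT.
 - move=> n; apply: (L1_meas (P := P)); exact: L1indic.
 - move=> n; apply: aeW => w; have tT := (sth n).1 w; have /andP[? ?] := tT.
  have := delay_ge0 n w tT; have := delay_leK n w tT.
  have : K (th n w) w <= K T w by exact: nK.
  rewrite indicE; case: (_ \in _); rewrite ?mul1r ?mul0r ?normr0 => *.
   rewrite ger0_norm; lra.
  lra.
 - apply: aeW => w; apply/cvgnP => e1 e10.
  have [[m tm]|neq] := pselect (exists m, th m w = θ w).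
   exists m => n mn; rewrite indicE memNset ?mul0r ?subrr ?normr0//= /C/=.
   rewrite ltNge => /negP; apply; rewrite -tm; exact: th_mono.
  have lt n : th n w < θ w.
   by rewrite lt_neqAle thle andbT; apply/eqP => E; apply: neq; exists n.
  have th0 : 0 < θ w.
   by apply: le_lt_trans (lt 0%N); have /andP[] := (sth 0%N).1 w.
  have thTw : 0 < θ w <= T by rewrite th0; have /andP[] := thT' w.
  have /lcvgP c := cadlag_left (cK w) thTw.
  have [c1 c10 H] := c (e1 / 2) (hgt0 e10).
  have [N1 N1P] := (cvgnP _ _).1 (thcvg w) (minr c1 (θ w) / 2)
   ltac:(by rewrite divr_gt0// lt_min c10).
  have [N2 N2P] := @mesh_small R (minr c1 (θ w) / 2)
   ltac:(by rewrite divr_gt0// lt_min c10).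
  exists (maxn N1 N2) => n; rewrite geq_max => /andP[nN1 nN2].
  have m1 := N1P n nN1; have m2 := @mesh_le R _ _ nN2.
  have ltn := lt n; have m0 := @mesh_gt0 R n.
  have hc1 : minr c1 (θ w) <= c1 by rewrite ge_min lexx.
  have hc2 : minr c1 (θ w) <= θ w by rewrite ge_min lexx orbT.
  move: m1; rewrite ger0_norm ?subr_ge0 ?ltW// -/(θ w) => m1.
  rewrite indicE mem_set// mul1r /delay.
  have -> : (th n w < mesh n) = false by lra.
  have := H (th n w) ltn ltac:(lra); have := H (th n w - mesh n) ltac:(lra) ltac:(lra).
  rewrite !ltr_distlC /cst => /andP[? ?] /andP[? ?]; lra.
have aeth : \forall w \ae P, exists n, th n w = θ w.
 have PC : P (\bigcap_n C n) = 0%E.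
  have mCc : measurable (\bigcap_n C n) by exact: bigcapT_measurable.
  suff : fine (P (\bigcap_n C n)) <= 0.
   move=> h; apply/eqP; rewrite -[X in X == _]fineK ?fin_num_measure// eqe.
   by rewrite eq_le h fine_ge0.
  rewrite EIcst// mul0r in cvg0.
  rewrite -(pmulr_rle0 _ e0); apply: (EI_cvg_ge _ cvg0) => n.
  rewrite EI_indic// setTI.
  have [_ _ i1 E1] := pNn n.
  have GCn := GC n.
  rewrite EIB//; [|exact: (raw_st T0 UG rK)|exact: (raw_st T0 UG (raw_delay n))].
  rewrite -(eN _ _ (sth n) GCn) -(E1 _ _ (sth n) GCn) -EIB//; [|exact: iN|exact: i1].
  apply: (@le_trans _ _ (e * fine (P (C n)))).
   apply: ler_wpM2l; first lra.
   apply: fine_le; rewrite ?fin_num_measure// le_measure ?inE//; exact: bigcap_inf.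
  rewrite -EIcst//; apply: EI_le => //; [exact: L1cst|by apply: L1B; [exact: iN|exact: i1]|].
  move=> w Cw; apply: (debut_val (cD n) qT).
  by apply: lt_le_trans Cw _; have /andP[] := thT w.
 exists (\bigcap_n C n); split => //; first exact: bigcapT_measurable.
 move=> w /= H n _ /=; rewrite /C/= lt_neqAle thle andbT; apply/eqP => E.
 by apply: H; exists n.
apply: filterS aeth => w [n0 E0].
have En n : (n0 <= n)%N -> th n w = θ w.
 move=> n0n; apply/eqP; rewrite eq_le thle -E0; exact: th_mono.
split=> [ltT|t tT eD].
 have cO : N (θ w) w - Nn n (θ w) w @[n --> \oo] -->
   N (θ w) w - leftp (θ w) w.
  by apply: cvgB; [exact: cvg_cst|exact: leftp_cvg].
 apply: (cvgr_to_ge cO); exists n0 => // n /= n0n.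
 have := @debut_val _ _ _ T (D n) q e (cD n) qT w.
 by rewrite -/(th n) En; exact.
have tT' : 0 <= t <= T by lra.
apply: (EI_cvg_le _ (thcvg w)) => n; apply: (debut_le qT tT).
apply: lt_le_trans eD _; rewrite lerD2l lerN2; exact: Nn_leftp.
Qed.

(** The graphs of the stopping times may intersect, and every jump of [K] has to be counted once. *)
Fixpoint distinct (th : nat -> Ω -> R) m (w : Ω) : seq R :=
 if m is m'.+1 then
  if th m' w \in distinct th m' w then distinct th m' w
  else th m' w :: distinct th m' w
 else [::].

Lemma distinct_uniq th m w : uniq (distinct th m w).
Proof. by elim: m => //= m IH; case: ifPn => //= ->. Qed.

Lemma mem_distinct th m w t : t \in distinct th m w <-> exists2 i, (i < m)%N & th i w = t.
Proof.
elim: m => [|m IH] /=; first by split => // -[].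
have [h1 h2] := IH; case: ifPn => [tm|_].
 split=> [/h1[i im E]|[i im E]]; first by exists i => //; exact: ltnW.
 by move: im; rewrite ltnS leq_eqVlt => /predU1P[iE|im]; [rewrite -E iE|apply: h2; exists i].
rewrite inE; split=> [/predU1P[->|/h1[i im E]]|[i im E]]; [by exists m|by exists i => //; exact: ltnW|].
move: im; rewrite ltnS leq_eqVlt => /predU1P[iE|im]; first by rewrite -E iE eqxx.
by apply/orP; right; apply: h2; exists i.
Qed.

Section distinct_times.
Context (th : nat -> Ω -> R)
 (sth : forall n, st (th n)).

(** Whether [τ] coincides with another stopping time is known at [τ]. *)
Lemma Gat_fresh m τ : st τ -> Gat τ [set w | τ w \notin distinct th m w].
Proof.
move=> sta; have cG := Gat_csub T0 UG sta; elim: m => [|m IH].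
 by rewrite (_ : mkset _ = setT); [exact: csubT cG|apply/seteqP; split].
have H : Gat τ ([set w | τ w < th m w] `|` ~` [set w | τ w <= th m w]).
 apply: (csubU cG); first exact: (Gat_lt T0 UG sta (sth m)).
 apply: (csubC cG); exact: (Gat_le T0 UG sta (sth m)).
have := csubI cG IH H; congr Gat; apply/seteqP; split=> w.
 move=> [/negP nt neq]; apply/negP => /mem_distinct[i].
 rewrite ltnS leq_eqVlt => /predU1P[->|im] E.
  by move: neq => /= -[]; rewrite E ?ltxx ?lexx// => /_.
 by apply: nt; apply/mem_distinct; exists i.
move=> /negP nt; split.
 apply/negP => /mem_distinct[i im E]; apply: nt; apply/mem_distinct.
 exists i => //; exact: ltnW.
have neq : th m w != τ w.
 by apply/eqP => E; apply: nt; apply/mem_distinct; exists m.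
by case: (ltgtP (τ w) (th m w)) neq => ?; rewrite ?eqxx//; [left|right; apply/negP; rewrite -ltNge].
Qed.

Lemma distinct_sumS (X : R -> Ω -> R) m w :
 \sum_(t <- distinct th m.+1 w) X t w = \sum_(t <- distinct th m w) X t w +
  \1_[set w | th m w \notin distinct th m w] w * X (th m w) w.
Proof.
rewrite /= indicE; case: ifPn => h.
 by rewrite memNset ?mul0r ?addr0//= h.
by rewrite big_cons mem_set// mul1r addrC.
Qed.

Lemma distinct_L1 (X : R -> Ω -> R) m : (forall n, L1 P (fun w => X (th n w) w)) ->
 L1 P (fun w => \sum_(t <- distinct th m w) X t w).
Proof.
move=> iX; elim: m => [|m IH].
 under eq_fun do rewrite big_nil; exact: L1cst.
under eq_fun do rewrite distinct_sumS; apply: L1D => //; apply: L1indic => //.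
exact: csubm (Gat_csub T0 UG (sth m)) (Gat_fresh m (sth m)).
Qed.

Lemma distinct_EI (X Y : R -> Ω -> R) m : (forall n, L1 P (fun w => X (th n w) w)) ->
 (forall n, L1 P (fun w => Y (th n w) w)) ->
 (forall n B, Gat (th n) B ->
   EI P B (fun w => X (th n w) w) = EI P B (fun w => Y (th n w) w)) ->
 EI P setT (fun w => \sum_(t <- distinct th m w) X t w) =
 EI P setT (fun w => \sum_(t <- distinct th m w) Y t w).
Proof.
move=> iX iY XY; elim: m => [|m IH].
 by apply: eq_EI => w _; rewrite !big_nil.
have GF := Gat_fresh m (sth m); have mF := csubm (Gat_csub T0 UG (sth m)) GF.
have E Z : (forall n, L1 P (fun w => Z (th n w) w)) ->
  EI P setT (fun w => \sum_(t <- distinct th m.+1 w) Z t w) =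
  EI P setT (fun w => \sum_(t <- distinct th m w) Z t w) +
  EI P [set w | th m w \notin distinct th m w] (fun w => Z (th m w) w).
 move=> iZ; under eq_fun do rewrite distinct_sumS.
 rewrite EID//; [by rewrite EI_indic// setTI|exact: distinct_L1|exact: L1indic].
by rewrite !E// IH XY.
Qed.

(** At stopping times the gap has the same mean as the jump of [K], and the jumps of [K] at distinct
    times add up to at most [K T]. *)
Lemma distinct_bound : \forall w \ae P, exists C : R, forall m,
 \sum_(t <- distinct th m w) (N t w - leftp t w) <= C.
Proof.
have [aN cN iN eN] := pN.
pose D' t w := N t w - leftp t w.
have iO n : L1 P (fun w => leftp (th n w) w).
 by have [] := leftp_EI (sth n) (csubT (Gat_csub T0 UG (sth n))).
have iD n : L1 P (fun w => D' (th n w) w) by apply: L1B; meas.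
have iJ n : L1 P (fun w => K (th n w) w - before (K ^~ w) (th n w)).
 by apply: L1B; [exact: (raw_st T0 UG rK)|exact: before_L1].
have dT m w t : t \in distinct th m w -> 0 <= t <= T.
 by move=> /mem_distinct[i _ <-]; exact: (sth i).1.
have D0 m w : 0 <= \sum_(t <- distinct th m w) D' t w.
 rewrite big_seq sumr_ge0// => t /dT tT.
 by rewrite subr_ge0; have /andP[] := leftp_bounds w tT.
have mD m : mfunT (fun w => \sum_(t <- distinct th m w) D' t w).
 apply: (L1_meas (P := P)); exact: distinct_L1.
have iT := raw_st T0 UG rK (st_cst UG (T_in T0)).
have mean m : EI P setT (fun w => \sum_(t <- distinct th m w) D' t w) <= EI P setT (K T).
 rewrite (@distinct_EI D' (fun t w => K t w - before (K ^~ w) t) m)//.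
  apply: EI_le => //; first by apply: distinct_L1.
  move=> w _; apply: jumps_le => //; first exact: distinct_uniq.
  move=> q; exact: dT.
 move=> n B GB; have mB := csubm (Gat_csub T0 UG (sth n)) GB.
 have [_ _ EO] := leftp_EI (sth n) GB.
 rewrite [RHS](EIB mB (raw_st T0 UG rK (sth n)) (before_L1 (sth n))) -EO -eN//.
 rewrite -EIB//; exact: iN.
have := @ae_bounded_events _ _ _ P
 (fun M m => [set w | M%:R < \sum_(t <- distinct th m w) D' t w]) (EI P setT (K T)).
have H1 M m : measurable [set w | M%:R < \sum_(t <- distinct th m w) D' t w] by meas.
move=> /(_ H1); have H2 (M m : nat) :
  [set w | (M%:R : R) < \sum_(t <- distinct th m w) D' t w] `<=`
  [set w | M%:R < \sum_(t <- distinct th m.+1 w) D' t w].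
 move=> w  /lt_le_trans; apply; rewrite distinct_sumS lerDl mulr_ge0//.
 by rewrite subr_ge0; have /andP[] := leftp_bounds w ((sth m).1 w).
move=> /(_ H2) H; apply: filterS (H _) => [w [M MP]|M m].
 exists M%:R => m; rewrite leNgt; apply/negP; exact: MP.
apply: le_trans (mean m); rewrite -EIcst//.
apply: (@le_trans _ _ (EI P [set w | M%:R < \sum_(t <- distinct th m w) D' t w]
  (fun w => \sum_(t <- distinct th m w) D' t w))).
 by apply: EI_le => //; [exact: L1cst|exact: distinct_L1|move=> w /ltW].
apply: EI_subset => //; exact: distinct_L1.
Qed.

End distinct_times.

(** The family consists of the entrance times above [mesh k] after each grid point. If a time [t]
    with a larger gap were missed, every grid point [q < t] would have a member of the family in
    [[q, t[] with a gap of at least [mesh k]; infinitely many of them contradict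
    [distinct_bound]. *)
Lemma leftp_gap : exists2 th : nat -> Ω -> R, forall n, st (th n) &
 \forall w \ae P, summable_gap T (N ^~ w) (leftp ^~ w) /\
  forall t, 0 <= t <= T -> leftp t w < N t w -> exists n, th n w = t.
Proof.
have qin (i : nat * nat) : 0 <= nth T (gridl T i.1) i.2 <= T.
 case: (ltnP i.2 (size (gridl T i.1))) => h; last by rewrite nth_default//; exact: T_in.
 apply: (gridl_in T0 (n := i.1)); exact: mem_nth.
have /choice[th thP] : forall i : (nat * nat) * nat, exists θ, [/\ st θ,
 forall w, nth T (gridl T i.1.1) i.1.2 <= θ w
 & \forall w \ae P, (θ w < T -> mesh i.2 <= N (θ w) w - leftp (θ w) w) /\
   forall t, nth T (gridl T i.1.1) i.1.2 <= t <= T ->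
    mesh i.2 < N t w - leftp t w -> θ w <= t].
 move=> i; apply: thin_debut => //; exact: mesh_gt0.
pose ths n := if unpickle n is Some i then th i else cst T.
have sths n : st (ths n).
 by rewrite /ths; case: unpickle => [i|]; [have [] := thP i|exact: (st_cst UG (T_in T0))].
have thsE i : ths (pickle i) = th i by rewrite /ths pickleK.
have ae1 := ae_count (fun i => let: And3 _ _ h := thP i in h).
exists ths => //; apply: filterS2 ae1 (distinct_bound sths) => w H [C CP].
pose D' t := N t w - leftp t w.
have D0 t : 0 <= t <= T -> 0 <= D' t.
 by move=> tT; rewrite subr_ge0; have /andP[] := leftp_bounds w tT.
have dT m t : t \in distinct ths m w -> 0 <= t <= T.
 by move=> /mem_distinct[i _ <-]; exact: (sths i).1.
have cover (l : seq R) : (forall t, t \in l -> exists i, th i w = t) -> uniq l ->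
  \sum_(t <- l) D' t <= C.
 move=> lt ul.
 have [m lm] : exists m, forall t, t \in l -> t \in distinct ths m w.
  elim: l lt {ul} => [|t l IH] lt; first by exists 0%N.
  have [i it] := lt t (mem_head _ _).
  have [m mP] := IH (fun r rl => lt r ltac:(by rewrite inE rl orbT)).
  exists (maxn m (pickle i).+1) => r; rewrite inE => /predU1P[->|/mP/mem_distinct[j jm E]].
   by apply/mem_distinct; exists (pickle i); [rewrite leq_max ltnSn orbT|rewrite thsE].
  by apply/mem_distinct; exists j => //; rewrite leq_max jm.
 apply: le_trans (CP m).
 have pl : perm_eq l [seq t <- distinct ths m w | t \in l].
  apply: uniq_perm => //; first by rewrite filter_uniq// distinct_uniq.
  by move=> t; rewrite mem_filter; case: (boolP (t \in l)) => // /lm ->.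
 rewrite (perm_big _ pl) big_filter [leRHS](bigID (fun t => t \in l))/= lerDl.
 by rewrite big_seq_cond sumr_ge0// => t /andP[/dT tT _]; exact: D0.
have inth t : 0 <= t <= T -> 0 < D' t -> exists i, th i w = t.
 move=> tT Dt; have [k ke] := mesh_small Dt.
 have fromq q : grid T q -> q <= t -> exists i, [/\ q <= th i w, th i w <= t
   & th i w < T -> mesh k <= D' (th i w)].
  move=> [n qn] qt; exists (n, index q (gridl T n), k).
  have [_ h1 _] := thP (n, index q (gridl T n), k).
  have [h2 h3] := H (n, index q (gridl T n), k).
  move: h1 h2 h3; rewrite /= nth_index// => h1 h2 h3; split => //.
  by apply: h3 => //; rewrite qt; have /andP[] := tT.
 have /andP[t0 tT'] := tT; apply: contrapT => nt.
 have lt q : grid T q -> q <= t -> exists i, [/\ q <= th i w, th i w < t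
   & mesh k <= D' (th i w)].
  move=> gq qt; have [i [h1 h2 h3]] := fromq q gq qt; exists i.
  have lt : th i w < t.
   by rewrite lt_neqAle h2 andbT; apply/eqP => E; apply: nt; exists i.
  split => //; apply: h3; exact: lt_le_trans lt tT'.
 have g0 : grid T 0.
  exists 0%N; apply/(gridlP T0); right; exists 0%N => //; lra.
 have tpos : 0 < t.
  have [i [h1 h2 _]] := lt 0 g0 t0; lra.
 have L (n : nat) : exists l, [/\ size l = n, uniq l,
   exists2 b, 0 <= b < t & forall r, r \in l -> r <= b
   & forall r, r \in l -> (exists i, th i w = r) /\ mesh k <= D' r].
  elim: n => [|n [l [sl ul [b /andP[b0 bt] bl] lP]]].
   by exists [::]; split => //; exists 0; rewrite ?lexx.
  have [q [gq bq qt]] := @grid_dense R T T0 b (t - b) b0 ltac:(lra) ltac:(lra).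
  have [i [h1 h2 h3]] := lt q gq ltac:(lra).
  exists (th i w :: l); split => /=; first by rewrite sl.
  - rewrite ul andbT; apply/negP => /bl; lra.
  - exists (th i w); first lra.
   move=> r; rewrite inE => /predU1P[->//|/bl]; lra.
  - move=> r; rewrite inE => /predU1P[->|/lP//]; split => //; by exists i.
 have [l [sl ul _ lP]] := L (Num.trunc (C / mesh k)).+1.
 have := cover l (fun r rl => (lP r rl).1) ul; rewrite leNgt => /negP; apply.
 apply: (@lt_le_trans _ _ (\sum_(q <- l) mesh k)); last first.
  by rewrite !big_seq; apply: ler_sum => q /lP[].
 rewrite big_const_seq iter_addr_0 count_predT sl -mulr_natr mulrC -ltr_pdivrMr ?mesh_gt0//.
 exact: truncnS_gt.
split; last first.
 move=> t tT lt; have [|i it] := inth t tT; first by rewrite subr_gt0.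
 by exists (pickle i); rewrite thsE.
exists C => l ul lT; rewrite (bigID (fun t => 0 < D' t))/= -[leLHS]addrC -[leRHS]add0r; apply: lerD.
 rewrite big_seq_cond big1// => t /andP[/lT tT]; rewrite -leNgt => h.
 by apply/eqP; rewrite eq_le h D0.
rewrite -big_filter; apply: cover; last exact: filter_uniq.
move=> t; rewrite mem_filter => /andP[h /lT tT]; exact: inth.
Qed.

End thin_set.

Definition is_leftproj (N O : R -> Ω -> R) :=
 [/\ is_proj K N,
  exists2 Nn : nat -> R -> Ω -> R, forall n, is_proj (delay n) (Nn n)
   & forall t w, 0 <= t <= T -> Nn n t w @[n --> \oo] --> O t w,
  forall θ, st θ -> [/\ smeas (Gat θ) (fun w => O (θ w) w),
   L1 P (fun w => O (θ w) w)
   & forall B, Gat θ B -> EI P B (fun w => O (θ w) w) =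
     EI P B (fun w => before (K ^~ w) (θ w))],
  forall t w, 0 <= t <= T -> 0 <= O t w <= N t w
 & exists2 th : nat -> Ω -> R, forall n, st (th n) &
   \forall w \ae P, summable_gap T (N ^~ w) (O ^~ w) /\
    forall t, 0 <= t <= T -> O t w < N t w -> exists n, th n w = t].

Theorem left_projection : exists N O, is_leftproj N O.
Proof.
have [N [Nn [pN pNn N0 NS]]] := nested_proj.
exists N, (leftp Nn); split => //.
- exists Nn => // t w tT; exact: (leftp_cvg NS).
- move=> θ sth.
 have [H i _] := leftp_EI pN pNn N0 NS sth (csubT (Gat_csub T0 UG sth)).
 split => // B GB; by have [] := leftp_EI pN pNn N0 NS sth GB.
- move=> t w tT; exact: leftp_bounds.
- exact: leftp_gap.
Qed.

End left_projection.

(** * Fubini's theorem for dominated functions *)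

Section fubini.
Context {R : realType} {d1 d2 : measure_display} {S1 : measurableType d1}
 {S2 : measurableType d2}.
Variables (Q1 : probability S1 R) (Q2 : probability S2 R).

Lemma measurable_slice1 (X : S1 -> S2 -> R) w :
 mfunT (fun p : S1 * S2 => X p.1 p.2) -> mfunT (X ^~ w).
Proof.
move=> mX; rewrite (_ : X ^~ w = (fun p : S1 * S2 => X p.1 p.2) \o (fun z => (z, w)))//.
exact: mcomp.
Qed.

Lemma measurable_slice2 (X : S1 -> S2 -> R) z :
 mfunT (fun p : S1 * S2 => X p.1 p.2) -> mfunT (X z).
Proof.
move=> mX; rewrite (_ : X z = (fun p : S1 * S2 => X p.1 p.2) \o (fun w => (z, w)))//.
apply: mcomp => //; exact: measurable_pair1.
Qed.

Lemma fubini_integrable (X : S1 -> S2 -> R) (Xi : S2 -> R) :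
 mfunT (fun p : S1 * S2 => X p.1 p.2) ->
 (forall z w, `|X z w| <= Xi w) -> L1 Q2 Xi ->
 (Q1 \x Q2)%E.-integrable setT (fun p : S1 * S2 => (X p.1 p.2)%:E).
Proof.
move=> mX XXi iXi.
have mE : mfunT (fun p : S1 * S2 => (X p.1 p.2)%:E) by meas.
apply/(integrable12ltyP Q1 Q2 mE).
apply: (@le_lt_trans _ _ (\int[Q1]_z (EI Q2 setT Xi)%:E)%E).
 apply: ge0_le_integral => //.
 - move=> z _; exact: integral_ge0.
 - apply: (@measurable_fun_fubini_tonelli_F _ _ _ _ _ Q2 (fun p => `|(X p.1 p.2)%:E|%E)) => //.
  exact: mcomp.
 - move=> z _; rewrite EIE//; apply: ge0_le_integral => //.
  + apply: mcomp => //; exact/measurable_EFinP/measurable_slice2.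
  + meas.
  + by move=> w _; rewrite abse_EFin lee_fin.
by rewrite -(EIE measurableT (L1cst Q1 _)) ltry.
Qed.

Lemma fubini_dom (X : S1 -> S2 -> R) (Xi : S2 -> R) :
 mfunT (fun p : S1 * S2 => X p.1 p.2) ->
 (forall z w, `|X z w| <= Xi w) -> L1 Q2 Xi ->
 [/\ forall w, L1 Q1 (X ^~ w), forall z, L1 Q2 (X z),
  L1 Q2 (fun w => EI Q1 setT (X ^~ w)), L1 Q1 (fun z => EI Q2 setT (X z))
 & EI Q2 setT (fun w => EI Q1 setT (X ^~ w)) = EI Q1 setT (fun z => EI Q2 setT (X z))].
Proof.
move=> mX XXi iXi; have iX := fubini_integrable mX XXi iXi.
have i1 w : L1 Q1 (X ^~ w) by apply: (L1bound Q1 (measurable_slice1 w mX)).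
have i2 z : L1 Q2 (X z) by apply: le_L1 iXi => //; exact: measurable_slice2.
have F1 := integrable_fubini_F iX; have F2 := measurable_fubini_G iX.
have E1 w : EFin (EI Q1 setT (X ^~ w)) = (\int[Q1]_z (X z w)%:E)%E by rewrite EIE.
have E2 z : EFin (EI Q2 setT (X z)) = (\int[Q2]_w (X z w)%:E)%E by rewrite EIE.
have iE1 : L1 Q2 (fun w => EI Q1 setT (X ^~ w)).
 apply: le_L1 iXi.
  apply/measurable_EFinP; rewrite (_ : EFin \o _ = fun w => (\int[Q1]_z (X z w)%:E)%E)//.
  by apply/funext => w /=; rewrite E1.
 move=> w; apply: le_trans (EI_abs measurableT (i1 w)) _.
 have P1 : fine (Q1 setT) = 1 by rewrite (probability_setT Q1).
 by rewrite -[leRHS]mulr1 -P1 -EIcst//; apply: EI_le => //; [exact: L1norm|exact: L1cst].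
have iE2 : L1 Q1 (fun z => EI Q2 setT (X z)).
 rewrite /L1 (_ : EFin \o _ = fun z => (\int[Q2]_w (X z w)%:E)%E)//.
 by apply/funext => z /=; rewrite E2.
split => //; apply: EFin_inj; rewrite EIE// EIE//.
under eq_integral do rewrite E1; under [RHS]eq_integral do rewrite E2.
by rewrite -(Fubini iX).
Qed.

Lemma fubini_dom_set (X : S1 -> S2 -> R) (Xi : S2 -> R) B :
 mfunT (fun p : S1 * S2 => X p.1 p.2) ->
 (forall z w, `|X z w| <= Xi w) -> L1 Q2 Xi -> measurable B ->
 L1 Q1 (fun z => EI Q2 B (X z)) /\
 EI Q2 B (fun w => EI Q1 setT (X ^~ w)) = EI Q1 setT (fun z => EI Q2 B (X z)).
Proof.
move=> mX XXi iXi mB.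
have mX' : mfunT (fun p : S1 * S2 => \1_B p.2 * X p.1 p.2).
 apply: mfunM => //; apply: mcomp => //; exact: measurable_indic.
have b z w : `|\1_B w * X z w| <= Xi w.
 rewrite indicE; case: (_ \in _); rewrite ?mul1r ?mul0r ?normr0//.
 exact: le_trans (XXi z w).
have [i1 i2 i3 i4 E] := fubini_dom mX' b iXi.
have [j1 _ _ _ _] := fubini_dom mX XXi iXi.
have EB z : EI Q2 setT (fun w => \1_B w * X z w) = EI Q2 B (X z).
 by rewrite EI_indic// setTI.
split; first by under eq_fun do rewrite -EB.
under [RHS]eq_EI do rewrite -EB; rewrite -E.
rewrite -[in LHS](setTI B) -EI_indic//.
by apply: eq_EI => w _; rewrite EIZ.
Qed.

End fubini.

Lemma ae_imp {R : realType} d (S : measurableType d) (Q : probability S R) (A B : S -> Prop) :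
 (\forall w \ae Q, A w) -> (forall w, A w -> B w) -> \forall w \ae Q, B w.
Proof. by move=> h AB; apply: filterS h. Qed.

(** * Boundedness of càdlàg paths and measurability of left limits *)

Section bounded_paths.
Context {R : realType}
 (T : R)
 (T0 : 0 < T).
Implicit Types (x : R -> R) (s t : R).

(** Let [s] be the supremum of the times up to which the path is bounded. The left limit extends the
    bound to [s], and right-continuity would extend it beyond unless [s] is [T]. *)
Lemma cadlag_bounded x : cadlag T x -> exists C : R, forall t, 0 <= t <= T -> `|x t| <= C.
Proof.
move=> [rx lx].
pose A := [set t | 0 <= t <= T /\ exists C : R, forall r, 0 <= r <= t -> `|x r| <= C].
have A0 : A 0.
 split; first by rewrite lexx ltW.
 by exists `|x 0| => r ?; have -> : r = 0 by lra.
have hA : has_sup A.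
 by split; [exists 0|exists T => t [/andP[]]].
pose s := sup A.
have s0 : 0 <= s by exact: sup_upper_bound hA _ A0.
have sT : s <= T by apply: sup_le_ub; [exists 0|move=> t [/andP[]]].
have below : exists C : R, forall r, 0 <= r < s -> `|x r| <= C.
 have [sp|sn] := ltP 0 s; last by exists 0 => r; lra.
 have /cvg_ex[l /lcvgP/(_ 1 ltr01)[c c0 H]] := lx s ltac:(rewrite sp sT//).
 have [t [/andP[t0 tT] [C CP]] ct] := sup_adherent c0 hA.
 exists (maxr C (`|l| + 1)) => r /andP[r0 rs]; rewrite le_max; apply/orP.
 have [rt|tr] := leP r t; first by left; apply: CP; rewrite r0.
 right; have := H r rs ltac:(move: ct tr; rewrite -/s; lra).
 have := ler_distD l (x r) 0; rewrite !subr0 distrC => ? ?; lra.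
have As : exists C : R, forall r, 0 <= r <= s -> `|x r| <= C.
 have [C CP] := below; exists (maxr C `|x s|) => r /andP[r0].
 rewrite le_eqVlt => /predU1P[->|rs]; first by rewrite le_max lexx orbT.
 by rewrite le_max CP// r0.
have [Ts|sltT] := leP T s.
 have [C CP] := As; exists C => t /andP[t0 tT]; apply: CP; rewrite t0/=; lra.
have [C CP] := As.
have /rcvgP/(_ 1 ltr01)[c c0 H] := rx s ltac:(rewrite s0 sltT//).
exfalso; pose t := s + minr c (T - s) / 2.
have m0 : 0 < minr c (T - s) by rewrite lt_min c0/=; lra.
have mc : minr c (T - s) <= c by rewrite ge_min lexx.
have mT : minr c (T - s) <= T - s by rewrite ge_min lexx orbT.
have : A t.
 split; first by rewrite /t; lra.
 exists (maxr C (`|x s| + 1)) => r /andP[r0 rt]; rewrite le_max; apply/orP.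
 have [rs|sr] := leP r s; first by left; apply: CP; rewrite r0.
 right; have := H r sr ltac:(move: rt; rewrite /t; lra).
 have := ler_distD (x s) (x r) 0; rewrite !subr0 distrC => ? ?; lra.
move=> /(sup_upper_bound hA); rewrite -/s /t; lra.
Qed.

Lemma nondec_cadlag x : nondec T x ->
 (forall t, 0 <= t < T -> x s @[s --> t^'+] --> x t) -> cadlag T x.
Proof.
move=> nx rx; split => // t /andP[t0 tT].
pose A := [set x s | s in [set s | 0 <= s < t]].
have hA : has_sup A.
 split; first by exists (x 0), 0; rewrite //= lexx.
 by exists (x T) => _ [s /= /andP[? ?] <-]; apply: nx => //; lra.
apply/cvg_ex; exists (sup A); apply/lcvgP => e e0.
have [_ [s /= /andP[s0 st] <-] lt] := sup_adherent e0 hA.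
exists (t - s); first lra.
move=> r rt sr; have r0 : s <= r by lra.
have : x r <= sup A by apply: sup_upper_bound => //; exists r => //=; lra.
have := nx s r s0 r0 ltac:(lra).
move=> ? ?; rewrite ger0_norm; lra.
Qed.

Lemma meas_before d (S : measurableType d) (X : R -> S -> R) (s : S -> R) :
 (forall t, 0 <= t <= T -> mfunT (X t)) ->
 (forall w, cadlag T (X ^~ w)) -> mfunT s ->
 (forall w, 0 <= s w <= T) -> mfunT (fun w => before (X ^~ w) (s w)).
Proof.
move=> mX cX ms sT.
apply: (@measurable_fun_cvg _ _ _ setT (fun n w => if s w < mesh n then 0
  else X (maxr 0 (s w - mesh n)) w)) => // [n|w _]; last first.
 apply: cvg_trans (before_cvg (cX w) (sT w)); apply: near_eq_cvg; apply: nearW => n.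
 by case: ltP => // h; rewrite max_r// subr_ge0.
apply: measurable_fun_if => //.
- meas.
- apply: measurable_funTS; apply: (meas_eval mX) => //.
 + move=> w t tT; exact: (cX w).1.
 + meas.
 + move=> w; have /andP[? ?] := sT w; have := @mesh_ge0 R n.
  rewrite le_max lexx ge_max (ltW T0)/= => ?; lra.
Qed.

End bounded_paths.

(** * Quantiles of control paths *)

Section qtl.
Context {R : realType}
 (T : R)
 (T0 : 0 < T).
Implicit Types (x : R -> R) (s t z c : R).

Definition unif : probability (mR R) R := uniform_prob (@ltr01 R).

Lemma unif_itv (A : set R) c : measurable A -> 0 <= c ->
 (A `&` `[0, 1]%classic = `[0, c[%classic \/ A `&` `[0, 1]%classic = `[0, c]%classic) ->
 unif A = c%:E.
Proof.
move=> mA c0 Ac; have -> : unif A = uniform_prob (@ltr01 R) A by [].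
rewrite /uniform_prob integral_uniform_pdf.
rewrite (eq_integral (cst 1%E)); last first.
 by move=> z; rewrite inE => -[_ /=]; rewrite in_itv/= /uniform_pdf => ->; rewrite subr0 invr1.
rewrite integral_cst/= ?mul1e; last meas.
case: Ac => ->; rewrite lebesgue_measure_itv/= lte_fin; case: ltP => h; rewrite ?sube0//.
 congr EFin; lra.
congr EFin; lra.
Qed.

Lemma unif_lt c : 0 <= c <= 1 -> unif [set z | z < c] = c%:E.
Proof.
move=> /andP[c0 c1]; apply: unif_itv => //.
 meas.
left; apply/seteqP; split=> z /=; rewrite !in_itv/=; first lra.
lra.
Qed.

Lemma unif_le c : 0 <= c <= 1 -> unif [set z | z <= c] = c%:E.
Proof.
move=> /andP[c0 c1]; apply: unif_itv => //.
 meas.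
right; apply/seteqP; split=> z /=; rewrite !in_itv/=; first lra.
lra.
Qed.

Lemma unif_ge1 : unif (~` [set z : mR R | z < 1]) = 0%E.
Proof.
have m3 : measurable [set z : mR R | z < 1] by meas.
by rewrite (probability_setC unif m3) unif_lt ?lexx ?ler01// subee.
Qed.

Lemma unif_ae : \forall z \ae unif, 0 <= z < 1.
Proof.
have m1 : measurable [set z : R | z < 0] by meas.
have m2 : measurable (~` [set z : R | z < 1]) by meas.
exists ([set z : R | z < 0] `|` ~` [set z : R | z < 1]); split.
- meas.
- have e1 : unif [set z : R | z < 0] = 0%E by rewrite unif_lt// lexx ler01.
 exact: (null_set_setU _ _ e1 unif_ge1).
- move=> z /= nz; case: (ltP z 0) => z0; first lra.
 lra.
Qed.

Definition cpath x := [/\ cadlag T x, nondec T x, 0 <= x 0 & x T = 1].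

(** This is [randomised_time] along one path. For [z >= 1] the set is empty for a control path and
    the value is the default 0; such levels have probability zero. *)
Definition qtl x z := inf [set t | 0 <= t <= T /\ z < x t].

Section path.
Context (x : R -> R)
 (hx : cpath x).
Let cx : cadlag T x. Proof. by have [] := hx. Qed.
Let nx : nondec T x. Proof. by have [] := hx. Qed.
Let x0 : 0 <= x 0. Proof. by have [] := hx. Qed.
Let xT : x T = 1. Proof. by have [] := hx. Qed.

Lemma cpath01 t : 0 <= t <= T -> 0 <= x t <= 1.
Proof.
move=> /andP[t0 tT]; rewrite -xT nx// andbT; apply: le_trans x0 _; exact: nx.
Qed.

Lemma cpath_before t : 0 <= t <= T -> 0 <= before x t <= 1.
Proof.
move=> tT; rewrite (before_ge0 cx nx x0 tT)/=.
by apply: le_trans (before_le cx nx x0 tT) _; have /andP[] := cpath01 tT.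
Qed.

Let A z := [set t | 0 <= t <= T /\ z < x t].
Let hA z : z < 1 -> has_inf (A z).
Proof.
move=> z1; split; first by exists T; split; [rewrite lexx ltW|rewrite xT].
by exists 0 => t [/andP[]].
Qed.

Lemma qtl_in z : 0 <= qtl x z <= T.
Proof.
have [z1|z1] := ltP z 1.
 apply/andP; split; first by apply: lb_le_inf; [exact: (hA z1).1|move=> t [/andP[]]].
 by apply: ge_inf; [exact: (hA z1).2|split; [rewrite lexx ltW|rewrite xT]].
rewrite /qtl (_ : mkset _ = set0) ?inf0 ?lexx ?ltW//.
apply/seteqP; split => // t [/cpath01/andP[_ ?] ?]; lra.
Qed.

Lemma quantile_le z t : 0 <= t <= T -> z < x t -> qtl x z <= t.
Proof.
move=> tT zt; apply: ge_inf; last by [].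
by exists 0 => r [/andP[]].
Qed.

(** The left limit tells whether the level is exceeded strictly before [t]; this is what makes
    quantiles of an adapted control stopping times. *)
Lemma qtl_lt z t : z < 1 -> 0 < t -> t <= T -> (qtl x z < t) = (z < before x t).
Proof.
move=> z1 t0 tT; apply/idP/idP.
 move=> /(inf_lt (hA z1).1)[s [/andP[s0 sT] zs] st].
 exact: lt_le_trans zs (le_before cx nx s0 st tT).
have tT' : 0 < t <= T by lra.
move=> zb; have c := cadlag_left cx tT'.
have /lcvgP/(_ (before x t - z) ltac:(lra))[e e0 H] := c.
pose s := t - minr e t / 2.
have m0 : 0 < minr e t by rewrite lt_min e0.
have me : minr e t <= e by rewrite ge_min lexx.
have mt : minr e t <= t by rewrite ge_min lexx orbT.
have sst : s < t by rewrite /s; lra.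
have := H s sst ltac:(rewrite /s; lra); rewrite ltr_distlC => /andP[h _].
apply: le_lt_trans (quantile_le _ _) sst; first by rewrite /s; lra.
lra.
Qed.

Lemma qtl_ge z t : z < 1 -> 0 <= z -> 0 <= t <= T ->
 (t <= qtl x z) = (before x t <= z).
Proof.
move=> z1 z0 /andP[t0 tT]; have [t0'|t0'] := ltP 0 t.
 by rewrite leNgt qtl_lt// -leNgt.
have -> : t = 0 by lra.
by rewrite /before lexx z0; have /andP[] := qtl_in z.
Qed.

Lemma le_quantile z t : z < 1 -> 0 <= t <= T -> qtl x z <= t -> z <= x t.
Proof.
move=> z1 /andP[t0 tT] qt; have [TT|tlt] := leP T t.
 have -> : t = T by lra.
 by rewrite xT ltW.
rewrite leNgt; apply/negP => xz.
have /rcvgP/(_ (z - x t) ltac:(lra))[c c0 H] := cx.1 t ltac:(rewrite t0 tlt//).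
have qlt : inf (A z) < minr T (t + c).
 apply: le_lt_trans qt _; rewrite lt_min tlt/=; lra.
have [s [/andP[s0 sT] zs]] := inf_lt (hA z1).1 qlt.
rewrite lt_min => /andP[sltT sc].
have [ts|st] := ltP t s.
 have := H s ts sc; rewrite ltr_distlC; lra.
have := nx s0 st tT; lra.
Qed.

Lemma quantile_jump z t : 0 <= t <= T -> 0 <= z < 1 -> before x t <= z -> z < x t ->
 qtl x z = t.
Proof.
move=> tT /andP[z0 z1] h1 h2; apply/eqP; rewrite eq_le quantile_le//=.
by rewrite qtl_ge.
Qed.

Lemma cpath_ext_nd : nondecreasing (path_ext T x).
Proof.
move=> s t st; rewrite /path_ext; have T0' := ltW T0.
have mT r : 0 <= r -> 0 <= minr r T <= T.
 by move=> r0; rewrite le_min r0 T0' ge_min lexx orbT.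
case: ltP => s0; case: ltP => t0 //; first by have /andP[] := cpath01 (mT t t0).
 lra.
apply: nx; [by have /andP[] := mT s s0| |by have /andP[] := mT t t0].
by rewrite le_min !ge_min lexx st orbT.
Qed.

Lemma cpath_ext_rc : right_continuous (path_ext T x).
Proof.
move=> t; rewrite /path_ext; apply/rcvgP => e e0.
case: ltP => t0.
 exists (- t); first lra.
 move=> r tr rt; have -> : r < 0 by lra.
 by rewrite subrr normr0.
have [tT|Tt] := ltP t T.
 have /rcvgP/(_ e e0)[c c0 H] := cx.1 t ltac:(rewrite t0 tT//).
 exists (minr c (T - t)); first by rewrite lt_min c0/=; lra.
 move=> r tr; rewrite -ltrBlDl lt_min => /andP[rc rT].
 have -> : (r < 0) = false by lra.
 rewrite min_l; last lra.
 apply: H; lra.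
exists 1 => // r tr _; have -> : (r < 0) = false by apply/negbTE; rewrite -leNgt; lra.
rewrite !min_r ?subrr ?normr0//; lra.
Qed.

End path.

Lemma meas_qtl d (S : measurableType d) (X : R -> S -> R) (Z : S -> R) :
 (forall t, 0 <= t <= T -> mfunT (X t)) ->
 (forall w, cpath (X ^~ w)) -> mfunT Z ->
 mfunT (fun w => qtl (X ^~ w) (Z w)).
Proof.
move=> mX hX mZ; apply: (measurability _ (RGenInftyO.measurableE R)) => _ [_ [s ->] <-].
rewrite setTI; have [s0|s0] := leP s 0.
 rewrite (_ : _ @^-1` _ = set0)//; apply/seteqP; split => // w /=.
 rewrite in_itv/=; have /andP[] := qtl_in (hX w) (Z w); lra.
have [sT|Ts] := leP s T; last first.
 rewrite (_ : _ @^-1` _ = setT)//; apply/seteqP; split => // w _ /=.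
 rewrite in_itv/=; have /andP[] := qtl_in (hX w) (Z w); lra.
have sT' : 0 <= s <= T by lra.
have mb : mfunT (fun w => before (X ^~ w) s).
 apply: (meas_before T0 mX (s := cst s)) => //.
 by move=> w; have [] := hX w.
rewrite (_ : _ @^-1` _ = [set w | Z w < before (X ^~ w) s] `|` ~` [set w | Z w < 1]).
 apply: measurableU; first meas.
 meas.
apply/seteqP; split=> w /=; rewrite in_itv/=.
 case: (ltP (Z w) 1) => z1; last lra.
 by rewrite (qtl_lt (hX w))//; left.
move=> [zb|/negP]; last rewrite -leNgt => z1.
 rewrite (qtl_lt (hX w))//.
 by have /andP[_ b1] := cpath_before (hX w) sT'; lra.
rewrite /qtl (_ : mkset _ = set0) ?inf0//.
apply/seteqP; split => // t [/(cpath01 (hX w))/andP[_ ?] ?]; lra.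
Qed.

Lemma meas_qtl1 x : cpath x ->
 mfunT (qtl x : mR R -> R).
Proof.
move=> hx; apply: (@meas_qtl _ (mR R) (fun t _ => x t) id) => //.
Qed.

(** Up to levels outside [0, 1[, the event lies between [z < x b] and [z <= x b], which have the
    same probability. *)
Lemma law_quantile x b : cpath x -> unif [set z | qtl x z <= b] = (path_ext T x b)%:E.
Proof.
move=> hx; have mq : measurable [set z : mR R | qtl x z <= b].
 apply: meas_le => //; exact: meas_qtl1.
rewrite /path_ext; case: ltP => b0.
 rewrite [X in unif X](_ : _ = set0) ?measure0//; apply/seteqP; split => // z /=.
 by have /andP[] := qtl_in hx z; lra.
have bT : 0 <= minr b T <= T by rewrite le_min b0 (ltW T0) ge_min lexx orbT.
rewrite -(unif_le (cpath01 hx bT)); apply/le_anti/andP; split.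
 have mm : measurable [set z : mR R | z <= x (minr b T)] by meas.
 have m3 : measurable [set z : mR R | z < 1] by meas.
 have m1 := measurableC m3.
 apply: (@le_trans _ _ (unif ([set z | z <= x (minr b T)] `|` ~` [set z : R | z < 1]))).
  apply: le_measure; rewrite ?inE//; first meas.
  move=> z /= qb; case: (ltP z 1) => z1; last lra.
  left; apply: (le_quantile hx) => //; rewrite le_min qb; by have /andP[] := qtl_in hx z.
 apply: le_trans (measureU2 _ mm m1) _.
 by rewrite [X in (_ + X)%E](_ : _ = 0%E) ?adde0//; exact: unif_ge1.
rewrite unif_le ?cpath01// -(unif_lt (cpath01 hx bT)); apply: le_measure; rewrite ?inE//.
 meas.
move=> z /= /(quantile_le bT) h; apply: le_trans h _; by rewrite ge_min lexx.
Qed.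

(** The distribution function determines the measure. It is applied to the law of a quantile and,
    for truncated controls, to a restriction of that law, rescaled. *)
Lemma stieltjes_law (cf : cumulative R R)
  (mu : {measure set (mR R) -> \bar R}) (A : set (mR R)) :
 (forall b, mu [set r | r <= b] = (cf b)%:E) -> measurable A ->
 lebesgue_stieltjes_measure cf A = mu A.
Proof.
move=> H mA; apply: (@lebesgue_stieltjes_measure_unique R cf mu _ A mA).
move=> _ [[a b] /= _ <-].
rewrite /lebesgue_stieltjes_measure /measure_extension/=.
rewrite measurable_mu_extE/=; last exact: is_ocitv.
have [ab | ba] := leP a b; last first.
 by rewrite set_itv_ge ?wlength0 ?measure0// bnd_simp -leNgt ltW.
rewrite wlength_itv_bnd// EFinB -!H.
have mc c : measurable [set z : mR R | z <= c] by meas.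
have fin : (mu [set r | (r <= b)%R] < +oo)%E by rewrite H ltry.
transitivity (mu ([set r | r <= b] `\` [set r | r <= a])).
 rewrite measureD// ?setIidr//.
 move=> r /= ra; exact: le_trans ra ab.
congr (mu _); apply/seteqP; split=> z /=; rewrite in_itv/=.
 lra.
lra.
Qed.

Lemma quantile_mfun x : cpath x ->
 (qtl x : mR R -> mR R) \in mfun.
Proof. move=> hx; rewrite inE; exact: meas_qtl1. Qed.

Lemma dmeas_law x (hx : cpath x) (A : set (mR R)) : measurable A ->
 dmeas T x A = distribution unif (mfun_Sub (quantile_mfun hx)) A.
Proof.
move=> mA; rewrite /dmeas; case: pselect => [xP|[]]; last first.
 by split; [exact: (cpath_ext_nd hx)|exact: (cpath_ext_rc hx)].
apply: (stieltjes_law (mu := distribution unif (mfun_Sub (quantile_mfun hx)))) => // b; exact: law_quantile.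
Qed.

(* Integrals against the measure of a control path are averages over the
  randomisation device. *)
Lemma dmeas_int x (D : set (mR R)) (φ : R -> R) : cpath x -> measurable D ->
 mfunT (φ : mR R -> R) ->
 L1 unif (fun z => φ (qtl x z)) ->
 (\int[dmeas T x]_(t in D) φ t)%R =
 EI unif (qtl x @^-1` D) (fun z => φ (qtl x z)).
Proof.
move=> hx mD mphi iphi.
rewrite /EI /Rintegral; congr fine.
apply: (etrans (eq_measure_integral (distribution unif (mfun_Sub (quantile_mfun hx))) _)).
 move=> A mA _; exact: (dmeas_law hx).
apply: (@integral_pushforward _ _ _ _ _ _ (measurable_funP (mfun_Sub (quantile_mfun hx))) unif D (EFin \o φ)) => //.
- meas.
- apply: (@integrableS _ _ _ unif setT) => //.
 meas.
Qed.

End qtl.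

(** * Integrals against a rescaled measure *)

Section scaled_measure.
Context {R : realType} {d : measure_display} {S : measurableType d}.
Local Open Scope ereal_scope.

Lemma integral_mscale_real (m : {measure set S -> \bar R}) (k : {nonneg R}) (D : set S)
  (a : S -> R) : measurable D -> m.-integrable D (EFin \o a) ->
 \int[mscale k m]_(t in D) (a t)%:E = k%:num%:E * \int[m]_(t in D) (a t)%:E.
Proof.
move=> mD iD; have mE := measurable_int _ iD.
have p : \int[mscale k m]_(t in D) (EFin \o a)^\+ t = k%:num%:E * \int[m]_(t in D) (EFin \o a)^\+ t.
 rewrite ge0_integral_mscale//; exact: measurable_funepos.
have n : \int[mscale k m]_(t in D) (EFin \o a)^\- t = k%:num%:E * \int[m]_(t in D) (EFin \o a)^\- t.
 rewrite ge0_integral_mscale//; exact: measurable_funeneg.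
rewrite [LHS]integralE p n -muleBr//.
 by rewrite [in RHS]integralE.
rewrite fin_num_adde_defl// fin_numN; exact: integrable_neg_fin_num.
Qed.

End scaled_measure.

Lemma maxr_posneg {R : realType} (a : R) : maxr 0 (1 * a) - maxr 0 (-1 * a) = a.
Proof.
rewrite mul1r mulN1r; case: leP => a0.
 rewrite max_l; lra.
rewrite max_r; lra.
Qed.

Lemma indic_between {R : realType} (a b z : R) : a <= b ->
 ((a <= z)%R && (z < b)%R)%:R = (z < b)%R%:R - (z < a)%R%:R :> R.
Proof.
move=> ab; case: ltP => h1; case: ltP => h2 /=; rewrite ?subr0; lra.
Qed.

Lemma EI_affine {R : realType} d (S : measurableType d) (P : probability S R)
  (X : S -> R) (c k : R) : L1 P X ->
 (EI P setT X - c) * k = EI P setT (fun w => (X w - c) * k).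
Proof.
move=> iX; have cE : EI P setT (fun=> c) = c by rewrite EIcst// probability_setT mulr1.
rewrite -[X in (_ - X) * _]cE -EIB//; last meas.
rewrite mulrC -EIZ//; last meas.
by apply: eq_EI => w _; rewrite mulrC.
Qed.

Lemma norm_indic_sub {R : realType} (b b' : bool) : `|b%:R - b'%:R| <= 1 :> R.
Proof. by case: b; case: b'; rewrite ?subrr ?subr0 ?sub0r ?normrN ?normr0 ?normr1. Qed.

(** * The game along fixed paths *)

Section path_game.
Context {R : realType}
 (T : R)
 (T0 : 0 < T).
Implicit Types (x y a : R -> R) (s t z c : R).
Notation cpath := (cpath T).
Notation qtl := (qtl T).
Notation u := (@unif R).

Lemma meas_comp_qtl a y : cadlag T a -> cpath y ->
 mfunT (fun z : mR R => a (qtl y z)).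
Proof.
move=> ca hy; apply: (@meas_eval _ _ (mR R) (fun t _ => a t) T) => //.
- move=> _ t tT; exact: ca.1.
- exact: meas_qtl1.
- move=> z; exact: qtl_in.
Qed.

Lemma meas_before_qtl x y : cadlag T x -> cpath y ->
 mfunT (fun z : mR R => before x (qtl y z)).
Proof.
move=> cx hy.
apply: (@meas_before _ T T0 _ (mR R) (fun t _ => x t)) => //.
- exact: meas_qtl1.
- move=> z; exact: qtl_in.
Qed.

Lemma L1_qtl a y : cadlag T a -> cpath y -> L1 u (fun z => a (qtl y z)).
Proof.
move=> ca hy; have [C CP] := cadlag_bounded T0 ca.
apply: (L1bound u (meas_comp_qtl ca hy) (c := C)) => z.
exact/CP/qtl_in.
Qed.

Lemma meas_clip a : cadlag T a ->
 mfunT (fun t : mR R => a (maxr 0 (minr T t))).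
Proof.
move=> ca; apply: (@meas_eval _ _ (mR R) (fun t _ => a t) T) => //.
- move=> _ t tT; exact: ca.1.
- by apply: measurable_maxr; [exact: mcst|apply: measurable_minr; [exact: mcst|exact: measurable_id]].
- move=> t; rewrite le_max lexx/= ge_max ge_min lexx ltW//.
Qed.

Lemma clipE t : 0 <= t <= T -> maxr 0 (minr T t) = t.
Proof. by move=> /andP[t0 tT]; rewrite min_r// max_r. Qed.

Lemma mlt c : measurable [set z : mR R | z < c].
Proof. meas. Qed.

Lemma cadlag1B x : cadlag T x -> cadlag T (fun t => 1 - x t).
Proof.
move=> cx; split=> t tT; first by apply: cvgB; [exact: cvg_cst|exact: cx.1].
by apply: is_cvgB; [exact: is_cvg_cst|exact: cx.2].
Qed.

Lemma cadlagM x y : cadlag T x -> cadlag T y -> cadlag T (fun t => x t * y t).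
Proof.
move=> cx cy; split=> t tT; first by apply: cvgM; [exact: cx.1|exact: cy.1].
by apply: is_cvgM; [exact: cx.2|exact: cy.2].
Qed.

Lemma cadlagD x y : cadlag T x -> cadlag T y -> cadlag T (fun t => x t + y t).
Proof.
move=> cx cy; split=> t tT; first by apply: cvgD; [exact: cx.1|exact: cy.1].
by apply: is_cvgD; [exact: cx.2|exact: cy.2].
Qed.

(* The integral of [a] against [dx], over the times reached by levels below [c]. *)
Definition lint x a c : R :=
 EI u setT (fun z => \1_[set z | z < c] z * a (qtl x z)).

Lemma L1_lint x a c : cadlag T a -> cpath x ->
 L1 u (fun z => \1_[set z : mR R | z < c] z * a (qtl x z)).
Proof. by move=> ca hx; apply: L1indic; [exact: mlt|exact: L1_qtl]. Qed.

Lemma lint_itv x a s t : cadlag T a -> cpath x -> 0 <= s -> s <= t -> t <= T ->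
 (\int[dmeas T x]_(r in `[s, t[) a r)%R = lint x a (before x t) - lint x a (before x s).
Proof.
move=> ca hx s0 st tT; have [cx nx x0 xT] := hx.
have sT : 0 <= s <= T by lra.
have mq := meas_qtl1 T0 hx.
(* [a] is controlled on [0, T] only; clipping the time gives a measurable function on the whole
   line. *)
transitivity (\int[dmeas T x]_(r in `[s, t[) a (maxr 0 (minr T r)))%R.
 apply: eq_Rintegral => r; rewrite inE/= in_itv/= => /andP[sr rt].
 rewrite clipE; lra.
have iq : L1 u (fun z => a (maxr 0 (minr T (qtl x z)))).
 under eq_fun do rewrite clipE ?qtl_in//; exact: L1_qtl.
rewrite (dmeas_int T0 hx _ (meas_clip ca) iq)//.
have mpre : measurable (qtl x @^-1` `[s, t[ : set (mR R)).
 rewrite -[X in measurable X]setTI; meas.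
rewrite -EIB//; [|exact: L1_lint..].
rewrite -[X in EI u X]setTI -EI_indic//; apply: EI_aeq => //.
- meas.
- apply: L1B; exact: L1_lint.
- apply: (ae_imp (@unif_ae R)) => z /andP[z0 z1] _; rewrite clipE ?qtl_in//.
 rewrite -mulrBl; congr (_ * _); rewrite !indicE.
 have b1 : (z \in qtl x @^-1` `[s, t[) = (before x s <= z) && (z < before x t).
  apply/idP/idP; rewrite inE/= in_itv/=.
   move=> /andP[sq qt]; rewrite -(qtl_ge T0 hx)// sq/=.
   rewrite -(qtl_lt T0 hx); lra.
  move=> /andP[h1 h2]; rewrite qtl_ge// h1/=.
  rewrite qtl_lt//; rewrite ltNge; apply/negP => tn.
  move: h2; rewrite /before tn; lra.
 have b2 c : (z \in [set z | z < c]) = (z < c) by apply/idP/idP; rewrite inE.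
 rewrite b1 !b2; apply: indic_between; exact: (before_mono cx nx x0 s0 st tT).
Qed.

(** All levels between [before x t] and [x t] have the quantile [t]. *)
Lemma lint_jump x a t : cadlag T a -> cpath x -> 0 <= t <= T ->
 lint x a (x t) - lint x a (before x t) = a t * (x t - before x t).
Proof.
move=> ca hx tT; have [cx nx x0 xT] := hx.
have b01 := cpath_before hx tT; have x01 := cpath01 hx tT.
have E c : 0 <= c <= 1 -> EI u setT (fun z => \1_[set z : mR R | z < c] z * a t) = a t * c.
 move=> c01; rewrite EI_indic//; last meas.
 rewrite setTI EIcst; last meas.
 by rewrite unif_lt.
rewrite mulrBr -!E// -!EIB//; [|by apply: L1indic; [exact: mlt|exact: L1cst]..|exact: L1_lint|exact: L1_lint].
apply: EI_aeq => //; [by apply: L1B; exact: L1_lint|by apply: L1B; apply: L1indic; [exact: mlt|exact: L1cst|exact: mlt|exact: L1cst]|].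
apply: (ae_imp (@unif_ae R)) => z z01 _; rewrite -!mulrBl !indicE.
have b2 c : (z \in [set z | z < c]) = (z < c) by apply/idP/idP; rewrite inE.
rewrite !b2; have bx := before_le cx nx x0 tT.
case: (ltP z (before x t)) => h1; case: (ltP z (x t)) => h2; rewrite ?subrr ?mul0r//; first lra.
by rewrite (quantile_jump T0 hx tT z01).
Qed.

Lemma lint_lip x a c c' C : cadlag T a -> cpath x -> (forall t, 0 <= t <= T -> `|a t| <= C) ->
 0 <= c -> c <= c' -> c' <= 1 -> `|lint x a c' - lint x a c| <= C * (c' - c).
Proof.
move=> ca hx aC c0 cc c1.
have i1 := L1_lint c' ca hx; have i2 := L1_lint c ca hx.
have E b : 0 <= b <= 1 -> EI u setT (fun z => C * \1_[set z : mR R | z < b] z) = C * b.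
 move=> b01; rewrite EIZ//; last by apply: integrable_indic; exact: mlt.
 congr (_ * _); rewrite -[LHS](@eq_EI _ _ _ u _ (fun z => \1_[set z : mR R | z < b] z * 1)).
  rewrite EI_indic//; last meas.
  by rewrite setTI EIcst ?mul1r; [rewrite unif_lt|exact: mlt].
 by move=> z _; rewrite mulr1.
have iC b : L1 u (fun z => C * \1_[set z : mR R | z < b] z).
 apply: L1Z; apply: integrable_indic; exact: mlt.
rewrite -EIB// mulrBr -!E; [|lra..].
rewrite -EIB//; apply: le_trans (EI_abs measurableT (L1B i1 i2)) _.
apply: EI_le => //; [by apply/L1norm/L1B|by apply: L1B|].
move=> z _; rewrite -mulrBl -mulrBr normrM.
have b2 b : ((z \in [set z | z < b]) = (z < b)) by apply/idP/idP; rewrite inE.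
rewrite !indicE !b2 mulrC; have aq := aC _ (qtl_in T0 hx z).
have : (0 : R) <= `|a (qtl x z)| by [].
case: ltP => h1; case: ltP => h2; rewrite ?subrr ?subr0 ?normr0 ?normr1 ?mulr0 ?mulr1//.
lra.
Qed.

Lemma quantile_lt_law y t : cpath y -> 0 <= t <= T ->
 u [set z | qtl y z < t] = (before y t)%:E.
Proof.
move=> hy tT; have mq := meas_qtl1 T0 hy.
have m2 : measurable [set z : mR R | qtl y z < t] by meas.
have /andP[t0 tT'] := tT.
have [tp|tn] := ltP 0 t; last first.
 rewrite (_ : [set z | _] = set0); first by rewrite measure0 /before tn.
 apply/seteqP; split => // z /=; have /andP[] := qtl_in T0 hy z; lra.
have b01 := cpath_before hy tT.
rewrite -(unif_lt b01); apply/le_anti/andP; split.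
 apply: (@le_trans _ _ (u ([set z | z < before y t] `|` ~` [set z : mR R | z < 1]))).
  apply: le_measure; rewrite ?inE//; first meas.
  move=> z /= qt; case: (ltP z 1) => z1; last lra.
  by left; rewrite -(qtl_lt T0 hy).
 apply: le_trans (measureU2 _ (mlt _) (measurableC (mlt 1))) _.
 by rewrite [X in (_ + X)%E](_ : _ = 0%E) ?adde0//; exact: unif_ge1.
apply: le_measure; rewrite ?inE//; first exact: mlt.
move=> z /= zb; rewrite (qtl_lt T0 hy); lra.
Qed.

Lemma jump_law y t : cpath y -> 0 <= t <= T ->
 u [set z | qtl y z = t] = (y t - before y t)%:E.
Proof.
move=> hy tT; have mq := meas_qtl1 T0 hy.
have m1 : measurable [set z : mR R | qtl y z <= t] by meas.
have m2 : measurable [set z : mR R | qtl y z < t] by meas.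
have /andP[t0 tT'] := tT.
have e1 : u [set z | qtl y z <= t] = (y t)%:E.
 by rewrite law_quantile// /path_ext ltNge t0 min_l.
rewrite EFinB -e1 -(quantile_lt_law hy tT).
transitivity (u ([set z | qtl y z <= t] `\` [set z | qtl y z < t])).
 congr (u _); apply/seteqP; split=> z /=; first lra.
 lra.
rewrite measureD ?setIidr//; last by rewrite ltey_eq fin_num_measure.
by move=> z  /ltW.
Qed.

Lemma L1_jump a x y : cadlag T a -> cpath x -> cpath y ->
 L1 u (fun z => a (qtl y z) * (x (qtl y z) - before x (qtl y z))).
Proof.
move=> ca hx hy; have [cx nx x0 _] := hx.
apply: (@le_L1 _ _ _ u _ (fun z => `|a (qtl y z)|)).
- apply: mfunM; first exact: meas_comp_qtl.
 apply: mfunB; first exact: meas_comp_qtl.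
 exact: meas_before_qtl.
- move=> z; rewrite normrM -[leRHS]mulr1; apply: ler_pM => //.
 have qT := qtl_in T0 hy z; have /andP[_ ?] := cpath01 hx qT.
 have /andP[? _] := cpath_before hx qT; have := before_le cx nx x0 qT.
 move=> ?; rewrite ger0_norm; lra.
- apply: L1norm; exact: L1_qtl.
Qed.

Section jump_sums.
Context (y : R -> R)
 (hy : cpath y).

Let mE t : measurable [set z : mR R | qtl y z = t].
Proof. have mq := meas_qtl1 T0 hy; meas. Qed.

Let iS (b : R -> R) (l : seq R) : L1 u (fun z => \sum_(t <- l) b t * \1_[set z : mR R | qtl y z = t] z).
Proof.
elim: l => [|t l IH]; first by under eq_fun do rewrite big_nil; exact: L1cst.
under eq_fun do rewrite big_cons; apply: L1D => //; apply: L1Z; exact: integrable_indic.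
Qed.

Lemma finite_jump_sum (b : R -> R) (l : seq R) : uniq l ->
 (forall t, t \in l -> 0 <= t <= T) ->
 EI u setT (fun z => \sum_(t <- l) b t * \1_[set z | qtl y z = t] z) =
 \sum_(t <- l) b t * (y t - before y t).
Proof.
move=> _; elim: l => [|t l IH] lT.
 by under eq_EI do rewrite big_nil; rewrite big_nil EIcst// mul0r.
under eq_EI do rewrite big_cons.
rewrite EID//; try by apply: L1Z; exact: integrable_indic.
rewrite big_cons IH => [|s sl]; last by apply: lT; rewrite inE sl orbT.
congr (_ + _); rewrite EIZ//; last exact: integrable_indic.
congr (_ * _); rewrite (@eq_EI _ _ _ u _ _ (fun z => \1_[set z : mR R | qtl y z = t] z * 1)); last first.
 by move=> z _; rewrite mulr1.
by rewrite EI_indic// setTI EIcst// mul1r (jump_law hy (lT t (mem_head _ _))).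
Qed.

Context (x : R -> R)
 (hx : cpath x).

Lemma big_jumps k : exists l, [/\ uniq l, forall t, t \in l -> 0 <= t <= T
 & forall t, 0 <= t <= T -> mesh k <= x t - before x t -> t \in l].
Proof.
have [cx nx x0 _] := hx; pose A := [set t | 0 <= t <= T /\ mesh k <= x t - before x t].
have fin : finite_set A.
 apply: (@gap_finite _ T x (before x)); rewrite ?mesh_gt0//; exists (x T) => l; exact: (jumps_le T0 cx nx x0).
exists (finmap.enum_fset (fset_set A)); rewrite finmap.fset_uniq; split=> // t.
 by rewrite in_fset_set// inE => -[].
by move=> tT tk; rewrite in_fset_set// inE.
Qed.

(** As [b] vanishes where [x] does not jump, the sum over an uncountable set is carried by countably
    many times. The lists of jumps of [x] of size at least [mesh k] exhaust them, and the jump of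
    [y] is the probability that its quantile sits there. *)
Lemma jump_esum (b : R -> R) (D : set R) :
 (forall t, 0 <= t <= T -> 0 <= b t) -> (D `<=` [set t | 0 <= t <= T]) ->
 (forall t, 0 <= t <= T -> b t != 0 -> 0 < x t - before x t) ->
 (\forall z \ae u, D (qtl y z)) ->
 L1 u (fun z => b (qtl y z)) ->
 (\esum_(t in D) (b t * (y t - before y t))%:E)%E =
 (EI u setT (fun z => b (qtl y z)))%:E.
Proof.
move=> b0 DT bx aD ib.
have val l z : uniq l -> \sum_(t <- l) b t * \1_[set z | qtl y z = t] z =
  if qtl y z \in l then b (qtl y z) else 0.
 elim: l => [|t l IH] /=; first by rewrite big_nil.
 move=> /andP[tl ul]; rewrite big_cons IH// inE indicE.
 have [qt|nqt] := eqVneq (qtl y z) t.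
  by rewrite mem_set// mulr1 qt (negbTE tl) addr0.
 by rewrite memNset ?mulr0 ?add0r; apply/eqP.
apply/le_anti/andP; split.
 apply: ub_ereal_sup => _ [A [fA AD] <-].
 rewrite fsbig_finite//= sumEFin lee_fin -finite_jump_sum ?finmap.fset_uniq//; last first.
  by move=> t; rewrite in_fset_set// inE => /AD/DT.
 apply: (EI_le measurableT (iS _ _) ib) => z _; rewrite val ?finmap.fset_uniq//; case: ifP => // _.
 exact/b0/qtl_in.
apply/lee_addgt0Pr => e e0.
have /choice[l lP] := big_jumps.
have cvg1 : EI u setT (fun z => \sum_(t <- [seq t <- l n | t \in D]) b t * \1_[set z | qtl y z = t] z)
  @[n --> \oo] --> EI u setT (fun z => b (qtl y z)).
 have [] // := @EI_dominated _ _ _ u (fun z => b (qtl y z))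
  (fun n z => \sum_(t <- [seq t <- l n | t \in D]) b t * \1_[set z | qtl y z = t] z)
  (fun z => b (qtl y z)) setT measurableT.
 - meas.
 - meas.
 - move=> n; apply: aeW => z; have [un _ _] := lP n.
  rewrite val ?filter_uniq//; have bq := b0 _ (qtl_in T0 hy z).
  by case: ifP => _; rewrite ger0_norm.
 - apply: (ae_imp aD) => z Dz; apply/cvgnP => e1 e10.
  have qT := qtl_in T0 hy z.
  have [bz|bz] := eqVneq (b (qtl y z)) 0.
   exists 0%N => n _; rewrite val ?filter_uniq//; last by have [] := lP n.
   by case: ifP; rewrite bz subrr normr0.
  have [N Nm] := mesh_small (bx _ qT bz); exists N => n Nn.
  have [un _ ln] := lP n; rewrite val ?filter_uniq// mem_filter mem_set//= ln//.
   by rewrite subrr normr0.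
  apply: le_trans (mesh_le Nn) _; exact: ltW.
have /cvgnP/(_ e e0)[n /(_ n (leqnn n))] := cvg1.
rewrite ltr_distlC => /andP[lt _].
apply: (@le_trans _ _ (EI u setT (fun z => \sum_(t <- [seq t <- l n | t \in D])
  b t * \1_[set z | qtl y z = t] z) + e)%:E); first by rewrite lee_fin; lra.
rewrite EFinD leeD2r//.
have [un lT _] := lP n; rewrite finite_jump_sum ?filter_uniq//; last first.
 by move=> t; rewrite mem_filter => /andP[_ /lT].
rewrite -sumEFin; apply: ereal_sup_ubound => /=.
exists [set` [seq t <- l n | t \in D]].
 split; first exact: finite_seq.
 by move=> t /=; rewrite mem_filter => /andP[]; rewrite inE.
rewrite -fsbig_seq//; exact: filter_uniq.
Qed.

End jump_sums.
Section truncated_game.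
Context (f g h x y : R -> R) (θ : R)
 (cf : cadlag T f) (cg : cadlag T g) (ch : cadlag T h)
 (hx : cpath x) (hy : cpath y)
 (thT : 0 <= θ <= T)
 (y_theta : before y θ = 0).

Let r := before x θ.
Let tr (t : R) : R := if t < θ then 0 else if r == 1 then 1 else (x t - r) / (1 - r).
Let cx : cadlag T x. Proof. by have [] := hx. Qed.
Let nx : nondec T x. Proof. by have [] := hx. Qed.
Let x0 : 0 <= x 0. Proof. by have [] := hx. Qed.
Let xT : x T = 1. Proof. by have [] := hx. Qed.
Let r01 : 0 <= r <= 1. Proof. rewrite /r; exact: (cpath_before hx). Qed.
Let th0 : 0 <= θ. Proof. by have /andP[] := thT. Qed.
Let thT' : θ <= T. Proof. by have /andP[] := thT. Qed.
Let r_le t : θ <= t -> t <= T -> r <= x t.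
Proof.
move=> tht tT; apply: le_trans (before_le cx nx x0 thT) _; exact: nx.
Qed.

Lemma trunc_cpath : cpath tr.
Proof.
have rc t : 0 <= t < T -> tr s @[s --> t^'+] --> tr t.
 move=> tT; apply/rcvgP => e e0; rewrite /tr; case: ltP => tth.
  exists (θ - t); first lra.
  move=> s ts st; have -> : s < θ by lra.
  by rewrite subrr normr0.
 have ns s : t < s -> (s < θ) = false by lra.
 case: eqVneq => r1.
  by exists 1 => // s ts _; rewrite ns// subrr normr0.
 have r1' : 0 < 1 - r by move: r01 r1; rewrite neq_lt; lra.
 have /rcvgP/(_ (e * (1 - r)) (mulr_gt0 e0 r1'))[c c0 H] := cx.1 t tT.
 exists c => // s ts sc; rewrite ns// -mulrBl normrM (ger0_norm (_ : 0 <= (1 - r)^-1)); last by rewrite invr_ge0 ltW.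
 rewrite ltr_pdivrMr//; have := H s ts sc.
 congr (_ < _); congr (`|_|); ring.
have nd : nondec T tr.
 move=> s t s0 st tT; rewrite /tr; case: ltP => sth; case: ltP => tth.
 - lra.
 - case: eqVneq => [_|r1]; first lra.
  by apply: divr_ge0; [have := r_le tth tT; lra|move: r01; lra].
 - lra.
 - case: eqVneq => // r1; apply: ler_pM => //.
  + have := r_le sth (le_trans st tT); lra.
  + rewrite invr_ge0; move: r01; lra.
  + rewrite lerD2r; exact: nx.
split => //; first exact: nondec_cadlag.
- rewrite /tr; case: ltP => // th0'; case: eqVneq => [_|r1]; first lra.
 by apply: divr_ge0; [have := r_le th0' (ltW T0); lra|move: r01; lra].
- rewrite /tr ltNge thT'/=; case: eqVneq => // r1.
 by rewrite xT divff// subr_eq0 eq_sym.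
Qed.

Lemma trunc_jump t : θ <= t -> t <= T -> (1 - r) * jump tr t = jump x t.
Proof.
(* For [r = 1] the factor on the left is zero, and [x] equals 1 from [θ] on, so it does not jump any
   more. *)
move=> tht tT; have [r1|r1] := eqVneq r 1.
 rewrite {1}r1 subrr mul0r /jump.
 have x1 : x t = 1.
  apply/eqP; rewrite eq_le; have := r_le tht tT; rewrite r1 => ->.
  have tT2 : 0 <= t <= T by rewrite (le_trans th0 tht).
  by have /andP[_ ->] := cpath01 hx tT2.
 have := before_mono cx nx x0 th0 tht tT; rewrite -/r r1.
 have := cpath_before hx (t := t); rewrite (le_trans th0 tht) tT => /(_ isT).
 rewrite x1; lra.
have r1' : 0 < 1 - r by move: r01 r1; rewrite neq_lt; lra.
rewrite /jump {1}/tr ltNge tht (negbTE r1) mulrBr mulrC divfK ?gt_eqF//.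
suff -> : (1 - r) * before tr t = before x t - r by lra.
move: tht; rewrite le_eqVlt => /predU1P[tE|tht].
 rewrite -tE subrr.
 suff -> : before tr θ = 0 by lra.
 have [tp|tn] := ltP 0 θ; last by rewrite /before tn.
 have thp : 0 < θ <= T by lra.
 have [ctr _ _ _] := trunc_cpath.
 apply: (cvg_unique _ (cadlag_left ctr thp)) => //.
 apply/lcvgP => e e0; exists 1 => // s st _; rewrite /tr st subrr normr0//.
have tp : 0 < t <= T by rewrite tT andbT; exact: le_lt_trans th0 tht.
have [ctr _ _ _] := trunc_cpath.
have c1 : (1 - r) * tr s @[s --> t^'-] --> (1 - r) * before tr t.
 apply: cvgMr; exact: (cadlag_left ctr tp).
have c2 : x s - r @[s --> t^'-] --> before x t - r.
 by apply: cvgB; [exact: (cadlag_left cx tp)|exact: cvg_cst].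
apply: (cvg_unique _ c1) => //; apply: cvg_trans c2; apply: near_eq_cvg.
exists (t - θ) => /=; first lra.
move=> s /= sn st; move: sn; rewrite ger0_norm => [sn|]; last lra.
rewrite /tr; have -> : (s < θ) = false by apply/negbTE; rewrite -leNgt; lra.
by rewrite (negbTE r1) mulrC divfK ?gt_eqF.
Qed.

(** Comparison of distribution functions: for [b] from [θ] on, both measures give
    [(x b - r) / (1 - r)] to the times up to [b], with [b] capped at [T]. *)
Lemma trunc_law (A : set (mR R)) : r != 1 -> measurable A ->
 A `<=` [set t | θ <= t] ->
 dmeas T tr A = ((1 - r)^-1%:E * dmeas T x A)%E.
Proof.
move=> r1 mA Ath; have r1' : 0 < 1 - r by move: r01 r1; rewrite neq_lt; lra.
have k0 : 0 <= (1 - r)^-1 by rewrite invr_ge0 ltW.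
have mth : measurable [set t : mR R | θ <= t] by meas.
pose X := mfun_Sub (quantile_mfun T0 hx).
pose mu := mscale (NngNum k0) (mrestr (distribution u X) mth).
have Aint : A `&` [set t | θ <= t] = A by apply/setIidPl; exact: Ath.
have -> : ((1 - r)^-1%:E * dmeas T x A)%E = mu A.
 by rewrite dmeas_law// -[in LHS]Aint.
have htr := trunc_cpath.
rewrite /dmeas; case: pselect => [xP|[]]; last first.
 by split; [exact: cpath_ext_nd|exact: cpath_ext_rc].
apply: stieltjes_law => // b.
change (((1 - r)^-1%:E * distribution u X ([set t | (t <= b)%R] `&` [set t | (θ <= t)%R]))%E =
 (path_ext T tr b)%:E); rewrite /path_ext.
have mq := meas_qtl1 T0 hx.
have ml : measurable [set z : mR R | qtl x z < θ] by meas.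
have [bth|thb] := ltP b θ.
 rewrite (_ : _ `&` _ = set0); last by apply/seteqP; split => // t /= []; lra.
 rewrite measure0 mule0; case: ltP => // b0.
 rewrite /tr; have -> : minr b T < θ by rewrite gt_min bth.
 by [].
have b0 : 0 <= b by exact: le_trans th0 thb.
have mlb : measurable [set z : mR R | qtl x z <= b] by meas.
have -> : distribution u X ([set t | t <= b] `&` [set t | θ <= t]) =
  (x (minr b T) - r)%:E.
 transitivity (u ([set z | qtl x z <= b] `\` [set z | qtl x z < θ])).
  congr (u _); apply/seteqP; split=> z /=; first lra.
  lra.
 rewrite measureD// ?setIidr; last 2 first.
 - move=> z  qz; exact: le_trans (ltW qz) thb.
 - by rewrite ltey_eq fin_num_measure.
 have e1 : u [set z | (qtl x z < θ)%R] = r%:E by exact: quantile_lt_law.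
 have e2 : u [set z | (qtl x z <= b)%R] = (x (minr b T))%:E.
  by rewrite law_quantile// /path_ext ltNge b0.
 by rewrite EFinB -e1 -e2.
rewrite ltNge b0/= /tr (negbTE r1).
have -> : (minr b T < θ) = false by apply/negbTE; rewrite -leNgt le_min thb.
by rewrite mulrC.
Qed.

Let gc := (\int[dmeas T y]_(t in `[θ, T[) (f t * (1 - tr t)))%R
 + (\int[dmeas T tr]_(t in `[θ, T[) (g t * (1 - y t)))%R
 + sum_over `[θ, T] (fun t => h t * jump tr t * jump y t).

(** Payoff of stopping at [s], averaged over the opponent's device: the opponent stops later,
    strictly before, or at the same time. *)
Definition ypay (s : R) := f s * (1 - x s) + lint x g (before x s) + h s * (x s - before x s).

Let q_ge : \forall z \ae u, θ <= qtl y z.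
Proof.
apply: (ae_imp (@unif_ae R)) => z /andP[z0 z1].
by rewrite qtl_ge// y_theta.
Qed.

Let mq : mfunT (qtl y : mR R -> R).
Proof. exact: meas_qtl1. Qed.

Let pre_itv : measurable (qtl y @^-1` `[θ, T[ : set (mR R)).
Proof. rewrite -[X in measurable X]setTI; meas. Qed.

Let term1 : (1 - r) * (\int[dmeas T y]_(t in `[θ, T[) (f t * (1 - tr t)))%R =
 EI u setT (fun z => f (qtl y z) * (1 - x (qtl y z))).
Proof.
have [ctr _ _ trT] := trunc_cpath.
pose a t := f t * (1 - tr t); have ca : cadlag T a by exact/cadlagM/cadlag1B.
have cb : cadlag T (fun t => f t * (1 - x t)) by exact/cadlagM/cadlag1B.
have -> : (\int[dmeas T y]_(t in `[θ, T[) (f t * (1 - tr t)))%R =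
  (\int[dmeas T y]_(t in `[θ, T[) a (maxr 0 (minr T t)))%R.
 apply: eq_Rintegral => t; rewrite inE/= in_itv/= => /andP[tht tT].
 by rewrite clipE// (le_trans th0 tht) ltW.
have iq : L1 u (fun z => a (maxr 0 (minr T (qtl y z)))).
 under eq_fun do rewrite clipE ?qtl_in//; exact: L1_qtl.
rewrite (dmeas_int T0 hy _ (meas_clip ca) iq)//.
rewrite -[X in EI u X]setTI -EI_indic// -EIZ//; last meas.
apply: EI_aeq => //; [by apply: L1Z; exact: L1indic|exact: (L1_qtl cb hy)|].
apply: (ae_imp q_ge) => z thq _; rewrite clipE ?qtl_in//.
have /andP[q0 qT] := qtl_in T0 hy z.
rewrite indicE; have [qlt|Tq] := ltP (qtl y z) T; last first.
 have -> : qtl y z = T by lra.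
 by rewrite /a trT xT subrr !mulr0.
rewrite mem_set ?mul1r/=; last by rewrite in_itv/= thq.
rewrite mulrCA; congr (_ * _); rewrite /tr ltNge thq/=.
have [r1|r1] := eqVneq r 1.
 rewrite r1 subrr mul0r; have := r_le thq qT; rewrite r1 => x1.
 have /andP[_ x2] := cpath01 hx (qtl_in T0 hy z).
 lra.
rewrite mulrBr mulr1 mulrC divfK ?subr_eq0 1?eq_sym//; ring.
Qed.

Let gx (t : R) := g t * (1 - y t).
Let cgx : cadlag T gx.
Proof. by apply: (cadlagM cg); apply: cadlag1B; have [] := hy. Qed.

Let term2a : (1 - r) * (\int[dmeas T tr]_(t in `[θ, T[) gx t)%R =
 if r == 1 then 0 else (\int[dmeas T x]_(t in `[θ, T[) gx t)%R.
Proof.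
case: eqVneq => r1; first by rewrite r1 subrr mul0r.
have r1' : 0 < 1 - r by move: r01 r1; rewrite neq_lt; lra.
have k0 : 0 <= (1 - r)^-1 by rewrite invr_ge0 ltW.
pose a t := gx (maxr 0 (minr T t)).
have ra (m : {measure set (mR R) -> \bar R}) : (\int[m]_(t in `[θ, T[) gx t)%R = (\int[m]_(t in `[θ, T[) a t)%R.
 apply: eq_Rintegral => t; rewrite inE/= in_itv/= => /andP[tht tT].
 by rewrite /a clipE// (le_trans th0 tht) ltW.
rewrite !ra /Rintegral.
have ma : mfunT (a : mR R -> R) by exact: meas_clip.
have iD : (dmeas T x).-integrable `[θ, T[%classic (EFin \o a).
 have [C CP] := cadlag_bounded T0 cgx.
 apply: measurable_bounded_integrable => //.
 - rewrite dmeas_law//; apply: le_lt_trans (ltry 1); exact: probability_le1.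
 - meas.
 - exists C; split; first exact: num_real.
  move=> M CM t _; apply: le_trans (ltW CM); rewrite /a; apply: CP.
  by rewrite le_max lexx/= ge_max ge_min lexx ltW.
have E : (\int[dmeas T tr]_(t in `[θ, T[) (a t)%:E =
  (1 - r)^-1%:E * \int[dmeas T x]_(t in `[θ, T[) (a t)%:E)%E.
 rewrite (eq_measure_integral (mscale (NngNum k0) (dmeas T x))); last first.
  move=> A mA Ath; rewrite trunc_law// => t /Ath/=; rewrite in_itv/=.
  lra.
 exact: integral_mscale_real.
rewrite E fineM//; last exact: integrable_fin_num.
by rewrite mulrA mulfV ?mul1r// gt_eqF.
Qed.

Let prex : measurable (qtl x @^-1` `[θ, T[ : set (mR R)).
Proof. rewrite -[X in measurable X]setTI; exact: meas_qtl1. Qed.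

Let L1_pre : L1 u (fun z => \1_(qtl x @^-1` `[θ, T[) z * gx (qtl x z)).
Proof. apply: L1indic => //; exact: L1_qtl. Qed.

Let term2b : (1 - r) * (\int[dmeas T tr]_(t in `[θ, T[) gx t)%R =
 EI u setT (fun z => \1_(qtl x @^-1` `[θ, T[) z * gx (qtl x z)).
Proof.
have -> : (1 - r) * (\int[dmeas T tr]_(t in `[θ, T[) gx t)%R =
  (\int[dmeas T x]_(t in `[θ, T[) gx t)%R.
 (* If [r = 1] then [before x T = 1] too, and [dx] has no mass on [[θ, T[]. *)
 rewrite term2a; case: eqVneq => // r1.
 rewrite lint_itv//; have := before_mono cx nx x0 th0 thT' (lexx T).
 have /andP[_ b1] := cpath_before hx (T_in T0).
 rewrite -/r r1 => b2; have -> : before x T = 1 by apply/eqP; rewrite eq_le b1.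
 lra.
have iq : L1 u (fun z => gx (maxr 0 (minr T (qtl x z)))).
 under eq_fun do rewrite clipE ?qtl_in//; exact: L1_qtl.
have -> : (\int[dmeas T x]_(t in `[θ, T[) gx t)%R =
  (\int[dmeas T x]_(t in `[θ, T[) gx (maxr 0 (minr T t)))%R.
 apply: eq_Rintegral => t; rewrite inE/= in_itv/= => /andP[tht tT].
 by rewrite clipE// (le_trans th0 tht) ltW.
rewrite (dmeas_int T0 hx _ (meas_clip cgx) iq)//.
rewrite EI_indic// setTI; apply: eq_EI => z _.
by rewrite clipE// qtl_in.
Qed.

Let L1_later z' : L1 u (fun z => \1_[set z' : mR R | z' < before x (qtl y z)] z').
Proof.
 apply: (L1bound u _ (c := 1)); last first.
  by move=> z; rewrite indicE; case: (_ \in _); rewrite ?normr0 ?normr1.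
 rewrite (_ : (fun z => _) = \1_[set z : mR R | z' < before x (qtl y z)])//.
 apply: measurable_indic; apply: meas_lt => //.
 exact: meas_before_qtl.
Qed.

(** The inequality says that the level [z'] of [x] is reached strictly before the level [z] of [y],
    which has probability [1 - y (qtl x z')] in [z]. *)
Let avg_later z' : 0 <= z' < 1 ->
 EI u setT (fun z => \1_[set z' : mR R | z' < before x (qtl y z)] z') =
 1 - y (qtl x z').
Proof.
move=> z'01; have /andP[z0 z1] := z'01.
have qT := qtl_in T0 hx z'; have /andP[q0 qT'] := qT.
have mle : measurable [set z : mR R | qtl y z <= qtl x z'] by meas.
have ltE z : (z' < before x (qtl y z)) = (qtl x z' < qtl y z).
 have /andP[p0 pT] := qtl_in T0 hy z.
 have [pp|pn] := ltP 0 (qtl y z); first by rewrite qtl_lt.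
 have -> : qtl y z = 0 by lra.
 by rewrite /before lexx !ltNge z0 q0.
 rewrite (@eq_EI _ _ _ u _ _ (fun z => 1 - \1_[set z : mR R | qtl y z <= qtl x z'] z * 1)).
  rewrite EIB//; [|exact: L1cst|by apply: L1indic => //; exact: L1cst].
  rewrite EI_indic// setTI !EIcst// mul1r probability_setT mul1r/=.
  by rewrite law_quantile//= /path_ext ltNge q0 min_l.
 move=> z _; rewrite !indicE mulr1.
 have -> : (z' \in [set z'0 | z'0 < before x (qtl y z)]) = (z' < before x (qtl y z)).
  by apply/idP/idP; rewrite inE.
 have -> : (z \in [set z0 | qtl y z0 <= qtl x z']) = (qtl y z <= qtl x z').
  by apply/idP/idP; rewrite inE.
 by rewrite ltE; case: ltP; rewrite ?subr0 ?subrr.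
Qed.

Let later_density z' : 0 <= z' < 1 ->
 \1_(qtl x @^-1` `[θ, T[) z' * gx (qtl x z') =
 (1 - y (qtl x z') - \1_[set z' : mR R | z' < r] z') * g (qtl x z').
Proof.
move=> z'01; have /andP[z0 z1] := z'01.
have qT := qtl_in T0 hx z'; have /andP[q0 qT'] := qT.
rewrite !indicE; have -> : (z' \in [set z' : mR R | z' < r]) = (qtl x z' < θ).
 by rewrite ltNge qtl_ge// -ltNge; apply/idP/idP; rewrite inE.
rewrite /gx; have [qth|thq] := ltP (qtl x z') θ.
 rewrite memNset ?mul0r/=; last by rewrite in_itv/= => /andP[]; lra.
 have [cy ny y0 _] := hy.
 have y1 : y (qtl x z') <= 0 by rewrite -y_theta; exact: (le_before cy ny q0 qth thT').
 have /andP[y2 _] := cpath01 hy qT.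
 have -> : y (qtl x z') = 0 by lra.
 lra.
have [qlt|Tq] := ltP (qtl x z') T.
 by rewrite mem_set ?mul1r/= ?in_itv/= ?thq// subr0 mulrC.
have -> : qtl x z' = T by lra.
by have [_ _ _ ->] := hy; rewrite subrr !subr0 mul0r mulr0 mulr0.
Qed.

Let later_average z' : 0 <= z' < 1 ->
 \1_(qtl x @^-1` `[θ, T[) z' * gx (qtl x z') =
 EI u setT (fun z => (\1_[set z' : mR R | z' < before x (qtl y z)] z'
   - \1_[set z' : mR R | z' < r] z') * g (qtl x z')).
Proof.
move=> z'01; rewrite (later_density z'01) -(avg_later z'01).
exact: (EI_affine _ _ (L1_later z')).
Qed.

(** Fubini in the two levels: integrating [g * (1 - y)] against [dx] amounts to averaging over the
    level of [y] the integral of [g] against [dx] up to strictly before the quantile. *)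
Let term2 : L1 u (fun z => lint x g (before x (qtl y z)) - lint x g r) /\
 (1 - r) * (\int[dmeas T tr]_(t in `[θ, T[) gx t)%R =
 EI u setT (fun z => lint x g (before x (qtl y z)) - lint x g r).
Proof.
have [C CP] := cadlag_bounded T0 cg.
pose X (z z' : mR R) : R := (\1_[set z' : mR R | z' < before x (qtl y z)] z'
   - \1_[set z' : mR R | z' < r] z') * g (qtl x z').
have lr z : lint x g (before x (qtl y z)) - lint x g r = EI u setT (X z).
 rewrite -EIB//; [|exact: L1_lint..].
 by apply: eq_EI => z' _; rewrite /X mulrBl.
have mX : mfunT (fun p : mR R * mR R => X p.1 p.2).
 apply: mfunM; last first.
  exact: (mcomp (meas_comp_qtl cg hx)).
 apply: mfunB.
  rewrite (_ : (fun p => _) = \1_[set p : mR R * mR R |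
    p.2 < before x (qtl y p.1)])//.
  apply: measurable_indic; apply: meas_lt; first meas.
  exact: (mcomp (meas_before_qtl cx hy)).
 apply: mcomp; last meas.
 meas.
have XC z z' : `|X z z'| <= C.
 rewrite normrM; apply: (@le_trans _ _ (1 * `|g (qtl x z')|)).
  apply: ler_wpM2r => //; rewrite !indicE.
  exact: norm_indic_sub.
 by rewrite mul1r; apply/CP/qtl_in.
have [i1 i2 i3 i4 E] := fubini_dom u mX XC (L1cst u C).
split; first by under eq_fun do rewrite lr.
transitivity (EI u setT (fun z => EI u setT (X z))); last by apply: eq_EI => z _; rewrite lr.
rewrite -E.
rewrite term2b; refine (EI_aeq measurableT L1_pre i3 _).
by apply: (ae_imp (@unif_ae R)) => z' z'01 _; rewrite later_average.
Qed.

(** [sum_over] separates positive and negative parts; each is an instance of [jump_esum], in which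
    the truncated path supplies the countable set of jumps. *)
Let term3 : (1 - r) * sum_over `[θ, T] (fun t => h t * jump tr t * jump y t) =
 EI u setT (fun z => h (qtl y z) * (x (qtl y z) - before x (qtl y z))).
Proof.
have htr := trunc_cpath; have [ctr ntr tr0 _] := htr; have [cy ny y0 _] := hy.
pose b t := h t * jump tr t.
have jt t : 0 <= t <= T -> 0 <= jump tr t by move=> tT; rewrite subr_ge0; exact: (before_le ctr ntr).
have jy t : 0 <= t <= T -> 0 <= jump y t by move=> tT; rewrite subr_ge0; exact: (before_le cy ny).
have DT : `[θ, T]%classic `<=` [set t | 0 <= t <= T].
 by move=> t /=; rewrite in_itv/= => /andP[tht ->]; rewrite (le_trans th0 tht).
have aD : \forall z \ae u, `[θ, T]%classic (qtl y z).
 apply: (ae_imp q_ge) => z thq /=; rewrite in_itv/= thq/=.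
 by have /andP[] := qtl_in T0 hy z.
have ib : L1 u (fun z => b (qtl y z)) := L1_jump ch htr hy.
have iM (s : R) : L1 u (fun z => maxr 0 (s * b (qtl y z))).
 apply: (le_L1 _ _ (L1norm (L1Z s ib))).
  apply: measurable_maxr => //.
  meas.
 by move=> z; rewrite ger0_norm ?le_max ?lexx// ge_max normr_ge0 ler_norm.
have es (s : R) : (\esum_(t in `[θ, T]%classic) (maxr 0 (s * b t) * (y t - before y t))%:E)%E =
  (EI u setT (fun z => maxr 0 (s * b (qtl y z))))%:E.
 apply: (jump_esum hy htr (b := fun t => maxr 0 (s * b t))) => //.
 - by move=> t _; rewrite le_max lexx.
 - move=> t tT; apply: contraR; rewrite -leNgt => jn.
  have j0 : jump tr t = 0 by apply/eqP; rewrite eq_le jn jt.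
  by rewrite /b j0 !mulr0 maxxx.
have -> : sum_over `[θ, T] (fun t => h t * jump tr t * jump y t) =
  EI u setT (fun z => b (qtl y z)).
 rewrite /sum_over.
 have ep : (\esum_(t in `[θ, T]%classic) (EFin \o (fun t => h t * jump tr t * jump y t)%R)^\+ t)%E =
   (\esum_(t in `[θ, T]%classic) (maxr 0 (1 * b t) * (y t - before y t))%:E)%E.
  apply: eq_esum => t /DT tT; rewrite funeposE mul1r -EFin_max; congr EFin.
  by rewrite maxC maxr_pMl ?jy// mul0r.
 have en : (\esum_(t in `[θ, T]%classic) (EFin \o (fun t => h t * jump tr t * jump y t)%R)^\- t)%E =
   (\esum_(t in `[θ, T]%classic) (maxr 0 (-1 * b t) * (y t - before y t))%:E)%E.
  apply: eq_esum => t /DT tT; rewrite funenegE mulN1r -EFin_max; congr EFin.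
  by rewrite maxC maxr_pMl ?jy// mul0r mulNr.
 rewrite ep en.
 rewrite !es -EFinB -EIB//; apply: eq_EI => z _.
 exact: maxr_posneg.
rewrite -EIZ//; apply: EI_aeq => //; first meas.
 exact: L1_jump.
apply: (ae_imp q_ge) => z thq _; have /andP[_ qT] := qtl_in T0 hy z.
by rewrite mulrCA trunc_jump.
Qed.

(** The factor [1 - r] undoes the normalisation of the truncated control, hence every division by
    zero. The game from [θ] on becomes the original one minus the cost [lint x g r] already
    incurred. *)
Theorem truncated_cost : (1 - r) * gc = EI u setT (fun z => ypay (qtl y z) - lint x g r).
Proof.
have [i2 E2] := term2.
have i1 : L1 u (fun z => f (qtl y z) * (1 - x (qtl y z))).
 apply: (L1_qtl (a := fun t => f t * (1 - x t))) => //; exact/cadlagM/cadlag1B.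
have i3 := L1_jump ch hx hy.
rewrite /gc 2!mulrDr term1 E2 term3.
rewrite -(EID measurableT i1 i2) -(EID measurableT (L1D i1 i2) i3).
by apply: eq_EI => z _; rewrite [RHS]addrAC; congr _; rewrite addrA.
Qed.

End truncated_game.
End path_game.

Lemma meas_inv {R : realType} d (S : measurableType d) (s : S -> R) :
 (forall w, 0 <= s w) -> mfunT s -> mfunT (fun w => (s w)^-1).
Proof.
move=> s0 ms; rewrite (_ : (fun w => _) = (@powR R)^~ (-1) \o s); last first.
 by apply/funext => w /=; rewrite powRN powRr1.
exact: mcomp.
Qed.

Lemma meas_contract {R : realType} d (S : measurableType d) (Z : S -> \bar R) :
 mfunT Z -> mfunT (fun w => contract (Z w)).
Proof.
move=> mZ; apply: (measurability _ (RGenOInfty.measurableE R)).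
move=> _ [_ [r ->] <-]; rewrite setTI.
have [r1|r1] := ltP r (-1).
 rewrite (_ : _ @^-1` _ = setT)//; apply/seteqP; split=> w //= _.
 rewrite in_itv/= (lt_le_trans r1)//.
 by have := contract_le1 (Z w); rewrite ler_norml => /andP[].
have [r2|r2] := leP r 1; last first.
 rewrite (_ : _ @^-1` _ = set0)//; apply/seteqP; split=> w //=.
 rewrite in_itv/= andbT => h; have := contract_le1 (Z w); rewrite ler_norml => /andP[_].
 lra.
have := mZ measurableT _ (emeasurable_itv `]expand r, +oo[); rewrite setTI.
congr measurable; apply/seteqP; split=> w /=; rewrite !in_itv/= !andbT.
 by rewrite -lt_contract expandK// inE ler_norml r1.
by rewrite -(lt_contract (expand r)) expandK// inE ler_norml r1.
Qed.

(** * Extended conditional expectations, essential infima and suprema *)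

Section conditional.
Context {R : realType} {d : measure_display} {Ω : measurableType d}
 (P : probability Ω R).
Implicit Types (X p s v : Ω -> R) (Y : Ω -> \bar R) (A B : set Ω)
 (H : set (set Ω)).

(** On the part of [Y < Y'] where [Y <= n], both variables are integrable and the integral
    inequality makes the event null; these parts exhaust [Y < Y']. *)
Lemma ereal_ae_le H Y Y' : csub P H -> (forall w, 0 <= Y w)%E -> (forall w, 0 <= Y' w)%E ->
 smeas H Y -> smeas H Y' ->
 (forall A, H A -> \int[P]_(w in A) Y' w <= \int[P]_(w in A) Y w)%E ->
 \forall w \ae P, (Y' w <= Y w)%E.
Proof.
move=> cH Y0 Y0' HY HY' le; have mY := sm_meas cH HY; have mY' := sm_meas cH HY'.
have H1 (n : nat) : \forall w \ae P, ~ ((Y w < Y' w)%E /\ (Y w <= n%:R%:E)%E).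
 pose A := [set w | (Y w < Y' w)%E] `&` [set w | (Y w <= n%:R%:E)%E].
 have HA : H A.
  apply: (csubI cH).
   have := @measurable_fun_lte _ (g_sigma_algebraType H) R setT Y Y'
    ((smE Y cH).1 HY) ((smE Y' cH).1 HY').
   by move=> /(_ measurableT [set true] I); rewrite setTI (csub_sigma cH).
  have := sm_preimage HY (emeasurable_itv `]-oo, n%:R%:E]).
  by congr (H _); apply/seteqP; split=> w /=; rewrite in_itv.
 have mA := csubm cH HA; have mYA := measurable_funTS mY (D := A).
 have lt : (\int[P]_(w in A) Y w < +oo)%E.
  apply: (@le_lt_trans _ _ (\int[P]_(w in A) n%:R%:E)%E).
   by apply: ge0_le_integral => // w [].
  by rewrite integral_cst//; apply: lte_mul_pinfty => //; rewrite ?lee_fin// ltey_eq fin_num_measure.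
 have iY : P.-integrable A Y.
  by apply/integrableP; split=> //; under eq_integral do rewrite gee0_abs//.
 have iY' : P.-integrable A Y'.
  apply/integrableP; split; first exact: measurable_funTS.
  under eq_integral do rewrite gee0_abs//; exact: le_lt_trans (le A HA) lt.
 have fA w : A w -> Y w \is a fin_num.
  by move=> [_ /= Yn]; rewrite ge0_fin_numE//; apply: le_lt_trans Yn (ltry _).
 have D0 : (\int[P]_(w in A) `|Y' w - Y w| = 0)%E.
  rewrite (eq_integral (fun w => Y' w - Y w)%E) => [|w /set_mem Aw]; last first.
   by rewrite gee0_abs// sube_ge0 ?fA// ltW//; case: Aw.
  apply/eqP; rewrite eq_le integralB// leeBlDr ?integrable_fin_num// add0e le//=.
  rewrite sube_ge0 ?integrable_fin_num//; apply: ge0_le_integral => //; last by move=> w [/ltW].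
  exact: measurable_funTS.
 have mD : measurable_fun A (fun w => Y' w - Y w)%E by exact: measurable_int (integrableB mA iY' iY).
 apply: filterS ((ae_eq_integral_abs P mA mD).1 D0) => w + [ltw len] => /(_ (conj ltw len)) e.
 by move: ltw; rewrite -sube_gt0 e ltxx.
apply: filterS (ae_count H1) => w Hw; rewrite leNgt; apply/negP => lt.
have fin : Y w \is a fin_num by rewrite ge0_fin_numE//; apply: lt_le_trans lt (leey _).
apply: (Hw (Num.trunc (fine (Y w))).+1); split => //.
by rewrite -[Y w]fineK// lee_fin ltW// truncnS_gt.
Qed.

Lemma cexp_ge0_uniq H (X : Ω -> \bar R) Y Y' : csub P H -> is_cexp_ge0 P H X Y ->
 is_cexp_ge0 P H X Y' -> \forall w \ae P, Y w = Y' w.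
Proof.
move=> cH [Y0 HY EY] [Y0' HY' EY'].
have h1 : \forall w \ae P, (Y' w <= Y w)%E.
 by apply: (ereal_ae_le cH) => // A HA; rewrite EY// EY'.
have h2 : \forall w \ae P, (Y w <= Y' w)%E.
 by apply: (ereal_ae_le cH) => // A HA; rewrite EY// EY'.
by apply: filterS2 h1 h2 => w ? ?; apply/eqP; rewrite eq_le; apply/andP.
Qed.

Lemma cexp_ge0E H (X : Ω -> \bar R) Y : csub P H -> is_cexp_ge0 P H X Y ->
 \forall w \ae P, cexp_ge0 P H X w = Y w.
Proof.
move=> cH XY; apply: (cexp_ge0_uniq cH _ XY).
by apply: (@xgetPex _ (cst 0%E) [set Y | is_cexp_ge0 P H X Y]); exists Y.
Qed.

Definition pos X (w : Ω) : R := maxr 0 (X w).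

Lemma L1_pos X : L1 P X -> L1 P (pos X).
Proof.
move=> iX; apply: le_L1 (L1norm iX).
 apply: measurable_maxr; meas.
by move=> w; rewrite ger0_norm ?le_max ?lexx// ge_max normr_ge0 ler_norm.
Qed.

Lemma posB X w : pos X w - pos (fun w => - X w) w = X w.
Proof. by rewrite -[RHS]maxr_posneg mul1r mulN1r. Qed.

Lemma pos_ce H X : csub P H -> L1 P X -> (forall w, 0 <= X w) ->
 is_ce P H X (pos (ce P H X)).
Proof.
move=> cH iX X0; have Hc := ce_sm cH iX; have ic := ce_L1 cH iX.
split.
- apply/(smE _ cH); apply: measurable_maxr => //.
 exact/(smE _ cH).
- exact: L1_pos.
- move=> A HA; rewrite -(EI_ce cH iX HA); have mA := csubm cH HA.
 apply: EI_aeq => //; first exact: L1_pos.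
 by apply: filterS (ce_ge0 cH iX X0) => w h _; rewrite /pos max_r.
Qed.

(** The factor, such as the inverse of a survival probability, may be unbounded. It is cut at [n],
    divided by [n + 1] to become a weight for [EI_dual], and restored by monotone convergence. *)
Lemma integral_factor H (c X X' : Ω -> R) : csub P H -> smeas H c -> (forall w, 0 <= c w) ->
 L1 P X -> L1 P X' -> (forall w, 0 <= X w) -> (forall w, 0 <= X' w) ->
 (forall B, H B -> EI P B X = EI P B X') -> forall B, H B ->
 (\int[P]_(w in B) (c w * X w)%:E = \int[P]_(w in B) (c w * X' w)%:E)%E.
Proof.
move=> cH Hc c0 iX iX' X0 X0' XX' B HB; have mB := csubm cH HB.
have mc := sm_meas cH Hc.
pose cn n w := minr n%:R (c w).
have cn0 n w : 0 <= cn n w by rewrite le_min c0 andbT.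
have mcn n : mfunT (cn n) by apply: measurable_minr.
have lim Z : L1 P Z -> (forall w, 0 <= Z w) ->
  (\int[P]_(w in B) (cn n w * Z w)%:E @[n --> \oo] --> \int[P]_(w in B) (c w * Z w)%:E)%E.
 move=> iZ Z0.
 have L w : B w -> limn (fun n => (cn n w * Z w)%:E) = (c w * Z w)%:E.
  move=> _; apply/cvg_lim => //; apply/fine_cvgP; split; first exact: nearW.
  apply: cvgMl; apply/cvgnP => e e0; exists (Num.trunc (c w)).+1 => n Nn.
  rewrite /cn min_r ?subrr ?normr0//; apply: le_trans (ltW (truncnS_gt _)) _.
  by rewrite ler_nat.
 rewrite -(eq_integral _ _ (fun w wB => L w (set_mem wB))).
 apply: cvg_monotone_convergence => //.
 - meas.
 - by move=> n w _; rewrite lee_fin mulr_ge0.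
 - move=> w _ m n mn; rewrite lee_fin ler_wpM2r// le_min !ge_min lexx orbT andbT.
  by rewrite ler_nat mn.
have E n : (\int[P]_(w in B) (cn n w * X w)%:E = \int[P]_(w in B) (cn n w * X' w)%:E)%E.
 have n0 : 0 < n.+1%:R :> R by [].
 pose φ w : R := \1_B w * (cn n w / n.+1%:R).
 have Hphi : smeas H φ.
  apply: (smM cH); first exact: (sm_indic cH).
  apply: (smM cH); last exact: (smcst cH).
  by apply/(smE _ cH); apply: measurable_minr; [exact: mcst|exact/(smE _ cH)].
 have p01 w : 0 <= φ w <= 1.
  have h0 : 0 <= cn n w / n.+1%:R by rewrite divr_ge0.
  have h1 : cn n w / n.+1%:R <= 1.
   by rewrite ler_pdivrMr// mul1r ge_min ler_nat leqnSn.
  by rewrite /φ indicE; case: (_ \in _); rewrite ?mul1r ?mul0r ?h0 ?lexx ?ler01.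
 have icn Z : L1 P Z -> L1 P (fun w => cn n w * Z w).
  move=> iZ; apply: le_L1 (L1Z n%:R (L1norm iZ)).
   meas.
  by move=> w; rewrite normrM (ger0_norm (cn0 n w)) ler_wpM2r// ge_min lexx.
 have F Z : L1 P Z -> EI P setT (fun w => φ w * Z w) = n.+1%:R^-1 * EI P B (fun w => cn n w * Z w).
  move=> iZ; rewrite -EIZ//; last exact: icn.
  rewrite -[X in EI P X (fun w => n.+1%:R^-1 * _)]setTI -EI_indic//.
  apply: eq_EI => w _; rewrite /φ; ring.
 have := EI_dual cH iX iX' XX' Hphi p01; rewrite !F// => /(mulfI (invr_neq0 (lt0r_neq0 n0))).
 by rewrite -!EIE; [move=> ->|exact: mB|exact: icn|exact: mB|exact: icn].
have := lim X iX X0; under eq_fun do rewrite E; move=> l1.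
by apply: (cvg_unique _ l1 (lim X' iX' X0')).
Qed.

Section scaled.
Context (H : set (set Ω)) (s p : Ω -> R)
 (cH : csub P H)
 (Hs : smeas H s)
 (s0 : forall w, 0 <= s w)
 (mp : mfunT p)
 (p01 : forall w, 0 <= p w <= 1).

(** The ratio [Pi], written with a real-valued non-negative version [s] of the survival
    probability. *)
Definition weight (w : Ω) : R := if s w == 0 then 1 else p w / s w.

Let p0 w : 0 <= p w. Proof. by have /andP[] := p01 w. Qed.

Lemma weight_ge0 w : 0 <= weight w.
Proof. by rewrite /weight; case: ifP => // _; rewrite divr_ge0. Qed.

(** The default value 1 of the ratio is moved into numerator and denominator, which makes the weight
    a genuine quotient. *)
Let s' (w : Ω) := if s w == 0 then 1 else s w.
Let p' (w : Ω) := if s w == 0 then 1 else p w.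

Let weightE w : weight w = (s' w)^-1 * p' w.
Proof. by rewrite /weight /s' /p'; case: ifP => _; [rewrite invr1 mulr1|rewrite mulrC]. Qed.

Let Hi : smeas H (fun w => (s' w)^-1).
Proof.
apply/(smE _ cH); apply: meas_inv => [w|]; first by rewrite /s'; case: ifP.
apply: measurable_fun_ifT => //; [apply: measurable_fun_eqr => //|]; exact/(smE _ cH).
Qed.

Let mp' : mfunT p'.
Proof. apply: measurable_fun_ifT => //; apply: measurable_fun_eqr => //; exact: (sm_meas cH Hs). Qed.

Let p'01 w : 0 <= p' w <= 1. Proof. by rewrite /p'; case: ifP; rewrite ?lexx ?ler01. Qed.

Lemma cexp_ge0_scaled X : L1 P X -> (forall w, 0 <= X w) ->
 is_cexp_ge0 P H (EFin \o (fun w => weight w * X w))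
  (EFin \o (fun w => (s' w)^-1 * pos (ce P H (fun w => p' w * X w)) w)).
Proof.
move=> iX X0; have iX' := L1_mul mp' p'01 iX.
have pX0 w : 0 <= p' w * X w by rewrite mulr_ge0//; have /andP[] := p'01 w.
have [Hy iy Ey] := pos_ce cH iX' pX0.
have y0 w : 0 <= pos (ce P H (fun w => p' w * X w)) w by rewrite le_max lexx.
have i0 w : 0 <= (s' w)^-1 by rewrite invr_ge0 /s'; case: ifP.
split=> [w|| A HA]; first by rewrite /= lee_fin mulr_ge0.
 apply/(smE _ cH)/measurable_EFinP/(smE _ cH); exact: (smM cH).
rewrite /= (integral_factor cH Hi i0 iy iX' y0 pX0 Ey HA).
by apply: eq_integral => w _; rewrite weightE mulrA.
Qed.

Lemma ce_local X X' B : L1 P X -> L1 P X' -> H B -> (forall w, B w -> X w = X' w) ->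
 \forall w \ae P, B w -> ce P H X w = ce P H X' w.
Proof.
move=> iX iX' HB XX'; have iB Z : L1 P Z -> L1 P (fun w => \1_B w * ce P H Z w).
 by move=> iZ; apply: L1indic; [exact: csubm cH HB|exact: ce_L1].
have mB Z : L1 P Z -> smeas H (fun w => \1_B w * ce P H Z w).
 by move=> iZ; apply: (smM cH); [exact: (sm_indic cH)|exact: (ce_sm cH)].
apply: filterS (sm_ae_eq cH (mB X iX) (mB X' iX') (iB X iX) (iB X' iX') _) => [w + Bw|A HA].
 by rewrite indicE mem_set// !mul1r.
have mA := csubm cH HA; have mB' := csubm cH HB; have HAB := csubI cH HA HB.
rewrite (EI_indic P _ mA mB') (EI_indic P _ mA mB') (EI_ce cH iX HAB) (EI_ce cH iX' HAB).
by apply: eq_EI => w [_]; exact: XX'.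
Qed.

Lemma cexp_scaled X : L1 P X -> \forall w \ae P, s w != 0 ->
 cexp P H (fun w => weight w * X w) w = (ce P H (fun w => p w * X w) w / s w)%:E.
Proof.
move=> iX; have i1 := L1_pos iX; have i2 := L1_pos (L1N iX).
have pos0 Z (w : Ω) : 0 <= pos Z w by rewrite le_max lexx.
have e1 := cexp_ge0E cH (cexp_ge0_scaled i1 (pos0 X)).
have e2 := cexp_ge0E cH (cexp_ge0_scaled i2 (pos0 _)).
have j1 := L1_mul mp' p'01 i1; have j2 := L1_mul mp' p'01 i2.
have pp0 Z w : 0 <= p' w * pos Z w by rewrite mulr_ge0//; have /andP[] := p'01 w.
have [Hy1 iy1 Ey1] := pos_ce cH j1 (pp0 _); have [Hy2 iy2 Ey2] := pos_ce cH j2 (pp0 _).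
have ipX := L1_mul mp' p'01 iX; have ipX' := L1_mul mp p01 iX.
have e3 := ceE cH ipX (_ : is_ce P H (fun w => p' w * X w) (fun w =>
  pos (ce P H (fun w => p' w * pos X w)) w - pos (ce P H (fun w => p' w * pos (fun w => - X w) w)) w)).
have {}e3 := e3 ltac:(split; [exact: (smB cH)|exact: L1B|move=> A HA; have mA := csubm cH HA;
  rewrite EIB// Ey1// Ey2// -EIB//; by apply: eq_EI => w _; rewrite -mulrBr posB]).
have Hn : H (~` [set w | s w = 0]) by apply: (csubC cH); apply: (csub_eq cH) => //; exact: (smcst cH).
have e4 := ce_local ipX ipX' Hn _.
apply: filterS3 e1 e2 (filterI e3 (e4 _)) => [w h1 h2 [h3 h4] sw|w /eqP/negbTE ns]; last by rewrite /p' ns.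
have q (f : Ω -> R) : (fun w => weight w * pos f w) = (fun w => maxr (weight w * f w) 0).
 by apply/funext => v; rewrite /pos maxC maxr_pMr ?weight_ge0// mulr0.
rewrite /cexp (_ : (_ \o _)^\+%E = EFin \o (fun w => weight w * pos X w)); last by rewrite q; apply/funext => v; rewrite funeposE -EFin_max.
rewrite (_ : (_ \o _)^\-%E = EFin \o (fun w => weight w * pos (fun w => - X w) w)); last first.
 by rewrite q; apply/funext => v; rewrite funenegE/= -EFin_max mulrN.
rewrite h1 h2/= -EFinB -mulrBr -h3 h4; last exact/eqP.
by rewrite /s' (negbTE sw) mulrC.
Qed.

End scaled.

Lemma cexp_L1 H X : csub P H -> L1 P X -> \forall w \ae P, cexp P H X w = (ce P H X w)%:E.
Proof.
move=> cH iX.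
have H1 : smeas H (cst 1 : Ω -> R) by exact: (smcst cH).
have := cexp_scaled cH H1 (fun=> ler01) (@measurable_cst _ _ _ _ _ (1 : R))
 (fun w => ltac:(by rewrite ler01 lexx)) iX.
apply: filterS => w /(_ (oner_neq0 _)).
have -> : (fun w => weight (cst 1) (cst 1) w * X w) = X.
 by apply/funext => v; rewrite /weight oner_eq0 divr1 mul1r.
have -> : (fun w => cst 1 w * X w) = X by apply/funext => v; rewrite mul1r.
by rewrite divr1.
Qed.

(** Among the lower bounds of the family, one maximises the mean of [contract], a bounded increasing
    image of the extended line: the supremum of a maximising sequence. Its maximum with any other
    lower bound has no larger mean, so it is the greatest. *)
Lemma essinf_exists (Phi : set (Ω -> \bar R)) : exists Y, is_essinf P Phi Y.
Proof.
pose L := [set Z : Ω -> \bar R | mfunT Z /\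
 forall U, Phi U -> \forall w \ae P, (Z w <= U w)%E].
pose c Z := EI P setT (fun w => contract (Z w)).
have ic Z : mfunT Z -> L1 P (fun w => contract (Z w)).
 move=> mZ; apply: (@L1bound _ _ _ P _ 1); first exact: meas_contract.
 move=> w; exact: contract_le1.
have L0 : L (cst -oo%E).
 by split=> [|U _]; [exact: mcst|apply: aeW => w; exact: leNye].
have hs : has_sup (c @` L).
 split; first by exists (c (cst -oo%E)), (cst -oo%E).
 have P1 : EI P setT (fun=> 1) = 1 by rewrite EIcst// probability_setT mulr1.
 exists 1 => _ [Z [mZ _] <-]; rewrite -[leRHS]P1; apply: EI_le => //; [exact: ic|exact: L1cst|].
 by move=> w _; have := contract_le1 (Z w); rewrite ler_norml => /andP[].
have Zn n : exists Z, L Z /\ sup (c @` L) - mesh n < c Z.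
 by have [_ [Z LZ <-] lt] := sup_adherent (mesh_gt0 n) hs; exists Z.
have {Zn}[Z_ Z_P] := boolp.choice Zn.
pose Y w := ereal_sup (range (Z_ ^~ w)).
have mY : mfunT Y.
 rewrite (_ : Y = fun w => esups (Z_ ^~ w) 0%N).
  by apply: measurable_fun_esups => n; have [[]] := Z_P n.
 apply/funext => w; rewrite /esups /sdrop; congr ereal_sup.
 by apply/seteqP; split=> x [n _ <-]; exists n.
have LY : L Y.
 split=> // U PU.
 have := ae_count (fun n => (Z_P n).1.2 U PU); apply: filterS => w Hw.
 by apply: ge_ereal_sup => _ [n _ <-].
have ZY n w : (Z_ n w <= Y w)%E by apply: ereal_sup_ubound; exists n.
have cY : sup (c @` L) <= c Y.
 apply/ler_addgt0Pl => e e0; have [n ne] := mesh_small e0.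
 rewrite -lerBlDl; apply: (@le_trans _ _ (sup (c @` L) - mesh n)).
  lra.
 apply: (le_trans (ltW (Z_P n).2)); apply: EI_le => //.
 - by apply: ic; have [[]] := Z_P n.
 - meas.
 - by move=> w _; rewrite le_contract.
exists Y; split=> //; first by case: LY.
move=> Z mZ ZP.
have mM : mfunT (fun w => maxe (Y w) (Z w)) by exact: measurable_maxe.
have LM : L (fun w => maxe (Y w) (Z w)).
 split=> // U PU; apply: filterS2 (LY.2 U PU) (ZP U PU) => w h1 h2.
 by rewrite ge_max h1.
have : \forall w \ae P, contract (maxe (Y w) (Z w)) <= contract (Y w).
 have i1 := ic _ mM; have i2 := ic _ mY.
 apply: ae_le_EI => //; set A := [set w | _]; have mA : measurable A.
  apply: meas_lt; meas.
 have le : c (fun w => maxe (Y w) (Z w)) <= c Y.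
  by apply: le_trans cY; apply: ub_le_sup; [exact: hs.2|exists (fun w => maxe (Y w) (Z w))].
 have nA w : (~` A) w -> contract (maxe (Y w) (Z w)) = contract (Y w).
  move=> /negP; rewrite -leNgt => h; apply/eqP; rewrite eq_le h/=.
  by rewrite le_contract le_max lexx.
 move: le; rewrite /c (EI_split measurableT mA i1) (EI_split measurableT mA i2) !setTI.
 by rewrite (eq_EI P nA) lerD2r.
apply: filterS => w; rewrite le_contract => h; apply: le_trans h.
by rewrite le_max lexx orbT.
Qed.

Lemma is_essinfE (Phi : set (Ω -> \bar R)) : is_essinf P Phi (essinf P Phi).
Proof. by have [Y hY] := essinf_exists Phi; apply: (@xgetPex _ _ (is_essinf P Phi)); exists Y. Qed.

Lemma is_essinfN (Phi : set (Ω -> \bar R)) Y :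
 is_esssup P Phi Y <-> is_essinf P [set (fun w => - U w)%E | U in Phi] (fun w => - Y w)%E.
Proof.
split=> -[mY lY gY]; split.
- exact: mcomp mY.
- by move=> _ [U PU <-]; apply: filterS (lY U PU) => w; rewrite leeN2.
- move=> Z mZ ZP; have := gY (fun w => - Z w)%E.
 move=> /(_ (mcomp _ mZ)) H; apply: filterS (H _ _) => //.
  by move=> w; rewrite leeNr.
 move=> U PU; have := ZP (fun w => - U w)%E; move=> /(_ (ex_intro2 _ _ U PU erefl)).
 by apply: filterS => w; rewrite leeNr.
- rewrite (_ : Y = (fun w => - - Y w)%E); last by apply/funext => w; rewrite oppeK.
 exact: mcomp mY.
- move=> U PU; have := lY (fun w => - U w)%E; move=> /(_ (ex_intro2 _ _ U PU erefl)).
 by apply: filterS => w; rewrite leeN2.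
- move=> Z mZ ZP; have := gY (fun w => - Z w)%E.
 move=> /(_ (mcomp _ mZ)) H; apply: filterS (H _ _) => //.
  by move=> w; rewrite leeN2.
 by move=> _ [U PU <-]; apply: filterS (ZP U PU) => w; rewrite leeN2.
Qed.

Lemma is_esssupE (Phi : set (Ω -> \bar R)) : is_esssup P Phi (esssup P Phi).
Proof.
apply: (@xgetPex _ _ (is_esssup P Phi)).
have [Y hY] := essinf_exists [set (fun w => - U w)%E | U in Phi].
exists (fun w => - Y w)%E; apply/is_essinfN.
by rewrite (_ : (fun w => - - Y w)%E = Y)//; apply/funext => w; rewrite oppeK.
Qed.

(** Multiplication by [s] hides the set [s = 0], where the members are arbitrary. Off it [v / s] is
    a lower bound, whence [v <= s * Y]; members of nearly minimal mean give the converse. *)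
Lemma essinf_scaled (Phi : set (Ω -> \bar R)) Y (s v : Ω -> R) :
 is_essinf P Phi Y -> (forall w, 0 <= s w) -> mfunT s -> L1 P v ->
 (\forall w \ae P, s w = 0 -> v w = 0) ->
 (forall U, Phi U -> exists W, [/\ L1 P W, \forall w \ae P, v w <= W w
   & \forall w \ae P, s w != 0 -> U w = (W w / s w)%:E]) ->
 (forall e : R, 0 < e -> exists U W, [/\ Phi U, L1 P W, EI P setT W <= EI P setT v + e,
   \forall w \ae P, v w <= W w & \forall w \ae P, s w != 0 -> U w = (W w / s w)%:E]) ->
 \forall w \ae P, ((s w)%:E * Y w = (v w)%:E)%E.
Proof.
move=> [mY lY gY] s0 ms iv v0 hP hinf; have mv := L1_meas iv.
(* The comparison must be with a lower bound on the whole space, so [Y] itself is used on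
   [s = 0]. *)
pose Z w : \bar R := if s w == 0 then Y w else (v w / s w)%:E.
have mZ : mfunT Z.
 apply: measurable_fun_ifT => //.
  exact: measurable_fun_eqr.
 apply/measurable_EFinP; apply: mfunM => //; exact: meas_inv.
have ge : \forall w \ae P, (Z w <= Y w)%E.
 apply: gY => // U PU; have [W [_ h1 h2]] := hP U PU.
 apply: filterS3 h1 h2 (lY U PU) => w a1 a2 a3; rewrite /Z; case: eqP => // /eqP sw.
 by rewrite (a2 sw) lee_fin ler_wpM2r// invr_ge0.
have fin w W : s w != 0 -> (Z w <= Y w)%E -> (Y w <= (W / s w)%:E)%E ->
  exists r, [/\ ((s w)%:E * Y w = r%:E)%E, v w <= r & r <= W].
 rewrite /Z => sw; have sp : 0 < s w by rewrite lt0r sw s0.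
 rewrite (negbTE sw); case: (Y w) => [y| |] //; rewrite !lee_fin ler_pdivrMr// ler_pdivlMr// => h1 h2.
 by exists (s w * y); rewrite EFinM mulrC.
have [U0 [W0 [PU0 iW0 _ _ u0]]] := hinf 1 ltr01.
(* An integrable version of [s * Y], kept between [v] and one member [W0]. *)
pose q w := maxr (v w) (minr (fine ((s w)%:E * Y w)%E) (W0 w)).
have iq : L1 P q.
 apply: (@le_L1 _ _ _ P q (fun w => `|v w| + `|W0 w|)); last by meas.
  apply: measurable_maxr => //; apply: measurable_minr; last meas.
  apply: mcomp => //; apply: emeasurable_funM; meas.
 move=> w; have := ler_norm (- v w); have := ler_norm (- W0 w).
 have := ler_norm (v w); have := ler_norm (W0 w).
 rewrite !normrN => h1 h2 h3 h4; rewrite /q ler_norml.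
 case: (leP _ (W0 w)) => ?; case: (leP (v w)) => ?; lra.
have up U W : Phi U -> (\forall w \ae P, v w <= W w) ->
  (\forall w \ae P, s w != 0 -> U w = (W w / s w)%:E) -> \forall w \ae P, q w <= W w.
 move=> PU h1 h2; apply: filterS3 (filterI v0 h1) h2 (filterI ge (lY U PU)) => w [z a1] a2 [a3 a4].
 have [sw|sw] := eqVneq (s w) 0.
  by rewrite /q sw mul0e/= z// ge_max -[in X in X && _]z// a1 ge_min -[in X in X || _]z// a1.
 rewrite (a2 sw) in a4; have [r [e _ rW]] := fin w _ sw a3 a4.
 by rewrite /q e ge_max a1 ge_min rW.
have qv : \forall w \ae P, q w <= v w.
 have le : EI P setT q <= EI P setT v.
  apply/ler_addgt0Pr => e e0; have [U [W [PU iW We h1 h2]]] := hinf e e0.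
  by apply: le_trans We; apply: EI_ae_le => //; apply: filterS (up U W PU h1 h2).
 apply: ae_le_EI => //; set A := [set w | _]; have mA : measurable A by apply: meas_lt; meas.
 move: le; rewrite (EI_split measurableT mA iq) (EI_split measurableT mA iv) !setTI.
 have : EI P (~` A) v <= EI P (~` A) q.
  by apply: EI_le => //; [meas|move=> w _; rewrite /q le_max lexx].
 lra.
apply: filterS3 (filterI v0 qv) (u0) (filterI ge (lY U0 PU0)) => w [z a1] a2 [a3 a4].
have [sw|sw] := eqVneq (s w) 0; first by rewrite sw mul0e z.
rewrite (a2 sw) in a4; have [r [e vr rW]] := fin w _ sw a3 a4; rewrite e; congr EFin.
by apply/le_anti; rewrite vr andbT; move: a1; rewrite /q e/= (min_idPl rW) ge_max => /andP[].
Qed.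

Lemma esssup_scaled (Phi : set (Ω -> \bar R)) Y (s v : Ω -> R) :
 is_esssup P Phi Y -> (forall w, 0 <= s w) -> mfunT s -> L1 P v ->
 (\forall w \ae P, s w = 0 -> v w = 0) ->
 (forall U, Phi U -> exists W, [/\ L1 P W, \forall w \ae P, v w <= W w
   & \forall w \ae P, s w != 0 -> U w = (- (W w / s w))%:E]) ->
 (forall e : R, 0 < e -> exists U W, [/\ Phi U, L1 P W, EI P setT W <= EI P setT v + e,
   \forall w \ae P, v w <= W w & \forall w \ae P, s w != 0 -> U w = (- (W w / s w))%:E]) ->
 \forall w \ae P, ((s w)%:E * Y w = (- v w)%:E)%E.
Proof.
move=> /is_essinfN hY s0 ms iv v0 hP hinf.
have := essinf_scaled hY s0 ms iv v0; move=> H; have {}H := H _ _; apply: filterS (H _ _).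
- by move=> w; rewrite muleN EFinN => <-; rewrite oppeK.
- move=> _ [U PU <-]; have [W [iW h1 h2]] := hP U PU; exists W; split=> //.
 by apply: filterS h2 => w h sw; rewrite (h sw) EFinN oppeK.
- move=> e e0; have [U [W [PU iW We h1 h2]]] := hinf e e0.
 exists (fun w => - U w)%E, W; split=> //; first by exists U.
 by apply: filterS h2 => w h sw; rewrite (h sw) EFinN oppeK.
Qed.

End conditional.

(** * Payoffs as processes that need not be adapted *)

Section raw_payoffs.
Context {R : realType} {d : measure_display} {Ω : measurableType d}
 (P : probability Ω R) (T : R)
 (T0 : 0 < T).
Implicit Types (a x rho : R -> Ω -> R) (Xi θ : Ω -> R) (s t : R).

Definition mcpath x := (forall w, cpath T (x ^~ w)) /\
 forall t, 0 <= t <= T -> mfunT (x t).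

Lemma meas_at_qtl d' (S : measurableType d') (a : R -> S -> R) (q : S -> R) :
 (forall t, 0 <= t <= T -> mfunT (a t)) -> (forall w, cadlag T (a ^~ w)) ->
 mfunT q -> (forall w, 0 <= q w <= T) -> mfunT (fun w => a (q w) w).
Proof. by move=> ma ca mq q01; apply: (meas_eval ma) => // w t; have [] := ca w => /(_ t). Qed.

Lemma snd_quantile rho : mcpath rho ->
 mfunT (fun p : mR R * Ω => qtl T (rho ^~ p.2) p.1).
Proof.
move=> [cr mr]; apply: (@meas_qtl R T T0 _ _ (fun t p => rho t p.2) fst) => //.
move=> t tT; exact: mcomp (mr t tT) measurable_snd.
Qed.

Lemma lint_L1 a Xi x (c : Ω -> R) : raw P T a Xi -> mcpath x -> mfunT c ->
 L1 P (fun w => lint T (x ^~ w) (a ^~ w) (c w)).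
Proof.
move=> [ca ma iXi aXi] mx mc.
have qT z w : 0 <= qtl T (x ^~ w) z <= T by apply: qtl_in => //; exact: mx.1.
have m : mfunT (fun p : mR R * Ω =>
  \1_[set v : mR R | v < c p.2] p.1 * a (qtl T (x ^~ p.2) p.1) p.2).
 apply: mfunM.
  rewrite (_ : (fun p => _) = \1_[set p : mR R * Ω | p.1 < c p.2]).
   apply: measurable_indic; apply: meas_lt; first meas.
   exact: mcomp mc measurable_snd.
  meas.
 apply: (@meas_at_qtl _ _ (fun t p => a t p.2)) => //.
  move=> t tT; exact: mcomp (ma t tT) measurable_snd.
 exact: snd_quantile.
have [] // := @fubini_dom R _ _ _ _ unif P (fun z w =>
  \1_[set v : mR R | v < c w] z * a (qtl T (x ^~ w) z) w) Xi m.
move=> z w; rewrite normrM normr_nat; apply: le_trans (aXi _ w (qT z w)).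
by apply: ler_piMl; rewrite // lern1 leq_b1.
Qed.

Lemma EI_cstT {d'} {S : measurableType d'} (Q : probability S R) (c : R) : EI Q setT (fun=> c) = c.
Proof. by rewrite EIcst// probability_setT mulr1. Qed.

Lemma EI_absT {d'} {S : measurableType d'} (Q : probability S R) (X : S -> R) (C : R) :
 L1 Q X -> (forall z, `|X z| <= C) -> `|EI Q setT X| <= C.
Proof.
move=> iX XC; apply: (le_trans (EI_abs measurableT iX)).
by rewrite -[leRHS](EI_cstT Q); apply: EI_le => //; [exact: L1norm|exact: L1cst].
Qed.

Section paths.
Context (x a : R -> R)
 (hx : cpath T x) (ca : cadlag T a).

Lemma lint_bound (c C : R) : (forall t, 0 <= t <= T -> `|a t| <= C) -> `|lint T x a c| <= C.
Proof.
move=> aC; apply: EI_absT; first exact: L1_lint.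
move=> z; rewrite normrM normr_nat; apply: le_trans (aC _ (qtl_in T0 hx z)).
by apply: ler_piMl; rewrite // lern1 leq_b1.
Qed.

Lemma lint0 : lint T x a 0 = 0.
Proof.
rewrite -[RHS](EI_cstT unif); apply: EI_aeq => //; [exact: L1_lint|exact: L1cst|].
apply: ae_imp unif_ae _ => z /andP[z0 _] _; rewrite indicE memNset ?mul0r//=.
lra.
Qed.

Lemma lint_mono (c c' : R) : (forall t, 0 <= t <= T -> 0 <= a t) -> c <= c' ->
 lint T x a c <= lint T x a c'.
Proof.
move=> a0 cc; apply: EI_le => //; [exact: L1_lint|exact: L1_lint|move=> z _].
apply: ler_wpM2r; first by apply: a0; exact: qtl_in.
rewrite ler_nat; case: (boolP (z \in [set v | v < c])) => //; rewrite inE => zc.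
rewrite mem_set//=; exact: lt_le_trans zc cc.
Qed.

Lemma lint_sub (b : R -> R) (c : R) : cadlag T b ->
 lint T x (fun t => a t - b t) c = lint T x a c - lint T x b c.
Proof.
move=> cb; rewrite /lint -EIB//; [|exact: L1_lint|exact: L1_lint].
by apply: eq_EI => z _; rewrite mulrBr.
Qed.

Lemma lint_cvg (F : set_system R) {FF : Filter F} (u : R -> R) (l : R) : 0 <= l <= 1 ->
 (\forall s \near F, 0 <= u s <= 1) -> u s @[s --> F] --> l ->
 lint T x a (u s) @[s --> F] --> lint T x a l.
Proof.
move=> l01 u01 ul; have [C aC] := cadlag_bounded T0 ca.
have C0 : 0 <= C by apply: le_trans (aC 0 _); rewrite // lexx ltW.
have dist (c c' : R) : 0 <= c <= 1 -> 0 <= c' <= 1 -> `|lint T x a c - lint T x a c'| <= C * `|c - c'|.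
 wlog cc : c c' / c' <= c.
  move=> H h1 h2; have [/H|/ltW /H] := leP c' c; first exact.
  by rewrite distrC [X in _ <= C * X]distrC; exact.
 move=> /andP[_ c1] /andP[c'0 _]; rewrite [X in _ <= C * X]ger0_norm ?subr_ge0//.
 exact: lint_lip.
apply/cvgrPdist_lt => e e0; have C1 : 0 < C + 1 by rewrite ltr_pwDr.
near=> s; have us : 0 <= u s <= 1 by near: s.
have h : `|l - u s| < e / (C + 1).
 by near: s; move/cvgrPdist_lt: ul; apply; rewrite divr_gt0.
apply: (le_lt_trans (dist _ _ l01 us)); apply: (@le_lt_trans _ _ ((C + 1) * `|l - u s|)).
 by rewrite ler_wpM2r// lerDl.
by rewrite mulrC -ltr_pdivlMr.
Unshelve. all: by end_near. Qed.

Lemma near_in_right t : 0 <= t < T -> \forall s \near t^'+, 0 <= s <= T.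
Proof.
move=> /andP[t0 tT]; near=> s; apply/andP; split.
 exact: (le_trans t0).
near: s; exact: nbhs_right_le.
Unshelve. all: by end_near. Qed.

Lemma near_in_left t : 0 < t <= T -> \forall s \near t^'-, 0 <= s < T.
Proof.
move=> /andP[t0 tT]; near=> s; apply/andP; split.
 near: s; exact: nbhs_left_ge.
exact: lt_le_trans tT.
Unshelve. all: by end_near. Qed.

Lemma lint_left t : 0 < t <= T ->
 lint T x a (x s) @[s --> t^'-] --> lint T x a (before x t).
Proof.
move=> tT; have [cx _ _ _] := hx; have /andP[t0 tT'] := tT.
apply: lint_cvg; [by apply: (cpath_before hx); rewrite ltW| |exact: (cadlag_left cx tT)].
apply: filterS (near_in_left tT) => s /andP[s0 sT]; apply: (cpath01 hx).
lra.
Qed.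

Lemma lint_cadlag : cadlag T (fun t => lint T x a (x t)).
Proof.
have [cx _ _ _] := hx; split=> t tT; last by apply/cvg_ex; exists (lint T x a (before x t)); exact: lint_left.
have /andP[t0 tT'] := tT; apply: lint_cvg; [by apply: (cpath01 hx); rewrite t0 ltW| |exact: cx.1].
apply: filterS (near_in_right tT) => s; exact: cpath01.
Qed.

Lemma lint_before t : 0 <= t <= T -> before (fun t => lint T x a (x t)) t = lint T x a (before x t).
Proof.
move=> /andP[]; rewrite le_eqVlt => /predU1P[<-|t0] tT; first by rewrite /before lexx lint0.
by rewrite before_lim//; apply/cvg_lim => //; apply: lint_left; rewrite t0.
Qed.

End paths.

(** The integral of [a] against [dx] over [[0, t]], written with levels; its left limit is the
    integral over [[0, t[]. *)
Definition Kint x a t w := lint T (x ^~ w) (a ^~ w) (x t w).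

Lemma Kint_raw x a Xi : raw P T a Xi -> mcpath x -> raw P T (Kint x a) Xi.
Proof.
move=> ra mx; have [ca ma iXi aXi] := ra; split=> //.
- move=> w; apply: lint_cadlag => //; exact: mx.1.
- move=> t tT; apply: L1_meas; apply: (lint_L1 ra mx); exact: mx.2.
- move=> t w tT; apply: lint_bound => //; [exact: mx.1|move=> s; exact: aXi].
Qed.

Lemma measurable_lint x a Xi d' (S : measurableType d') (s : S -> R) (p : S -> Ω) :
 raw P T a Xi -> mcpath x -> mfunT s -> (forall v, 0 <= s v <= T) ->
 mfunT p ->
 mfunT (fun v => lint T (x ^~ (p v)) (a ^~ (p v)) (before (x ^~ (p v)) (s v))).
Proof.
move=> ra mx ms s01 mp; have [cK mK _ _] := Kint_raw ra mx; have [ca _ _ _] := ra.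
rewrite (_ : (fun v => _) = fun v => before (Kint x a ^~ (p v)) (s v)).
 apply: (@meas_before R T T0 _ _ (fun t v => Kint x a t (p v))) => //.
 move=> t tT; exact: mcomp (mK t tT) mp.
apply/funext => v; rewrite lint_before//; exact: mx.1.
Qed.

Lemma truncated_cpath x θ w : mcpath x -> 0 <= θ w <= T -> cpath T (truncated x θ ^~ w).
Proof. move=> mx thT; exact: (trunc_cpath T0 (mx.1 w) thT). Qed.

Lemma truncated_mcpath x θ : mcpath x -> mfunT θ ->
 (forall w, 0 <= θ w <= T) -> mcpath (truncated x θ).
Proof.
move=> mx mth thT; split=> [w|t tT]; first exact: truncated_cpath.
have mr : mfunT (fun w => before (x ^~ w) (θ w)).
 by apply: (meas_before T0) => //; [exact: mx.2|move=> w; have [] := mx.1 w].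
apply: measurable_fun_ifT => //.
 meas.
apply: measurable_fun_ifT => //.
 exact: measurable_fun_eqr.
apply: mfunM; first by apply: mfunB => //; exact: mx.2.
apply: meas_inv; last meas.
by move=> w; rewrite subr_ge0; have /andP[] := cpath_before (mx.1 w) (thT w).
Qed.

Lemma truncated_before x θ w : 0 <= θ w <= T -> before (truncated x θ ^~ w) (θ w) = 0.
Proof.
move=> /andP[]; rewrite le_eqVlt => /predU1P[<-|t0] tT; first by rewrite /before lexx.
rewrite before_lim//; apply/cvg_lim => //; apply: cvg_near_cst.
by apply: filterS (nbhs_left_lt (θ w)) => s sth; rewrite /truncated sth.
Qed.

Context (f g h : R -> Ω -> R) (Xi : Ω -> R)
 (rf : raw P T f Xi) (rg : raw P T g Xi) (rh : raw P T h Xi).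

Definition Ypay x s w := ypay T (f ^~ w) (g ^~ w) (h ^~ w) (x ^~ w) s.

Let iXi : L1 P Xi. Proof. by have [] := rf. Qed.

Lemma Y_bound x s w : mcpath x -> 0 <= s <= T -> `|Ypay x s w| <= 3 * Xi w.
Proof.
move=> mx sT; have hx := mx.1 w; have [cx nx x0 _] := hx.
have [_ _ _ fXi] := rf; have [cg _ _ gXi] := rg; have [_ _ _ hXi] := rh.
have /andP[x0' x1'] := cpath01 hx sT; have /andP[b0 b1] := cpath_before hx sT.
have bx := before_le cx nx x0 sT.
have prod (u v : R) : `|u| <= Xi w -> 0 <= v <= 1 -> `|u * v| <= Xi w.
 move=> uX /andP[v0 v1]; rewrite normrM (ger0_norm v0); apply: le_trans uX.
 exact: ler_piMr.
have h1 : `|f s w * (1 - x s w)| <= Xi w.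
 by apply: prod; [exact: fXi|lra].
have h2 : `|lint T (x ^~ w) (g ^~ w) (before (x ^~ w) s)| <= Xi w.
 apply: lint_bound => // t; exact: gXi.
have h3 : `|h s w * (x s w - before (x ^~ w) s)| <= Xi w.
 by apply: prod; [exact: hXi|lra].
apply: (le_trans (ler_normD _ _)); apply: (le_trans (lerD (ler_normD _ _) (lexx _))).
apply: (@le_trans _ _ (Xi w + Xi w + Xi w)); first lra.
lra.
Qed.

Lemma Y_meas x d' (S : measurableType d') (s : S -> R) (p : S -> Ω) :
 mcpath x -> mfunT s -> (forall v, 0 <= s v <= T) ->
 mfunT p -> mfunT (fun v => Ypay x (s v) (p v)).
Proof.
move=> mx ms s01 mp.
have ev a : (forall t, 0 <= t <= T -> mfunT (a t)) ->
  (forall w, cadlag T (a ^~ w)) -> mfunT (fun v => a (s v) (p v)).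
 move=> ma ca; apply: (@meas_at_qtl _ _ (fun t v => a t (p v))) => //.
 move=> t tT; exact: mcomp (ma t tT) mp.
have cx w : cadlag T (x ^~ w) by have [] := mx.1 w.
have mxs := ev x mx.2 cx.
have mb : mfunT (fun v => before (x ^~ (p v)) (s v)).
 apply: (@meas_before R T T0 _ _ (fun t v => x t (p v))) => //.
 move=> t tT; exact: mcomp (mx.2 t tT) mp.
apply: mfunD; first apply: mfunD.
- apply: mfunM; first by apply: ev; have [] := rf.
 meas.
- exact: (measurable_lint rg).
- apply: mfunM; first by apply: ev; have [] := rh.
 meas.
Qed.

Lemma Y_L1 x (s : Ω -> R) : mcpath x -> mfunT s ->
 (forall w, 0 <= s w <= T) -> L1 P (fun w => Ypay x (s w) w).
Proof.
move=> mx ms s01; apply: le_L1 (L1Z 3 iXi); first exact: @Y_meas.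
move=> w; exact: Y_bound.
Qed.

(** The reward averaged over the player's own device: the quantiles of [rho] are its pure stopping
    times. *)
Definition Yavg x rho w := EI unif setT (fun z => Ypay x (qtl T (rho ^~ w) z) w).

Lemma YavgP x rho : mcpath x -> mcpath rho ->
 [/\ forall w, L1 unif (fun z => Ypay x (qtl T (rho ^~ w) z) w),
  L1 P (Yavg x rho), forall w, `|Yavg x rho w| <= 3 * Xi w
 & forall B, measurable B ->
  L1 unif (fun z => EI P B (fun w => Ypay x (qtl T (rho ^~ w) z) w)) /\
  EI P B (Yavg x rho) =
  EI unif setT (fun z => EI P B (fun w => Ypay x (qtl T (rho ^~ w) z) w))].
Proof.
move=> mx mr.
have qT z w : 0 <= qtl T (rho ^~ w) z <= T by apply: qtl_in => //; exact: mr.1.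
have m : mfunT (fun p : mR R * Ω =>
  Ypay x (qtl T (rho ^~ p.2) p.1) p.2).
 apply: Y_meas => //; exact: snd_quantile.
have b (z : mR R) w : `|Ypay x (qtl T (rho ^~ w) z) w| <= 3 * Xi w by exact: Y_bound.
have i3 := L1Z 3 iXi.
have [i1 _ i2 _ _] := @fubini_dom R _ _ _ _ unif P (fun z w => Ypay x (qtl T (rho ^~ w) z) w) _ m b i3.
split=> //; first by move=> w; apply: EI_absT.
move=> B mB.
exact: (@fubini_dom_set R _ _ _ _ unif P (fun z w => Ypay x (qtl T (rho ^~ w) z) w) _ B m b i3 mB).
Qed.

Section cost.
Context (x rho : R -> Ω -> R) (θ : Ω -> R)
 (mx : mcpath x) (mr : mcpath rho)
 (mth : mfunT θ) (thT : forall w, 0 <= θ w <= T)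
 (rho0 : forall w, before (rho ^~ w) (θ w) = 0).

Definition past w := lint T (x ^~ w) (g ^~ w) (before (x ^~ w) (θ w)).

Lemma past_L1 : L1 P past.
Proof.
apply: (lint_L1 rg mx); apply: (meas_before T0) => //; first exact: mx.2.
by move=> w; have [] := mx.1 w.
Qed.

Lemma cost_scaled w :
 (1 - before (x ^~ w) (θ w)) * game_cost T f g h rho (truncated x θ) θ w =
 Yavg x rho w - past w.
Proof.
have [cf _ _ _] := rf; have [cg _ _ _] := rg; have [ch _ _ _] := rh.
have [i1 _ _ _] := YavgP mx mr.
rewrite -[past w](EI_cstT unif) -EIB//; last meas.
exact: (truncated_cost T0 (cf w) (cg w) (ch w) (mx.1 w) (mr.1 w) (thT w) (rho0 w)).
Qed.

End cost.

(** Truncating twice at [θ] is truncating once, and the truncated control has not begun to stop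
    before [θ] and has no past there. The cost itself is thus an average of rewards, with no
    division by a small probability. *)
Lemma cost_L1 x rho θ : mcpath x -> mcpath rho -> mfunT θ ->
 (forall w, 0 <= θ w <= T) -> (forall w, before (rho ^~ w) (θ w) = 0) ->
 L1 P (game_cost T f g h rho (truncated x θ) θ).
Proof.
move=> mx mr mth thT rho0; have mt := truncated_mcpath mx mth thT.
have [_ i _ _] := YavgP mt mr.
rewrite (_ : game_cost _ _ _ _ _ _ _ = Yavg (truncated x θ) rho)//; apply/funext => w.
have := cost_scaled mt mr thT rho0 w.
have -> : truncated (truncated x θ) θ = truncated x θ.
 apply/funext => t; apply/funext => v; rewrite [LHS]/truncated.
 by rewrite truncated_before// eq_sym oner_eq0 !subr0 divr1; case: ifP => // tv; rewrite /truncated tv.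
rewrite /past truncated_before// subr0 mul1r lint0 ?subr0//; first exact: mt.1.
by have [] := rg.
Qed.

End raw_payoffs.

(** * Scaled essential infima of conditional costs *)

Section values.
Context {R : realType} {d : measure_display} {Ω : measurableType d}
 (P : probability Ω R).
Implicit Types (X C : Ω -> R) (A B : set Ω) (H : set (set Ω)).

Lemma csub_all H : csub P H -> csub P measurable.
Proof.
move=> [_ Hm HN]; split=> //; last exact: subset_trans HN Hm.
split; [exact: measurable0|by move=> A mA; rewrite setTD; exact: measurableC|].
exact: bigcupT_measurable.
Qed.

Lemma cexp_aeq H X X' : csub P H -> mfunT X -> mfunT X' ->
 (\forall w \ae P, X w = X' w) -> cexp P H X = cexp P H X'.
Proof.
move=> cH mX mX' XX'.
have ge0 (Z Z' : Ω -> \bar R) : mfunT Z -> mfunT Z' ->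
  (\forall w \ae P, Z w = Z' w) -> cexp_ge0 P H Z = cexp_ge0 P H Z'.
 move=> mZ mZ' ZZ'; have E A : H A -> (\int[P]_(w in A) Z w = \int[P]_(w in A) Z' w)%E.
  move=> HA; have mA := csubm cH HA; apply: ae_eq_integral => //.
  - meas.
  - meas.
  - by apply: filterS ZZ' => w.
 rewrite /cexp_ge0; congr xget; apply/funext => Y; apply/propext; rewrite /mkset.
 by split=> -[Y0 HY EY]; split=> // A HA; rewrite EY// E.
have me (Z : Ω -> R) : mfunT Z -> mfunT (EFin \o Z) by meas.
have e1 : cexp_ge0 P H ((EFin \o X)^\+)%E = cexp_ge0 P H ((EFin \o X')^\+)%E.
 apply: ge0; [exact: measurable_funepos (me _ mX)|exact: measurable_funepos (me _ mX')|].
 by apply: filterS XX' => v e; rewrite !funeposE /= e.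
have e2 : cexp_ge0 P H ((EFin \o X)^\-)%E = cexp_ge0 P H ((EFin \o X')^\-)%E.
 apply: ge0; [exact: measurable_funeneg (me _ mX)|exact: measurable_funeneg (me _ mX')|].
 by apply: filterS XX' => v e; rewrite !funenegE /= e.
by rewrite /cexp e1 e2.
Qed.

Section family.
Context (H : set (set Ω)) (s p X : Ω -> R) (fam : set (Ω -> R))
 (cH : csub P H) (s0 : forall w, 0 <= s w) (iX : L1 P X)
 (sp : is_ce P H p s)
 (mp : mfunT p) (p01 : forall w, 0 <= p w <= 1).
Hypothesis famP : forall C, fam C -> L1 P C /\
 forall B, H B -> EI P B X <= EI P B (fun w => p w * C w).
Hypothesis fam_inf : forall e : R, 0 < e -> exists2 C, fam C &
 EI P setT (fun w => p w * C w) <= EI P setT X + e.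

Let Hs : smeas H s. Proof. by case: sp. Qed.
Let ip : L1 P p.
Proof. by apply: (@L1bound _ _ _ P _ 1) => // w; have /andP[? ?] := p01 w; rewrite ger0_norm. Qed.

Let ipC C : fam C -> L1 P (fun w => p w * C w).
Proof. move=> /famP[iC _]; exact: L1_mul. Qed.

Let Hs0 : H [set w | s w = 0].
Proof. apply: (csub_eq cH) => //; exact: (smcst cH). Qed.

Let p_null : \forall w \ae P, s w = 0 -> p w = 0.
Proof.
have m0 := csubm cH Hs0; have i1 := L1indic m0 ip.
have : \forall w \ae P, \1_[set w | s w = 0] w * p w <= 0.
 apply: ae_le_EI => //; first meas.
 set A := [set w | _]; have mA : measurable A.
  apply: meas_lt; meas.
 rewrite EIcst// mul0r EI_indic//; have [_ _ E] := sp.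
 have pE : EI P [set w | s w = 0] p = 0.
  by rewrite -E// (eq_EI P (Y := fun=> 0)) ?EIcst ?mul0r.
 apply: (@le_trans _ _ (EI P [set w | s w = 0] p)); last lra.
 apply: EI_subset => //; [exact: measurableI|by move=> w; have /andP[] := p01 w].
apply: filterS => w  h sw; apply/eqP; rewrite eq_le; have /andP[-> _] := p01 w.
by move: h; rewrite indicE mem_set// mul1r => ->.
Qed.

Let pC_null C B : fam C -> H B -> B `<=` [set w | s w = 0] -> EI P B (fun w => p w * C w) = 0.
Proof.
move=> fC HB Bs; have mB := csubm cH HB.
transitivity (EI P B (fun=> 0)); last by rewrite EIcst// mul0r.
apply: EI_aeq => //; [exact: ipC|exact: L1cst|].
apply: filterS p_null => w h Bw; rewrite h ?mul0r//; exact: Bs.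
Qed.

Let v := ce P H X.

Let v_le C : fam C -> \forall w \ae P, v w <= ce P H (fun w => p w * C w) w.
Proof.
move=> fC; have iC := ipC fC.
apply: (sm_ae_le cH); [exact: ce_sm|exact: ce_sm|exact: ce_L1|exact: ce_L1|].
move=> A HA; rewrite !EI_ce//; exact: (famP fC).2.
Qed.

(** [p] is almost surely zero where [s = 0], so each [p * C] has integral 0 over events contained
    there. Nearly optimal members force the same on [X]. *)
Lemma family_null : \forall w \ae P, s w = 0 -> ce P H X w = 0.
Proof.
have m0 := csubm cH Hs0.
have : \forall w \ae P, \1_[set w | s w = 0] w * ce P H X w = 0.
 apply: (sm_ae_eq cH).
 - by apply: (smM cH); [exact: (sm_indic cH)|exact: ce_sm].
 - exact: (smcst cH).
 - meas.
 - meas.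
 move=> A HA; have mA := csubm cH HA; have HB := csubI cH HA Hs0.
 have mB := csubm cH HB.
 rewrite EIcst// mul0r EI_indic// EI_ce//.
 have Bs : A `&` [set w | s w = 0] `<=` [set w | s w = 0] by [].
 apply/le_anti/andP; split.
  by have [C fC _] := fam_inf ltr01; rewrite -[leRHS](pC_null fC HB Bs); exact: (famP fC).2.
 apply/ler_addgt0Pl => e e0; have [C fC Ce] := fam_inf e0.
 have iC := ipC fC; have HBc := csubC cH HB; have := (famP fC).2 _ HBc.
 move: Ce; rewrite (EI_split measurableT mB iX) (EI_split measurableT mB iC) !setTI.
 rewrite (pC_null fC HB Bs); lra.
by apply: filterS => w h sw; move: h; rewrite indicE mem_set// mul1r.
Qed.

Let members C : fam C -> [/\ L1 P (ce P H (fun w => p w * C w)),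
 EI P setT (ce P H (fun w => p w * C w)) = EI P setT (fun w => p w * C w)
 & \forall w \ae P, s w != 0 ->
  cexp P H (fun w => weight s p w * C w) w = (ce P H (fun w => p w * C w) w / s w)%:E].
Proof.
move=> fC; have iC := ipC fC; split; [exact: ce_L1|by rewrite EI_ce//; exact: (csubT cH)|].
by apply: cexp_scaled; have [] := famP fC.
Qed.

Lemma scaled_essinf : \forall w \ae P,
 ((s w)%:E * essinf P [set cexp P H (fun w => weight s p w * C w)%R | C in fam] w = (v w)%:E)%E.
Proof.
apply: (essinf_scaled (is_essinfE P _) s0 (sm_meas cH Hs) (ce_L1 cH iX) family_null).
- move=> _ [C fC <-]; have [i _ e] := members fC.
 exists (ce P H (fun w => p w * C w)); split=> //; exact: v_le.
- move=> e e0; have [C fC Ce] := fam_inf e0; have [i E m] := members fC.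
 exists (cexp P H (fun w => weight s p w * C w)), (ce P H (fun w => p w * C w)); split=> //.
 + by exists C.
 + rewrite E EI_ce//; exact: (csubT cH).
 + exact: v_le.
Qed.

Lemma scaled_esssup : \forall w \ae P,
 ((s w)%:E * esssup P [set cexp P H (fun w => weight s p w * - C w)%R | C in fam] w = (- v w)%:E)%E.
Proof.
have neg C : fam C -> \forall w \ae P, s w != 0 ->
  cexp P H (fun w => weight s p w * - C w) w = (- (ce P H (fun w => p w * C w) w / s w))%:E.
 move=> fC; have iC := ipC fC; have [i _] := famP fC.
 have h1 := cexp_scaled cH Hs s0 mp p01 (L1N i).
 have h2 : \forall w \ae P, ce P H (fun w => p w * - C w) w = - ce P H (fun w => p w * C w) w.
  by rewrite (_ : (fun u => p u * - C u) = fun u => - (p u * C u)); [exact: ceN|apply/funext => u; rewrite mulrN].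
 by apply: filterS2 h1 h2 => w a b sw; rewrite (a sw) b mulNr.
apply: (esssup_scaled (is_esssupE P _) s0 (sm_meas cH Hs) (ce_L1 cH iX) family_null).
- move=> _ [C fC <-]; have [i _ e] := members fC.
 by exists (ce P H (fun w => p w * C w)); split=> //; [exact: v_le|exact: neg].
- move=> e e0; have [C fC Ce] := fam_inf e0; have [i E m] := members fC.
 exists (cexp P H (fun w => weight s p w * - C w)), (ce P H (fun w => p w * C w)); split=> //.
 + by exists C.
 + rewrite E EI_ce//; exact: (csubT cH).
 + exact: v_le.
 + exact: neg.
Qed.

End family.
End values.

(** * The stopping problem and its value *)

Section stopping_value.
Context {R : realType} {d : measure_display} {Ω : measurableType d}
 (P : probability Ω R) (T : R) (G : R -> set (set Ω))
 (T0 : 0 < T) (UG : usual_filtration P T G).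
Implicit Types (rho : R -> Ω -> R) (θ τ : Ω -> R) (B : set Ω) (t : R).
Notation st := (stopping_time T G).
Notation Gat := (sigma_at T G).
Context (f g h x : R -> Ω -> R) (Xi : Ω -> R)
 (rf : raw P T f Xi) (rg : raw P T g Xi) (rh : raw P T h Xi) (mx : mcpath T x)
 (ghf : \forall w \ae P, forall t, 0 <= t <= T -> g t w <= h t w <= f t w).
Notation Y := (Ypay T f g h x).

Let cx w : cadlag T (x ^~ w). Proof. by have [] := mx.1 w. Qed.
Let nx w : nondec T (x ^~ w). Proof. by have [] := mx.1 w. Qed.
Let cg w : cadlag T (g ^~ w). Proof. by have [] := rg. Qed.

(* The right limit of [Y]: stopping just after [t]. *)
Definition Ustop t w := if t < T then f t w * (1 - x t w) + Kint T x g t w else Y T w.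

Lemma Ustop_raw : raw P T Ustop (fun w => 3 * Xi w).
Proof.
have [cf mf iXi fXi] := rf; have [cK mK _ KXi] := Kint_raw T0 rg mx.
have cu w : cadlag T (fun t => f t w * (1 - x t w) + Kint T x g t w).
 apply: cadlagD => //; apply: cadlagM => //; exact: cadlag1B.
split.
- move=> w; split=> t tT.
  have /andP[t0 tT'] := tT; rewrite {2}/Ustop tT'; apply: cvg_trans ((cu w).1 t tT).
  apply: near_eq_cvg; near=> s; rewrite /Ustop; have -> // : s < T.
  by [].
 apply: (cvgP (lim (f s w * (1 - x s w) + Kint T x g s w @[s --> t^'-]))).
 apply: cvg_trans ((cu w).2 t tT); apply: near_eq_cvg.
 by apply: filterS (near_in_left tT) => s /andP[_ sT]; rewrite /Ustop sT.
- move=> t tT; have [h1|h1] := ltP t T; rewrite /Ustop ?h1 ?ltNge ?h1/=.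
  by apply: mfunD; [apply: mfunM; [exact: mf|
   apply: mfunB; [exact: mcst|exact: mx.2]]|exact: mK].
 apply: (@Y_meas _ _ _ P T T0 _ _ _ _ rf rg rh x _ Ω (cst T) id) => //.
 move=> w; exact: T_in.
- meas.
- move=> t w tT; rewrite /Ustop; case: ifP => _; last by apply: (Y_bound T0 rf rg rh) => //; exact: T_in.
 apply: (le_trans (ler_normD _ _)); have X0 : 0 <= Xi w by apply: le_trans (fXi t w tT).
 have h1 : `|f t w * (1 - x t w)| <= Xi w.
  have /andP[a b] := cpath01 (mx.1 w) tT; rewrite normrM.
  apply: le_trans (fXi t w tT); apply: ler_piMr => //; rewrite ger0_norm; lra.
 have := KXi t w tT; lra.
Unshelve. all: by end_near. Qed.

Lemma before_right w t : 0 <= t < T -> before (x ^~ w) s @[s --> t^'+] --> x t w.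
Proof.
move=> tT; have /andP[t0 tT'] := tT.
apply: (@squeeze_cvgr _ _ _ _ (fun=> x t w) (x ^~ w)); [|exact: cvg_cst|exact: (cx w).1].
near=> s; have ts : t < s by [].
have sT : s <= T by near: s; exact: nbhs_right_le.
rewrite (le_before (cx w) (nx w))//=; apply: before_le => //; last by rewrite (le_trans t0 (ltW ts)).
by have [] := mx.1 w.
Unshelve. all: by end_near. Qed.

Lemma Y_right w t : 0 <= t < T -> Y s w @[s --> t^'+] --> Ustop t w.
Proof.
move=> tT; have /andP[t0 tT'] := tT; have [cf _ _ _] := rf; have [ch _ _ _] := rh.
have xr := (cx w).1 t tT; have br := before_right (w := w) tT.
rewrite /Ustop tT' -[_ + Kint _ _ _ _ _]addr0 -(mulr0 (h t w)) -(subrr (x t w)).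
apply: cvgD; first apply: cvgD.
- apply: cvgM; [exact: (cf w).1|apply: cvgB => //; exact: cvg_cst].
- apply: lint_cvg => //; [exact: mx.1|by apply: (cpath01 (mx.1 w)); rewrite t0 ltW|].
 apply: filterS (near_in_right tT) => s sT; exact: (cpath_before (mx.1 w) sT).
- by apply: cvgM; [exact: (ch w).1|exact: cvgB].
Qed.

(** Before [T] the approximating times are strictly after [τ], so the value of [Y] at [τ] may be
    replaced by the right limit, which makes the path right-continuous there. *)
Lemma Y_stup τ w : st τ -> Y (stup T n τ w) w @[n --> \oo] --> Ustop (τ w) w.
Proof.
move=> stau; pose y s := if s == τ w then Ustop (τ w) w else Y s w.
have /andP[t0 tT] := stau.1 w.
have : y (stup T n τ w) @[n --> \oo] --> y (τ w).
 apply: (stup_cvg stau) => lt; rewrite {2}/y eqxx.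
 have tT' : 0 <= τ w < T by lra.
 apply: cvg_trans (Y_right (w := w) tT'); apply: near_eq_cvg; near=> s; rewrite /y.
 rewrite gt_eqF//; near: s; exact: nbhs_right_gt.
rewrite {2}/y eqxx; apply: cvg_trans; apply: near_eq_cvg; apply: nearW => n; rewrite /y.
case: eqP => // e; move: tT; rewrite le_eqVlt => /predU1P[E|lt].
 by rewrite e E /Ustop ltxx.
have : τ w < stup T n τ w by rewrite lt_min lt lt_up.
lra.
Unshelve. all: by end_near. Qed.

(** Stopping just after [t] rather than at [t] replaces [h] by [g] on the jump of [x]. *)
Lemma U_le_Y : \forall w \ae P, forall t, 0 <= t <= T -> Ustop t w <= Y t w.
Proof.
apply: filterS ghf => w hw t tT; rewrite /Ustop; case: ifPn => [lt|]; last first.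
 by rewrite -leNgt => Tt; have -> : t = T by apply/eqP; rewrite eq_le Tt andbT; have /andP[] := tT.
have := lint_jump T0 (cg w) (mx.1 w) tT; have /andP[gh _] := hw t tT.
have x0 : 0 <= x 0 w by have [] := mx.1 w.
have b : 0 <= x t w - before (x ^~ w) t by rewrite subr_ge0; exact: before_le.
move=> E; have := ler_wpM2r b gh; rewrite /Ypay /ypay /Kint; lra.
Qed.

Let Y_st τ : st τ -> L1 P (fun w => Y (τ w) w).
Proof. by move=> s; apply: (Y_L1 T0 rf rg rh) => //; [exact: (st_meas T0 UG s)|exact: s.1]. Qed.

Definition is_value S := [/\ dsub P T G S (fun w => 3 * Xi w),
 forall θ τ B, st θ -> st τ -> (forall w, θ w <= τ w) -> Gat θ B ->
  EI P B (fun w => S (θ w) w) <= EI P B (fun w => Y (τ w) w)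
 & forall θ (e : R), st θ -> 0 < e -> exists τ, [/\ st τ, forall w, θ w <= τ w
  & EI P setT (fun w => Y (τ w) w) <= EI P setT (fun w => S (θ w) w) + e]].

(** The envelope is taken for the right limit of [Y], which is càdlàg. The infimum is the same:
    [Ustop <= Y], and the reward at [stup T n τ] tends to [Ustop] at [τ]. *)
Theorem value_exists : exists S, is_value S.
Proof.
have rU := Ustop_raw; have [S [aS cS eS]] := envelope T0 UG rU.
exists S; split; first exact: (env_dsub T0 UG rU).
- move=> θ τ B s1 s2 le HB; have [_ _ lb _] := eS θ s1.
 apply: (le_trans (lb τ B s2 le HB)); have mB := csubm (Gat_csub T0 UG s1) HB.
 apply: EI_ae_le => //; [exact: (raw_st T0 UG rU s2)|exact: Y_st|].
 apply: filterS U_le_Y => w hw _; apply: hw; exact: s2.1.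
- move=> θ e s1 e0; have [_ _ _ att] := eS θ s1.
 have [τ [s2 le lt]] := att _ (hgt0 e0).
 have [_ _ i3 _] := rU.
 have [_ cv] : L1 P (fun w => Ustop (τ w) w) /\
   EI P setT (fun w => Y (stup T n τ w) w) @[n --> \oo] --> EI P setT (fun w => Ustop (τ w) w).
  apply: (EI_dominated measurableT _ _ i3).
  - move=> n; apply: L1_meas; apply: Y_st; exact: (st_stup T0 UG).
  - exact: L1_meas (raw_st T0 UG rU s2).
  - move=> n; apply: aeW => w; apply: (Y_bound T0 rf rg rh) => //.
   exact: (st_stup T0 UG n s2).1.
  - apply: aeW => w; exact: Y_stup.
 have [N /(_ N (leqnn N)) hN] := (cvgnP _ _).1 cv _ (hgt0 e0).
 exists (stup T N τ); split; first exact: (st_stup T0 UG).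
  move=> w; apply: (le_trans (le w)); exact: (le_stup _ _ s2).
 move: hN; rewrite ltr_norml => /andP[]; lra.
Qed.

Lemma before_adapted (X : R -> Ω -> R) t : adapted T G X -> (forall w, cadlag T (X ^~ w)) ->
 0 <= t <= T -> smeas (G t) (fun w => before (X ^~ w) t).
Proof.
move=> aX cX tT; have cG := G_csub UG tT; have /andP[t0 tT'] := tT.
apply: (@sm_lim _ _ _ P _ (fun n w => if t < mesh n then 0 else X (t - mesh n) w)) => //.
 move=> n; case: ltP => [_|mt]; first exact: (smcst cG).
 have le : t - mesh n <= t by rewrite lerBlDr lerDl mesh_ge0.
 have s0 : 0 <= t - mesh n by lra.
 apply: (sm_sub (G_mono UG s0 le tT')); apply: aX; rewrite s0; lra.
move=> w; exact: (before_cvg (cX w) tT).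
Qed.

Lemma quantile_st rho (z : R) : adapted T G rho -> mcpath T rho -> 0 <= z < 1 ->
 st (fun w => qtl T (rho ^~ w) z).
Proof.
move=> ar mr /andP[z0 z1]; apply: (st_of_lt UG).
 move=> w; apply: qtl_in => //; exact: mr.1.
move=> t /andP[t0 tT]; have tT' : 0 <= t <= T by rewrite ltW.
rewrite (_ : [set w | _] = [set w | z < before (rho ^~ w) t]).
 apply: (csub_lt (G_csub UG tT')); first exact: (smcst (G_csub UG tT')).
 by apply: before_adapted => // w; have [] := mr.1 w.
by apply/seteqP; split=> w /=; rewrite (qtl_lt T0 (mr.1 w)).
Qed.

Lemma control_mcpath rho θ : control T G θ rho ->
 [/\ adapted T G rho, mcpath T rho & forall w, before (rho ^~ w) (θ w) = 0].
Proof.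
move=> [ar cr nr r0 r1]; split=> //; last by move=> w; have [] := r1 w.
split=> [w|t tT]; last exact: (sm_meas (G_csub UG tT) (ar t tT)).
by split=> //; [exact: nr|have [] := r1 w].
Qed.

(** Almost every quantile of [rho] is a stopping time after [θ], to which the lower bound applies;
    Fubini then averages over the level. *)
Lemma value_le_avg S θ rho B : is_value S -> st θ -> control T G θ rho ->
 Gat θ B -> EI P B (fun w => S (θ w) w) <= EI P B (Yavg T f g h x rho).
Proof.
move=> [_ lb _] s1 /control_mcpath[ar mr r0] HB; have mB := csubm (Gat_csub T0 UG s1) HB.
have [_ _ _ av] := YavgP T0 rf rg rh mx mr; have [i ->] := av B mB.
rewrite -[leLHS](EI_cstT unif); apply: EI_ae_le => //; first meas.
apply: ae_imp unif_ae _ => z z01 _; have /andP[z0 z1] := z01.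
have s2 := quantile_st ar mr z01; apply: lb => // w.
by rewrite (qtl_ge T0 (mr.1 w))//; [rewrite r0|exact: s1.1].
Qed.

(** The degenerate control of a pure stopping time: its quantiles at levels in [0, 1[ all equal
    [τ]. *)
Definition stop_control τ (t : R) (w : Ω) : R := \1_[set v | τ v <= t] w.

Lemma stop_controlP θ τ : st τ -> (forall w, θ w <= τ w) ->
 control T G θ (stop_control τ).
Proof.
move=> s2 le; rewrite /stop_control.
have e t w : \1_[set v | τ v <= t] w = (τ w <= t)%R%:R :> R by rewrite indicE mem_setE.
split.
- move=> t tT; apply: (sm_indic (G_csub UG tT)); exact: st_le s2 tT.
- move=> w; apply: nondec_cadlag.
  by move=> s t _ st _; rewrite !e ler_nat; case: leP => // h'; rewrite (le_trans h' st).
 move=> t /andP[t0 tT]; rewrite e; apply: cvg_near_cst; case: (leP (τ w) t) => h'.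
  near=> s; rewrite e (le_trans h')//; apply: ltW; near: s; lra.
 near=> s; rewrite e leNgt; have -> // : s < τ w by [].
- by move=> w s t _ st _; rewrite !e ler_nat; case: leP => // h'; rewrite (le_trans h' st).
- by [].
- move=> w; split; last by rewrite e; have /andP[_ ->] := s2.1 w.
 have [t0|t0] := leP (θ w) 0; first by rewrite /before t0.
 rewrite before_lim//; apply/cvg_lim => //; apply: cvg_near_cst; near=> s.
 rewrite e leNgt; have -> // : s < τ w; apply: lt_le_trans (le w).
 by [].
Unshelve. all: by end_near. Qed.

Lemma quantile_stopping τ z w : st τ -> 0 <= z < 1 ->
 qtl T (stop_control τ ^~ w) z = τ w.
Proof.
move=> s2 /andP[z0 z1].
have [_ mr r0] := control_mcpath (stop_controlP s2 (fun w => lexx (τ w))).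
have tT := s2.1 w; apply/le_anti/andP; split.
 by apply: quantile_le => //; rewrite /stop_control indicE mem_set//=.
by rewrite (qtl_ge T0 (mr.1 w))// r0.
Qed.

Lemma Yavg_stopping τ : st τ -> forall w, Yavg T f g h x (stop_control τ) w = Y (τ w) w.
Proof.
move=> s2 w; have [_ mr _] := control_mcpath (stop_controlP s2 (fun w => lexx (τ w))).
have [i _ _ _] := YavgP T0 rf rg rh mx mr.
rewrite -[RHS](EI_cstT unif); apply: EI_aeq => //; first meas.
by apply: ae_imp unif_ae _ => z z01 _; rewrite quantile_stopping.
Qed.

End stopping_value.

(** * Paths of finite variation *)

Section finite_variation.
Context {R : realType}
 (T : R)
 (T0 : 0 < T).

(** A point of a subdivision enters at most two increments, and the gaps at distinct points add up
    to at most [C]; hence the bound [C + C]. *)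
Lemma gap_bounded_variation (x y : R -> R) : (forall t, 0 <= t <= T -> y t <= x t) ->
 summable_gap T x y -> bounded_variation 0 T (fun t => x t - y t).
Proof.
move=> yx [C CP]; exists (C + C) => _ [s [ps /eqP ls] <-]; rewrite /variation/=.
have sl : sorted <%R (0 :: s) by [].
have us : uniq (0 :: s) := lt_sorted_uniq sl.
have inT t : t \in 0 :: s -> 0 <= t <= T.
 move=> ts; have tn := nth_index T ts; have ti : (index t (0%R :: s) < size (0%R :: s))%N by rewrite index_mem.
 apply/andP; split.
  rewrite -[X in X <= _](_ : nth T (0 :: s) 0 = 0)// -[X in _ <= X]tn.
  by rewrite (sorted_leq_nth le_trans lexx T (sub_sorted (@ltW _ R) sl)).
 rewrite -ls (last_nth T) -{1}tn.
 by apply: (sorted_leq_nth le_trans lexx T (sub_sorted (@ltW _ R) sl)); rewrite ?inE.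
pose D t := x t - y t; have D0 t : t \in 0 :: s -> 0 <= D t.
 by move=> /inT tT; rewrite subr_ge0 yx.
have n0 n : (n < size s)%N -> nth T (0 :: s) n \in 0 :: s.
 by move=> h; apply: mem_nth; rewrite ltnW.
have n1 n : (n < size s)%N -> nth T (0 :: s) n.+1 \in 0 :: s.
 by move=> h; apply: mem_nth; rewrite /=.
apply: (@le_trans _ _ (\sum_(0 <= n < size s) (D (nth T (0 :: s) n.+1) + D (nth T (0 :: s) n)))).
 rewrite !big_mkord; apply: ler_sum => n _; apply: le_trans (ler_normB _ _) _.
 by rewrite !ger0_norm ?D0 ?n0 ?n1.
rewrite big_split/=; apply: lerD.
 have := CP s (proj2 (andP us)); rewrite (big_nth T); apply => t ts.
 by apply: inT; rewrite inE ts orbT.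
apply: le_trans (CP _ us inT); rewrite (big_nth T) /= big_nat_recr//= lerDl.
by apply: D0; apply: mem_nth.
Qed.

Lemma nondec_bv (x : R -> R) : nondec T x -> bounded_variation 0 T x.
Proof.
move=> nx; apply: nondecreasing_bounded_variation => s t.
by rewrite !in_itv => /andP[s0 _] /andP[_ tT] st; exact: nx.
Qed.

End finite_variation.

(** * Class (D), optional processes, left limits at previsible times *)

Section processes.
Context {R : realType} {d : measure_display} {Ω : measurableType d}
 (P : probability Ω R).
Implicit Types (X Y Z : Ω -> R) (A B : set Ω) (H : set (set Ω)).

Lemma abs_dom H X Z B : csub P H -> smeas H X -> L1 P X -> L1 P Z ->
 (forall B, H B -> EI P B X = EI P B Z) -> H B ->
 EI P B (fun w => `|X w|) <= EI P B (fun w => `|Z w|).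
Proof.
move=> cH HX iX iZ XZ HB; have mB := csubm cH HB.
have HC : H [set w | 0 <= X w] by apply: (csub_le cH) => //; exact: (smcst cH).
have mC := csubm cH HC; have iX' := L1norm iX; have iZ' := L1norm iZ.
have H1 := csubI cH HB HC; have H2 := csubI cH HB (csubC cH HC).
have m1 := csubm cH H1; have m2 := csubm cH H2.
rewrite (EI_split mB mC iX') (EI_split mB mC iZ') lerD//.
 rewrite (eq_EI P (Y := X)); last by move=> w [_ h]; rewrite ger0_norm.
 rewrite XZ//; apply: EI_le => // w _; exact: ler_norm.
rewrite (eq_EI P (Y := fun w => - X w)); last first.
 by move=> w [_ /negP]; rewrite -ltNge => h; rewrite ler0_norm// ltW.
by rewrite EIN// XZ// -EIN//; apply: EI_le => //; [exact: L1N|move=> w _; rewrite ler_normr lexx orbT].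
Qed.

Lemma uidom_uniformly_integrable (Xi : Ω -> R) (Phi : set (Ω -> R)) : L1 P Xi ->
 (forall Y, Phi Y -> uidom P Xi Y) -> uniformly_integrable P Phi.
Proof.
move=> iXi hP; split; first by move=> Y /hP[iY _]; exact: L1_meas iY.
move=> e e0; have [k k0 ke] := tail_cvg0 iXi (hgt0 e0).
(* Where [|Y|] exceeds [2 * k], it is at most twice its tail above [k]. *)
exists (2 * k) => Y /hP[iY Yt]; have iY' := L1norm iY; have it := L1_tail (ltW k0) iY.
have mA : measurable [set w | 2 * k < `|Y w|] by meas.
rewrite -EIE//; apply: (@le_trans _ _ (EI P [set w | 2 * k < `|Y w|] (fun w => 2 * tail k Y w))).
 apply: EI_le => //; first meas.
 move=> w /= h; rewrite /tail; have := le_max (`|Y w| - k) 0 (`|Y w| - k); lra.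
apply: (@le_trans _ _ (EI P setT (fun w => 2 * tail k Y w))).
 by apply: EI_subset => //; [exact: L1Z|move=> w; rewrite mulr_ge0// tail_ge0].
rewrite EIZ//; have := Yt k (ltW k0); lra.
Qed.

Lemma uidom_indic Xi B X : measurable B -> uidom P Xi X -> uidom P Xi (fun w => \1_B w * X w).
Proof.
move=> mB [iX h]; split=> [|k k0]; first meas.
apply: le_trans (h k k0); apply: EI_le => //; [exact: L1_tail (L1indic mB iX)|exact: L1_tail|].
move=> w _; rewrite ge_max !le_max lexx lerB ?orbT// normrM normr_nat.
by apply: ler_piMl; rewrite // lern1 leq_b1.
Qed.

Lemma pi_lambda (E : set (set Ω)) X Y : setI_closed E -> E `<=` measurable ->
 L1 P X -> L1 P Y -> EI P setT X = EI P setT Y -> (forall B, E B -> EI P B X = EI P B Y) ->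
 forall B, <<s E >> B -> EI P B X = EI P B Y.
Proof.
move=> IE Em iX iY XYT XY.
have L : lambda_system setT [set B | measurable B /\ EI P B X = EI P B Y].
 split => //.
  move=> A B BA [mA EA] [mB EB]; split; first meas.
  have := EI_split mA mB iX; have := EI_split mA mB iY.
  by rewrite setIC (setIidl BA) EA EB => -> /addrI.
 move=> F ndF hF; have mF n : measurable (F n) by have [] := hF n.
 have mU : measurable (\bigcup_n F n) by exact: bigcupT_measurable.
 split=> //; have lim Z : L1 P Z -> EI P (F n) Z @[n --> \oo] --> EI P (\bigcup_n F n) Z.
  move=> iZ; rewrite -[X in _ --> EI P X _]setTI -EI_indic//.
  rewrite (_ : (fun n => EI P (F n) Z) = fun n => EI P setT (fun w => \1_(F n) w * Z w)); last first.
   by apply/funext => n; rewrite EI_indic// setTI.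
  apply: (EI_dominated measurableT _ _ (L1norm iZ) _ _).2.
  - meas.
  - meas.
  - move=> n; apply: aeW => w; rewrite normrM normr_nat.
   by apply: ler_piMl; rewrite // lern1 leq_b1.
  - apply: aeW => w; apply: cvgMl; apply: cvg_near_cst.
   have [h|h] := pselect ((\bigcup_n F n) w); last first.
    apply: nearW => n; rewrite !indicE (memNset h) memNset// => Fn.
    by apply: h; exists n.
   have [m _ Fm] := h; exists m => // n /= mn; rewrite !indicE (mem_set h) mem_set//.
   by have /(_ m n mn) := ndF; rewrite subsetEset; exact.
 have lX := lim X iX; have lY := lim Y iY.
 rewrite (_ : (fun n => EI P (F n) X) = fun n => EI P (F n) Y) in lX; last first.
  by apply/funext => n; have [_] := hF n.
 exact: (cvg_unique _ lX lY).
have sub := lambda_system_subset IE L _ (fun _ _ => @subsetT _ _).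
by move=> B sB; have [] := sub _ B sB => // A EA; split; [exact: Em|exact: XY].
Qed.

Context (T : R) (G : R -> set (set Ω))
 (T0 : 0 < T) (UG : usual_filtration P T G).
Implicit Types (θ τ : Ω -> R) (t : R).
Notation st := (stopping_time T G).
Notation Gat := (sigma_at T G).

Lemma cmart_martingale M X : cmart P T G M X -> martingale P T G M.
Proof.
move=> [aM cM iX iM EM].
have iMt t : 0 <= t <= T -> L1 P (M t) by move=> tT; exact: (iM _ (st_cst UG tT)).
have EMt t B : 0 <= t <= T -> G t B -> EI P B (M t) = EI P B X.
 by move=> tT GB; apply: (EM _ _ (st_cst UG tT)); rewrite (Gat_cst UG tT).
split=> // s t s0 st' tT; have sT : 0 <= s <= T by rewrite s0 (le_trans st').
have tT' : 0 <= t <= T by lra.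
have cG := G_csub UG sT; apply: filterS2 (cexp_L1 cG (iMt t tT')) (ceE cG (iMt t tT') (_ : is_ce P (G s) (M t) (M s))).
 by move=> w -> ->.
split; [exact: aM|exact: iMt|move=> A GA; rewrite !EMt//; exact: (G_mono UG s0 st' tT)].
Qed.

Lemma cmart_local_martingale M X : cmart P T G M X -> local_martingale P T G M.
Proof.
move=> cM; have [aM cM' _ _ _] := cM; split=> //; exists (fun _ _ => T); split.
- move=> n; exact: (st_cst UG (T_in T0)).
- by move=> w m n _.
- by apply: aeW => w; exists 0%N.
- move=> n; have [a b c] := cmart_martingale cM.
 have E t : 0 <= t <= T -> M (minr t T) = M t by move=> /andP[_ tT]; rewrite min_l.
 split=> [t tT|t tT|s t s0 st' tT]; [by rewrite E//; exact: a|by rewrite E//; exact: b|].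
 by rewrite !E; [exact: c|rewrite s0 (le_trans st')|rewrite (le_trans s0)].
Qed.

Lemma cmart_combine M M' X X' (c : R) : cmart P T G M X -> cmart P T G M' X' ->
 cmart P T G (fun t w => M t w + c * M' t w) (fun w => X w + c * X' w).
Proof.
move=> [aM cM iX iM EM] [aM' cM' iX' iM' EM']; split.
- move=> t tT; have cG := G_csub UG tT; apply: (smD cG); first exact: aM.
 by apply: (smM cG); [exact: (smcst cG)|exact: aM'].
- move=> w; apply: cadlagD => //; apply: (cadlagM (x := fun=> c)) => //.
 by split=> t _; [exact: cvg_cst|exact: is_cvg_cst].
- meas.
- meas.
- move=> θ B s GB; have mB := csubm (Gat_csub T0 UG s) GB.
 rewrite !EID ?EIZ ?EM ?EM'; meas.
Qed.

(** The events [X_ n > a + mesh k] are generators of the optional sigma-algebra, and the event that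
    the limit exceeds [a] is built from countably many of them. *)
Lemma optional_lim (X_ : nat -> R -> Ω -> R) (X : R -> Ω -> R) :
 (forall n, adapted T G (X_ n) /\ forall w, cadlag T (X_ n ^~ w)) ->
 (forall t w, 0 <= t <= T -> X_ n t w @[n --> \oo] --> X t w) -> optional T G X.
Proof.
move=> hX lX; pose D : set (R * Ω) := `[0, T] `*` [set: Ω].
have sO : sigma_algebra D (optional_sigma T G) by exact: smallest_sigma_algebra.
have [sO0 sOD sOU] := sO.
have sOI (F : nat -> set (R * Ω)) : (forall n, F n `<=` D) ->
  (forall n, optional_sigma T G (F n)) -> optional_sigma T G (\bigcap_n F n).
 move=> FD FO; rewrite (_ : \bigcap_n F n = D `\` \bigcup_n (D `\` F n)).
  apply: (sOD); apply: sOU => n; exact: sOD.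
 apply/seteqP; split=> p.
  move=> Fp; split; [exact: (FD 0%N _ (Fp 0%N I))|move=> [n _ [_]]; apply; exact: Fp].
 move=> [Dp nF] n _; apply: contrapT => nFp; apply: nF; by exists n.
have ray n (a : R) : optional_sigma T G (D `&` (fun p : R * Ω => X_ n p.1 p.2) @^-1` `]a, +oo[).
 apply: sub_sigma_algebra; exists (X_ n) => //.
 by exists `]a, +oo[%classic => //; exact: measurable_itv.
have im : sigma_algebra setT (image_set_system D (fun p : R * Ω => X p.1 p.2) (optional_sigma T G)).
 exact: sigma_algebra_image.
move=> _ [B mB <-]; have {}mB : <<s (@RGenOInfty.G R) >> B.
 exact: (eq_ind _ (fun S => S B) mB _ (RGenOInfty.measurableE R)).
move: B mB; apply: smallest_sub => // _ [a ->]; rewrite /image_set_system.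
rewrite (_ : _ `&` _ = \bigcup_k \bigcup_N \bigcap_n
  (D `&` (fun p : R * Ω => X_ (N + n)%N p.1 p.2) @^-1` `]a + mesh k, +oo[)).
 by apply: (sOU) => k; apply: (sOU) => N; apply: sOI => n; [by move=> p []|exact: ray].
apply/seteqP; split=> p.
 move=> [Dp]; rewrite /= in_itv/= andbT => h.
 have pT : 0 <= p.1 <= T by move: Dp => [/=]; rewrite in_itv => ->.
 have [k hk] := mesh_small (R := R) (e := (X p.1 p.2 - a) / 2) ltac:(lra).
 have [N hN] := (cvgnP _ _).1 (lX p.1 p.2 pT) _ (mesh_gt0 (R := R) k).
 exists k => //; exists N => // n _; split=> //=; rewrite in_itv/= andbT.
 have := hN (N + n)%N (leq_addr _ _); rewrite ltr_norml => /andP[_]; lra.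
move=> [k _ [N _ hN]]; have Dp : D p by have [] := hN 0%N I.
have pT : 0 <= p.1 <= T by move: Dp => [/=]; rewrite in_itv => ->.
split=> //=; rewrite in_itv/= andbT.
have [M hM] := (cvgnP _ _).1 (lX p.1 p.2 pT) _ (mesh_gt0 (R := R) k).
have [_ /=] := hN M I; rewrite in_itv/= andbT.
have := hM (N + M)%N (leq_addl _ _); rewrite ltr_norml => /andP[+ _]; lra.
Qed.

Lemma proj_dsub K Xi N : raw P T K Xi -> (forall w, nondec T (K ^~ w)) ->
 is_proj P T G K N -> dsub P T G N Xi.
Proof.
move=> rK nK [aN cN iN EN]; have [_ _ iXi KXi] := rK; split=> //; split=> //.
 move=> θ B s GB; have cG := Gat_csub T0 UG s; have iK := raw_st T0 UG rK s.
 apply: (le_trans (abs_dom cG (eval_sm T0 UG aN cN s) (iN _ s) iK _ GB)); first by move=> B'; exact: EN.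
 apply: EI_le => //; [exact: (csubm cG)|exact: L1norm|move=> w _; apply: KXi; exact: s.1].
move=> θ τ B s1 s2 le GB; rewrite EN// EN//; last exact: (Gat_mono UG s1 s2 le).
apply: EI_le; [exact: (csubm (Gat_csub T0 UG s1))|exact: (raw_st T0 UG rK)|exact: (raw_st T0 UG rK)|].
move=> w _; have /andP[a _] := s1.1 w; have /andP[_ b] := s2.1 w; exact: nK.
Qed.

(** [N] is a submartingale, hence a martingale plus an increasing process, and [N - O] has finite
    variation as a summable gap. *)
Lemma leftproj_decomp K Xi N O : raw P T K Xi -> (forall w, nondec T (K ^~ w)) ->
 is_leftproj P T G K N O -> exists M X D, [/\ cmart P T G M X, adapted T G D,
  forall t w, O t w = M t w + D t w & \forall w \ae P, bounded_variation 0 T (D ^~ w)].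
Proof.
move=> rK nK [pN _ OP O_N [th _ gap]].
have [M [Bp [X [cM aB cB E nB]]]] := doob_meyer T0 UG (proj_dsub rK nK pN).
have [aM _ _ _ _] := cM; exists M, X, (fun t w => O t w - M t w); split=> //.
- move=> t tT; have cG := G_csub UG tT; apply: (smB cG); last exact: aM.
 by have [+ _ _] := OP _ (st_cst UG tT); rewrite (Gat_cst UG tT).
- by move=> t w; rewrite addrC subrK.
apply: filterS2 gap nB => w [sg _] nb.
rewrite (_ : (fun t => _) = (Bp ^~ w) \+ (\- (fun t => N t w - O t w))).
 apply: bounded_variationD => //; first exact: nondec_bv.
 apply: bounded_variationN; apply: gap_bounded_variation => // t tT.
 by have /andP[] := O_N t w tT.
apply/funext => t /=; rewrite E; ring.
Qed.

Section before_time.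
Context (θ : Ω -> R)
 (s : st θ).
Notation Gbf := (sigma_before T G θ).

Lemma Gbf_lt t A : 0 <= t <= T -> G t A -> Gbf (A `&` [set w | t < θ w]).
Proof. by move=> tT GA; apply: sub_sigma_algebra; right; exists t, A. Qed.

Lemma Gbf_sub : Gbf `<=` Gat θ.
Proof.
have cG := Gat_csub T0 UG s; have [sa _ _] := cG.
apply: smallest_sub => // B [G0B|[t [A [tT GA ->]]]].
 split; first exact: (G_mono UG (lexx 0) (ltW T0) (lexx T)).
 move=> t tT; apply: (csubI (G_csub UG tT)); last exact: st_le s tT.
 by have /andP[? ?] := tT; exact: (G_mono UG (lexx 0)).
have /andP[t0 tT'] := tT; split.
 apply: (csubI (G_csub UG (T_in T0))); first exact: (G_mono UG t0 tT' (lexx T)).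
 apply: (G_mono UG t0 tT' (lexx T)); exact: (st_gt UG s tT).
move=> u uT; have cu := G_csub UG uT; have /andP[u0 uT'] := uT.
have [tu|ut] := leP t u.
 apply: (csubI cu); last exact: st_le s uT.
 apply: (csubI cu); apply: (G_mono UG t0 tu uT') => //; exact: (st_gt UG s tT).
rewrite (_ : _ `&` _ = set0); first exact: (csub_set0 cu).
apply/seteqP; split=> w //= [[_ a] b]; lra.
Qed.

Lemma Gbf_csub : csub P Gbf.
Proof.
have [_ m _] := Gat_csub T0 UG s; split; first exact: smallest_sigma_algebra.
- exact: subset_trans Gbf_sub m.
- by move=> A nA; apply: sub_sigma_algebra; left; have [_ _ _] := UG; exact.
Qed.

(** [up] reflected at [T]: times strictly before [t > 0] that tend to it, so that what is read there
    is known before [t]. *)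
Definition down n t : R := maxr 0 (T - up n (T - t)).

Lemma down_lt n t : 0 < t -> down n t < t.
Proof. move=> t0; rewrite gt_max; have := lt_up n (T - t); lra. Qed.

Lemma down_ge n t : 0 <= t <= T -> t - mesh n <= down n t.
Proof.
move=> /andP[t0 tT]; rewrite le_max; apply/orP; right.
have := @up_le R n (T - t) ltac:(lra); lra.
Qed.

(** The left limit is reached along [down n θ], which has countably many values [q]; an event of
    [G q] intersected with [q < θ] is a generator of [G_{θ-}]. *)
Lemma before_Gbf (X : R -> Ω -> R) : adapted T G X -> (forall w, cadlag T (X ^~ w)) ->
 smeas Gbf (fun w => before (X ^~ w) (θ w)).
Proof.
move=> aX cX; have cB := Gbf_csub.
have Glt t : 0 <= t <= T -> Gbf [set w | t < θ w].
 move=> tT; rewrite -[X in Gbf X]setTI; apply: Gbf_lt => //; exact: (csubT (G_csub UG tT)).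
pose grd n j : R := maxr 0 (T - j%:R * mesh n).
have gT n j : 0 <= grd n j <= T.
 by rewrite le_max lexx ge_max (ltW T0) gerBl mulr_ge0// mesh_ge0.
have Hth : smeas Gbf θ.
 apply/(smE _ cB); apply: (measurability _ (RGenOInfty.measurableE R)).
 move=> _ [_ [a ->] <-]; rewrite setTI (csub_sigma cB).
 have [a0|a0] := ltP a 0.
  rewrite (_ : _ @^-1` _ = setT); first exact: (csubT cB).
  apply/seteqP; split=> w //= _; rewrite in_itv/=; have /andP[? _] := s.1 w; lra.
 have [aT|aT] := leP a T; last first.
  rewrite (_ : _ @^-1` _ = set0); first exact: (csub_set0 cB).
  apply/seteqP; split=> w //=; rewrite in_itv/=; have /andP[_ ?] := s.1 w; lra.
 have := Glt a; rewrite a0 aT => /(_ isT); congr Gbf.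
 by apply/seteqP; split=> w /=; rewrite in_itv andbT.
apply: (@sm_lim _ _ _ P _ (fun n w => if 0 < θ w then X (down n (θ w)) w else 0)) => //; last first.
 move=> w; have tT := s.1 w; have [t0|t0] := ltP 0 (θ w); last first.
  rewrite /before t0; exact: cvg_cst.
 have /andP[_ tT'] := tT; have tT2 : 0 < θ w <= T by rewrite t0.
 apply/cvgnP => e e0; have [c c0 hc] := (lcvgP _ _ _).1 (cadlag_left (cX w) tT2) e e0.
 have [N hN] := mesh_small c0; exists N => n Nn; apply: hc; first exact: down_lt.
 have := down_ge n tT; have := @mesh_le R N n Nn; lra.
move=> n _ [B mB <-]; rewrite setTI.
rewrite (_ : _ @^-1` B = ([set w | 0 < θ w] `&` \bigcup_j ((X (grd n j) @^-1` B `&`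
  [set w | grd n j < θ w]) `&` [set w | down n (θ w) = grd n j])) `|`
  (~` [set w | 0 < θ w] `&` [set w | B 0])); last first.
 apply/seteqP; split=> w /=.
  have [t0|t0] := ltP 0 (θ w) => h; [left|by right; split=> //; rewrite ltNge].
  split=> //; exists (Num.trunc ((T - θ w) * 2 ^+ n)).+1 => //; rewrite /=.
  split=> //; split=> //; exact: down_lt.
 case=> [[t0 [j _ [[h _] e]]]|[nt h]]; first by rewrite t0 e.
 by case: ifP.
have T00 : 0 <= (0 : R) <= T by rewrite lexx ltW.
apply: (csubU cB); apply: (csubI cB).
- exact: Glt.
- apply: (csub_bigcup cB) => j; apply: (csubI cB).
  apply: Gbf_lt => //; exact: (sm_preimage (aX _ (gT n j)) mB).
 apply: (csub_eq cB); last exact: (smcst cB).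
 apply/(smE _ cB); apply: mcomp; last exact/(smE _ cB).
 apply: nondecreasing_measurable => // x y xy; rewrite ge_max !le_max lexx lerB ?orbT//.
 rewrite ler_pM2r ?mesh_gt0// ler_nat; apply: le_truncn.
 by rewrite ler_pM2r ?exprn_gt0// lerB.
- apply: (csubC cB); exact: Glt.
- have [h|h] := pselect (B 0).
  by rewrite (_ : [set w | _] = setT); [exact: (csubT cB)|apply/seteqP; split].
 by rewrite (_ : [set w | _] = set0); [exact: (csub_set0 cB)|apply/seteqP; split].
Qed.

End before_time.

(** The projection identity at the announcing times passes to the left limits by Vitali convergence.
    On a generator formed by [A] and [t < θ] it is used with [t < th n] in place of [t < θ], an
    event known at [th n]; a pi-lambda argument covers the rest of [G_{θ-}]. *)
Lemma before_proj θ U Xi N : previsible_time P T G θ -> (\forall w \ae P, 0 < θ w) ->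
 raw P T U Xi -> is_proj P T G U N -> L1 P (fun w => before (N ^~ w) (θ w)) /\
 forall B, sigma_before T G θ B ->
  EI P B (fun w => before (N ^~ w) (θ w)) = EI P B (fun w => before (U ^~ w) (θ w)).
Proof.
move=> [s [th sth ann]] th0 rU [aN cN iN EN]; have [cU mU iXi UXi] := rU.
have cB := Gbf_csub s.
have mb : mfunT (fun w => before (N ^~ w) (θ w)) := sm_meas cB (before_Gbf s aN cN).
have mbU : mfunT (fun w => before (U ^~ w) (θ w)).
 by apply: (meas_before T0) => //; [exact: (st_meas T0 UG s)|exact: s.1].
have uN τ : st τ -> uidom P Xi (fun w => N (τ w) w).
 move=> s2; have cG := Gat_csub T0 UG s2; have HN := eval_sm T0 UG aN cN s2.
 have iU := raw_st T0 UG rU s2.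
 apply: (uidom_sm cG) => //; first exact: iN.
 move=> B GB; apply: (le_trans (abs_dom cG HN (iN _ s2) iU _ GB)); first by move=> B'; exact: EN.
 apply: EI_le => //; [exact: (csubm cG)|exact: L1norm|move=> w _; apply: UXi; exact: s2.1].
have lim (X : R -> Ω -> R) : (forall w, cadlag T (X ^~ w)) ->
  \forall w \ae P, X (th n w) w @[n --> \oo] --> before (X ^~ w) (θ w).
 move=> cX; apply: filterS2 ann th0 => w [_ lt cv] t0; have /andP[_ tT] := s.1 w.
 have tT2 : 0 < θ w <= T by lra.
 apply/cvgnP => e e0; have [c c0 hc] := (lcvgP _ _ _).1 (cadlag_left (cX w) tT2) e e0.
 have [M hM] := (cvgnP _ _).1 cv c c0; exists M => n Mn; apply: hc; first exact: lt.
 have := hM n Mn; rewrite ltr_norml => /andP[]; lra.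
have ind A t : \forall w \ae P, \1_(A `&` [set w | t < th n w]) w @[n --> \oo] -->
  (\1_(A `&` [set w | t < θ w]) w : R).
 apply: filterS2 ann th0 => w [nd lt cv] t0; apply: cvg_near_cst.
 have [tt|tt] := ltP t (θ w).
  have [M hM] := (cvgnP _ _).1 cv (θ w - t) ltac:(lra); exists M => // n Mn.
  have tn : t < th n w by have := hM n Mn; rewrite ltr_norml => /andP[]; lra.
  by rewrite !indicE; congr (_%:R); congr nat_of_bool; apply/idP/idP; rewrite !inE => -[a _].
 apply: nearW => n; have := lt t0 n => tn; rewrite !indicE !memNset//= => -[_]; lra.
have iN' : L1 P (fun w => before (N ^~ w) (θ w)).
 by have [] := @vitali_EI _ _ _ P Xi (fun n w => N (th n w) w) _ setT iXi measurableT
  (fun n => uN _ (sth n)) mb (lim N cN).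
split=> //.
have uU n : uidom P Xi (fun w => U (th n w) w).
 apply: le_uidom => //; first exact: L1_meas (raw_st T0 UG rU (sth n)).
 move=> w; apply: UXi; exact: (sth n).1.
have iU' : L1 P (fun w => before (U ^~ w) (θ w)).
 by have [] := @vitali_EI _ _ _ P Xi (fun n w => U (th n w) w) _ setT iXi measurableT
  uU mbU (lim U cU).
have main t A : 0 <= t <= T -> G t A -> let B := A `&` [set w | t < θ w] in
  EI P B (fun w => before (N ^~ w) (θ w)) = EI P B (fun w => before (U ^~ w) (θ w)).
 move=> tT GA B; have GB := Gbf_lt (θ := θ) tT GA; have mB := csubm cB GB.
 pose Bn n := A `&` [set w | t < th n w].
 have GBn n : Gat (th n) (Bn n) by apply: (Gbf_sub (sth n)); exact: Gbf_lt.
 have mBn n : measurable (Bn n) := csubm (Gat_csub T0 UG (sth n)) (GBn n).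
 have lN := @vitali_EI _ _ _ P Xi (fun n w => \1_(Bn n) w * N (th n w) w)
   (fun w => \1_B w * before (N ^~ w) (θ w)) setT iXi measurableT
   (fun n => uidom_indic (mBn n) (uN _ (sth n))) (L1_meas (L1indic mB iN')).
 have [|_ {}lN] := lN.
  apply: filterS2 (ind A t) (lim N cN) => w a b; exact: cvgM.
 have lU := @vitali_EI _ _ _ P Xi (fun n w => \1_(Bn n) w * U (th n w) w)
   (fun w => \1_B w * before (U ^~ w) (θ w)) setT iXi measurableT
   (fun n => uidom_indic (mBn n) (uU n)) (L1_meas (L1indic mB iU')).
 have [|_ {}lU] := lU.
  apply: filterS2 (ind A t) (lim U cU) => w a b; exact: cvgM.
 rewrite (_ : (fun n => EI P setT _) = fun n => EI P setT (fun w => \1_(Bn n) w * U (th n w) w)) in lN.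
  by have := cvg_unique _ lN lU; rewrite !EI_indic// !setTI; exact.
 apply/funext => n; rewrite !EI_indic// !setTI; exact: EN.
have T00 : 0 <= (0 : R) <= T by rewrite lexx ltW.
have G0m B : G 0 B -> measurable B := @csubm _ _ _ _ _ _ (G_csub UG T00).
have null B Z : measurable B -> L1 P Z -> EI P B Z = EI P (B `&` [set w | 0 < θ w]) Z.
 move=> mB iZ; have m0 : measurable [set w | 0 < θ w].
  apply: meas_lt => //; exact: (st_meas T0 UG s).
 rewrite -EI_indic//; apply: EI_aeq => //; first meas.
 by apply: filterS th0 => w h _; rewrite indicE mem_set// mul1r.
(* As [θ > 0] almost surely, an event of [G 0] is, up to a null set, a generator of the other kind
   with [t = 0]. *)
have zero B : G 0 B -> EI P B (fun w => before (N ^~ w) (θ w)) =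
  EI P B (fun w => before (U ^~ w) (θ w)).
 move=> GB; have mB := G0m B GB; rewrite (null B _ mB iN') (null B _ mB iU'); exact: main.
apply: pi_lambda => //.
- move=> A B [GA|[t [A' [tT GA ->]]]] [GB|[u [B' [uT GB ->]]]].
 + left; exact: (csubI (G_csub UG T00)).
 + right; exists u, (A `&` B'); split=> //; last by rewrite setIA.
  have /andP[u0 uT'] := uT; apply: (csubI (G_csub UG uT)) => //; exact: (G_mono UG (lexx 0) u0 uT').
 + right; exists t, (A' `&` B); split=> //; last by rewrite setIAC.
  have /andP[t0 tT'] := tT; apply: (csubI (G_csub UG tT)) => //; exact: (G_mono UG (lexx 0) t0 tT').
 + have /andP[t0 tT'] := tT; have /andP[u0 uT'] := uT.
  have [tu|ut] := leP t u; right; [exists u|exists t]; exists (A' `&` B'); split=> //.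
  * apply: (csubI (G_csub UG uT)) => //; exact: (G_mono UG t0 tu uT').
  * apply/seteqP; split=> w /=; [move=> [[a b] [c e]]|move=> [[a c] e]]; do ?split=> //; lra.
  * apply: (csubI (G_csub UG tT)) => //; exact: (G_mono UG u0 (ltW ut) tT').
  * apply/seteqP; split=> w /=; [move=> [[a b] [c e]]|move=> [[a c] e]]; do ?split=> //; lra.
- move=> B [GB|[t [A [tT GA ->]]]]; first meas.
 apply: (csubm cB); exact: Gbf_lt.
- apply: zero; exact: (csubT (G_csub UG T00)).
- by move=> B [GB|[t [A [tT GA ->]]]]; [exact: zero|exact: main].
Qed.

End processes.

(** * Continuous filtrations *)

Section continuous_filtrations.
Context {R : realType} {d : measure_display} {Ω : measurableType d}
 (P : probability Ω R) (T : R) (G : R -> set (set Ω))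
 (T0 : 0 < T) (UG : usual_filtration P T G).
Implicit Types (θ τ : Ω -> R) (t : R) (B : set Ω) (X : Ω -> R).
Notation st := (stopping_time T G).
Notation Gat := (sigma_at T G).

Lemma ae_grid (Q : R -> Ω -> Prop) : (forall q, 0 <= q <= T -> \forall w \ae P, Q q w) ->
 \forall w \ae P, forall q, grid T q -> Q q w.
Proof.
move=> hQ; have key : \forall w \ae P, forall i : nat * nat, Q (nth T (gridl T i.1) i.2) w.
 apply: ae_count => i; apply: hQ.
 case: (ltnP i.2 (size (gridl T i.1))) => h; last by rewrite nth_default//; exact: T_in.
 apply: (gridl_in T0 (n := i.1)); exact: mem_nth.
apply: filterS key => w kw q [n qn].
by have := kw (n, index q (gridl T n)); rewrite nth_index.
Qed.

Lemma cadlag_le (x y : R -> R) (a c : R) : cadlag T x -> cadlag T y -> 0 <= a ->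
 (forall q, grid T q -> a <= q -> q < c -> x q <= y q) ->
 forall t, a <= t -> t <= T -> t < c -> x t <= y t.
Proof.
move=> cx cy a0 H t at' tT tc; have t0 := le_trans a0 at'.
have c1 : x (minr T (up n t)) @[n --> \oo] --> x t.
 by apply: @minup_cvg => [|lt]; [rewrite t0|apply: cx.1; rewrite t0].
have c2 : y (minr T (up n t)) @[n --> \oo] --> y t.
 by apply: @minup_cvg => [|lt]; [rewrite t0|apply: cy.1; rewrite t0].
rewrite -(cvg_lim _ c1)// -(cvg_lim _ c2)//; apply: ler_lim.
- apply/cvg_ex; eexists; exact: c1.
- apply/cvg_ex; eexists; exact: c2.
- have [N hN] := mesh_small (R := R) (e := c - t) ltac:(lra).
 exists N => // n Nn; apply: H; first exact: grid_up.
 + by rewrite le_min (le_trans at' tT) (le_trans at' (ltW (lt_up n t))).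
 + rewrite gt_min; apply/orP; right; have := up_le n t0; have := @mesh_le R N n Nn; lra.
Qed.

Lemma proj_at_le (U U' N N' : R -> Ω -> R) t (E : set Ω) : is_proj P T G U N ->
 is_proj P T G U' N' -> 0 <= t <= T -> L1 P (U t) -> L1 P (U' t) -> G t E ->
 (forall w, E w -> U t w <= U' t w) -> \forall w \ae P, E w -> N t w <= N' t w.
Proof.
move=> [aN cN iN EN] [aN' cN' iN' EN'] tT iU iU' GE le; have cG := G_csub UG tT.
have mE := csubm cG GE; have sc := st_cst UG tT.
have : \forall w \ae P, \1_E w * N t w <= \1_E w * N' t w.
 have i1 := iN _ sc; have i2 := iN' _ sc.
 apply: (sm_ae_le cG); [by apply: (smM cG); [exact: (sm_indic cG)|exact: aN]|
  by apply: (smM cG); [exact: (sm_indic cG)|exact: aN']|exact: L1indic|exact: L1indic|].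
 move=> A GA; have mA := csubm cG GA; rewrite !EI_indic//.
 have GB : Gat (cst t) (A `&` E) by rewrite (Gat_cst UG tT); exact: (csubI cG).
 rewrite (EN _ _ sc GB) (EN' _ _ sc GB); apply: EI_le => //; first meas.
 by move=> w [_ Ew]; exact: le.
by apply: filterS => w h Ew; move: h; rewrite indicE mem_set// !mul1r.
Qed.

Lemma cmart_proj (M : R -> Ω -> R) X : cmart P T G M X -> is_proj P T G (fun=> X) M.
Proof. by move=> [aM cM iX iM EM]; split. Qed.

Hypothesis cont : continuous_filtration P T G.

(** [M] and its continuous version agree almost surely on the grid, hence at all times by
    right-continuity. *)
Lemma cmart_continuous (M : R -> Ω -> R) X : cmart P T G M X ->
 \forall w \ae P, forall t, 0 < t <= T -> M s w @[s --> t^'-] --> M t w.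
Proof.
move=> cM; have [aM caM _ _ _] := cM.
have [N cN MN] := cont (cmart_martingale UG cM).
have cNw w := (continuous_within_itvP (N ^~ w) T0).1 (cN w).
have caN w : cadlag T (N ^~ w).
 have [c0 c1 c2] := cNw w; split=> t /andP[t0 tT].
  move: t0; rewrite le_eqVlt => /predU1P[<-//|t0]; apply: cvg_within_filter.
  by apply: c0; rewrite in_itv/= t0.
 move: tT; rewrite le_eqVlt => /predU1P[->|tT]; first exact: (cvgP _ c2).
 by apply: (cvgP (N t w)); apply: cvg_within_filter; apply: c0; rewrite in_itv/= t0.
apply: filterS (ae_grid MN) => w hw.
have MNt t : 0 <= t <= T -> M t w = N t w.
 move=> /andP[t0 tT]; apply/le_anti/andP; split.
  by apply: (@cadlag_le (M ^~ w) (N ^~ w) 0 (T + 1)) => //; [move=> q /hw -> //|lra].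
 by apply: (@cadlag_le (N ^~ w) (M ^~ w) 0 (T + 1)) => //; [move=> q /hw -> //|lra].
move=> t tT; have /andP[t0 tT'] := tT; rewrite MNt; last lra.
have [c0 c1 c2] := cNw w.
have : N s w @[s --> t^'-] --> N t w.
 move: tT'; rewrite le_eqVlt => /predU1P[->//|lt].
 by apply: cvg_within_filter; apply: c0; rewrite in_itv/= t0.
apply: cvg_trans; apply: near_eq_cvg; apply: filterS (near_in_left tT) => s /andP[s0 sT].
by rewrite MNt// s0 ltW.
Qed.

(* Only the predictable part of the Doob-Meyer decomposition jumps. *)
Lemma proj_jump_ge0 (K : R -> Ω -> R) (Xi : Ω -> R) N : raw P T K Xi ->
 (forall w, nondec T (K ^~ w)) -> is_proj P T G K N ->
 \forall w \ae P, forall t, 0 < t <= T -> before (N ^~ w) t <= N t w.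
Proof.
move=> rK nK pN.
have [M [Bp [X [cM aB cB E nB]]]] := doob_meyer T0 UG (proj_dsub T0 UG rK nK pN).
apply: filterS2 (cmart_continuous cM) nB => w cMw nBw t tT; have /andP[t0 tT'] := tT.
have lB := cadlag_left (cB w) tT; have lM := cMw t tT.
rewrite before_lim// (_ : N ^~ w = fun s => M s w + Bp s w); last exact/funext.
rewrite (cvg_lim _ (cvgD lM lB))// E lerD2l -(cvg_lim _ lB)//.
apply: limr_le; first exact: (cvgP _ lB).
near=> s; have s0 : 0 <= s by near: s; exact: nbhs_left_ge.
have st' : s < t by [].
exact: nBw s0 (ltW st') tT'.
Unshelve. all: by end_near. Qed.

Section increasing.
Context (K : R -> Ω -> R) (Xi : Ω -> R)
 (rK : raw P T K Xi) (nK : forall w, nondec T (K ^~ w)) (K0 : forall w, 0 <= K 0 w).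

Definition stopped_before θ t w := if t < θ w then K t w else before (K ^~ w) (θ w).

Let cK w : cadlag T (K ^~ w). Proof. by have [] := rK. Qed.

Lemma stopped_before_raw θ : st θ -> raw P T (stopped_before θ) Xi /\
 forall w, nondec T (stopped_before θ ^~ w).
Proof.
move=> sth; have [_ mK iXi KXi] := rK.
have nS w : nondec T (stopped_before θ ^~ w).
 move=> s t s0 st' tT; rewrite /stopped_before; have /andP[_ thT] := sth.1 w.
 case: (ltP s (θ w)) => h1; case: (ltP t (θ w)) => h2 //; first exact: nK.
  exact: le_before.
 lra.
split=> //; split=> //.
- move=> w; apply: nondec_cadlag => // t /andP[t0 tT].
 rewrite {2}/stopped_before; case: (ltP t (θ w)) => h.
  have tT2 : 0 <= t < T by lra.
  apply: cvg_trans ((cK w).1 t tT2); apply: near_eq_cvg; near=> s.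
  rewrite /stopped_before; have -> // : s < θ w; near: s; exact: nbhs_right_lt.
 apply: cvg_near_cst; near=> s; rewrite /stopped_before ltNge; have -> // : θ w <= s.
 exact: (le_trans h).
- move=> t tT; apply: measurable_fun_ifT; [|exact: mK|].
  apply: measurable_fun_ltr => //; exact: (st_meas T0 UG sth).
 by apply: (meas_before T0) => //; [exact: (st_meas T0 UG sth)|exact: sth.1].
- move=> t w tT; rewrite /stopped_before; case: ifP => _; first exact: KXi.
 have thT := sth.1 w; rewrite ger0_norm; last exact: before_ge0.
 apply: (le_trans (before_le (cK w) (@nK w) (K0 w) thT)); apply: le_trans (KXi _ _ thT); exact: ler_norm.
Unshelve. all: by end_near. Qed.

(** [N'] projects [K] frozen at its left limit from [θ] on. It agrees with [N] before [θ] and with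
    [O] at [θ], and its jump there is non-negative by [proj_jump_ge0]. *)
Lemma leftproj_stopping N O θ : is_leftproj P T G K N O -> st θ ->
 \forall w \ae P, 0 < θ w -> before (N ^~ w) (θ w) <= O (θ w) w.
Proof.
move=> [pN _ OP _ _] sth; have [rS nS] := stopped_before_raw sth.
have [N' pN'] := proj_exists T0 UG rS nS.
have [aN cN iN EN] := pN; have [aN' cN' iN' EN'] := pN'; have cG := Gat_csub T0 UG sth.
have [HO iO EO] := OP _ sth.
have h1 : \forall w \ae P, N' (θ w) w = O (θ w) w.
 apply: (sm_ae_eq cG) => //; [exact: (eval_sm T0 UG)|exact: iN'|].
 move=> A GA; rewrite EN'// EO//; apply: eq_EI => w _; by rewrite /stopped_before ltxx.
have h2 : \forall w \ae P, forall q, grid T q -> q < θ w -> N' q w = N q w.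
 apply: (ae_grid (Q := fun q w => q < θ w -> N' q w = N q w)) => q qT.
 have GE := st_gt UG sth qT; have i1 := raw_st T0 UG rK (st_cst UG qT).
 have i2 := raw_st T0 UG rS (st_cst UG qT).
 have a1 : \forall w \ae P, q < θ w -> N' q w <= N q w.
  by apply: (proj_at_le pN' pN qT i2 i1 GE) => w  h; rewrite /stopped_before h.
 have a2 : \forall w \ae P, q < θ w -> N q w <= N' q w.
  by apply: (proj_at_le pN pN' qT i1 i2 GE) => w  h; rewrite /stopped_before h.
 by apply: filterS2 a1 a2 => w b1 b2 h; apply/eqP; rewrite eq_le b1// b2.
have h3 := proj_jump_ge0 rS nS pN'.
apply: filterS3 h1 h2 h3 => w e1 e2 e3 t0; have /andP[_ tT] := sth.1 w.
have tT2 : 0 < θ w <= T by lra.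
rewrite -e1; apply: le_trans (e3 _ tT2); rewrite le_eqVlt; apply/orP; left; apply/eqP.
rewrite !before_lim//; congr lim; apply/seteqP.
have near_eq : \forall s \near (θ w)^'-, N s w = N' s w.
 near=> s; have sth' : s < θ w by [].
 have s0 : 0 <= s by near: s; exact: nbhs_left_ge.
 apply/le_anti/andP; split.
  by apply: (@cadlag_le (N ^~ w) (N' ^~ w) 0 (θ w)) => //; [move=> q gq _ h; rewrite e2|lra].
 by apply: (@cadlag_le (N' ^~ w) (N ^~ w) 0 (θ w)) => //; [move=> q gq _ h; rewrite e2|lra].
split; apply: near_eq_cvg; by apply: filterS near_eq => s ->.
Unshelve. all: by end_near. Qed.

(** To bound [O] above, the left-continuous martingale closed by [K q], with [q] in []t - mesh n,
    t[], separates [Nn n] from [N] near [t]. Conversely, either [O = N] at [t] and the jump of [N]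
    is non-negative, or [t] is one of countably many stopping times and [leftproj_stopping]
    applies. *)
Theorem leftproj_continuous N O : is_leftproj P T G K N O ->
 \forall w \ae P, forall t, 0 < t <= T -> before (N ^~ w) t = O t w.
Proof.
move=> hNO; have [pN [Nn pNn NnO] OP O_N [th sth gap]] := hNO.
have [aN cN iN EN] := pN.
have iK t : 0 <= t <= T -> L1 P (K t) by move=> tT; exact: (raw_st T0 UG rK (st_cst UG tT)).
have upper n : \forall w \ae P, forall t, 0 < t <= T -> Nn n t w <= before (N ^~ w) t.
 have Q : \forall w \ae P, forall q, grid T q -> exists L : R -> R,
   [/\ forall t, 0 < t <= T -> L s @[s --> t^'-] --> L t,
    forall t, q <= t -> t <= T -> L t <= N t w
   & forall t, q <= t -> t <= T -> t < q + mesh n -> Nn n t w <= L t].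
  apply: ae_grid => q qT; have /andP[q0 qT'] := qT.
  have [L cL] := cmart_exists T0 UG (iK q qT); have [_ caL _ _ _] := cL.
  have pL := cmart_proj cL.
  have a1 : \forall w \ae P, forall p, grid T p -> q <= p -> L p w <= N p w.
   apply: (ae_grid (Q := fun p w => q <= p -> L p w <= N p w)) => p pT.
   have [qp|pq] := leP q p; last by apply: aeW.
   have cG := G_csub UG pT; have /andP[_ pT'] := pT.
   have := @proj_at_le (fun=> K q) K L N p setT pL pN pT (iK q qT) (iK p pT) (csubT cG).
   move=> /(_ (fun w _ => @nK w _ _ q0 qp pT')); apply: filterS => w h _; exact: h.
  have a2 : \forall w \ae P, forall p, grid T p -> p < q + mesh n -> Nn n p w <= L p w.
   apply: (ae_grid (Q := fun p w => p < q + mesh n -> Nn n p w <= L p w)) => p pT.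
   have [pq|qp] := ltP p (q + mesh n); last by apply: aeW.
   have cG := G_csub UG pT.
   have iD : L1 P (delay K n p).
    rewrite /delay; case: ltP => h; first meas.
    have m0 := @mesh_ge0 R n; apply: iK; lra.
   have := @proj_at_le (delay K n) (fun=> K q) (Nn n) L p setT (pNn n) pL pT iD (iK q qT) (csubT cG).
   move=> H; apply: filterS (H _) => [w h _|w _]; first exact: h.
   rewrite /delay; case: ltP => h; last by apply: nK; lra.
   apply: (le_trans (K0 w)); exact: nK.
  have [_ cNn _ _] := pNn n.
  apply: filterS3 (cmart_continuous cL) a1 a2 => w b0 b1 b2; exists (L ^~ w); split=> //.
   move=> t qt tT; apply: (@cadlag_le (L ^~ w) (N ^~ w) q (T + 1)) => //; [move=> p gp h _; exact: b1|lra].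
  move=> t qt tT tn.
  apply: (@cadlag_le (Nn n ^~ w) (L ^~ w) q (q + mesh n)) => // p gp _ h; exact: b2.
 apply: filterS Q => w hw t tT; have /andP[t0 tT'] := tT.
 pose a := maxr 0 (t - mesh n); have m0 := mesh_gt0 (R := R) n.
 have at' : a < t by rewrite gt_max; lra.
 have [q [gq aq qt]] := @grid_dense R T T0 a (t - a) ltac:(by rewrite le_max lexx)
  ltac:(exact: lt_le_trans at' tT') ltac:(lra).
 have am : t - mesh n <= a by rewrite le_max lexx orbT.
 have [L [cL LN NL]] := hw q gq.
 have lN := cadlag_left (cN w) tT; have lL := cL t tT.
 apply: (@le_trans _ _ (L t)); first by apply: NL; lra.
 rewrite -(cvg_lim _ lL)// -(cvg_lim _ lN)//; apply: ler_lim; [exact: (cvgP _ lL)|exact: (cvgP _ lN)|].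
 near=> s; have st' : s < t by [].
 apply: LN; [|exact: le_trans (ltW st') tT'].
 near: s; apply: nbhs_left_ge; lra.
have hst := ae_count (fun n => leftproj_stopping hNO (sth n)).
have up2 := ae_count upper; have j2 := proj_jump_ge0 rK nK pN.
apply: filterS3 up2 j2 (filterI gap hst) => w u j [[_ ex] {}hst] t tT.
have /andP[t0 tT'] := tT; have tT2 : 0 <= t <= T by rewrite ltW.
apply/le_anti/andP; split.
 have /andP[_ le] := O_N t w tT2; have [->|ne] := eqVneq (O t w) (N t w); first exact: j.
 have lt : O t w < N t w by lra.
 by have [n nt] := ex t tT2 lt; have := hst n; rewrite nt; exact.
have c1 := NnO t w tT2; rewrite -(cvg_lim _ c1)//; apply: limr_le; first exact: (cvgP _ c1).
apply: nearW => n; exact: u.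
Unshelve. all: by end_near. Qed.

End increasing.
End continuous_filtrations.

Lemma ae_le_L1 {R : realType} d (S : measurableType d) (P : probability S R) (X Y : S -> R) :
 mfunT X -> L1 P Y -> (\forall w \ae P, `|X w| <= Y w) -> L1 P X.
Proof.
move=> mX iY XY; apply: (EI_dominated measurableT (fun _ : nat => mX) mX iY (fun=> XY) _).1.
apply: aeW => w; exact: cvg_cst.
Qed.

Lemma bracket_swap {R : realType} (a b c e k : R) : a + b - c + e = a + k - (c - e) - (k - b).
Proof. lra. Qed.

Lemma bracket_subs {R : realType} (a b c e : R) : a - b - (c - e) = (a - c) - (b - e).
Proof. lra. Qed.

(** * The aggregated value process *)

Section value_process.
Context {R : realType} {d : measure_display} {Ω : measurableType d}
 (P : probability Ω R) (T : R) (G : R -> set (set Ω))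
 (T0 : 0 < T) (UG : usual_filtration P T G).
Implicit Types (θ τ : Ω -> R) (t : R) (B : set Ω).
Notation st := (stopping_time T G).
Notation Gat := (sigma_at T G).
Notation Gbf := (sigma_before T G).
Context (g x S : R -> Ω -> R) (Xi Xs : Ω -> R)
 (rg : raw P T g Xi) (mx : mcpath T x) (dS : dsub P T G S Xs).

(** The positive part of [g] for [c = 1] and the negative part for [c = -1]; each has a
    non-decreasing integral against [dx]. *)
Definition gpart (c : R) t w := (`|g t w| + c * g t w) / 2.

Lemma gpart_raw c : `|c| <= 1 -> raw P T (gpart c) Xi.
Proof.
have [cg mg iXi gXi] := rg => c1; split=> //.
- move=> w; have [r l] := cg w; split=> t tT.
  apply: cvgMl; apply: cvgD; first exact: cvg_norm (r t tT).
  apply: cvgMr; exact: r.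
 apply: is_cvgMl; apply: is_cvgD; [exact: is_cvg_norm (l t tT)|apply: is_cvgMr; exact: l].
- move=> t tT; apply: mfunM; last meas.
 apply: mfunD; first meas.
 meas.
- move=> t w tT; apply: le_trans (gXi t w tT); rewrite normrM [`|2^-1|]ger0_norm// ler_pdivrMr//.
 apply: (le_trans (ler_normD _ _)); rewrite normr_id normrM mulr_natr lerD2l.
 exact: ler_piMl.
Qed.

Lemma gpart_ge0 c t w : `|c| <= 1 -> 0 <= gpart c t w.
Proof.
move=> c1; rewrite divr_ge0//; have := ler_norm (- (c * g t w)); rewrite normrN normrM.
have := ler_piMl (normr_ge0 (g t w)) c1; lra.
Qed.

Lemma gpartB t w : gpart 1 t w - gpart (-1) t w = g t w.
Proof. by rewrite /gpart; field. Qed.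

Notation K c := (Kint T x (gpart c)).

Lemma K_nondec c : `|c| <= 1 -> (forall w, nondec T (K c ^~ w)) /\ forall w, 0 <= K c 0 w.
Proof.
move=> c1; have [cg _ _ _] := gpart_raw c1; split=> w.
 move=> s t s0 st' tT; have [_ nx _ _] := mx.1 w.
 apply: lint_mono => //; [exact: mx.1|by move=> r _; exact: gpart_ge0|exact: nx].
have T00 : 0 <= (0 : R) <= T by rewrite lexx ltW.
apply: (@le_trans _ _ (lint T (x ^~ w) (gpart c ^~ w) 0)).
 by rewrite (lint0 T0 (mx.1 w) (cg w)).
apply: lint_mono => //; [exact: mx.1|by move=> r _; exact: gpart_ge0|].
by have /andP[] := cpath01 (mx.1 w) T00.
Qed.

Let p1 : `|1 : R| <= 1. Proof. by rewrite normr1. Qed.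
Let m1 : `|-1 : R| <= 1. Proof. by rewrite normrN1. Qed.

Lemma lint_gpart w (c : R) :
 lint T (x ^~ w) (gpart 1 ^~ w) c - lint T (x ^~ w) (gpart (-1) ^~ w) c = lint T (x ^~ w) (g ^~ w) c.
Proof.
have [c1 _ _ _] := gpart_raw p1; have [c2 _ _ _] := gpart_raw m1.
rewrite -(lint_sub T0 (mx.1 w) (c1 w) _ (c2 w)); congr lint.
apply/funext => t; exact: gpartB.
Qed.

Lemma past_gpart w t : 0 <= t <= T ->
 before (K 1 ^~ w) t - before (K (-1) ^~ w) t = lint T (x ^~ w) (g ^~ w) (before (x ^~ w) t).
Proof.
move=> tT; have [c1 _ _ _] := gpart_raw p1; have [c2 _ _ _] := gpart_raw m1.
rewrite !lint_before ?lint_gpart//; exact: mx.1.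
Qed.

Context (Np Op Nm Om M Bp : R -> Ω -> R) (X : Ω -> R)
 (hp : is_leftproj P T G (K 1) Np Op) (hm : is_leftproj P T G (K (-1)) Nm Om)
 (cM : cmart P T G M X) (aB : adapted T G Bp) (cB : forall w, cadlag T (Bp ^~ w))
 (SE : forall t w, S t w = M t w + Bp t w)
 (nB : \forall w \ae P, forall s t, 0 <= s -> s <= t -> t <= T -> Bp s w <= Bp t w).

(** The past cost is subtracted in its left-continuous projections because it runs over [[0, t[]. *)
Definition V t w := S t w - Op t w + Om t w.

Let rp := Kint_raw T0 (gpart_raw p1) mx.
Let rm := Kint_raw T0 (gpart_raw m1) mx.
Let cS w : cadlag T (S ^~ w). Proof. by have [] := dS. Qed.
Let aS : adapted T G S. Proof. by have [] := dS. Qed.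
Let iXs : L1 P Xs. Proof. by have [] := dS. Qed.
Let iXi : L1 P Xi. Proof. by have [] := rg. Qed.
Let iS θ : st θ -> L1 P (fun w => S (θ w) w).
Proof. by have [_ _ _ [+ _ _]] := dS; exact. Qed.

Let past_dom w t : 0 <= t <= T -> `|lint T (x ^~ w) (g ^~ w) (before (x ^~ w) t)| <= Xi w.
Proof. move=> tT; have [cg _ _ gX] := rg; apply: lint_bound => //; [exact: mx.1|move=> s; exact: gX]. Qed.

Let ib c θ : `|c| <= 1 -> st θ -> L1 P (fun w => before (K c ^~ w) (θ w)).
Proof.
move=> c1 s; have [ck mk _ _] := Kint_raw T0 (gpart_raw c1) mx.
apply: le_L1 iXi; first by apply: (meas_before T0) => //; [exact: (st_meas T0 UG s)|exact: s.1].
move=> w; have thT := s.1 w; have [cg _ _ gX] := gpart_raw c1.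
rewrite lint_before//; last exact: mx.1.
apply: lint_bound => //; [exact: mx.1|move=> r; exact: gX].
Qed.

Let ipast θ : st θ -> L1 P (past T g x θ).
Proof. by move=> s; apply: (past_L1 T0 rg mx); [exact: (st_meas T0 UG s)|exact: s.1]. Qed.

Lemma V_stopping θ : st θ -> [/\ smeas (Gat θ) (fun w => V (θ w) w),
 L1 P (fun w => V (θ w) w)
 & forall B, Gat θ B -> EI P B (fun w => V (θ w) w) =
   EI P B (fun w => S (θ w) w - past T g x θ w)].
Proof.
move=> s; have cG := Gat_csub T0 UG s; have [_ _ OP _ _] := hp; have [_ _ OM _ _] := hm.
have [H1 i1 E1] := OP _ s; have [H2 i2 E2] := OM _ s; have i0 := iS s.
split=> [|| B GB].
- apply: (smD cG) => //; apply: (smB cG) => //; exact: (eval_sm T0 UG).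
- apply: L1D; meas.
have mB := csubm cG GB; have ip := ipast s.
have thT := s.1.
have j1 := ib p1 s; have j2 := ib m1 s.
rewrite /V EID//; last meas.
rewrite !EIB// E1// E2// -addrA; congr (_ + _); rewrite addrC -[RHS]opprK opprK.
rewrite -opprB; congr (- _); rewrite -EIB//; apply: eq_EI => w _; exact: past_gpart.
Qed.

Lemma V_class_D : class_D P T G V.
Proof.
apply: (uidom_uniformly_integrable (Xi := fun w => Xs w + Xi w)); first meas.
move=> _ [θ s <-]; have cG := Gat_csub T0 UG s; have [HV iV EV] := V_stopping s.
have i2 : L1 P (fun w => S (θ w) w - past T g x θ w) by meas.
apply: (uidom_sm cG HV iV); first meas.
move=> B GB; have mB := csubm cG GB; apply: (le_trans (abs_dom cG HV iV i2 EV GB)).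
have [_ _ _ [_ Sd _]] := dS; have j1 := L1norm (iS s); have j2 := L1norm (ipast s).
apply: (@le_trans _ _ (EI P B (fun w => `|S (θ w) w| + `|past T g x θ w|))).
 apply: EI_le => //; [exact: L1norm|exact: L1D|by move=> w _; exact: ler_normB].
rewrite !EID//; apply: lerD; first exact: Sd.
apply: EI_le => // w _; apply: past_dom; exact: s.1.
Qed.

Lemma V_semimartingale : optional_semimartingale P T G V.
Proof.
split.
 have [_ [N1 pN1 l1] _ _ _] := hp; have [_ [N2 pN2 l2] _ _ _] := hm.
 apply: (optional_lim (X_ := fun n t w => S t w - N1 n t w + N2 n t w)).
  move=> n; have [a1 c1 _ _] := pN1 n; have [a2 c2 _ _] := pN2 n; split.
   move=> t tT; have cG := G_csub UG tT; apply: (smD cG); last exact: a2.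
   meas.
  move=> w; apply: cadlagD => //; apply: (cadlagD (y := fun t => - N1 n t w)) => //.
  by have [r l] := c1 w; split=> t tT; [apply: cvgN; exact: r|apply: is_cvgN; exact: l].
 by move=> t w tT; apply: cvgD; [apply: cvgB; [exact: cvg_cst|exact: l1]|exact: l2].
have [nK1 _] := K_nondec p1; have [nK2 _] := K_nondec m1.
have [M1 [X1 [D1 [cM1 aD1 E1 bv1]]]] := leftproj_decomp T0 UG rp nK1 hp.
have [M2 [X2 [D2 [cM2 aD2 E2 bv2]]]] := leftproj_decomp T0 UG rm nK2 hm.
have cM' := cmart_combine T0 UG 1 (cmart_combine T0 UG (-1) cM cM1) cM2.
exists (fun t w => M t w + -1 * M1 t w + 1 * M2 t w), (fun t w => Bp t w - D1 t w + D2 t w); split.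
- exact: (cmart_local_martingale T0 UG cM').
- move=> t tT; have cG := G_csub UG tT; apply: (smD cG); last exact: aD2.
 meas.
- apply: filterS3 nB bv1 bv2 => w b0 b1 b2.
 rewrite (_ : (fun t => _) = ((Bp ^~ w) \+ (\- (D1 ^~ w))) \+ (D2 ^~ w)); last by [].
 apply: bounded_variationD => //; apply: bounded_variationD => //; last exact: bounded_variationN.
 exact: nondec_bv.
- apply: aeW => w t _; rewrite /V SE E1 E2; ring.
Qed.

(** A summable gap does not affect right limits: those of [Op] and [Om] are the values of the càdlàg
    [Np] and [Nm], which include the cost at [t] itself. *)
Lemma V_right : \forall w \ae P, forall t, 0 <= t < T ->
 V s w @[s --> t^'+] --> S t w - Np t w + Nm t w.
Proof.
have [[_ c1 _ _] _ _ O1 [th1 _ g1]] := hp; have [[_ c2 _ _] _ _ O2 [th2 _ g2]] := hm.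
apply: filterS2 g1 g2 => w [s1 _] [s2 _] t tT; apply: cvgD; first apply: cvgB.
- exact: (cS w).1.
- apply: (gap_right (x := Np ^~ w) _ s1 tT); last exact: (c1 w).1.
 by move=> r rT; have /andP[] := O1 r w rT.
- apply: (gap_right (x := Nm ^~ w) _ s2 tT); last exact: (c2 w).1.
 by move=> r rT; have /andP[] := O2 r w rT.
Qed.

Lemma V_left : \forall w \ae P, forall t, 0 < t <= T ->
 V s w @[s --> t^'-] --> before (S ^~ w) t - before (Np ^~ w) t + before (Nm ^~ w) t.
Proof.
have [[_ c1 _ _] _ _ O1 [th1 _ g1]] := hp; have [[_ c2 _ _] _ _ O2 [th2 _ g2]] := hm.
apply: filterS2 g1 g2 => w [s1 _] [s2 _] t tT; apply: cvgD; first apply: cvgB.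
- exact: cadlag_left.
- apply: (gap_left (x := Np ^~ w) _ s1 tT); last exact: cadlag_left.
 by move=> r rT; have /andP[] := O1 r w rT.
- apply: (gap_left (x := Nm ^~ w) _ s2 tT); last exact: cadlag_left.
 by move=> r rT; have /andP[] := O2 r w rT.
Qed.

Definition gjump θ w := g (θ w) w * jump (x ^~ w) (θ w).

Lemma gjump_L1 θ : st θ -> L1 P (gjump θ).
Proof.
move=> s; have [cg mg _ gX] := rg; have mth := st_meas T0 UG s; have thT := s.1.
have cx w : cadlag T (x ^~ w) by have [] := mx.1 w.
apply: le_L1 iXi.
 apply: mfunM; first exact: (meas_at_qtl mg cg mth thT).
 apply: mfunB; first exact: (meas_at_qtl mx.2 cx mth thT).
 apply: (meas_before T0) => //; exact: mx.2.
move=> w; have /andP[a b] := cpath01 (mx.1 w) (thT w); have /andP[a' b'] := cpath_before (mx.1 w) (thT w).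
rewrite normrM; apply: le_trans (gX _ w (thT w)); apply: ler_piMr => //.
rewrite /jump ler_norml; lra.
Qed.

(** Value and right limit differ by the gaps between the two kinds of projections, whose conditional
    mean is that of the jump of the past cost, [g] times the jump of [x]. *)
Lemma V_right_jump θ : st θ -> \forall w \ae P, θ w < T ->
 V s w @[s --> (θ w)^'+] --> V (θ w) w - ce P (Gat θ) (gjump θ) w.
Proof.
move=> s; have cG := Gat_csub T0 UG s; have ij := gjump_L1 s.
have [[aN1 cN1 iN1 E1] _ O1 _ _] := hp; have [[aN2 cN2 iN2 E2] _ O2 _ _] := hm.
have [H1 i1 F1] := O1 _ s; have [H2 i2 F2] := O2 _ s.
pose D w := (Np (θ w) w - Op (θ w) w) - (Nm (θ w) w - Om (θ w) w).
have ej : \forall w \ae P, ce P (Gat θ) (gjump θ) w = D w.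
 have j1 := iN1 _ s; have j2 := iN2 _ s.
 have k1 := L1B j1 i1; have k2 := L1B j2 i2.
 apply: (ceE cG ij); split.
 - apply: (smB cG); apply: (smB cG) => //; exact: (eval_sm T0 UG).
 - exact: L1B.
 move=> B GB; have mB := csubm cG GB.
 rewrite EIB// (EIB mB j1 i1) (EIB mB j2 i2) E1// E2// F1// F2//.
 have r1 := raw_st T0 UG rp s; have r2 := raw_st T0 UG rm s.
 have b1 := ib p1 s; have b2 := ib m1 s.
 rewrite -(EIB mB r1 b1) -(EIB mB r2 b2) -(EIB mB (L1B r1 b1) (L1B r2 b2)); apply: eq_EI => w _.
 have thT := s.1 w; have [cg _ _ _] := rg; have := past_gpart w thT.
 have := lint_jump T0 (cg w) (mx.1 w) thT; rewrite /gjump => <- <-.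
 rewrite -lint_gpart; exact: bracket_subs.
apply: filterS2 V_right ej => w h e lt; have /andP[th0 _] := s.1 w.
have thT : 0 <= θ w < T by lra.
rewrite e (_ : _ - D w = S (θ w) w - Np (θ w) w + Nm (θ w) w); first exact: h.
rewrite /V /D; ring.
Qed.

(** What is retained of optimality: at quantiles of levels arbitrarily close to 1, the submartingale
    [S] still has its initial mean. *)
Definition optimal_times (xi : R -> Ω -> R) := [/\ adapted T G xi, mcpath T xi &
 forall n : nat, exists z : R, [/\ 0 <= z < 1, 1 - mesh n < z
  & EI P setT (fun w => S (qtl T (xi ^~ w) z) w) = EI P setT (S 0)]].

Let iB θ : st θ -> L1 P (fun w => Bp (θ w) w).
Proof.
move=> s; have [_ _ _ iM _] := cM; rewrite (_ : (fun w => _) = fun w => S (θ w) w - M (θ w) w).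
 meas.
by apply/funext => w; rewrite SE addrAC subrr add0r.
Qed.

Let EB θ : st θ -> EI P setT (fun w => Bp (θ w) w) =
 EI P setT (fun w => S (θ w) w) - EI P setT X.
Proof.
move=> s; have [_ _ _ iM EM] := cM; rewrite -(EM _ _ s (csubT (Gat_csub T0 UG s))) -EIB//.
- by apply: eq_EI => w _; rewrite SE addrAC subrr add0r.
- meas.
- meas.
Qed.

(* Optimality makes the increasing part of [S] constant up to the quantiles of
  the optimal control, hence up to any time at which it has not reached 1. *)
Lemma B_constant xi : optimal_times xi -> \forall w \ae P, forall t, 0 <= t <= T ->
 before (xi ^~ w) t < 1 -> forall s, 0 <= s <= t -> Bp s w = Bp 0 w.
Proof.
move=> [axi mxi /choice[z hz]]; have T00 : 0 <= (0 : R) <= T by rewrite lexx ltW.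
have s0 := st_cst UG T00.
have sq n := quantile_st T0 UG axi mxi (let: And3 h _ _ := hz n in h).
have key n : \forall w \ae P, Bp (qtl T (xi ^~ w) (z n)) w <= Bp 0 w.
 apply: ae_le_EI; [exact: iB|exact: iB|].
 set A := [set w | _]; have i1 := iB (sq n); have i0 := iB s0.
 have mA : measurable A by apply: meas_lt; meas.
 have [_ _ eS] := hz n.
 have E : EI P setT (fun w => Bp (qtl T (xi ^~ w) (z n)) w) = EI P setT (Bp 0).
  by rewrite (EB (sq n)) eS EB.
 have le : EI P (~` A) (Bp 0) <= EI P (~` A) (fun w => Bp (qtl T (xi ^~ w) (z n)) w).
  apply: EI_ae_le; [exact: measurableC|exact: i0|exact: i1|].
  apply: filterS nB => w hw _; have /andP[a b] := (sq n).1 w; exact: hw.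
 move: E; rewrite (EI_split measurableT mA i1) (EI_split measurableT mA i0) !setTI; lra.
apply: filterS2 nB (ae_count key) => w nBw hw t tT lt s /andP[sge0 st'].
have /andP[t0 tT'] := tT.
(* A level above the left limit of [xi] at [t] has its quantile at [t] or later. *)
have [n nl] := mesh_small (R := R) (e := 1 - before (xi ^~ w) t) ltac:(lra).
have [/andP[z0 z1] zn _] := hz n.
have tq : t <= qtl T (xi ^~ w) (z n).
 rewrite (qtl_ge T0 (mxi.1 w)); lra.
have /andP[q0 qT] := (sq n).1 w.
apply/le_anti/andP; split; last exact: nBw (lexx 0) sge0 (le_trans st' tT').
apply: le_trans (hw n); apply: nBw => //; exact: le_trans st' tq.
Qed.

(** Each term is left-continuous: the martingale part because the filtration is continuous, the
    projected costs by [leftproj_continuous], and [Bp] because it is constant as long as [xi] stays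
    below 1. *)
Lemma V_left_continuous xi : optimal_times xi -> continuous_filtration P T G ->
 \forall w \ae P, forall t, 0 < t <= T -> before (xi ^~ w) t < 1 -> V s w @[s --> t^'-] --> V t w.
Proof.
move=> oxi cont; have [nK1 K01] := K_nondec p1; have [nK2 K02] := K_nondec m1.
have h1 := leftproj_continuous T0 UG cont rp nK1 K01 hp.
have h2 := leftproj_continuous T0 UG cont rm nK2 K02 hm.
apply: filterS3 (filterI h1 h2) (filterI V_left (cmart_continuous T0 UG cont cM)) (B_constant oxi).
move=> w [{}h1 {}h2] [vl cm] bc t tT lt; have /andP[t0 tT'] := tT; have tT2 : 0 <= t <= T by rewrite ltW.
rewrite {2}/V -(h1 t tT) -(h2 t tT) (_ : S t w = before (S ^~ w) t); first exact: vl.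
rewrite before_lim// (_ : S ^~ w = fun s => M s w + Bp s w); last exact/funext.
have lB : Bp s w @[s --> t^'-] --> Bp t w.
 rewrite (bc t tT2 lt) ?(ltW t0) ?lexx//; apply: cvg_near_cst; near=> s.
 apply: (bc t tT2 lt); apply/andP; split; first by near: s; exact: nbhs_left_ge.
 by [].
by rewrite (cvg_lim _ (cvgD (cm t tT) lB)).
Unshelve. all: by end_near. Qed.

Section previsible.
Context (θ : Ω -> R)
 (pth : previsible_time P T G θ) (th0 : \forall w \ae P, 0 < θ w).
Let s : st θ. Proof. by have [] := pth. Qed.
Let cGb : csub P (Gbf θ). Proof. exact: Gbf_csub. Qed.

Let VL w := before (S ^~ w) (θ w) - before (Np ^~ w) (θ w) + before (Nm ^~ w) (θ w).

Let bS : \forall w \ae P, before (S ^~ w) (θ w) = before (M ^~ w) (θ w) + before (Bp ^~ w) (θ w).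
Proof.
have [_ cM' _ _ _] := cM.
apply: filterS th0 => w t0; have /andP[_ tT] := s.1 w; have tT2 : 0 < θ w <= T by rewrite t0.
rewrite {1}before_lim// (_ : S ^~ w = fun s => M s w + Bp s w); last exact/funext.
by rewrite (cvg_lim _ (cvgD (cadlag_left (cM' w) tT2) (cadlag_left (cB w) tT2))).
Qed.

Let bB : \forall w \ae P, Bp 0 w <= before (Bp ^~ w) (θ w) <= Bp (θ w) w.
Proof.
apply: filterS2 th0 nB => w t0 nb; have /andP[_ tT] := s.1 w; have tT2 : 0 < θ w <= T by rewrite t0.
have lB := cadlag_left (cB w) tT2; rewrite -(cvg_lim _ lB)//; apply/andP; split.
 apply: limr_ge; first exact: (cvgP _ lB).
 by apply: filterS (near_in_left tT2) => r /andP[r0 rT]; apply: nb => //; exact: ltW.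
apply: limr_le; first exact: (cvgP _ lB).
near=> r; have r0 : 0 <= r by near: r; exact: nbhs_left_ge.
have rt : r < θ w by [].
exact: nb r0 (ltW rt) tT.
Unshelve. all: by end_near. Qed.

Let ibB : L1 P (fun w => before (Bp ^~ w) (θ w)).
Proof.
have T00 : 0 <= (0 : R) <= T by rewrite lexx ltW.
have i0 : L1 P (Bp 0) := iB (st_cst UG T00); have i1 := iB s.
have mb := sm_meas cGb (before_Gbf T0 UG s aB cB).
apply: (ae_le_L1 mb (L1D (L1norm i0) (L1norm i1))).
apply: filterS bB => w /andP[a b]; rewrite ler_norml.
have := ler_norm (Bp (θ w) w); have := ler_norm (- Bp 0 w); rewrite normrN.
have := normr_ge0 (Bp 0 w); have := normr_ge0 (Bp (θ w) w).
lra.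
Qed.

Let HVL : smeas (Gbf θ) VL.
Proof.
have [[a1 c1 _ _] _ _ _ _] := hp; have [[a2 c2 _ _] _ _ _ _] := hm.
apply: (smD cGb); last exact: (before_Gbf T0 UG s a2 c2).
by apply: (smB cGb); [exact: (before_Gbf T0 UG s aS cS)|exact: (before_Gbf T0 UG s a1 c1)].
Qed.

Let W w := S (θ w) w - past T g x θ w.
Let iW : L1 P W. Proof. apply: L1B; meas. Qed.

(** Given [G_{θ-}], the jump of the martingale part has mean zero and the left limits of the
    projections have the mean of the past cost. Only the jump of [Bp] separates the left limit of
    [V] from [W]. *)
Let EVL : L1 P VL /\ forall B, Gbf θ B -> EI P B VL =
 EI P B W - EI P B (fun w => Bp (θ w) w - before (Bp ^~ w) (θ w)).
Proof.
have [pN1 _ _ _ _] := hp; have [pN2 _ _ _ _] := hm; have [aM cM' iX iM EM] := cM.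
have [i1 E1] := before_proj T0 UG pth th0 rp pN1; have [i2 E2] := before_proj T0 UG pth th0 rm pN2.
have [i3 E3] := before_proj T0 UG pth th0 (raw_cst T iX) (cmart_proj cM).
have i4 := ibB.
have iVL' : L1 P (fun w => before (M ^~ w) (θ w) + before (Bp ^~ w) (θ w)
   - before (Np ^~ w) (θ w) + before (Nm ^~ w) (θ w)) by meas.
have eVL : \forall w \ae P, before (M ^~ w) (θ w) + before (Bp ^~ w) (θ w)
   - before (Np ^~ w) (θ w) + before (Nm ^~ w) (θ w) = VL w.
 by apply: filterS bS => w e; rewrite /VL e.
have iVL : L1 P VL.
 apply: (ae_le_L1 (sm_meas cGb HVL) (L1norm iVL')).
 by apply: filterS eVL => w ->.
split=> // B GB; have mB := csubm cGb GB.
have GB' := Gbf_sub T0 UG s GB.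
transitivity (EI P B (fun w => before (M ^~ w) (θ w) + before (Bp ^~ w) (θ w)
   - before (Np ^~ w) (θ w) + before (Nm ^~ w) (θ w))).
 by apply: EI_aeq => //; apply: filterS eVL => w -> _.
rewrite EID//; last meas.
rewrite EIB//; last meas.
rewrite EID// E1// E2// E3//.
have iBt := iB s; have iMt := iM _ s; have ip := ipast s.
have eW : EI P B W = EI P B X + EI P B (fun w => Bp (θ w) w) - EI P B (past T g x θ).
 rewrite EIB//; last exact: iS.
 congr (_ - _); rewrite -(EM _ _ s GB') -EID//; apply: eq_EI => w _; exact: SE.
have eP : EI P B (past T g x θ) = EI P B (fun w => before (K 1 ^~ w) (θ w)) -
  EI P B (fun w => before (K (-1) ^~ w) (θ w)).
 rewrite -EIB//; [apply: eq_EI => w _; rewrite past_gpart//; exact: s.1|exact: ib|exact: ib].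
have eX : EI P B (fun w => before (fun=> X w) (θ w)) = EI P B X.
 have e : \forall w \ae P, X w = before (fun=> X w) (θ w).
  by apply: filterS th0 => w t0; rewrite before_lim// lim_cst.
 apply/esym/EI_aeq => //; last by apply: filterS e => w h _; exact: h.
 apply: (ae_le_L1 _ (L1norm iX)); last by apply: filterS e => w <-.
 exact: (sm_meas (csub_all cGb) (sm_ae (csub_all cGb) (smT (L1_meas iX)) e)).
rewrite (EIB mB iBt i4) eX eW eP; exact: bracket_swap.
Qed.

(** The jump of [Bp] is non-negative, hence the inequality; it vanishes where [xi] has not reached
    1, hence the equality there. *)
Lemma V_previsible xi : optimal_times xi -> \forall w \ae P,
 [/\ V r w @[r --> (θ w)^'-] --> VL w, VL w <= ce P (Gbf θ) W w
  & before (xi ^~ w) (θ w) < 1 -> VL w = ce P (Gbf θ) W w].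
Proof.
move=> oxi; have [axi mxi _] := oxi; have [iVL E] := EVL.
have cxi w : cadlag T (xi ^~ w) by have [] := mxi.1 w.
have HE : Gbf θ [set w | before (xi ^~ w) (θ w) < 1].
 by apply: (csub_lt cGb); [exact: (before_Gbf T0 UG s axi cxi)|exact: (smcst cGb)].
have iD : L1 P (fun w => Bp (θ w) w - before (Bp ^~ w) (θ w)) by meas.
have h1 : \forall w \ae P, VL w <= ce P (Gbf θ) W w.
 apply: (sm_ae_le cGb) => //; [exact: ce_sm|exact: ce_L1|].
 move=> B GB; have mB := csubm cGb GB; rewrite EI_ce// E// gerBl.
 have z : EI P B (fun=> 0) = 0 by rewrite EIcst// mul0r.
 rewrite -[leLHS]z; apply: EI_ae_le => //; first meas.
 by apply: filterS bB => w /andP[_ h] _; rewrite subr_ge0.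
have h2 : \forall w \ae P, before (xi ^~ w) (θ w) < 1 -> Bp (θ w) w - before (Bp ^~ w) (θ w) = 0.
 apply: filterS2 (B_constant oxi) th0 => w bc t0 lt; have thT := s.1 w; have /andP[_ tT] := thT.
 rewrite (bc _ thT lt (θ w)); last lra.
 apply/eqP; rewrite subr_eq0 eq_sym before_lim//; apply/eqP/cvg_lim => //; apply: cvg_near_cst; near=> r.
 apply: (bc _ thT lt); apply/andP; split; first by near: r; exact: nbhs_left_ge.
 by [].
pose EV := [set w | before (xi ^~ w) (θ w) < 1]; have mE : measurable EV := csubm cGb HE.
have h3 : \forall w \ae P, \1_EV w * VL w = \1_EV w * ce P (Gbf θ) W w.
 apply: (sm_ae_eq cGb).
 - apply: (smM cGb) => //; exact: (sm_indic cGb).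
 - by apply: (smM cGb); [exact: (sm_indic cGb)|exact: ce_sm].
 - meas.
 - meas.
 move=> A HA; have mA := csubm cGb HA; have HAE := csubI cGb HA HE; have mAE := csubm cGb HAE.
 rewrite !EI_indic// EI_ce// E//; rewrite [X in _ - X](_ : _ = 0) ?subr0//.
 have z : EI P (A `&` EV) (fun=> 0) = 0 by rewrite EIcst// mul0r.
 rewrite -[RHS]z; apply: EI_aeq => //; first meas.
 by apply: filterS h2 => w h [_ Ew]; exact: h.
apply: filterS3 (filterI V_left th0) h1 h3 => w [vl t0] a b; have /andP[_ tT] := s.1 w; split=> //.
 by apply: vl; rewrite t0.
by move=> lt; move: b; rewrite indicE mem_set// !mul1r.
Unshelve. all: by end_near. Qed.

End previsible.
End value_process.

Lemma ae_and {R : realType} d (S : measurableType d) (Q : probability S R) (A B : S -> Prop) :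
 (\forall w \ae Q, A w) -> (\forall w \ae Q, B w) -> \forall w \ae Q, A w /\ B w.
Proof. by apply: filterS2. Qed.

(** * Freezing an independent randomisation device *)

Section freezing.
Context {R : realType} {d : measure_display} {Ω : measurableType d}
 (P : probability Ω R) (E : set (set Ω))
 (Em : <<s E >> `<=` measurable).
Notation OE := (g_sigma_algebraType E).

Lemma coarsen_mfun : (id : Ω -> OE) \in mfun.
Proof. rewrite inE => _ B EB; rewrite setTI; exact: Em. Qed.

(** [P] on the type whose measurable sets are generated by [E]. The integrand must be jointly
    measurable for this smaller sigma-algebra, the one of which the device is independent. *)
Definition coarsen : probability OE R := distribution P (mfun_Sub coarsen_mfun).

Lemma coarsen_meas (X : Ω -> R) : measurable_fun (setT : set OE) (X : OE -> R) ->
 mfunT X.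
Proof. move=> mX; exact: (mcomp mX (measurable_funP (mfun_Sub coarsen_mfun))). Qed.

Lemma coarsen_L1 (X : Ω -> R) : measurable_fun (setT : set OE) (X : OE -> R) -> L1 P X ->
 L1 coarsen (X : OE -> R).
Proof.
move=> mX iX; apply: (@integrable_pushforward _ _ _ _ _ _ (measurable_funP (mfun_Sub coarsen_mfun)) P setT (EFin \o X)) => //.
meas.
Qed.

Lemma coarsen_EI (X : Ω -> R) : measurable_fun (setT : set OE) (X : OE -> R) -> L1 P X ->
 EI coarsen (setT : set OE) X = EI P setT X.
Proof.
move=> mX iX; rewrite /EI; congr fine.
apply: (@integral_distribution _ _ _ _ _ P (mfun_Sub coarsen_mfun) (EFin \o X)); meas.
Qed.

Context (Z Xi : Ω -> R)
 (uZ : uniform01 P Z).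
Hypothesis indep : forall A B, <<s E >> A -> measurable B ->
 P (A `&` Z @^-1` B) = (P A * P (Z @^-1` B))%E.

(** By independence the pair formed by [Z w] and [w] has the product of the uniform law and
    [coarsen] as its law; Fubini does the rest. *)
Lemma freeze (Phi : R -> Ω -> R) :
 mfunT (fun p : mR R * OE => Phi p.1 p.2) ->
 (forall z w, `|Phi z w| <= Xi w) -> measurable_fun (setT : set OE) (Xi : OE -> R) -> L1 P Xi ->
 EI P setT (fun w => Phi (Z w) w) = EI P setT (fun w => EI unif setT (Phi ^~ w)).
Proof.
move=> mPhi PhiXi mXi iXi; have [mZ lawZ] := uZ.
have iXi' := coarsen_L1 mXi iXi.
have mZI : (fun w => (Z w, w) : mR R * OE) \in mfun.
 rewrite inE; apply: measurable_fun_pair => //.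
 exact: (measurable_funP (mfun_Sub coarsen_mfun)).
have mPZ : mfunT (fun w => Phi (Z w) w).
 exact: (mcomp mPhi (measurable_funP (mfun_Sub mZI))).
have iPZ : L1 P (fun w => Phi (Z w) w) by apply: le_L1 iXi.
have iPhi := fubini_integrable unif mPhi PhiXi iXi'.
have [iPhiw _ iin _ _] := @fubini_dom R _ _ _ _ unif coarsen Phi Xi mPhi PhiXi iXi'.
rewrite -(coarsen_EI (L1_meas iin)); last first.
 apply: le_L1 iXi; first exact: coarsen_meas (L1_meas iin).
 by move=> w; apply: EI_absT.
apply: EFin_inj; rewrite EIE// EIE//.
transitivity (\int[distribution P (mfun_Sub mZI)]_p (Phi p.1 p.2)%:E)%E.
 rewrite (@integral_distribution _ _ _ _ _ P (mfun_Sub mZI) (fun p => (Phi p.1 p.2)%:E))//.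
 meas.
transitivity (\int[unif \x coarsen]_p (Phi p.1 p.2)%:E)%E.
 apply: eq_measure_integral => A mA _; apply/esym.
 apply: (product_measure_unique (m1 := unif) (m2 := coarsen)) => // A1 A2 mA1 mA2.
 transitivity (P (A2 `&` Z @^-1` A1)).
  by congr (P _); apply/seteqP; split=> w  [].
 by rewrite indep// lawZ// muleC.
rewrite -(integral21_prod_meas1 iPhi); apply: eq_integral => w _.
rewrite EIE; meas.
Qed.

End freezing.

(** * Payoff against a randomised opponent *)

Section stopping_payoff.
Context {R : realType}
 (T : R)
 (T0 : 0 < T).

Definition pay (f g h : R -> R) (s t : R) : R :=
 f s * (s < t)%R%:R + h s * (s == t)%:R + g t * (t < s)%R%:R.

Lemma pay_le3 f g h s t (C : R) : (forall r, 0 <= r <= T -> `|f r| <= C) ->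
 (forall r, 0 <= r <= T -> `|g r| <= C) -> (forall r, 0 <= r <= T -> `|h r| <= C) ->
 0 <= s <= T -> 0 <= t <= T -> `|pay f g h s t| <= 3 * C.
Proof.
move=> fC gC hC sT tT; have C0 : 0 <= C := le_trans (normr_ge0 _) (fC s sT).
have b (u : R) (p : bool) : `|u| <= C -> `|u * p%:R| <= C.
 by move=> uC; case: p; rewrite ?mulr1 ?mulr0 ?normr0.
apply: (le_trans (ler_normD _ _)); apply: (le_trans (lerD (ler_normD _ _) (lexx _))).
have h1 := b _ (s < t)%R (fC s sT); have h2 := b _ (s == t) (hC s sT); have h3 := b _ (t < s)%R (gC t tT).
lra.
Qed.

(** The opponent's level decides who stops first: the quantile is below [s] with probability
    [before x s], and equal to [s] with the probability of the jump. *)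
Lemma pay_average f g h x s : cadlag T f -> cadlag T g -> cadlag T h -> cpath T x -> 0 <= s <= T ->
 EI unif setT (fun z => pay f g h s (qtl T x z)) = ypay T f g h x s.
Proof.
move=> cf cg ch hx sT.
have mq := meas_qtl1 T0 hx.
pose A := [set z : mR R | qtl T x z < s].
pose B := [set z : mR R | qtl T x z = s].
have mA : measurable A by apply: meas_lt.
have mB : measurable B by apply: meas_eq.
have i1 : L1 unif (fun z => \1_A z : R).
 by apply: (@L1bound _ _ _ unif _ 1) => [|z]; [exact: measurable_indic|rewrite normr_nat lern1 leq_b1].
have i2 : L1 unif (fun z => \1_B z : R).
 by apply: (@L1bound _ _ _ unif _ 1) => [|z]; [exact: measurable_indic|rewrite normr_nat lern1 leq_b1].
have ind (D : set (mR R)) c : measurable D -> unif D = c%:E -> EI unif setT (fun z => \1_D z : R) = c.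
 by move=> mD e; rewrite -[RHS]/(fine c%:E) -e /EI /Rintegral integral_indic// setIT.
have i3 := L1_lint T0 (before x s) cg hx.
have ae : \forall z \ae unif, pay f g h s (qtl T x z) =
  (f s * 1 + ((h s - f s) * \1_B z - f s * \1_A z)) +
  \1_[set z : mR R | z < before x s] z * g (qtl T x z).
 apply: ae_imp unif_ae _ => z /andP[z0 z1].
 have e : (z < before x s) = (qtl T x z < s).
  have /andP[] := sT; rewrite le_eqVlt => /predU1P[<-|s0] sT'; last by rewrite qtl_lt.
  have /andP[q0 _] := qtl_in T0 hx z; rewrite /before lexx !ltNge z0 q0//.
 have ib (D : set (mR R)) (b : bool) : (D z <-> b) -> \1_D z = b%:R :> R.
  by move=> Db; rewrite indicE; congr (nat_of_bool _)%:R; apply/idP/idP; rewrite inE Db.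
 rewrite (ib A (qtl T x z < s)%R)// (ib B (qtl T x z == s)); last exact: (rwP eqP).
 rewrite (ib [set v : mR R | v < before x s] (qtl T x z < s)%R) ?/pay /= ?e//.
 case: (ltgtP (qtl T x z : R) s) => _ /=; ring.
have iD : L1 unif (fun z => (h s - f s) * \1_B z - f s * \1_A z : R) by meas.
have iR : L1 unif (fun z => f s * 1 + ((h s - f s) * \1_B z - f s * \1_A z) : R) by meas.
rewrite (_ : EI unif setT _ = EI unif setT (fun z => (f s * 1 + ((h s - f s) * \1_B z - f s * \1_A z)) +
  \1_[set z : mR R | z < before x s] z * g (qtl T x z))).
 rewrite EID// EID//; last meas.
 rewrite EIB//; [|exact: L1Z|exact: L1Z].
 have eB : EI unif setT (fun z => (h s - f s) * \1_B z) = (h s - f s) * (x s - before x s).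
  rewrite EIZ//; congr (_ * _); exact: (ind B _ mB (jump_law T0 hx sT)).
 have eA : EI unif setT (fun z => f s * \1_A z) = f s * before x s.
  rewrite EIZ//; congr (_ * _); exact: (ind A _ mA (quantile_lt_law T0 hx sT)).
 rewrite eA eB (EI_cstT unif (f s * 1)).
 rewrite /ypay /lint; ring.
have mp : mfunT (fun z : mR R => pay f g h s (qtl T x z)).
 rewrite (_ : (fun z => _) = fun z => f s * \1_[set z : mR R | s < qtl T x z] z +
   h s * \1_B z + g (qtl T x z) * \1_A z); last first.
  apply/funext => z; rewrite /pay; congr (_ * (nat_of_bool _)%:R + _ * (nat_of_bool _)%:R + _ * (nat_of_bool _)%:R).
  + by apply/idP/idP; rewrite inE.
  + apply/idP/idP => [/eqP e|]; first by rewrite inE; exact: esym e.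
   by rewrite inE => ->; rewrite eqxx.
  + by apply/idP/idP; rewrite inE.
 apply: mfunD; first apply: mfunD.
 - apply: mfunM => //.
  meas.
 - meas.
 - by apply: mfunM; [exact: meas_comp_qtl|exact: measurable_indic].
apply: EI_aeq => //; [|exact: L1D|by apply: ae_imp ae _ => z h' _].
by apply: (ae_le_L1 mp (L1norm (L1D iR i3))); apply: ae_imp ae _ => z ->.
Qed.

End stopping_payoff.

Lemma split_le {R : realType} (a a1 a2 b b1 b2 : R) : b2 <= a2 -> a <= b -> a = a1 + a2 ->
 b = b1 + b2 -> a1 <= b1.
Proof. lra. Qed.

(** * Consequences of the saddle point *)

Section saddle.
Context {R : realType} {d : measure_display} {Ω : measurableType d}
 (P : probability Ω R) (T : R) (H : set (set Ω)) (G : R -> set (set Ω))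
 (T0 : 0 < T) (sH : sigma_algebra setT H) (Hm : H `<=` measurable)
 (UG : usual_filtration P T G) (GH : G T `<=` H).
Implicit Types (rho : R -> Ω -> R) (τ : Ω -> R).
Context (f g h x : R -> Ω -> R) (Xi : Ω -> R)
 (rf : raw P T f Xi) (rg : raw P T g Xi) (rh : raw P T h Xi) (mx : mcpath T x)
 (ghf : \forall w \ae P, forall t, 0 <= t <= T -> g t w <= h t w <= f t w).
Let Hmeas (X : Ω -> R) := smeas H X.
Context (Hf : forall t, 0 <= t <= T -> Hmeas (f t)) (Hg : forall t, 0 <= t <= T -> Hmeas (g t))
 (Hh : forall t, 0 <= t <= T -> Hmeas (h t)) (Hx : forall t, 0 <= t <= T -> Hmeas (x t))
 (HXi : Hmeas Xi).
Notation Y := (Ypay T f g h x).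

Section one_device.
Context (E : set (set Ω)) (Z : Ω -> R)
 (Em : <<s E >> `<=` measurable) (HE : H `<=` <<s E >>) (uZ : uniform01 P Z).
Hypothesis indep : forall A B, <<s E >> A -> measurable B ->
 P (A `&` Z @^-1` B) = (P A * P (Z @^-1` B))%E.
Notation OE := (g_sigma_algebraType E).
Notation Q := (coarsen P Em).

Let lift (X : Ω -> R) : Hmeas X -> measurable_fun (setT : set OE) (X : OE -> R).
Proof. move=> HX _ B mB; rewrite setTI; apply: HE; exact: sm_preimage. Qed.

Let iXi : L1 P Xi. Proof. by have [] := rf. Qed.
Let iXi' : L1 Q (Xi : OE -> R). Proof. exact: coarsen_L1 (lift HXi) iXi. Qed.

Let liftraw a : raw P T a Xi -> (forall t, 0 <= t <= T -> Hmeas (a t)) ->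
 raw Q T (a : R -> OE -> R) (Xi : OE -> R).
Proof. move=> [ca _ _ aX] Ha; split=> // t tT; apply: lift; exact: Ha. Qed.

Let mxE : @mcpath _ _ OE T x.
Proof. split; [exact: mx.1|move=> t tT; apply: lift; exact: Hx]. Qed.

Let fE := liftraw rf Hf. Let gE := liftraw rg Hg. Let hE := liftraw rh Hh.

Lemma freeze_quantile rho : @mcpath _ _ OE T rho ->
 EI P setT (fun w => Y (qtl T (rho ^~ w) (Z w)) w) = EI P setT (Yavg T f g h x rho).
Proof.
move=> mr; have i3 : L1 P (fun w => 3 * Xi w) by exact: L1Z.
have qT z w : 0 <= qtl T (rho ^~ w) z <= T by apply: qtl_in => //; exact: mr.1.
apply: (@freeze _ _ _ P E Em Z (fun w => 3 * Xi w) uZ indep (fun z w => Y (qtl T (rho ^~ w) z) w)) => //.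
- apply: (@Y_meas _ _ OE Q T T0 _ _ _ _ fE gE hE x _ _ _ snd mxE) => //.
 exact: snd_quantile.
- move=> z w; exact: (@Y_bound _ _ OE Q T T0 _ _ _ _ fE gE hE).
- meas.
Qed.

(** [τ] is measurable for the sigma-algebra generated by [E], so it may depend on the other
    device. *)
Lemma freeze_stop τ : measurable_fun (setT : set OE) (τ : OE -> R) ->
 (forall w, 0 <= τ w <= T) ->
 L1 P (payoff f g h τ (randomised_time T x Z)) /\
 EI P setT (payoff f g h τ (randomised_time T x Z)) = EI P setT (fun w => Y (τ w) w).
Proof.
move=> mt tT; have i3 : L1 P (fun w => 3 * Xi w) by exact: L1Z.
have qT z w : 0 <= qtl T (x ^~ w) z <= T by apply: qtl_in => //; exact: mx.1.
have [cf mf _ fX] := fE; have [cg mg _ gX] := gE; have [ch mh _ hX] := hE.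
pose Phi z w := pay (f ^~ w) (g ^~ w) (h ^~ w) (τ w) (qtl T (x ^~ w) z).
have pE w : payoff f g h τ (randomised_time T x Z) w = Phi (Z w) w.
 rewrite /payoff; congr (_ * (nat_of_bool _)%:R + _ * (nat_of_bool _)%:R + _ * (nat_of_bool _)%:R).
 - by apply/idP/idP; rewrite inE.
 - by apply/idP/idP; rewrite inE => /eqP.
 - by apply/idP/idP; rewrite inE.
have PhiX z w : `|Phi z w| <= 3 * Xi w.
 by apply: (pay_le3 (T := T)) => // r; [exact: fX|exact: gX|exact: hX].
have mPhi : mfunT (fun p : mR R * OE => Phi p.1 p.2).
 have mq := snd_quantile T0 mxE.
 have mt2 : mfunT (fun p : mR R * OE => τ p.2).
  exact: mcomp mt measurable_snd.
 have ev (a : R -> OE -> R) (s : mR R * OE -> R) : (forall t, 0 <= t <= T -> mfunT (a t)) ->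
   (forall w, cadlag T (a ^~ w)) -> mfunT s -> (forall p, 0 <= s p <= T) ->
   mfunT (fun p : mR R * OE => a (s p) p.2).
  move=> ma ca ms sT; apply: (@meas_at_qtl _ _ _ _ (fun t (p : mR R * OE) => a t p.2)) => //.
  move=> t tT'; exact: mcomp (ma t tT') measurable_snd.
 have mind (b : pred (mR R * OE)) : measurable [set p | b p] ->
   mfunT (fun p => (b p)%:R : R).
  move=> mb; rewrite (_ : (fun p => _) = \1_[set p | b p]); first meas.
  by apply/funext => p; rewrite indicE; congr (nat_of_bool _)%:R; apply/idP/idP; rewrite inE.
 apply: mfunD; first apply: mfunD; apply: mfunM.
 - meas.
 - apply: mind; meas.
 - meas.
 - apply: mind; rewrite (_ : [set p | _] = [set p | τ p.2 = qtl T (x ^~ p.2) p.1]).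
   meas.
  by apply/seteqP; split=> p  /eqP.
 - meas.
 - apply: mind; meas.
have mp : mfunT (fun w => Phi (Z w) w).
 have mZI : mfunT (fun w => (Z w, w) : mR R * OE).
  by apply: measurable_fun_pair; [exact: uZ.1|exact: (measurable_funP (mfun_Sub (coarsen_mfun Em)))].
 exact: (mcomp mPhi mZI).
have ePhi : payoff f g h τ (randomised_time T x Z) = fun w => Phi (Z w) w by exact/funext.
rewrite ePhi; split; first by apply: le_L1 i3.
rewrite (@freeze _ _ _ P E Em Z (fun w => 3 * Xi w) uZ indep Phi)//.
 apply: eq_EI => w _; apply: pay_average => //; exact: mx.1.
meas.
Qed.

End one_device.

Context (Z1 Z2 : Ω -> R)
 (dev : devices P H Z1 Z2).

(** A pi-system generating what is known from [H] and the first device. *)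
Let H1 := [set C | exists A B, [/\ H A, measurable B & C = A `&` Z1 @^-1` B]].

Let uZ1 : uniform01 P Z1. Proof. by case: dev. Qed.
Let uZ2 : uniform01 P Z2. Proof. by case: dev. Qed.

Let preT (Z : Ω -> R) B : uniform01 P Z -> measurable B -> measurable (Z @^-1` B).
Proof. move=> [mZ _] mB; rewrite -[X in measurable X]setTI; exact: mZ. Qed.

Let HT : H setT. Proof. have [h0 hD _] := sH; rewrite -[setT]setD0; exact: hD. Qed.

Let H1m : H1 `<=` measurable.
Proof. by move=> _ [A [B [HA mB ->]]]; apply: measurableI; [exact: Hm|exact: preT]. Qed.

Let sH1m : <<s H1 >> `<=` measurable.
Proof. apply: smallest_sub => //; exact: sigma_algebra_measurable. Qed.

Let HH1 : H `<=` <<s H1 >>.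
Proof.
move=> A HA; apply: sub_sigma_algebra; exists A, setT; split=> //.
by rewrite setIT.
Qed.

Let HHs : <<s H >> = H. Proof. exact: sigma_algebra_id. Qed.

Let HI : setI_closed H.
Proof.
have [h0 hD hU] := sH; move=> A B HA HB.
rewrite (_ : A `&` B = setT `\` ((setT `\` A) `|` (setT `\` B))).
 apply: (hD); rewrite -bigcup2E; apply: (hU) => -[|[|n]] /=; [exact: hD|exact: hD|exact: h0].
by apply/seteqP; split=> w; [move=> [a b]; split=> //= -[[_ /(_ a)]|[_ /(_ b)]]|
 move=> [_  nn]; split; apply: contrapT => na; apply: nn; [left|right]].
Qed.

Let indep1 A B : <<s H >> A -> measurable B -> P (A `&` Z1 @^-1` B) = (P A * P (Z1 @^-1` B))%E.
Proof.
rewrite HHs => HA mB; have [_ _ /(_ A B setT HA mB measurableT)] := dev.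
by rewrite setIT probability_setT mule1.
Qed.

(** Mutual independence is given on products of events; the pi-lambda theorem carries it over to the
    generated sigma-algebra. *)
Let indep2 A B : <<s H1 >> A -> measurable B -> P (A `&` Z2 @^-1` B) = (P A * P (Z2 @^-1` B))%E.
Proof.
move=> HA mB; have mA := sH1m HA; have mZB := preT uZ2 mB.
have i1 : L1 P (\1_(Z2 @^-1` B) : Ω -> R).
 by apply: (@L1bound _ _ _ P _ 1) => [|w]; [exact: measurable_indic|rewrite normr_nat lern1 leq_b1].
have e1 A' : measurable A' -> EI P A' (\1_(Z2 @^-1` B) : Ω -> R) = fine (P (A' `&` Z2 @^-1` B)).
 by move=> mA'; rewrite /EI /Rintegral integral_indic// setIC.
have e2 A' : measurable A' -> EI P A' (fun=> fine (P (Z2 @^-1` B))) = fine (P A' * P (Z2 @^-1` B)).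
 by move=> mA'; rewrite EIcst// fineM ?fin_num_measure// mulrC.
have fA A' : measurable A' -> P (A' `&` Z2 @^-1` B) = (P A' * P (Z2 @^-1` B))%E ->
  EI P A' (\1_(Z2 @^-1` B) : Ω -> R) = EI P A' (fun=> fine (P (Z2 @^-1` B))).
 by move=> mA' e; rewrite e1// e2// e.
have key : EI P A (\1_(Z2 @^-1` B) : Ω -> R) = EI P A (fun=> fine (P (Z2 @^-1` B))).
 apply: (pi_lambda (E := H1)) => //; [|exact: L1cst|by apply: fA => //; rewrite setTI probability_setT mul1e|].
  move=> _ _ [A1 [B1 [HA1 mB1 ->]]] [A2 [B2 [HA2 mB2 ->]]].
  exists (A1 `&` A2), (B1 `&` B2); split; [exact: HI|exact: measurableI|].
  by rewrite setIACA.
 move=> C H1C; have mC := H1m H1C; apply: fA => //; have [A1 [B1 [HA1 mB1 ->]]] := H1C.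
 have [_ _ ind] := dev; rewrite ind//; congr (_ * _)%E.
 by apply/esym; apply: indep1 => //; rewrite HHs.
move: key; rewrite e1// e2// => key.
rewrite -[LHS]fineK ?key ?fineK ?fin_numM ?fin_num_measure; meas.
Qed.

Let ctlH rho : control T G (cst 0) rho -> forall t, 0 <= t <= T -> Hmeas (rho t).
Proof.
move=> [ar _ _ _ _] t tT; have /andP[t0 tT'] := tT.
exact: (sm_sub (subset_trans (G_mono UG t0 tT' (lexx T)) GH) (ar t tT)).
Qed.

(** The second device is frozen given [H] and the first one, then the first given [H]. *)
Lemma saddle_value rho : control T G (cst 0) rho ->
 L1 P (payoff f g h (randomised_time T rho Z1) (randomised_time T x Z2)) /\
 EI P setT (payoff f g h (randomised_time T rho Z1) (randomised_time T x Z2)) =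
 EI P setT (Yavg T f g h x rho).
Proof.
move=> crho; have Hr := ctlH crho; have [_ mr _] := control_mcpath UG crho.
have mrE (E : set (set Ω)) : H `<=` <<s E >> -> @mcpath _ _ (g_sigma_algebraType E) T rho.
 move=> HE; split=> [|t tT]; first exact: mr.1.
 move=> _ B mB; rewrite setTI; apply: HE; exact: (sm_preimage (Hr t tT) mB).
have [|i ->] := freeze_stop sH1m HH1 uZ2 indep2 (τ := randomised_time T rho Z1) _
 (fun w => qtl_in T0 (mr.1 w) (Z1 w)).
 apply: (@meas_qtl R T T0 _ (g_sigma_algebraType H1)); [exact: (mrE _ HH1).2|exact: mr.1|].
 move=> _ B mB; rewrite setTI; apply: sub_sigma_algebra; exists setT, B; split=> //.
 by rewrite setTI.
have HH : H `<=` <<s H >> by [].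
have HHm : <<s H >> `<=` measurable by rewrite HHs.
split=> //; exact: (freeze_quantile HHm HH uZ1 indep1 (mrE _ HH)).
Qed.

(** The cost of [xi] is the mean over levels of the rewards [y z] of its quantiles. Optimality
    against pure stopping times bounds it by the mean of [S 0], while [y z] is at least the mean of
    [S] at the quantile, itself at least that of [S 0]. Hence equality for almost every level. *)
Lemma saddle_optimal_times S xi : is_value P T G f g h x Xi S -> control T G (cst 0) xi ->
 (forall rho, control T G (cst 0) rho ->
  EI P setT (payoff f g h (randomised_time T xi Z1) (randomised_time T x Z2)) <=
  EI P setT (payoff f g h (randomised_time T rho Z1) (randomised_time T x Z2))) ->
 optimal_times P T G S xi.
Proof.
move=> vS cxi opt; have [axi mxi b0] := control_mcpath UG cxi.
have [[_ _ _ [iS _ subS]] lb att] := vS.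
have T00 : 0 <= (0 : R) <= T by rewrite lexx ltW.
have s0 := st_cst UG T00.
have le0 : EI P setT (Yavg T f g h x xi) <= EI P setT (S 0).
 apply/ler_addgt0Pr => e e0; have [τ [st' le te]] := att (cst 0) e s0 e0.
 have ct := stop_controlP UG st' le; have := opt _ ct.
 rewrite (saddle_value cxi).2 (saddle_value ct).2 => h1; apply: (le_trans h1); apply: le_trans te.
 rewrite le_eqVlt; apply/orP; left; apply/eqP; apply: eq_EI => w _.
 exact: (Yavg_stopping T0 UG rf rg rh mx st').
have [_ _ _ av] := YavgP T0 rf rg rh mx mxi; have [iz ez] := av setT measurableT.
pose y z := EI P setT (fun w => Y (qtl T (xi ^~ w) z) w).
have bounds z : 0 <= z < 1 -> EI P setT (S 0) <= EI P setT (fun w => S (qtl T (xi ^~ w) z) w) <= y z.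
 move=> z01; have sq := quantile_st T0 UG axi mxi z01.
 have GT := csubT (Gat_csub T0 UG s0); have GTq := csubT (Gat_csub T0 UG sq).
 apply/andP; split; last by apply: lb => // w.
 by apply: (subS (cst 0) _ setT s0 sq) => // w; have /andP[] := sq.1 w.
have ae1 : \forall z \ae unif, y z <= EI P setT (S 0).
 apply: ae_le_EI => //; first meas.
 set A := [set z | _]; have mA : measurable A.
  apply: meas_lt; meas.
 have ic := L1cst unif (EI P setT (S 0)).
 have le1 : EI unif (~` A) (fun=> EI P setT (S 0)) <= EI unif (~` A) y.
  apply: EI_ae_le => //; first meas.
  by apply: ae_imp unif_ae _ => z /bounds/andP[a b] _; exact: le_trans a b.
 have le2 : EI unif setT y <= EI unif setT (fun=> EI P setT (S 0)) by rewrite EI_cstT -ez.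
 have e1 := EI_split measurableT mA iz; have e2 := EI_split measurableT mA ic.
 rewrite !setTI in e1 e2; exact: (split_le le1 le2 e1 e2).
(* If no level above [1 - mesh n] qualified, almost every level would lie below it, against the
   uniform law. *)
split=> // n; apply: contrapT => nz.
have m0 := @mesh_gt0 R n; have m1 : mesh n <= 1 :> R.
 by have := @mesh_le R 0 n isT; rewrite {2}/mesh invr1.
have aec : \forall z \ae @unif R, (z : R) <= 1 - mesh n.
 have ae2 := @unif_ae R; apply: (ae_imp (ae_and ae1 ae2)) => z [yz z01]; rewrite leNgt; apply/negP => lt; apply: nz; exists z; split=> //.
 have /andP[a b] := bounds z z01; apply/eqP; rewrite eq_le; lra.
have mC : measurable [set z : mR R | z <= 1 - mesh n] by meas.
have : EI unif setT (fun z => \1_[set z : mR R | z <= 1 - mesh n] z : R) = 1.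
 rewrite -[RHS](EI_cstT unif); apply: EI_aeq => //; [|exact: L1cst|].
  apply: (@L1bound _ _ _ unif _ 1) => [|z]; first meas.
  by rewrite normr_nat lern1 leq_b1.
 by apply: ae_imp aec _ => z zc _; rewrite indicE mem_set.
have c01 : 0 <= 1 - @mesh R n <= 1 by lra.
have := unif_le c01; rewrite /EI /Rintegral integral_indic// setIT => e e1.
have : fine (unif [set z : mR R | z <= 1 - mesh n]) = 1 - mesh n by exact: (congr1 fine e).
lra.
Qed.

End saddle.

(** * Integrable bounds for the payoffs *)

Section payoff_bounds.
Context {R : realType} {d : measure_display} {Ω : measurableType d}
 (P : probability Ω R) (T : R) (F : R -> set (set Ω))
 (T0 : 0 < T) (UF : usual_filtration P T F).

(** By right-continuity the supremum over [0, T] is one over the countable grid. It is therefore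
    measurable for [F T], which is required to freeze the devices. *)
Lemma payoff_bound X : bounded_payoff P T X -> adapted T F X ->
 exists Xi : Ω -> R, [/\ smeas (F T) Xi, L1 P Xi, forall w, 0 <= Xi w
  & forall t w, 0 <= t <= T -> `|X t w| <= Xi w].
Proof.
move=> [cX _ iX] aX; have cF := G_csub UF (T_in T0).
pose q n : R := if (unpickle n : option (nat * nat)) is Some i then nth T (gridl T i.1) i.2 else T.
have qT n : 0 <= q n <= T.
 rewrite /q; case: unpickle => [i|]; last exact: T_in.
 case: (ltnP i.2 (size (gridl T i.1))) => h; last by rewrite nth_default//; exact: T_in.
 apply: (gridl_in T0 (n := i.1)); exact: mem_nth.
pose E w : \bar R := ereal_sup [set `|X t w|%:E | t in `[0%R, T]].
pose D w : \bar R := ereal_sup (range (fun n => `|X (q n) w|%:E)).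
have D0 w : (0 <= D w)%E.
 by apply: le_trans (_ : `|X (q 0%N) w|%:E <= _)%E; [rewrite lee_fin|apply: ereal_sup_ubound; exists 0%N].
have Dfin w : D w \is a fin_num.
 rewrite ge0_fin_numE//; have [C hC] := cadlag_bounded T0 (cX w).
 apply: @le_lt_trans; last exact: ltry.
 by apply: ge_ereal_sup => _ [n _ <-]; rewrite lee_fin; exact: hC.
have XD t w : 0 <= t <= T -> (`|X t w|%:E <= D w)%E.
 move=> tT; rewrite -(fineK (Dfin w)) lee_fin.
 have c1 : X (minr T (up n t)) w @[n --> \oo] --> X t w.
  by apply: (@minup_cvg _ (X ^~ w)) => // lt; apply: (cX w).1; have /andP[-> _] := tT.
 apply: EI_cvg_le (cvg_norm c1) => n; rewrite -lee_fin (fineK (Dfin w)).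
 apply: ereal_sup_ubound; exists (pickle (n, index (minr T (up n t)) (gridl T n))) => //.
 by rewrite /q pickleK nth_index// gridl_up.
have DE : D = E.
 apply/funext => w; apply/le_anti/andP; split; apply: ge_ereal_sup.
  by move=> _ [n _ <-]; apply: ereal_sup_ubound; exists (q n) => //=; rewrite in_itv/=.
 by move=> y [t tT <-]; apply: XD; move: tT; rewrite /=.
have HD : smeas (F T) D.
 apply/(smE _ cF); rewrite (_ : D = fun w => esups (fun n => `|X (q n) w|%:E) 0%N).
  apply: measurable_fun_esups => n; apply/measurable_EFinP; apply: mcomp => //.
  have /andP[q0 qT'] := qT n.
  apply/(smE _ cF); apply: (sm_sub (G_mono UF q0 qT' (lexx T))); exact: aX.
 apply/funext => w; rewrite /esups /sdrop; congr ereal_sup.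
 by apply/seteqP; split=> y [n _ <-]; exists n.
have HXi : smeas (F T) (fun w => fine (D w)).
 apply/(smE _ cF); apply: (mcomp (f := fine)) => //; exact/(smE _ cF).
exists (fun w => fine (D w)); split=> //.
- apply/integrableP; split; first meas.
 move: iX; rewrite -/E -DE; congr (_ < _)%E; apply: eq_integral => w _ /=.
 by rewrite ger0_norm ?fine_ge0// fineK.
- move=> w; exact: fine_ge0.
- move=> t w tT; rewrite -lee_fin fineK//; exact: XD.
Qed.

End payoff_bounds.

Lemma move_past {R : realType} (a b c e : R) : a + (b - e) + c = a + b + c - e.
Proof. lra. Qed.

(** * The value of a minimising player *)

Section player.
Context {R : realType} {d : measure_display} {Ω : measurableType d}
 (P : probability Ω R) (T : R) (G : R -> set (set Ω))
 (T0 : 0 < T) (UG : usual_filtration P T G).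
Implicit Types (θ τ : Ω -> R) (H : set (set Ω)).
Notation st := (stopping_time T G).
Notation Gat := (sigma_at T G).
Notation Gbf := (sigma_before T G).
Context (f g h x S : R -> Ω -> R) (Xi : Ω -> R)
 (rf : raw P T f Xi) (rg : raw P T g Xi) (rh : raw P T h Xi) (mx : mcpath T x)
 (ghf : \forall w \ae P, forall t, 0 <= t <= T -> g t w <= h t w <= f t w)
 (vS : is_value P T G f g h x Xi S).

(** Its conditional expectation will be the survival probability times the equilibrium value, by
    [survival_value]. *)
Definition gain θ w := S (θ w) w - past T g x θ w.

Let dS : dsub P T G S (fun w => 3 * Xi w). Proof. by case: vS. Qed.

Lemma gain_L1 θ : st θ -> L1 P (gain θ).
Proof.
move=> s; have [_ _ _ [iS _ _]] := dS; apply: L1B; first meas.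
by apply: (past_L1 T0 rg mx); [exact: (st_meas T0 UG s)|exact: s.1].
Qed.

(** Everything is expressed with real conditional expectations of [gain]; [player1] and [player2]
    translate it into the objects of the statement. *)
Definition value_aggregate V xi := [/\ optional_semimartingale P T G V, class_D P T G V,
  forall θ, st θ -> \forall w \ae P, V (θ w) w = ce P (Gat θ) (gain θ) w,
  forall θ, st θ -> \forall w \ae P, θ w < T ->
   V s w @[s --> (θ w)^'+] --> V (θ w) w - ce P (Gat θ) (gjump g x θ) w
 & (forall θ, previsible_time P T G θ -> (\forall w \ae P, 0 < θ w) ->
   exists VL : Ω -> R, \forall w \ae P, [/\ V s w @[s --> (θ w)^'-] --> VL w,
    VL w <= ce P (Gbf θ) (gain θ) w
   & before (xi ^~ w) (θ w) < 1 -> VL w = ce P (Gbf θ) (gain θ) w]) /\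
  (continuous_filtration P T G -> \forall w \ae P, forall t, 0 <= t <= T ->
   before (xi ^~ w) t < 1 -> (0 < t -> V s w @[s --> t^'-] --> V t w) /\
    (t < T -> cvg (V s w @[s --> t^'+])))].

Theorem value_aggregate_exists xi : optimal_times P T G S xi -> exists V, value_aggregate V xi.
Proof.
move=> oxi; have [M [Bp [X [cM aB cB SE nB]]]] := doob_meyer T0 UG dS.
have p1 : `|1 : R| <= 1 by rewrite normr1.
have m1 : `|-1 : R| <= 1 by rewrite normrN1.
have [nK1 K01] := K_nondec T0 rg mx p1; have [nK2 K02] := K_nondec T0 rg mx m1.
have [Np [Op hp]] := left_projection T0 UG (Kint_raw T0 (gpart_raw rg p1) mx) nK1 K01.
have [Nm [Om hm]] := left_projection T0 UG (Kint_raw T0 (gpart_raw rg m1) mx) nK2 K02.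
exists (V S Op Om); split.
- exact: (V_semimartingale T0 UG rg mx dS hp hm cM aB SE nB).
- exact: (V_class_D T0 UG rg mx dS hp hm).
- move=> θ s; have [HV iV EV] := V_stopping T0 UG rg mx dS hp hm s.
 have cG := Gat_csub T0 UG s; have := ceE cG (gain_L1 s) (_ : is_ce P (Gat θ) (gain θ) _).
 move=> /(_ (fun w => V S Op Om (θ w) w)) e; apply: filterS (e _) => [w ->//|].
 by [].
- move=> θ s; exact: (V_right_jump T0 UG rg mx dS hp hm s).
split=> [θ pth th0|cont].
 eexists; exact: (V_previsible T0 UG rg mx dS hp hm cM aB cB SE nB pth th0 oxi).
have hl := V_left_continuous T0 UG rg mx dS hp hm cM SE nB oxi cont.
have hr := V_right dS hp hm; apply: filterS2 hl hr => w l r t tT lt; have /andP[t0 tT'] := tT; split=> [tpos|tlt].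
 by apply: l => //; rewrite tpos.
by apply: (cvgP _ (r t _)); rewrite t0.
Qed.

Definition alive θ w := 1 - before (x ^~ w) (θ w).

Lemma alive01 θ w : st θ -> 0 <= alive θ w <= 1.
Proof. move=> s; have /andP[a b] := cpath_before (mx.1 w) (s.1 w); rewrite /alive; lra. Qed.

Lemma alive_meas θ : st θ -> mfunT (alive θ).
Proof.
move=> s; apply: mfunB => //.
apply: (meas_before T0); [exact: mx.2|by move=> w; have [] := mx.1 w|exact: (st_meas T0 UG s)|exact: s.1].
Qed.

Section conditioning.
Context (θ : Ω -> R) (H : set (set Ω))
 (s : st θ) (cH : csub P H) (HG : H `<=` Gat θ).
Let p := alive θ.
Let p01 w : 0 <= p w <= 1. Proof. exact: alive01. Qed.
Let mp : mfunT p. Proof. exact: alive_meas. Qed.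
Let ip : L1 P p.
Proof. by apply: (@L1bound _ _ _ P _ 1) => // w; have /andP[? ?] := p01 w; rewrite ger0_norm. Qed.
Let p0 w : 0 <= p w. Proof. by have /andP[] := p01 w. Qed.
Let sv := pos (ce P H p).
Let sp : is_ce P H p sv. Proof. exact: pos_ce. Qed.
Let s0 w : 0 <= sv w. Proof. by rewrite le_max lexx. Qed.
Let Hs : smeas H sv. Proof. by case: sp. Qed.

Let survivalE : \forall w \ae P, survival P H x θ w = (sv w)%:E.
Proof.
by apply: filterS2 (cexp_L1 cH ip) (ce_ge0 cH ip p0) => w e e'; rewrite /sv /pos max_r.
Qed.

Let PiE : \forall w \ae P, Pi P H x θ w = weight sv p w.
Proof. by apply: filterS survivalE => w e; rewrite /Pi e. Qed.

Let weight_cexp C : L1 P C ->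
 cexp P H (fun w => Pi P H x θ w * C w) = cexp P H (fun w => weight sv p w * C w).
Proof.
move=> iC; have cm := csub_all cH.
have mw : mfunT (fun w => weight sv p w * C w).
 apply: mfunM; last meas.
 apply: measurable_fun_ifT => //.
  apply: measurable_fun_eqr; meas.
 apply: mfunM => //; apply: meas_inv => //; exact: (sm_meas cH Hs).
have e : \forall w \ae P, weight sv p w * C w = Pi P H x θ w * C w.
 by apply: filterS PiE => w ->.
apply: (cexp_aeq cH _ mw); last by apply: filterS e => w ->.
exact: (sm_meas cm (sm_ae cm (smT mw) e)).
Qed.

(** Where the survival probability is positive it cancels the denominator of [Pi]. Where it is zero
    the right-hand side vanishes, by [family_null] for a family with a single member. *)
Lemma survival_cexp C : L1 P C -> \forall w \ae P,
 (survival P H x θ w * cexp P H (fun w => (Pi P H x θ w * C w)%R) w =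
  (ce P H (fun w => p w * C w)%R w)%:E)%E.
Proof.
move=> iC; rewrite (weight_cexp iC); have ipC := L1_mul mp p01 iC.
have h0 : \forall w \ae P, sv w = 0 -> ce P H (fun w => p w * C w) w = 0.
 apply: (family_null cH ipC sp mp p01 (fam := [set C])) => [D ->|e e0]; first by [].
 by exists C => //; rewrite lerDl ltW.
apply: filterS3 survivalE h0 (cexp_scaled cH Hs s0 mp p01 iC) => w -> z e.
have [sw|sw] := eqVneq (sv w) 0; first by rewrite sw mul0e z.
by rewrite e// -EFinM mulrCA divff// mulr1.
Qed.

Let costs := [set game_cost T f g h rho (truncated x θ) θ | rho in control T G θ].

Let costP C : costs C -> L1 P C /\ forall B, H B -> EI P B (gain θ) <= EI P B (fun w => p w * C w).
Proof.
move=> [rho crho <-]; have [ar mr r0] := control_mcpath UG crho.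
have mth := st_meas T0 UG s; have thT := s.1.
split; first exact: (cost_L1 T0 rf rg rh mx mr mth thT r0).
move=> B HB; have GB := HG HB; have mB := csubm cH HB.
have [_ iY _ _] := YavgP T0 rf rg rh mx mr; have ipast := past_L1 T0 rg mx mth thT.
have [_ _ _ [iS _ _]] := dS.
rewrite [leRHS](eq_EI P (Y := fun w => Yavg T f g h x rho w - past T g x θ w)).
 rewrite (EIB mB (iS _ s) ipast) (EIB mB iY ipast) lerD2r.
 exact: (value_le_avg T0 UG rf rg rh mx vS s crho GB).
move=> w _; exact: (cost_scaled T0 rf rg rh mx mr thT r0).
Qed.

Let cost_inf (e : R) : 0 < e -> exists2 C, costs C &
 EI P setT (fun w => p w * C w) <= EI P setT (gain θ) + e.
Proof.
move=> e0; have [_ _ att] := vS; have [τ [s2 le te]] := att θ e s e0.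
have crho := stop_controlP UG s2 le; have [ar mr r0] := control_mcpath UG crho.
have mth := st_meas T0 UG s; have thT := s.1.
exists (game_cost T f g h (stop_control τ) (truncated x θ) θ); first by exists (stop_control τ).
have [_ iY _ _] := YavgP T0 rf rg rh mx mr; have ipast := past_L1 T0 rg mx mth thT.
have [_ _ _ [iS _ _]] := dS.
rewrite [leLHS](eq_EI P (Y := fun w => Yavg T f g h x (stop_control τ) w - past T g x θ w)).
 rewrite (EIB measurableT (iS _ s) ipast) (EIB measurableT iY ipast) addrAC lerD2r.
 apply: le_trans te; rewrite le_eqVlt; apply/orP; left; apply/eqP; apply: eq_EI => w _.
 exact: (Yavg_stopping T0 UG rf rg rh mx s2).
move=> w _; exact: (cost_scaled T0 rf rg rh mx mr thT r0).
Qed.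

(** Averaging over quantiles makes [gain θ] a lower bound of the scaled costs, and controls of pure
    stopping times come arbitrarily close. Allowing any [H] inside [G_θ] covers [G_{θ-}] as well. *)
Lemma survival_value : \forall w \ae P,
 (survival P H x θ w * value1 P T f g h G x θ H w = (ce P H (gain θ) w)%:E)%E.
Proof.
have -> : value1 P T f g h G x θ H =
  essinf P [set cexp P H (fun w => weight sv p w * C w) | C in costs].
 congr essinf; apply/seteqP; split=> U.
  move=> [rho crho <-]; have c : costs (game_cost T f g h rho (truncated x θ) θ) by exists rho.
  exists (game_cost T f g h rho (truncated x θ) θ) => //; rewrite -weight_cexp//; exact: (costP c).1.
 move=> [C cC <-]; have iC := (costP cC).1; have [rho crho E] := cC; exists rho => //.
 by rewrite -(weight_cexp iC) -E.
have := scaled_essinf cH s0 (gain_L1 s) sp mp p01 costP cost_inf.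
by apply: filterS2 survivalE => w ->.
Qed.

Lemma survival_valueN (f' g' h' : R -> Ω -> R) :
 (forall rho, control T G θ rho -> game_cost T f' g' h' (truncated x θ) rho θ =
   (fun w => - game_cost T f g h rho (truncated x θ) θ w)) -> \forall w \ae P,
 (survival P H x θ w * value2 P T f' g' h' G x θ H w = (- ce P H (gain θ) w)%:E)%E.
Proof.
move=> gN.
have -> : value2 P T f' g' h' G x θ H =
  esssup P [set cexp P H (fun w => weight sv p w * - C w) | C in costs].
 congr esssup; apply/seteqP; split=> U.
  move=> [rho crho <-]; have c : costs (game_cost T f g h rho (truncated x θ) θ) by exists rho.
  exists (game_cost T f g h rho (truncated x θ) θ) => //.
  rewrite /J gN// -weight_cexp//; apply: L1N; exact: (costP c).1.
 move=> [C cC <-]; have iC := (costP cC).1; have [rho crho E] := cC; exists rho => //.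
 by rewrite /J gN// -(weight_cexp (L1N iC)) -E.
have := scaled_esssup cH s0 (gain_L1 s) sp mp p01 costP cost_inf.
by apply: filterS2 survivalE => w ->.
Qed.

End conditioning.

Section stopping.
Context (θ : Ω -> R)
 (s : st θ).

Let stops := [set stop1 T f g h x θ τ | τ in stopping_times_from T G θ].

Let stop1E τ : st τ -> (forall w, θ w <= τ w) ->
 stop1 T f g h x θ τ = fun w => Ypay T f g h x (τ w) w - past T g x θ w.
Proof.
move=> s2 le; apply/funext => w; have [cg _ _ _] := rg.
have /andP[a b] := s.1 w; have /andP[a' b'] := s2.1 w.
rewrite /stop1 (lint_itv T0 (cg w) (mx.1 w))//; exact: move_past.
Qed.

Let Yi τ : st τ -> L1 P (fun w => Ypay T f g h x (τ w) w).
Proof. by move=> s2; apply: (Y_L1 T0 rf rg rh) => //; [exact: (st_meas T0 UG s2)|exact: s2.1]. Qed.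

Let ipast : L1 P (past T g x θ).
Proof. by apply: (past_L1 T0 rg mx); [exact: (st_meas T0 UG s)|exact: s.1]. Qed.

Let iSt : L1 P (fun w => S (θ w) w). Proof. have [_ _ _ [iS _ _]] := dS; exact: iS. Qed.

Let stopsP C : stops C -> L1 P C /\
 forall B, Gat θ B -> EI P B (gain θ) <= EI P B (fun w => cst 1 w * C w).
Proof.
move=> [τ [s2 le] <-]; rewrite stop1E//; split; first meas.
move=> B GB; have mB := csubm (Gat_csub T0 UG s) GB.
rewrite [leRHS](eq_EI P (Y := fun w => Ypay T f g h x (τ w) w - past T g x θ w)); last by move=> w _; rewrite mul1r.
rewrite (EIB mB iSt ipast) (EIB mB (Yi s2) ipast) lerD2r.
by have [_ lb _] := vS; exact: lb.
Qed.

Let stops_inf (e : R) : 0 < e -> exists2 C, stops C &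
 EI P setT (fun w => cst 1 w * C w) <= EI P setT (gain θ) + e.
Proof.
move=> e0; have [_ _ att] := vS; have [τ [s2 le te]] := att θ e s e0.
exists (stop1 T f g h x θ τ); first by exists τ.
rewrite stop1E// [leLHS](eq_EI P (Y := fun w => Ypay T f g h x (τ w) w - past T g x θ w)); last by move=> w _; rewrite mul1r.
by rewrite (EIB measurableT iSt ipast) (EIB measurableT (Yi s2) ipast) addrAC lerD2r.
Qed.

Let one_ce : is_ce P (Gat θ) (cst 1) (cst 1).
Proof. by split=> //; [exact: (smcst (Gat_csub T0 UG s))|exact: L1cst]. Qed.

Let weight1 (C : Ω -> R) : (fun w => weight (cst 1) (cst 1) w * C w) = C.
Proof. by apply/funext => w; rewrite /weight oner_eq0 divr1 mul1r. Qed.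

Let le01 (w : Ω) : 0 <= (cst 1 w : R) <= 1. Proof. by rewrite ler01 lexx. Qed.

(** The same argument for pure stopping times, with trivial weights: [p] and [s] are constantly
    1. *)
Lemma stopping_essinf : \forall w \ae P,
 essinf P [set cexp P (Gat θ) (stop1 T f g h x θ τ) | τ in stopping_times_from T G θ] w =
 (ce P (Gat θ) (gain θ) w)%:E.
Proof.
have := scaled_essinf (Gat_csub T0 UG s) (fun=> ler01) (gain_L1 s) one_ce (@measurable_cst _ _ _ _ _ (1 : R)) le01 stopsP stops_inf.
apply: filterS => w <-; rewrite mul1e; congr (essinf _ _ w); apply/seteqP; split=> U.
 by move=> [τ ft <-]; exists (stop1 T f g h x θ τ); [exists τ|rewrite weight1].
by move=> [_ [τ ft <-] <-]; exists τ; rewrite ?weight1.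
Qed.

Lemma stopping_esssup (f' g' h' : R -> Ω -> R) :
 (forall τ, stopping_times_from T G θ τ ->
   stop2 T f' g' h' x θ τ = fun w => - stop1 T f g h x θ τ w) -> \forall w \ae P,
 esssup P [set cexp P (Gat θ) (stop2 T f' g' h' x θ τ) | τ in stopping_times_from T G θ] w =
 (- ce P (Gat θ) (gain θ) w)%:E.
Proof.
move=> sN.
have := scaled_esssup (Gat_csub T0 UG s) (fun=> ler01) (gain_L1 s) one_ce (@measurable_cst _ _ _ _ _ (1 : R)) le01 stopsP stops_inf.
have weight1N (C : Ω -> R) := weight1 (fun w => - C w).
apply: filterS => w <-; rewrite mul1e; congr (esssup _ _ w); apply/seteqP; split=> U.
 by move=> [τ ft <-]; exists (stop1 T f g h x θ τ); [exists τ|rewrite weight1N sN].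
by move=> [_ [τ ft <-] <-]; exists τ; rewrite ?weight1N ?sN.
Qed.

End stopping.
End player.

(** * Change of sign *)

Section negation.
Context {R : realType}.

(** Infinite values are covered because [fine] sends both infinities to 0. *)
Lemma fine_subC (a b : \bar R) : (0 <= a)%E -> (0 <= b)%E -> fine (b - a) = - fine (a - b).
Proof.
by case: a b => [a| |] [b| |] _ _; rewrite ?oppr0 ?opprB.
Qed.

Lemma EFin_oppr {U : Type} (a : U -> R) : EFin \o (fun t => - a t) = (fun t => - (EFin \o a) t)%E.
Proof. by []. Qed.

Lemma Rintegral_oppr d (S : measurableType d) (mu : {measure set S -> \bar R}) (D : set S) (a : S -> R) :
 (\int[mu]_(t in D) (- a t))%R = - (\int[mu]_(t in D) a t)%R.
Proof.
rewrite /Rintegral (_ : (fun t => (- a t)%:E) = (fun t => - (EFin \o a) t)%E)//.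
rewrite integralE [in RHS]integralE funeposN funenegN.
by apply: fine_subC; apply: integral_ge0 => x _; rewrite ?funepos_ge0.
Qed.

Lemma sum_over_oppr (D : set R) (a : R -> R) : sum_over D (fun t => - a t) = - sum_over D a.
Proof.
rewrite /sum_over EFin_oppr funeposN funenegN.
by apply: fine_subC; apply: esum_ge0 => x _; rewrite ?funepos_ge0.
Qed.

Context {d : measure_display} {Ω : measurableType d}.
Implicit Types (f g h x y M V : R -> Ω -> R) (θ τ : Ω -> R) (X : Ω -> R)
 (G : R -> set (set Ω)) (H : set (set Ω)).

Definition oppp f t w : R := - f t w.

(** Exchanging the players swaps [f] and [g], and the change of sign turns the maximiser into a
    minimiser. *)
Lemma payoff_oppp f g h τ θ :
 payoff f g h τ θ = (fun w => - payoff (oppp g) (oppp f) (oppp h) θ τ w).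
Proof.
apply/funext => w; rewrite /payoff !mulNr !opprD !opprK.
have -> : h (θ w) w * \1_[set v | θ v = τ v] w = h (τ w) w * \1_[set v | τ v = θ v] w.
 rewrite (_ : [set v | θ v = τ v] = [set v | τ v = θ v]); last by apply/seteqP; split=> v /= ->.
 rewrite indicE; case: (asboolP (τ w = θ w)) => [-> //|n].
 by rewrite memNset// !mulr0.
ring.
Qed.

Variables (P : probability Ω R) (T : R).

Lemma game_cost_oppp f g h x y θ :
 game_cost T f g h x y θ = (fun w => - game_cost T (oppp g) (oppp f) (oppp h) y x θ w).
Proof.
apply/funext => w; rewrite /game_cost /oppp.
under [X in - (X + _ + _)]eq_Rintegral do rewrite mulNr.
under [X in - (_ + X + _)]eq_Rintegral do rewrite mulNr.
rewrite (_ : (fun t => - h t w * _ * _) = fun t => - (h t w * jump (y ^~ w) t * jump (x ^~ w) t)).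
 by rewrite sum_over_oppr 2!Rintegral_oppr -!opprD opprK [X in _ = X + _]addrC.
by apply/funext => t; rewrite !mulNr mulrAC.
Qed.

Lemma stop_oppp f g h x θ τ :
 stop2 T f g h x θ τ = (fun w => - stop1 T (oppp g) (oppp f) (oppp h) x θ τ w).
Proof.
by apply/funext => w; rewrite /stop1 Rintegral_oppr !mulNr !opprD !opprK.
Qed.

Lemma raw_oppp f Xi : raw P T f Xi -> raw P T (oppp f) Xi.
Proof.
move=> [cf mf iXi fX]; split=> //.
- move=> w; have [r l] := cf w; split=> t tT; [apply: cvgN; exact: r|apply: is_cvgN; exact: l].
- move=> t tT; apply: mcomp => //; exact: mf.
- move=> t w tT; rewrite normrN; exact: fX.
Qed.

Lemma cexp_opp H X w : cexp P H X w \is a fin_num -> cexp P H (fun v => - X v) w = (- cexp P H X w)%E.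
Proof.
rewrite /cexp fin_numB => /andP[fa fb]; rewrite EFin_oppr funeposN funenegN.
by rewrite oppeB ?fin_num_adde_defr// addeC.
Qed.

Lemma martingale_oppp G M : usual_filtration P T G -> martingale P T G M -> martingale P T G (oppp M).
Proof.
move=> UG [aM iM eM]; split.
- move=> t tT; apply: (sm_opp (G_csub UG tT)); exact: aM.
- move=> t tT; apply: L1N; exact: iM.
- move=> s t s0 st' tT; apply: filterS (eM s t s0 st' tT) => w e.
 by rewrite cexp_opp e.
Qed.

Lemma optional_semimartingale_oppp G V : usual_filtration P T G ->
 optional_semimartingale P T G V -> optional_semimartingale P T G (oppp V).
Proof.
move=> UG [oV [M [A [[aM cM [th [sth nth Tth mth]]] aA bA E]]]]; split.
 move=> _ [B mB <-]; apply: oV; exists (-%R @^-1` B) => //.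
 rewrite -[X in measurable X]setTI; exact: @oppr_measurable.
exists (oppp M), (oppp A); split.
- split; last exists th.
 + move=> t tT; apply: (sm_opp (G_csub UG tT)); exact: aM.
 + move=> w; have [r l] := cM w; split=> t tT; [apply: cvgN; exact: r|apply: is_cvgN; exact: l].
 + split=> // n; exact: (martingale_oppp UG (mth n)).
- move=> t tT; apply: (sm_opp (G_csub UG tT)); exact: aA.
- apply: filterS bA => w; exact: bounded_variationN.
- by apply: filterS E => w h t tT; rewrite /oppp h// opprD.
Qed.

Lemma class_D_oppp G V : class_D P T G V -> class_D P T G (oppp V).
Proof.
move=> [mV uV]; split.
 by move=> _ [θ s <-]; apply: mcomp => //; apply: mV; exists θ.
move=> e e0; have [K hK] := uV e e0; exists K => _ [θ s <-].
have := hK _ (ex_intro2 _ _ θ s erefl); rewrite /oppp.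
rewrite (_ : [set w | K < `|- V (θ w) w|] = [set w | K < `|V (θ w) w|]); last first.
 by apply/seteqP; split=> w /=; rewrite normrN.
by rewrite (_ : (fun w => `|- V (θ w) w|%:E) = fun w => `|V (θ w) w|%:E)//; apply/funext => w; rewrite normrN.
Qed.

End negation.

(** * Conclusions for each player *)

Section conclusions.
Context {R : realType} {d : measure_display} {Ω : measurableType d}
 (P : probability Ω R) (T : R) (G : R -> set (set Ω))
 (T0 : 0 < T) (UG : usual_filtration P T G).
Notation st := (stopping_time T G).
Notation Gat := (sigma_at T G).
Notation Gbf := (sigma_before T G).

(** The factor [alive x θ] undoes the normalisation of the truncated jump, by [trunc_jump]. *)
Lemma survival_jump (g x : R -> Ω -> R) Xi θ : raw P T g Xi -> mcpath T x -> st θ ->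
 \forall w \ae P, (survival P (Gat θ) x θ w * cexp P (Gat θ)
   (fun w' => (Pi P (Gat θ) x θ w' * g (θ w') w'
    * jump (truncated x θ ^~ w') (θ w'))%R) w =
  (ce P (Gat θ) (gjump g x θ) w)%:E)%E.
Proof.
move=> rg mx s; have mt := truncated_mcpath T0 mx (st_meas T0 UG s) s.1.
have := survival_cexp T0 UG mx s (Gat_csub T0 UG s) (gjump_L1 T0 UG rg mt s).
rewrite (_ : (fun w => alive x θ w * gjump g (truncated x θ) θ w) = gjump g x θ); last first.
 apply/funext => w; have /andP[t0 tT] := s.1 w.
 rewrite mulrCA; congr (_ * _); exact: (trunc_jump T0 (mx.1 w) (s.1 w) (lexx _) tT).
by apply: filterS => w <-; congr (_ * cexp _ _ _ w)%E; apply/funext => v; rewrite mulrA.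
Qed.

(* The assertions of the theorem about one player, whose own strategy is [xi]:
  [x] is the strategy of the opponent and [a] the payoff collected when the
  opponent stops first. *)
Definition player_concl (x xi a V : R -> Ω -> R)
  (value : (Ω -> R) -> set (set Ω) -> Ω -> \bar R)
  (stop : (Ω -> R) -> (Ω -> R) -> Ω -> R)
  (ess : set (Ω -> \bar R) -> Ω -> \bar R) (le : rel (\bar R)) :=
 [/\ aggregates P T G V (fun θ w => survival P (Gat θ) x θ w
     * value θ (Gat θ) w)%E,
   optional_semimartingale P T G V /\ class_D P T G V,
   forall θ, st θ -> \forall w \ae P, (V (θ w) w)%:E = ess
    [set cexp P (Gat θ) (stop θ τ) | τ in stopping_times_from T G θ] w,
   forall θ, st θ -> \forall w \ae P, θ w < T ->
    [/\ cvg (V s w @[s --> (θ w)^'+]),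
      ((lim (V s w @[s --> (θ w)^'+]))%:E = (V (θ w) w)%:E
       - survival P (Gat θ) x θ w * cexp P (Gat θ)
          (fun w' => (Pi P (Gat θ) x θ w' * a (θ w') w'
           * jump (truncated x θ ^~ w') (θ w'))%R) w)%E
     & ((lim (V s w @[s --> (θ w)^'+]))%:E = (V (θ w) w)%:E
       - cexp P (Gat θ) (fun w' => (a (θ w') w' * jump (x ^~ w') (θ w'))%R) w)%E]
  & (forall θ, previsible_time P T G θ -> (\forall w \ae P, 0 < θ w) ->
    \forall w \ae P,
    let bound := (survival P (Gbf θ) x θ w
     * value θ (Gbf θ) w)%E in
    [/\ cvg (V s w @[s --> (θ w)^'-]), le (lim (V s w @[s --> (θ w)^'-]))%:E bound
     & before (xi ^~ w) (θ w) < 1 -> (lim (V s w @[s --> (θ w)^'-]))%:E = bound])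
   /\ (continuous_filtration P T G ->
    \forall w \ae P, forall t, 0 <= t <= T -> before (xi ^~ w) t < 1 ->
     (0 < t -> V s w @[s --> t^'-] --> V t w) /\ (t < T -> cvg (V s w @[s --> t^'+])))].

Variables (f g h x xi S V : R -> Ω -> R) (Xi : Ω -> R).

Theorem player1 : raw P T f Xi -> raw P T g Xi -> raw P T h Xi -> mcpath T x ->
 is_value P T G f g h x Xi S -> value_aggregate P T G g x S V xi ->
 player_concl x xi g V (value1 P T f g h G x) (stop1 T f g h x) (essinf P) (fun u v => u <= v)%E.
Proof.
move=> rf rg rh mx vS [oV cV gV rV [lV kV]]; split=> //; last split=> //.
- split=> [|θ s]; first by case: oV.
 have hv := survival_value T0 UG rf rg rh mx vS s (Gat_csub T0 UG s) (@subset_refl _ _).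
 by apply: filterS2 hv (gV θ s) => w -> ->.
- move=> θ s; apply: filterS2 (stopping_essinf T0 UG rf rg rh mx vS s) (gV θ s).
 by move=> w -> ->.
- move=> θ s; have ij := gjump_L1 T0 UG rg mx s.
 apply: filterS3 (rV θ s) (survival_jump rg mx s) (cexp_L1 (Gat_csub T0 UG s) ij).
 move=> w hl e1 e2 lt; have {}hl := hl lt.
 by split; [exact: (cvgP _ hl)|rewrite e1 (cvg_lim _ hl)|rewrite e2 (cvg_lim _ hl)].
- move=> θ pth th0; have [s _] := pth; have [VL hVL] := lV θ pth th0.
 have hv := survival_value T0 UG rf rg rh mx vS s (Gbf_csub T0 UG s) (Gbf_sub T0 UG s).
 apply: filterS2 hVL hv => w [l le eq] e; rewrite e (cvg_lim _ l)//.
 by split; [exact: l|rewrite lee_fin|move=> /eq ->].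
Qed.

(** [S] and [V] belong to the game with payoffs [-g], [-f], [-h], in which the second player
    minimises; the process of the statement is minus [V]. *)
Theorem player2 : raw P T f Xi -> raw P T g Xi -> raw P T h Xi -> mcpath T x ->
 is_value P T G (oppp g) (oppp f) (oppp h) x Xi S -> value_aggregate P T G (oppp f) x S V xi ->
 player_concl x xi f (oppp V) (value2 P T f g h G x) (stop2 T f g h x) (esssup P) (fun u v => u >= v)%E.
Proof.
move=> rf rg rh mx vS [oV cV gV rV [lV kV]].
have rf' := raw_oppp rf; have rg' := raw_oppp rg; have rh' := raw_oppp rh.
have oV' := optional_semimartingale_oppp UG oV.
have cost θ rho : control T G θ rho -> game_cost T f g h (truncated x θ) rho θ =
  (fun w => - game_cost T (oppp g) (oppp f) (oppp h) rho (truncated x θ) θ w).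
 move=> _; exact: game_cost_oppp.
split; [|split=> //; exact: class_D_oppp| | |split].
- split=> [|θ s]; first by case: oV'.
 have hv := survival_valueN T0 UG rg' rf' rh' mx vS s (Gat_csub T0 UG s) (@subset_refl _ _) (cost θ).
 by apply: filterS2 hv (gV θ s) => w -> e; rewrite /oppp e.
- move=> θ s.
 have hv := stopping_esssup T0 UG rg' rf' rh' mx vS s (fun τ _ => stop_oppp T f g h x θ τ).
 by apply: filterS2 hv (gV θ s) => w -> e; rewrite /oppp e.
- move=> θ s; have ij := gjump_L1 T0 UG rf mx s; have cG := Gat_csub T0 UG s.
 have jN : gjump (oppp f) x θ = fun w => - gjump f x θ w.
  by apply/funext => w; rewrite /gjump mulNr.
 have h1 := rV θ s; rewrite jN in h1.
 apply: filterS3 (filterI h1 (ceN cG ij)) (survival_jump rf mx s) (cexp_L1 cG ij).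
 move=> w [hl eN] e1 e2 lt; have {}hl := hl lt; rewrite eN opprK in hl.
 have l : oppp V s w @[s --> (θ w)^'+] --> oppp V (θ w) w - ce P (Gat θ) (gjump f x θ) w.
  rewrite -opprD; exact: cvgN.
 by split; [exact: (cvgP _ l)|rewrite e1 (cvg_lim _ l)|rewrite e2 (cvg_lim _ l)].
- move=> θ pth th0; have [s _] := pth; have [VL hVL] := lV θ pth th0.
 have hv := survival_valueN T0 UG rg' rf' rh' mx vS s (Gbf_csub T0 UG s) (Gbf_sub T0 UG s) (cost θ).
 apply: filterS2 hVL hv => w [l le eq] e.
 have l' : oppp V s w @[s --> (θ w)^'-] --> - VL w by exact: cvgN.
 rewrite e (cvg_lim _ l')//.
 by split; [exact: l'|rewrite lee_fin lerN2|move=> /eq ->].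
- move=> cont; apply: filterS (kV cont) => w hw t tT lt; have [a b] := hw t tT lt; split=> h'.
  apply: cvgN; exact: a.
 apply: is_cvgN; exact: b.
Qed.

End conclusions.

Theorem player_exists (R : realType) d (Ω : measurableType d) (P : probability Ω R) (T : R)
  (F G : R -> set (set Ω)) (f g h x xi : R -> Ω -> R) (Xi Z1 Z2 : Ω -> R) :
 0 < T -> usual_filtration P T F -> usual_filtration P T G -> G T `<=` F T ->
 raw P T f Xi -> raw P T g Xi -> raw P T h Xi -> smeas (F T) Xi ->
 adapted T F f -> adapted T F g -> adapted T F h -> adapted T F x -> mcpath T x ->
 (\forall w \ae P, forall t, 0 <= t <= T -> g t w <= h t w <= f t w) ->
 control T G (cst 0) xi -> devices P (F T) Z1 Z2 ->
 (forall rho, control T G (cst 0) rho ->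
  EI P setT (payoff f g h (randomised_time T xi Z1) (randomised_time T x Z2)) <=
  EI P setT (payoff f g h (randomised_time T rho Z1) (randomised_time T x Z2))) ->
 exists S V, is_value P T G f g h x Xi S /\ value_aggregate P T G g x S V xi.
Proof.
move=> T0 UF UG GF rf rg rh HXi af ag ah ax mx ghf cxi dev opt.
have [sF mF _] := G_csub UF (T_in T0).
have up X : adapted T F X -> forall t, 0 <= t <= T -> smeas (F T) (X t).
 move=> aX t tT; have /andP[t0 tT'] := tT.
 exact: (sm_sub (G_mono UF t0 tT' (lexx T)) (aX t tT)).
have [S vS] := value_exists T0 UG rf rg rh mx ghf.
have oxi := saddle_optimal_times T0 sF mF UG GF rf rg rh mx (up f af) (up g ag) (up h ah) (up x ax) HXi dev vS cxi opt.
by have [V hV] := value_aggregate_exists T0 UG rg mx vS oxi; exists S, V.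
Qed.

Theorem theorem3p4 (R : realType) (d : measure_display)
    (Omega : measurableType d) (P : probability Omega R) (T : R)
    (F F1 F2 : R -> set (set Omega)) (f g h xi zeta : R -> Omega -> R) :
  0 < T ->
  measure_is_complete P ->
  usual_filtration P T F ->
  F T `<` measurable ->
  usual_filtration P T F1 ->
  usual_filtration P T F2 ->
  (forall t, 0 <= t <= T -> <<s F1 t `|` F2 t >> `<=` F t) ->
  bounded_payoff P T f -> bounded_payoff P T g -> bounded_payoff P T h ->
  adapted T F f -> adapted T F g -> adapted T F h ->
  (\forall w \ae P, forall t, 0 <= t <= T -> g t w <= h t w <= f t w) ->
  optimal_pair P T f g h F F1 F2 xi zeta ->
  exists V1 V2 : R -> Omega -> R,
  [/\ (* aggregation *)
      [/\ aggregates P T F1 V1 (fun theta w =>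
            survival P (sigma_at T F1 theta) zeta theta w
            * value1 P T f g h F1 zeta theta (sigma_at T F1 theta) w)%E,
          optional_semimartingale P T F1 V1,
          class_D P T F1 V1
        & forall theta, stopping_time T F1 theta -> \forall w \ae P,
            (V1 (theta w) w)%:E =
            essinf P
              [set cexp P (sigma_at T F1 theta) (stop1 T f g h zeta theta tau)
              | tau in stopping_times_from T F1 theta] w]
      /\
      [/\ aggregates P T F2 V2 (fun gamma w =>
            survival P (sigma_at T F2 gamma) xi gamma w
            * value2 P T f g h F2 xi gamma (sigma_at T F2 gamma) w)%E,
          optional_semimartingale P T F2 V2,
          class_D P T F2 V2
        & forall gamma, stopping_time T F2 gamma -> \forall w \ae P,
            (V2 (gamma w) w)%:E =
            esssup P
              [set cexp P (sigma_at T F2 gamma) (stop2 T f g h xi gamma sigma)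
              | sigma in stopping_times_from T F2 gamma] w],
      (* right limits *)
      (forall theta, stopping_time T F1 theta -> \forall w \ae P,
        theta w < T ->
        [/\ cvg (V1 s w @[s --> (theta w)^'+]),
            ((lim (V1 s w @[s --> (theta w)^'+]))%:E =
             (V1 (theta w) w)%:E
             - survival P (sigma_at T F1 theta) zeta theta w
               * cexp P (sigma_at T F1 theta)
                   (fun w' => (Pi P (sigma_at T F1 theta) zeta theta w'
                      * g (theta w') w'
                      * jump (truncated zeta theta ^~ w') (theta w'))%R) w)%E
          & ((lim (V1 s w @[s --> (theta w)^'+]))%:E =
             (V1 (theta w) w)%:E
             - cexp P (sigma_at T F1 theta)
                 (fun w' => (g (theta w') w'
                    * jump (zeta ^~ w') (theta w'))%R) w)%E])
      /\
      (forall gamma, stopping_time T F2 gamma -> \forall w \ae P,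
        gamma w < T ->
        [/\ cvg (V2 s w @[s --> (gamma w)^'+]),
            ((lim (V2 s w @[s --> (gamma w)^'+]))%:E =
             (V2 (gamma w) w)%:E
             - survival P (sigma_at T F2 gamma) xi gamma w
               * cexp P (sigma_at T F2 gamma)
                   (fun w' => (Pi P (sigma_at T F2 gamma) xi gamma w'
                      * f (gamma w') w'
                      * jump (truncated xi gamma ^~ w') (gamma w'))%R) w)%E
          & ((lim (V2 s w @[s --> (gamma w)^'+]))%:E =
             (V2 (gamma w) w)%:E
             - cexp P (sigma_at T F2 gamma)
                 (fun w' => (f (gamma w') w'
                    * jump (xi ^~ w') (gamma w'))%R) w)%E]),
      (* left limits at previsible times *)
      (forall theta, previsible_time P T F1 theta ->
        (\forall w \ae P, 0 < theta w) ->
        \forall w \ae P,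
        let bound := (survival P (sigma_before T F1 theta) zeta theta w
          * value1 P T f g h F1 zeta theta (sigma_before T F1 theta) w)%E in
        [/\ cvg (V1 s w @[s --> (theta w)^'-]),
            ((lim (V1 s w @[s --> (theta w)^'-]))%:E <= bound)%E
          & before (xi ^~ w) (theta w) < 1 ->
            (lim (V1 s w @[s --> (theta w)^'-]))%:E = bound])
      /\
      (forall gamma, previsible_time P T F2 gamma ->
        (\forall w \ae P, 0 < gamma w) ->
        \forall w \ae P,
        let bound := (survival P (sigma_before T F2 gamma) xi gamma w
          * value2 P T f g h F2 xi gamma (sigma_before T F2 gamma) w)%E in
        [/\ cvg (V2 s w @[s --> (gamma w)^'-]),
            ((lim (V2 s w @[s --> (gamma w)^'-]))%:E >= bound)%E
          & before (zeta ^~ w) (gamma w) < 1 ->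
            (lim (V2 s w @[s --> (gamma w)^'-]))%:E = bound])
    & (* continuous filtrations *)
      continuous_filtration P T F1 -> continuous_filtration P T F2 ->
      (\forall w \ae P, forall t, 0 <= t <= T -> before (xi ^~ w) t < 1 ->
         (0 < t -> V1 s w @[s --> t^'-] --> V1 t w) /\
         (t < T -> cvg (V1 s w @[s --> t^'+])))
      /\
      (\forall w \ae P, forall t, 0 <= t <= T -> before (zeta ^~ w) t < 1 ->
         (0 < t -> V2 s w @[s --> t^'-] --> V2 t w) /\
         (t < T -> cvg (V2 s w @[s --> t^'+])))].
Proof.
move=> T0 _ UF _ UF1 UF2 sub bf bg bh af ag ah ghf [cxi czeta [Z1 [Z2 [dev opt2 opt1]]]].
have F1F t : 0 <= t <= T -> F1 t `<=` F t.
 by move=> tT A FA; apply: (sub t tT); apply: sub_sigma_algebra; left.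
have F2F t : 0 <= t <= T -> F2 t `<=` F t.
 by move=> tT A FA; apply: (sub t tT); apply: sub_sigma_algebra; right.
have [Xf [Hf if_ f0 fX]] := payoff_bound T0 UF bf af.
have [Xg [Hg ig g0 gX]] := payoff_bound T0 UF bg ag.
have [Xh [Hh ih h0 hX]] := payoff_bound T0 UF bh ah.
have cF := G_csub UF (T_in T0).
(* A single dominating variable for the three payoffs. *)
pose Xi w := Xf w + Xg w + Xh w.
have HXi : smeas (F T) Xi by apply: (smD cF) => //; exact: (smD cF).
have iXi : L1 P Xi by apply: L1D => //; exact: L1D.
have rawX X XX : (forall w, 0 <= XX w <= Xi w) -> (forall t w, 0 <= t <= T -> `|X t w| <= XX w) ->
  bounded_payoff P T X -> adapted T F X -> raw P T X Xi.
 move=> XXi bX [cX _ _] aX; split=> //.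
  move=> t tT; exact: (sm_meas (G_csub UF tT) (aX t tT)).
 by move=> t w tT; apply: (le_trans (bX t w tT)); have /andP[] := XXi w.
have rf : raw P T f Xi by apply: (rawX f Xf) => // w; rewrite f0 /Xi -addrA lerDl addr_ge0.
have rg : raw P T g Xi by apply: (rawX g Xg) => // w; rewrite g0 /Xi addrAC lerDr addr_ge0.
have rh : raw P T h Xi by apply: (rawX h Xh) => // w; rewrite h0 lerDr addr_ge0.
have [axi mxi _] := control_mcpath UF1 cxi; have [azeta mzeta _] := control_mcpath UF2 czeta.
have lift (G : R -> set (set Omega)) X : (forall t, 0 <= t <= T -> G t `<=` F t) -> adapted T G X -> adapted T F X.
 move=> GF aX t tT; exact: (sm_sub (GF t tT) (aX t tT)).
have axiF := lift F1 xi F1F axi; have azetaF := lift F2 zeta F2F azeta.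
have [sF mF _] := cF.
have up X : adapted T F X -> forall t, 0 <= t <= T -> smeas (F T) (X t).
 move=> aX t tT; have /andP[t0 tT'] := tT.
 exact: (sm_sub (G_mono UF t0 tT' (lexx T)) (aX t tT)).
have GT1 := F1F T (T_in T0); have GT2 := F2F T (T_in T0).
have EE X : L1 P X -> 'E_P[X]%E = (EI P setT X)%:E by move=> iX; rewrite unlock EIE.
have sd1 rho := @saddle_value _ _ _ P T (F T) F1 T0 sF mF UF1 GT1 f g h zeta Xi rf rg rh mzeta
 (up f af) (up g ag) (up h ah) (up zeta azetaF) HXi Z1 Z2 dev rho.
have o1 rho : control T F1 (cst 0) rho ->
  EI P setT (payoff f g h (randomised_time T xi Z1) (randomised_time T zeta Z2)) <=
  EI P setT (payoff f g h (randomised_time T rho Z1) (randomised_time T zeta Z2)).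
 move=> crho; have [i1 _] := sd1 xi cxi; have [i2 _] := sd1 rho crho.
 by have := opt1 rho Z1 crho dev; rewrite !EE.
have [S1 [V1 [vS1 hV1]]] := player_exists T0 UF UF1 GT1 rf rg rh HXi af ag ah azetaF mzeta ghf cxi dev o1.
have [ag1 [sm1 cd1] es1 rt1 [lf1 ct1]] := player1 T0 UF1 rf rg rh mzeta vS1 hV1.
(* For the second player, the roles of the strategies and of the devices are exchanged. *)
have dev' : devices P (F T) Z2 Z1.
 have [u1 u2 ind] := dev; split=> // A B1 B2 FA mB1 mB2.
 by rewrite setIAC ind// muleAC.
have rf' := raw_oppp rf; have rg' := raw_oppp rg; have rh' := raw_oppp rh.
have adN X : adapted T F X -> adapted T F (oppp X).
 move=> aX t tT; apply: (sm_opp (G_csub UF tT)); exact: aX.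
have sd2 rho := @saddle_value _ _ _ P T (F T) F2 T0 sF mF UF2 GT2 (oppp g) (oppp f) (oppp h) xi Xi
 rg' rf' rh' mxi (up _ (adN g ag)) (up _ (adN f af)) (up _ (adN h ah)) (up xi axiF) HXi Z2 Z1 dev' rho.
have o2 rho : control T F2 (cst 0) rho ->
  EI P setT (payoff (oppp g) (oppp f) (oppp h) (randomised_time T zeta Z2) (randomised_time T xi Z1)) <=
  EI P setT (payoff (oppp g) (oppp f) (oppp h) (randomised_time T rho Z2) (randomised_time T xi Z1)).
 move=> crho; have [i1 _] := sd2 zeta czeta; have [i2 _] := sd2 rho crho.
 have := opt2 rho Z2 crho dev; rewrite !(payoff_oppp f g h) !EE; [|exact: L1N|exact: L1N].
 by rewrite lee_fin !EIN// lerN2.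
have ghf' : \forall w \ae P, forall t, 0 <= t <= T -> oppp f t w <= oppp h t w <= oppp g t w.
 apply: filterS ghf => w hw t tT; rewrite !lerN2 andbC; exact: hw.
have [S2 [V2 [vS2 hV2]]] := player_exists T0 UF UF2 GT2 rg' rf' rh' HXi (adN g ag) (adN f af) (adN h ah)
 axiF mxi ghf' czeta dev' o2.
have [ag2 [sm2 cd2] es2 rt2 [lf2 ct2]] := player2 T0 UF2 rf rg rh mxi vS2 hV2.
by exists V1, (oppp V2); split=> //; split=> //; auto.
Qed.
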